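(* For any data $f\in L^2(\Omega\times[0,h])$, $g\in L^2(\Omega\times\{0,h\})$, and $j\in\left(H^{1/2}([0,h])\right)^*$ there exists a unique solution $u\in\mathbb{H}$ to the variational problem $(V)$, and $$\|u\|_{\mathbb{H}}\leq C(\Omega,h,\lambda)\left(\|f\|_{L^2}+\|g\|_{L^2}+\|j\|_{(H^{1/2})^*}\right).$$ If in addition $(f,g,j)$ satisfies the compatibility condition $$\int_{\Omega\times[0,h]}f\,dx\,dy\,dz=\langle j,1\rangle+\int_{\Omega\times\{0,h\}}\lambda(z)g\,dx\,dy,$$ then: (1) $\mathcal{L}(u)=f$ in $\Omega\times[0,h]$ is satisfied in the weak sense; (2) $\partial_\nu u=g$ on $\Omega\times\{0,h\}$ is satisfied in the weak sense; (3) $u(x,y,z)=c(z)$ on $\partial\Omega\times[0,h]$, for some function $c$ of $z$ only, is satisfied pointwise; (4) the condition $\int_{\partial\Omega\times\{z\}}\overline{\nabla}u\cdot\nu_s\,d\omega=j(z)$ is satisfied weakly; that is, for every $\phi\in C_c^\infty((0,h))$ (a function of $z$ only), $$\int_{\Omega\times[0,h]}\mathcal{L}(u)\phi(z)-u\,\partial_z(\lambda\partial_z\phi(z))\,dx\,dy\,dz=\langle j,\phi\rangle.$$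
   Context: $\Omega\subset\mathbb{R}^2$ is a fixed smooth, bounded set and $h\in(0,\infty)$ is fixed; $\lambda=\lambda(z)$ is a smooth function of $z$ with $\frac1\Lambda\le\lambda(z)\le\Lambda$ for some $\Lambda\in(0,\infty)$. Notation: $\overline{\nabla}=(\partial_x,\partial_y,0)$, $\tilde\nabla=(\partial_x,\partial_y,\lambda(z)\partial_z)$, $\mathcal{L}=\partial_{xx}+\partial_{yy}+\partial_z(\lambda\partial_z)$; $\partial_\nu$ is the outward normal derivative on $\Omega\times\{0,h\}$; $\nu_s$ is the outward normal to $\partial\Omega\times\{z\}$; $d\omega$ is Hausdorff measure on $\partial\Omega$; $\langle\cdot,\cdot\rangle$ denotes the duality between $(H^{1/2}([0,h]))^*$ and $H^{1/2}([0,h])$ (equal to $\int_0^h j\phi\,dz$ when $j\in L^2$). Let $H$ be the set of $\alpha\in C^\infty(\bar\Omega\times[0,h])$ with $\int_{\Omega\times[0,h]}\alpha\,dx\,dy\,dz=0$ and such that $\alpha|_{\partial\Omega\times[0,h]}$ depends only on $z$. Equip $H$ with the inner product $\langle\alpha,\gamma\rangle_{\mathbb{H}}=\int_{\Omega\times[0,h]}\tilde\nabla\alpha\cdot\nabla\gamma\,dx\,dy\,dz$, and let $\mathbb{H}$ be the closure (completion) of $H$ in the induced norm. For $\gamma\in\mathbb{H}$ the lateral boundary value $\gamma|_{\partial\Omega\times\{z\}}$ is a function of $z$ only, in $H^{1/2}([0,h])$. The variational problem $(V)$ with data $(f,g,j)$ is: find $u\in\mathbb{H}$ such that for all $\gamma\in\mathbb{H}$,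 $$\int_{\Omega\times[0,h]}\tilde\nabla u\cdot\nabla\gamma\,dx\,dy\,dz=-\int_{\Omega\times[0,h]}f\gamma\,dx\,dy\,dz+\int_{\Omega\times\{0,h\}}\lambda g\gamma\,dx\,dy+\langle j,\gamma|_{\partial\Omega\times\{z\}}\rangle.$$ That (1) and (2) hold in the weak sense means: for all $\gamma\in C^\infty(\bar\Omega\times[0,h])$ vanishing on $\partial\Omega\times[0,h]$, $\int_{\Omega\times[0,h]}\tilde\nabla u\cdot\nabla\gamma=-\int_{\Omega\times[0,h]}f\gamma+\int_{\Omega\times\{0,h\}}\lambda g\gamma$. *)

(* Defs.v *)
From HB Require Import structures.
From mathcomp Require Import all_boot all_order all_algebra.
From mathcomp Require Import all_classical all_reals all_analysis.
Set Implicit Arguments.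
Unset Strict Implicit.
Unset Printing Implicit Defensive.
Import Order.TTheory GRing.Theory Num.Theory.
Import numFieldNormedType.Exports.
Local Open Scope classical_set_scope.
Local Open Scope ring_scope.

Definition leb1 (R : realType) : {measure set (measurableTypeR R) -> \bar R} :=
  @lebesgue_measure R.

Definition leb2 (R : realType) :
    {measure set (measurableTypeR R * measurableTypeR R) -> \bar R} :=
  (@lebesgue_measure R \x @lebesgue_measure R)%E.

Definition leb3 (R : realType) :
    {measure set (measurableTypeR R * measurableTypeR R * measurableTypeR R)
       -> \bar R} :=
  ((@lebesgue_measure R \x @lebesgue_measure R) \x @lebesgue_measure R)%E.

Section SquareIntegrable.
Context d (T : measurableType d) (R : realType).
Variable mu : {measure set T -> \bar R}.

Definition L2 (D : set T) (f : T -> R) : Prop :=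
  measurable_fun D f /\ (\int[mu]_(x in D) ((f x) ^+ 2)%:E < +oo)%E.

Definition L2norm (D : set T) (f : T -> R) : R :=
  Num.sqrt (\int[mu]_(x in D) ((f x) ^+ 2)).

End SquareIntegrable.

Section Smooth.
Context (R : realType) (V : normedModType R).

Fixpoint dirder (l : seq V) (f : V -> R) : V -> R :=
  if l is v :: l' then (fun x => 'D_v (dirder l' f) x) else f.

Definition smooth (f : V -> R) : Prop :=
  forall l : seq V, continuous (dirder l f) /\
    forall x v, derivable (dirder l f) x v.

Definition test_fun (U : set V) (f : V -> R) : Prop :=
  smooth f /\
  exists K, [/\ compact K, K `<=` U & forall x, ~ K x -> f x = 0].

End Smooth.

Definition boundary (T : topologicalType) (A : set T) : set T :=
  closure A `\` interior A.

Section Domain.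
Context (R : realType).

Definition reorient (swap flip : bool) (q : R * R) : R * R :=
  let q' := if swap then (q.2, q.1) else q in
  if flip then (q'.1, - q'.2) else q'.

(* Up to relabelling and reorienting the axes, Omega is locally the strict
   epigraph of a smooth function. *)
Definition smooth_boundary (Omega : set (R * R)) : Prop :=
  forall p, boundary Omega p ->
  exists (swap flip : bool) (r : R) (psi : R -> R),
    [/\ 0 < r, smooth psi &
        forall q, ball p r q ->
          (Omega q <->
           psi (reorient swap flip q).1 < (reorient swap flip q).2)].

Definition smooth_bounded_domain (Omega : set (R * R)) : Prop :=
  [/\ open Omega, Omega !=set0, bounded_set Omega & smooth_boundary Omega].

(* An injective smooth arc on the boundary. Along it the Hausdorff measure
   of the boundary is speed x y t dt, and the (compact, one-dimensional)
   boundary is a finite union of such arcs. *)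
Definition boundary_arc (Omega : set (R * R)) (a b : R) (x y : R -> R) : Prop :=
  [/\ a < b, smooth x, smooth y,
      {in `[a, b] &, injective (fun t => (x t, y t))} &
      forall t, a <= t <= b -> boundary Omega (x t, y t)].

Definition speed (x y : R -> R) (t : R) : R :=
  Num.sqrt (derive1 x t ^+ 2 + derive1 y t ^+ 2).

End Domain.

Section HalfSobolev.
Context (R : realType) (h : R).

(* Sobolev-Slobodeckij description of H^(1/2)([0,h]); the quotient is 0 on
   the diagonal, which is a null set. *)
Definition gagliardo (phi : R -> R) : \bar R :=
  (\int[@leb2 R]_(p in `[0%R, h] `*` `[0%R, h])
     (((phi p.1 - phi p.2) / (p.1 - p.2)) ^+ 2)%:E)%E.

Definition H12 (phi : R -> R) : Prop :=
  L2 (@leb1 R) `[0, h] phi /\ (gagliardo phi < +oo)%E.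

Definition H12norm (phi : R -> R) : R :=
  Num.sqrt (L2norm (@leb1 R) `[0, h] phi ^+ 2 + fine (gagliardo phi)).

(* A bounded linear functional on H^(1/2); its values outside of H12 are
   irrelevant. *)
Definition H12dual (j : (R -> R) -> R) : Prop :=
  (forall (a : R) phi psi, H12 phi -> H12 psi ->
     j (fun z => a * phi z + psi z) = a * j phi + j psi) /\
  exists M : R, forall phi, H12 phi -> `|j phi| <= M * H12norm phi.

Definition H12dualnorm (j : (R -> R) -> R) : R :=
  sup [set r | exists phi, [/\ H12 phi, H12norm phi <= 1 & r = `|j phi|]].

End HalfSobolev.

Section Cylinder.
Context (R : realType) (Omega : set (R * R)) (h : R) (lambda : R -> R).
Local Notation pt := (R * R * R)%type.
Local Notation mu := (@leb3 R).

Definition cyl : set pt := Omega `*` `[0, h].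

Definition ex : pt := (1, 0, 0).
Definition ey : pt := (0, 1, 0).
Definition ez : pt := (0, 0, 1).

Definition is_weak_der (v : pt) (u w : pt -> R) : Prop :=
  L2 mu cyl w /\
  forall psi : pt -> R, test_fun (Omega `*` `]0, h[) psi ->
    \int[mu]_(p in cyl) (u p * 'D_v psi p) =
    - (\int[mu]_(p in cyl) (w p * psi p)).

Definition H1 (u : pt -> R) : Prop :=
  L2 mu cyl u /\ forall v : pt, exists w, is_weak_der v u w.

(* Weak derivatives are unique almost everywhere; one is selected. For a
   smooth function it agrees a.e. in the cylinder with the classical one. *)
Definition wder (v : pt) (u : pt -> R) : pt -> R :=
  xget (fun=> 0) [set w | is_weak_der v u w].

Definition grad_dot (u gamma : pt -> R) (p : pt) : R :=
  wder ex u p * wder ex gamma p + wder ey u p * wder ey gamma p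
  + lambda p.2 * wder ez u p * wder ez gamma p.

Definition dotH (u gamma : pt -> R) : R :=
  \int[mu]_(p in cyl) grad_dot u gamma p.

Definition normH (u : pt -> R) : R := Num.sqrt (dotH u u).

(* Smooth functions on the closed cylinder are taken to be restrictions of
   smooth functions on the whole space. *)
Definition preH (alpha : pt -> R) : Prop :=
  [/\ smooth alpha, \int[mu]_(p in cyl) alpha p = 0 &
      exists c : R -> R, forall q z, boundary Omega q -> 0 <= z <= h ->
        alpha (q, z) = c z].

(* On preH the induced norm controls the L^2 norm (Poincare inequality), so
   the abstract completion is realised by functions: those that are limits,
   in the induced norm and in L^2, of sequences in preH. The L^2 limit fixes
   the locally constant part, which the induced norm does not see. *)
Definition HH (u : pt -> R) : Prop :=
  H1 u /\
  exists alpha : nat -> pt -> R,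
    [/\ forall n, preH (alpha n),
        normH (alpha n \- u) @[n --> \oo] --> (0 : R) &
        L2norm mu cyl (alpha n \- u) @[n --> \oo] --> (0 : R)].

Definition H1_approx (v : nat -> pt -> R) (u : pt -> R) : Prop :=
  [/\ H1 u, forall n, smooth (v n),
      L2norm mu cyl (v n \- u) @[n --> \oo] --> (0 : R) &
      forall e : pt, L2norm mu cyl (wder e (v n \- u)) @[n --> \oo] --> (0 : R)].

Definition int_ends (F : pt -> R) : R :=
  (\int[@leb2 R]_(q in Omega) F (q, 0)) + (\int[@leb2 R]_(q in Omega) F (q, h)).

Definition L2_ends (g : pt -> R) : Prop :=
  L2 (@leb2 R) Omega (fun q => g (q, 0)) /\
  L2 (@leb2 R) Omega (fun q => g (q, h)).

Definition L2norm_ends (g : pt -> R) : R :=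
  Num.sqrt (int_ends (fun p => g p ^+ 2)).

Definition is_trace_ends (u t : pt -> R) : Prop :=
  measurable_fun [set: measurableTypeR R * measurableTypeR R * measurableTypeR R] t /\
  exists v : nat -> pt -> R, H1_approx v u /\
    forall z, z = 0 \/ z = h ->
      (\int[@leb2 R]_(q in Omega) ((v n (q, z) - t (q, z)) ^+ 2)%:E)%E
        @[n --> \oo] --> 0%E.

Definition is_trace_lateral (u t : pt -> R) : Prop :=
  measurable_fun [set: measurableTypeR R * measurableTypeR R * measurableTypeR R] t /\
  exists v : nat -> pt -> R, H1_approx v u /\
    forall a b x y, boundary_arc Omega a b x y ->
      (\int[@leb2 R]_(s in `[a, b] `*` `[0%R, h])
         ((v n (x s.1, y s.1, s.2) - t (x s.1, y s.1, s.2)) ^+ 2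
          * speed x y s.1)%:E)%E
        @[n --> \oo] --> 0%E.

(* c is the lateral boundary value of u: a representative of the trace of u
   equals c(z) at every point of the lateral boundary. *)
Definition lateral_value (u : pt -> R) (c : R -> R) : Prop :=
  exists t, is_trace_lateral u t /\
    forall q z, boundary Omega q -> 0 <= z <= h -> t (q, z) = c z.

(* Traces are unique almost everywhere; one is selected. *)
Definition trace_ends (u : pt -> R) : pt -> R :=
  xget (fun=> 0) [set t | is_trace_ends u t].

Definition lateral (u : pt -> R) : R -> R :=
  xget (fun=> 0) [set c | H12 h c /\ lateral_value u c].

Definition solves_V (f g : pt -> R) (j : (R -> R) -> R) (u : pt -> R) : Prop :=
  HH u /\
  forall gamma, HH gamma ->
    dotH u gamma =
      - (\int[mu]_(p in cyl) (f p * gamma p))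
      + int_ends (fun p => lambda p.2 * g p * trace_ends gamma p)
      + j (lateral gamma).

(* L(u) = f in the cylinder and d_nu u = g on its two ends, weakly *)
Definition weak_Neumann (f g u : pt -> R) : Prop :=
  forall gamma : pt -> R, smooth gamma ->
    (forall q z, boundary Omega q -> 0 <= z <= h -> gamma (q, z) = 0) ->
    dotH u gamma =
      - (\int[mu]_(p in cyl) (f p * gamma p))
      + int_ends (fun p => lambda p.2 * g p * gamma p).

(* L(u) = w in the sense of distributions *)
Definition is_weak_L (u w : pt -> R) : Prop :=
  L2 mu cyl w /\
  forall psi : pt -> R, test_fun (Omega `*` `]0, h[) psi ->
    dotH u psi = - (\int[mu]_(p in cyl) (w p * psi p)).

(* The flux condition; the weak L(u) is unique almost everywhere. *)
Definition weak_flux (j : (R -> R) -> R) (u : pt -> R) : Prop :=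
  forall w, is_weak_L u w ->
  forall phi : R -> R, test_fun `]0, h[ phi ->
    \int[mu]_(p in cyl)
      (w p * phi p.2 - u p * derive1 (fun z => lambda z * derive1 phi z) p.2) = j phi.

Definition compatible (f g : pt -> R) (j : (R -> R) -> R) : Prop :=
  \int[mu]_(p in cyl) f p =
  j (fun=> 1) + int_ends (fun p => lambda p.2 * g p).

End Cylinder.

(* Main.v *)
Require Import Defs.
From HB Require Import structures.
From mathcomp Require Import all_boot all_order all_algebra.
From mathcomp Require Import all_classical all_reals all_analysis.
From mathcomp Require Import measurable_realfun.
From mathcomp Require Import ring lra.
Set Implicit Arguments.
Unset Strict Implicit.
Unset Printing Implicit Defensive.
Import Order.TTheory GRing.Theory Num.Theory.
Import numFieldNormedType.Exports.
Local Open Scope classical_set_scope.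
Local Open Scope ring_scope.

(* [(V)] is the Euler-Lagrange equation of [u |-> (u, u) / 2 - F u] for the
   functional [F] on its right-hand side, so a minimising sequence of smooth
   functions is Cauchy in the energy norm (parallelogram law) as soon as [F] is
   bounded there, and its limit is the solution. Boundedness of [F] rests on
   three inequalities for smooth functions. A horizontal line issued from a
   point of the domain leaves it through the lateral boundary, where the
   function depends on [z] alone; with the vertical derivative and the zero
   mean this gives a Poincare inequality. The traces on the two ends are
   controlled by the fundamental theorem of calculus in [z]. For the lateral
   value [c], in a chart where the domain is the epigraph of a smooth function
   the increment [c z - c z'] is the increment of the function along a diagonal
   and a transverse segment that meet at distance [|z - z'|] inside the domain;
   dividing by [z - z'], Hardy's inequality bounds the Gagliardo seminorm of
   [c] by the energy. Under the compatibility condition constants may be added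
   to the test functions, which gives (1), (2) and, for test functions of [z]
   alone and after an integration by parts in [z], the flux condition (4). *)

(** * Smooth functions *)

(** Weak derivatives, traces and lateral values are selected by choice and known only almost
    everywhere, whereas every estimate is one-dimensional (fundamental theorem of calculus,
    Cauchy-Schwarz, Hardy), along segments and for smooth functions. Hence the minimisation runs
    over [preH], where the end values and the lateral value in the functional are read off
    pointwise; selected objects enter when the resulting identity is extended to [HH], and this
    rests on uniqueness: of weak derivatives by the fundamental lemma of the calculus of variations,
    of traces because their L^2 limit is the same for all approximating sequences. The lateral term
    is the delicate one: an L^2 bound for a trace does not bound a functional on H^(1/2), and the
    energy does not control the derivative of [c]. The detour through the interior trades increments
    of [c] for first derivatives inside the domain. As [c] is common to all boundary points, one
    chart, met by leaving the domain along a row, carries the argument: averaging over it turns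
    integrals over transverse squares into integrals over the cylinder. *)

Section SmoothCalculus.
Context (R : realType) (V : normedModType R).
Implicit Types (f g : V -> R) (v w x : V) (l : seq V).

Lemma dirder_rcons l v f : dirder (rcons l v) f = dirder l ('D_v f).
Proof. by elim: l => //= u l ->. Qed.

Lemma smooth_cont f : smooth f -> continuous f.
Proof. by move=> /(_ [::])[]. Qed.

Lemma smooth_derivable f x v : smooth f -> derivable f x v.
Proof. by move=> /(_ [::])[]. Qed.

Lemma smooth_derive f v : smooth f -> smooth ('D_v f).
Proof. by move=> sf l; rewrite -dirder_rcons; exact: sf. Qed.

(** [smooth] quantifies over all lists of directions, and the last direction of a list is applied
    first; peeling the list from its right end reduces smoothness to an invariant [P] stable under
    one directional derivative. *)
Lemma smooth_coind (P : (V -> R) -> Prop) :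
  (forall f, P f -> [/\ continuous f, forall x v, derivable f x v &
     forall v, P ('D_v f)]) ->
  forall f, P f -> smooth f.
Proof.
move=> H f Pf l; elim/last_ind: l f Pf => [|l v IH] f Pf /=.
  by have [] := H _ Pf.
by rewrite dirder_rcons; apply: IH; have [] := H _ Pf.
Qed.

Lemma smooth_cst (k : R) : smooth (fun _ : V => k).
Proof.
apply: (@smooth_coind (fun f => exists k, f = cst k)); last by exists k.
move=> _ [c ->]; split.
- by move=> x; exact: cvg_cst.
- by move=> x v; exact: derivable_cst.
- by move=> v; exists 0; apply/funext => x; rewrite derive_cst.
Qed.

(** Invariant for [smooth_coind]: the product rule leaves the set of products of smooth functions
    but stays in their closure under sums and products. *)
Inductive ringhull : (V -> R) -> Prop :=
| rh_smooth f of smooth f : ringhull f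
| rh_add f g of ringhull f & ringhull g : ringhull (f + g)
| rh_mul f g of ringhull f & ringhull g : ringhull (f * g).

Lemma ringhull_smooth f : ringhull f -> smooth f.
Proof.
apply: (@smooth_coind ringhull) => {}f.
elim => {f} [f sf|f g hf [cf df Df] hg [cg dg Dg]|f g hf [cf df Df] hg [cg dg Dg]].
- split; [exact: smooth_cont|by move=> *; exact: smooth_derivable|].
  by move=> v; apply: rh_smooth; exact: smooth_derive.
- split.
  + by move=> x; apply: cvgD; [exact: cf|exact: cg].
  + by move=> x v; exact: derivableD.
  + move=> v; rewrite (_ : 'D_v (f + g) = 'D_v f + 'D_v g); first exact: rh_add.
    by apply/funext => x; rewrite deriveD.
- split.
  + by move=> x; apply: cvgM; [exact: cf|exact: cg].
  + by move=> x v; exact: derivableM.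
  + move=> v; rewrite (_ : 'D_v (f * g) = f * 'D_v g + g * 'D_v f).
      by apply: rh_add; apply: rh_mul.
    by apply/funext => x; rewrite deriveM.
Qed.

Lemma smoothD f g : smooth f -> smooth g -> smooth (fun x => f x + g x).
Proof. by move=> sf sg; apply: ringhull_smooth; apply: rh_add; exact: rh_smooth. Qed.

Lemma smoothM f g : smooth f -> smooth g -> smooth (fun x => f x * g x).
Proof. by move=> sf sg; apply: ringhull_smooth; apply: rh_mul; exact: rh_smooth. Qed.

Lemma smoothZ (a : R) f : smooth f -> smooth (fun x => a * f x).
Proof. exact: smoothM (smooth_cst a). Qed.

Lemma smoothN f : smooth f -> smooth (fun x => - f x).
Proof.
move=> /(smoothZ (-1)); congr smooth.
by apply/funext => x; rewrite mulN1r.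
Qed.

Lemma smoothB f g : smooth f -> smooth g -> smooth (fun x => f x - g x).
Proof. by move=> sf sg; exact: smoothD sf (smoothN sg). Qed.

Lemma smooth_lincomb (a : R) f g : smooth f -> smooth g ->
  smooth (fun x => a * f x + g x).
Proof. by move=> sf sg; exact: smoothD (smoothZ a sf) sg. Qed.

(** Bridge to one variable: the difference quotient along the line is literally that of the
    directional derivative. The estimates on segments start from here. *)
Lemma is_derive_line f x v (t : R) : smooth f ->
  is_derive t (1 : R) (fun s : R => f (x + s *: v)) ('D_v f (x + t *: v)).
Proof.
move=> sf; have df := @smooth_derivable f (x + t *: v) v sf.
have E : (fun s : R => s^-1 *: ((fun s : R => f (x + s *: v)) (s *: (1:R) + t)
          - f (x + t *: v))) =
         (fun s : R => s^-1 *: (f (s *: v + (x + t *: v)) - f (x + t *: v))).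
  apply/funext => s; congr (_ *: (f _ - _)).
  by rewrite -[s *: 1]/(s * 1) mulr1 scalerDl addrCA.
apply: DeriveDef.
- by rewrite /derivable E.
- by rewrite /derive E.
Qed.

Lemma continuous_line f x v : continuous f ->
  continuous (fun s : R => f (x + s *: v)).
Proof.
move=> cf t; apply: continuous_comp; last exact: cf.
apply: cvgD; first exact: cvg_cst.
apply: cvgZl; exact: cvg_id.
Qed.

(** Smoothness provides directional derivatives, not a differential. The increment along [v + w] is
    split at [x + s *: w]: the part along [w] is a difference quotient at [x], the part along [v] is
    handled by the mean value theorem and the continuity of ['D_v f] at [x]. *)
Lemma deriveD_dir f x v w : smooth f ->
  'D_(v + w) f x = 'D_v f x + 'D_w f x.
Proof.
move=> sf.
suff: (fun h : R => h^-1 *: (f (h *: (v + w) + x) - f x)) @ 0^' -->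
   'D_v f x + 'D_w f x by move=> H; rewrite {1}/derive; exact: cvg_lim H.
have -> : (fun h : R => h^-1 *: (f (h *: (v + w) + x) - f x)) =
   (fun h : R => h^-1 *: (f (h *: (v + w) + x) - f (h *: w + x)) +
      h^-1 *: (f (h *: w + x) - f x)).
  by apply/funext => s; rewrite -scalerDr addrA subrK.
apply: cvgD; last exact: smooth_derivable.
apply/cvgrPdist_le => e e0.
have cD := smooth_cont (smooth_derive v sf).
have /nbhs_ballP[d /= d0 Hd] : \forall y \near x, `|'D_v f x - 'D_v f y| <= e.
  by have /cvgrPdist_le/(_ _ e0) := cD x.
(* [|s| * M] bounds the distance from [x] to every point of the segment on which the mean value
   theorem is applied; the 1 keeps [M] positive. *)
set M := `|v| + `|w| + 1.
have M0 : 0 < M by rewrite ltr_wpDl// addr_ge0.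
near=> s.
have s0 : s != 0 by near: s; exact: nbhs_dnbhs_neq.
have sd : `|s| * M < d.
  rewrite -ltr_pdivlMr//; near: s.
  apply: dnbhs0_lt; exact: divr_gt0.
pose k t := f ((x + s *: w) + t *: (s *: v)).
have [c cI Ec] : exists2 c, c \in `[(0:R), 1] & k 1 - k 0 = 'D_(s *: v) f ((x + s *: w) + c *: (s *: v)) * (1 - 0).
  apply: MVT_segment => // [t _|]; first exact: is_derive_line.
  by apply: continuous_subspaceT; apply: continuous_line; exact: smooth_cont.
have DZ y : 'D_(s *: v) f y = s * 'D_v f y.
  have H1 := is_derive_line y (s *: v) 0 sf.
  have G : is_derive (0 : R) (1 : R) (fun u : R => u * s) s.
    by apply: is_derive_eq; rewrite scaler0 add0r -[_ *: _]/(_ * _) mulr1.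
  have H2 := @is_derive1_comp R (fun u => f (y + u *: v)) (fun u => u * s) 0 _ _
    (is_derive_line y v (0 * s) sf) G.
  have Ef : (fun u : R => f (y + u *: v)) \o (fun u => u * s) =
     (fun u : R => f (y + u *: (s *: v))).
    by apply/funext => u /=; rewrite scalerA.
  rewrite Ef in H2.
  move: (@derive_val _ _ _ _ _ _ _ H1); rewrite (@derive_val _ _ _ _ _ _ _ H2).
  by rewrite mul0r !scale0r !addr0 => <-; rewrite mulrC.
have -> : f (s *: (v + w) + x) = k 1.
  by rewrite /k scale1r; congr f; rewrite scalerDr -addrA [s *: w + x]addrC addrC.
have -> : f (s *: w + x) = k 0 by rewrite /k scale0r addr0 addrC.
rewrite Ec subr0 mulr1 DZ -[_ *: _]/(_ * _) mulKf//.
apply: Hd; rewrite -ball_normE /ball_ /=.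
rewrite opprD addrA opprD addrA subrr sub0r -opprD normrN.
apply: le_lt_trans sd; rewrite (le_trans (ler_normD _ _))//.
rewrite !normrZ /M.
move: cI; rewrite in_itv/= => /andP[c0 c1].
rewrite mulrDr mulrDr (ger0_norm c0).
have : c * (`|s| * `|v|) <= `|s| * `|v| by rewrite ler_piMl// mulr_ge0.
have : 0 <= `|s| by [].
lra.
Unshelve. all: by end_near.
Qed.

Lemma deriveZ_dir f x v (a : R) : smooth f -> 'D_(a *: v) f x = a * 'D_v f x.
Proof.
move=> sf; have H1 := is_derive_line x (a *: v) 0 sf.
have G : is_derive (0 : R) (1 : R) (fun u : R => u * a) a.
  by apply: is_derive_eq; rewrite scaler0 add0r -[_ *: _]/(_ * _) mulr1.
have H2 := @is_derive1_comp R (fun u => f (x + u *: v)) (fun u => u * a) 0 _ _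
  (is_derive_line x v (0 * a) sf) G.
have Ef : (fun u : R => f (x + u *: v)) \o (fun u => u * a) =
   (fun u : R => f (x + u *: (a *: v))).
  by apply/funext => u /=; rewrite scalerA.
rewrite Ef in H2.
move: (@derive_val _ _ _ _ _ _ _ H1); rewrite (@derive_val _ _ _ _ _ _ _ H2).
by rewrite mul0r !scale0r !addr0 => <-; rewrite mulrC.
Qed.

End SmoothCalculus.

Section Affine.
Context (R : realType) (V : normedModType R).

(** [phi] is affine with linear part [L], so the difference quotient of [k \o phi] at [x] along [v]
    is that of [k] at [phi x] along [L v]. The compositions [k \o phi] with [k] smooth are the
    invariant. *)
Lemma smooth_comp_affine (g : R -> R) (phi L : V -> R) :
  smooth g -> continuous phi ->
  (forall x v (s : R), phi (s *: v + x) = s * L v + phi x) ->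
  smooth (fun x => g (phi x)) /\
  forall x v, 'D_v (fun x => g (phi x)) x = L v * 'D_1 g (phi x).
Proof.
move=> sg cphi aff.
have Q (k : R -> R) x v : (fun h : R => h^-1 *: (k (phi (h *: v + x)) - k (phi x)))
   = (fun h : R => h^-1 *: (k (h *: L v + phi x) - k (phi x))).
  by apply/funext => s; rewrite aff.
have QD (k : R -> R) x v : 'D_v (fun x => k (phi x)) x = 'D_(L v) k (phi x).
  by rewrite /derive Q.
split.
  apply: (smooth_coind (P := fun f => exists2 k, smooth k & f = (fun x => k (phi x))));
    last by exists g.
  move=> _ [k sk ->]; split.
  - by move=> x; apply: continuous_comp; [exact: cphi|exact: smooth_cont].
  - by move=> x v; rewrite /derivable Q; exact: smooth_derivable.
  - by move=> v; exists ('D_(L v) k); [exact: smooth_derive|apply/funext => x].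
move=> x v; rewrite QD -(deriveZ_dir _ _ _ sg) -[_ *: _]/(_ * _) mulr1//.
Qed.

End Affine.

Section Lines.
Context (R : realType).
Lemma FTC_is_derive (F f : R -> R) (a b : R) :
  (forall s, is_derive s (1 : R) F (f s)) -> continuous f -> a <= b ->
  (\int[@lebesgue_measure R]_(s in `[a, b]) (f s)%:E = (F b - F a)%:E)%E.
Proof.
move=> dF cf; rewrite le_eqVlt => /predU1P[->|ab].
  by rewrite set_itv1 integral_set1 subrr.
have cF : continuous F.
  move=> x; apply: differentiable_continuous; apply/derivable1_diffP.
  by have [] := dF x.
rewrite EFinB; apply: continuous_FTC2 => //.
- exact: continuous_subspaceT.
- split.
  + by move=> s _; have [] := dF s.
  + exact: cvg_at_right_filter (cF a).
  + exact: cvg_at_left_filter (cF b).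
- by move=> s _; rewrite derive1E; have [_ ->] := dF s.
Qed.

Lemma line_FTC (V : normedModType R) (f : V -> R) (p v : V) (a b : R) :
  smooth f -> a <= b ->
  (\int[@lebesgue_measure R]_(s in `[a, b]) ('D_v f (p + s *: v))%:E =
   (f (p + b *: v) - f (p + a *: v))%:E)%E.
Proof.
move=> sf ab; apply: (@FTC_is_derive (fun s => f (p + s *: v)) (fun s => 'D_v f (p + s *: v))) => //.
  by move=> s; exact: is_derive_line.
by apply: (@continuous_line _ _ ('D_v f)); apply: smooth_cont; exact: smooth_derive.
Qed.

End Lines.

(** * Flat functions and smooth approximations of the indicator of a box *)

Section Bump.
Context (R : realType).

(** With [t = y / k], this is [t <= 1 + t <= exp t] raised to the power [k]. *)
Lemma expR_pow_bound (k : nat) : exists C : R, forall y : R, 0 < y ->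
  y ^+ k * expR (- y) <= C.
Proof.
exists (k%:R ^+ k) => y y0; rewrite expRN ler_pdivrMr ?expR_gt0//.
case: k => [|k].
  by rewrite !expr0 mul1r -[1](@expR0 R) ler_expR ltW.
have k0 : 0 < k.+1%:R :> R by rewrite ltr0n.
rewrite -ler_pdivrMl ?exprn_gt0// -exprVn -exprMn.
have -> : expR y = expR (k.+1%:R^-1 * y) ^+ k.+1.
  by rewrite -expRM_natl mulrA mulfV ?mul1r// gt_eqF.
apply: lerXn2r; rewrite ?nnegrE ?expR_ge0//.
  by rewrite mulr_ge0 ?invr_ge0 ?ltW.
by rewrite (le_trans _ (expR_ge1Dx _))// lerDr.
Qed.

Lemma poly_exp_bound (p : {poly R}) (k : nat) : exists C : R, forall y : R, 0 < y ->
  y ^+ k * (`|p.[y]| * expR (- y)) <= C.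
Proof.
elim/poly_ind: p k => [|p c IH] k.
  by exists 0 => y y0; rewrite horner0 normr0 mul0r mulr0.
have [C1 H1] := IH k.+1; have [C2 H2] := expR_pow_bound k.
exists (C1 + `|c| * C2) => y y0.
rewrite hornerD hornerC hornerM hornerX.
apply: (@le_trans _ _ (y ^+ k.+1 * (`|p.[y]| * expR (- y)) +
   `|c| * (y ^+ k * expR (- y)))).
  rewrite exprS; have : `|p.[y] * y + c| <= `|p.[y]| * y + `|c|.
    by rewrite (le_trans (ler_normD _ _))// normrM (gtr0_norm y0).
  move=> /(ler_wpM2r (expR_ge0 (- y))) /(ler_wpM2l (exprn_ge0 k (ltW y0))).
  by move=> /le_trans; apply; rewrite le_eqVlt; apply/orP; left; apply/eqP; ring.
by apply: lerD => //; [exact: H1|rewrite ler_wpM2l ?H2].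
Qed.

(** The polynomial is a parameter so that the family, which contains the classical flat function
    [exp (- 1 / x)], is stable under differentiation: [p] becomes [X^2 (p - p')]. *)
Definition flat_fun (p : {poly R}) (x : R) : R :=
  if 0 < x then p.[x^-1] * expR (- x^-1) else 0.

Lemma flat_fun_le0 p x : x <= 0 -> flat_fun p x = 0.
Proof. by rewrite /flat_fun leNgt => /negbTE ->. Qed.

(** Quadratic vanishing is what makes the difference quotient at 0 tend to 0. *)
Lemma flat_fun_bound p : exists2 C : R, 0 <= C & forall x, `|flat_fun p x| <= C * x ^+ 2.
Proof.
have [C H] := poly_exp_bound p 2; exists (`|C|) => // x.
rewrite /flat_fun; case: ltP => [x0|_]; last by rewrite normr0 mulr_ge0// sqr_ge0.
have xV : 0 < x^-1 by rewrite invr_gt0.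
have := H _ xV; rewrite exprVn mulrC ler_pdivrMr ?exprn_gt0// normrM (ger0_norm (expR_ge0 _)).
by move/le_trans; apply; rewrite ler_wpM2r ?sqr_ge0// ler_norm.
Qed.

Lemma is_derive_flat_fun p (x : R) :
  is_derive x (1 : R) (flat_fun p) (flat_fun ('X^2 * (p - p^`())) x).
Proof.
have [x0|x0|x0] := ltgtP x 0.
- rewrite flat_fun_le0 ?ltW//.
  apply: (@near_eq_is_derive _ _ _ (cst 0)) => //.
  near=> y; rewrite flat_fun_le0// ltW//; near: y.
  exact: lt_nbhsl.
- have xn : x != 0 by rewrite gt_eqF.
  rewrite {2}/flat_fun x0.
  apply: (@near_eq_is_derive _ _ _ (fun y : R => p.[y^-1] * expR (- y^-1))) => //.
  + near=> y; rewrite /flat_fun ifT//; near: y; exact: lt_nbhsr.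
  have dV : is_derive x (1 : R) (fun y : R => y^-1) (- x ^- 2).
    have di : derivable (@id R) x (1 : R) by exact: derivable_id.
    apply: DeriveDef; first exact: (@derivableV R R id).
    rewrite (@deriveV R R id x 1 xn di) (@derive_id R R).
    by rewrite -[_ *: _]/(_ * _) mulr1.
  have dN : is_derive x (1 : R) (fun y : R => - y^-1) (x ^- 2).
    by apply: is_derive_eq; rewrite opprK.
  have dp : is_derive (x^-1) (1 : R) (horner p) (p^`()).[x^-1].
    apply: DeriveDef; first exact: derivable_horner.
    by rewrite -derive1E -derivE.
  have d1 := @is_derive1_comp R (horner p) (fun y => y^-1) x _ _ dp dV.
  have d2 := @is_derive1_comp R expR (fun y => - y^-1) x _ _ (is_derive_expR _) dN.
  apply: (@is_derive_eq _ _ _ _ _ _ _ _ (is_deriveM d1 d2)).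
  rewrite /= -![_ *: _]/(_ * _) !(hornerM, hornerD, hornerN, hornerX) expr2 invfM.
  ring.
- rewrite x0 flat_fun_le0//.
  have [C C0 H] := flat_fun_bound p.
  have F0 : flat_fun p 0 = 0 by rewrite flat_fun_le0.
  have E : (fun h : R => h^-1 *: (flat_fun p (h *: (1 : R) + 0) - flat_fun p 0))
      @ 0^' --> (0 : R).
    apply/cvgrPdist_le => e e0; near=> h.
    rewrite sub0r normrN F0 subr0 addr0 -[h *: 1]/(h * 1) mulr1.
    have h0 : h != 0 by near: h; exact: nbhs_dnbhs_neq.
    rewrite normrM normfV mulrC ler_pdivrMr ?normr_gt0//.
    rewrite (le_trans (H h))// -(real_normK (num_real h)) expr2 mulrA ler_wpM2r//.
    have /ltW : `|h| < e / (C + 1).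
      near: h; apply: dnbhs0_lt; rewrite divr_gt0//; lra.
    rewrite ler_pdivlMr; last by lra.
    have := normr_ge0 h; lra.
  by apply: DeriveDef; [exact/cvgP/E|exact: cvg_lim E].
Unshelve. all: by end_near.
Qed.

Lemma smooth_flat_fun p : smooth (flat_fun p).
Proof.
apply: (smooth_coind (P := fun f => exists q, f = flat_fun q)); last by exists p.
move=> _ [q ->]; split.
- move=> x; apply: differentiable_continuous; apply/derivable1_diffP.
  by have [] := is_derive_flat_fun q x.
- move=> x v; apply: diff_derivable; apply/derivable1_diffP.
  by have [] := is_derive_flat_fun q x.
- move=> v; exists (v *: ('X^2 * (q - q^`()))); apply/funext => x.
  have [dq D] := is_derive_flat_fun q x.
  have df : differentiable (flat_fun q) x by exact/derivable1_diffP.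
  have -> : 'D_v (flat_fun q) x = v * 'D_1 (flat_fun q) x.
    by rewrite !deriveE// -[in LHS](mulr1 v) -[v * 1]/(v *: 1) linearZ.
  rewrite D /flat_fun; case: ifP => _; last by rewrite mulr0.
  by rewrite hornerZ; ring.
Qed.

(** The factor [n.+1] steepens the flanks and leaves the support fixed: the bumps, bounded by 1,
    tend to the indicator of the open interval. *)
Definition itv_bump (a b : R) (n : nat) (t : R) : R :=
  flat_fun 1 (n.+1%:R * (t - a)) * flat_fun 1 (n.+1%:R * (b - t)).

Lemma flat_fun1_01 t : 0 <= flat_fun 1 t <= 1.
Proof.
rewrite /flat_fun; case: ifP => t0; last by rewrite lexx ler01.
rewrite hornerC mul1r expR_ge0/= -[1](@expR0 R) ler_expR.
by rewrite oppr_le0 invr_ge0 ltW.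
Qed.

Lemma smooth_itv_bump a b n : smooth (itv_bump a b n).
Proof.
apply: smoothM.
- have [] := @smooth_comp_affine R R (flat_fun 1) (fun t => n.+1%:R * (t - a))
    (fun t => n.+1%:R * t) (smooth_flat_fun 1) _ _ => //.
  + move=> t; apply: cvgMr; apply: cvgB; [exact: cvg_id|exact: cvg_cst].
  + by move=> x v s; rewrite -[s *: v]/(s * v); ring.
- have [] := @smooth_comp_affine R R (flat_fun 1) (fun t => n.+1%:R * (b - t))
    (fun t => - n.+1%:R * t) (smooth_flat_fun 1) _ _ => //.
  + move=> t; apply: cvgMr; apply: cvgB; [exact: cvg_cst|exact: cvg_id].
  + by move=> x v s; rewrite -[s *: v]/(s * v); ring.
Qed.

Lemma itv_bump_01 a b n t : 0 <= itv_bump a b n t <= 1.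
Proof.
have /andP[? ?] := flat_fun1_01 (n.+1%:R * (t - a)).
have /andP[? ?] := flat_fun1_01 (n.+1%:R * (b - t)).
by rewrite mulr_ge0//= mulr_ile1.
Qed.

Lemma itv_bump_out a b n t : ~~ (a < t < b) -> itv_bump a b n t = 0.
Proof.
rewrite negb_and -!leNgt => /orP[ta|bt]; rewrite /itv_bump.
  by rewrite flat_fun_le0 ?mul0r// mulr_ge0_le0// subr_le0.
by rewrite mulrC flat_fun_le0 ?mul0r// mulr_ge0_le0// subr_le0.
Qed.

Lemma flat_fun1_cvg t : 0 < t -> flat_fun 1 (n.+1%:R * t) @[n --> \oo] --> (1 : R).
Proof.
move=> t0.
have -> : (fun n => flat_fun 1 (n.+1%:R * t)) = (fun n => expR (- (t^-1 * (n.+1%:R)^-1))).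
  apply/funext => n; rewrite /flat_fun mulr_gt0 ?ltr0n// hornerC mul1r.
  by rewrite invfM mulrC.
rewrite -[X in _ --> X](@expR0 R); apply: continuous_cvg; first exact: continuous_expR.
rewrite -oppr0; apply: cvgN; rewrite -(mulr0 t^-1); apply: cvgMr.
exact: cvg_harmonic.
Qed.

Lemma itv_bump_cvg a b t : a < t < b -> itv_bump a b n t @[n --> \oo] --> (1 : R).
Proof.
move=> /andP[ta tb]; rewrite -[X in _ --> X](mulr1 1).
by apply: cvgM; apply: flat_fun1_cvg; rewrite subr_gt0.
Qed.

Local Notation pt := (R * R * R)%type.

Lemma continuous_coord1 : continuous (fun p : pt => p.1.1).
Proof.
by move=> p; apply: (@continuous_comp _ _ _ fst fst);
  [exact: cvg_fst|exact: cvg_fst].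
Qed.

Lemma continuous_coord2 : continuous (fun p : pt => p.1.2).
Proof.
by move=> p; apply: (@continuous_comp _ _ _ fst snd);
  [exact: cvg_fst|exact: cvg_snd].
Qed.

Lemma continuous_coord3 : continuous (fun p : pt => p.2).
Proof. by move=> p; exact: cvg_snd. Qed.

Definition box_bump (a b : pt) (n : nat) (p : pt) : R :=
  itv_bump a.1.1 b.1.1 n p.1.1 * itv_bump a.1.2 b.1.2 n p.1.2 *
  itv_bump a.2 b.2 n p.2.

Lemma smooth_box_bump a b n : smooth (box_bump a b n).
Proof.
apply: smoothM; [apply: smoothM|].
- have [] := smooth_comp_affine (L := fun p : pt => p.1.1)
    (smooth_itv_bump a.1.1 b.1.1 n) continuous_coord1 _ => //.
- have [] := smooth_comp_affine (L := fun p : pt => p.1.2)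
    (smooth_itv_bump a.1.2 b.1.2 n) continuous_coord2 _ => //.
- have [] := smooth_comp_affine (L := fun p : pt => p.2)
    (smooth_itv_bump a.2 b.2 n) continuous_coord3 _ => //.
Qed.

Lemma box_bump_01 a b n p : 0 <= box_bump a b n p <= 1.
Proof.
have /andP[? ?] := itv_bump_01 a.1.1 b.1.1 n p.1.1.
have /andP[? ?] := itv_bump_01 a.1.2 b.1.2 n p.1.2.
have /andP[? ?] := itv_bump_01 a.2 b.2 n p.2.
rewrite /box_bump; apply/andP; split.
  by apply: mulr_ge0 => //; apply: mulr_ge0.
by apply: mulr_ile1 => //; [exact: mulr_ge0|exact: mulr_ile1].
Qed.

Definition obox (a b : pt) : set pt :=
  `]a.1.1, b.1.1[ `*` `]a.1.2, b.1.2[ `*` `]a.2, b.2[.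

Definition cbox (a b : pt) : set pt :=
  `[a.1.1, b.1.1] `*` `[a.1.2, b.1.2] `*` `[a.2, b.2].

Lemma compact_cbox a b : compact (cbox a b).
Proof.
by apply: compact_setX; [apply: compact_setX|]; exact: segment_compact.
Qed.

Lemma box_bump_cvg a b p : box_bump a b n p @[n --> \oo] --> (\1_(obox a b) p : R).
Proof.
rewrite indicE; have [pab|] := boolP (p \in obox a b).
  move: pab; rewrite inE => -[[/= p1 p2] p3].
  move: p1 p2 p3; rewrite !in_itv/= => p1 p2 p3.
  have := cvgM (cvgM (itv_bump_cvg p1) (itv_bump_cvg p2)) (itv_bump_cvg p3).
  rewrite !mulr1; exact.
rewrite notin_setE => pab.
suff -> : (fun n => box_bump a b n p) = (fun=> 0) by exact: cvg_cst.
apply/funext => n; rewrite /box_bump.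
have [p1|p1] := boolP (a.1.1 < p.1.1 < b.1.1); last by rewrite itv_bump_out// !mul0r.
have [p2|p2] := boolP (a.1.2 < p.1.2 < b.1.2); last first.
  by rewrite (itv_bump_out _ p2) mulr0 mul0r.
have [p3|p3] := boolP (a.2 < p.2 < b.2); last by rewrite (itv_bump_out _ p3) mulr0.
by exfalso; apply: pab; split; [split|]; rewrite /= in_itv/=.
Qed.

Lemma test_fun_box_bump (U : set pt) a b n : cbox a b `<=` U ->
  test_fun U (box_bump a b n).
Proof.
move=> abU; split; first exact: smooth_box_bump.
exists (cbox a b); split => //; first exact: compact_cbox.
move=> p pab; rewrite /box_bump.
have [p1|p1] := boolP (a.1.1 < p.1.1 < b.1.1); last by rewrite itv_bump_out// !mul0r.
have [p2|p2] := boolP (a.1.2 < p.1.2 < b.1.2); last first.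
  by rewrite (itv_bump_out _ p2) mulr0 mul0r.
have [p3|p3] := boolP (a.2 < p.2 < b.2); last by rewrite (itv_bump_out _ p3) mulr0.
exfalso; apply: pab; split; [split|]; rewrite /= in_itv/=.
- by move: p1 => /andP[/ltW-> /ltW->].
- by move: p2 => /andP[/ltW-> /ltW->].
- by move: p3 => /andP[/ltW-> /ltW->].
Qed.

End Bump.

(** * Measure-theoretic preliminaries *)

Section OpenMeasurable.
Context (R : realType).

(** Balls around a dense family are kept when the ball of twice the radius lies in [U]. The doubling
    leaves room for the closed cube of the same radius. *)
Lemma open_bigcup_ball (T : pseudoMetricType R) (I : Type) (e : I -> T) (U : set T) :
  (forall x (r : R), 0 < r -> exists i, ball x r (e i)) -> open U ->
  U = \bigcup_(s in [set s : I * nat | ball (e s.1) (2 * s.2.+1%:R^-1) `<=` U])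
        ball (e s.1) (s.2.+1%:R^-1).
Proof.
move=> de oU; apply/seteqP; split => [x Ux|x [[i k] /= H] bx]; last first.
  by apply: H; apply: le_ball bx; rewrite ler_peMl ?invr_ge0// ler1n.
have /nbhs_ballP[r /= r0 rU] : nbhs x U by exact: open_nbhs_nbhs.
(* A third of [r]: the distance to the centre and the doubled radius add up to [3 / (k + 1) < r]. *)
have [k kr] : exists k, k.+1%:R^-1 < r / 3.
  have /cvgrPdist_lt/(_ (r / 3)) := @cvg_harmonic R.
  have r3 : 0 < r / 3 by rewrite divr_gt0.
  move=> /(_ r3)[k _ /(_ k (leqnn k))] /=; rewrite sub0r normrN /harmonic.
  by rewrite gtr0_norm ?invr_gt0// => kr; exists k.
have k0 : 0 < k.+1%:R^-1 :> R by rewrite invr_gt0.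
have [i ei] := de x _ k0.
exists (i, k) => /=; last exact: ball_sym.
move=> y /= ey; apply: rU.
have := ball_triangle ei ey; apply: le_ball.
by move: kr; set t := _^-1; lra.
Qed.

Lemma bigcup_countType_measurable d (T : sigmaRingType d) (I : countType)
    (D : set I) (F : I -> set T) :
  (forall i, D i -> measurable (F i)) -> measurable (\bigcup_(i in D) F i).
Proof.
move=> mF; rewrite bigcup_mkcond.
have -> : \bigcup_i (if i \in D then F i else set0) =
   \bigcup_n (if @unpickle I n is Some i then (if i \in D then F i else set0) else set0).
  apply/seteqP; split => [x [i _ Fx]|x [n _]].
    by exists (pickle i) => //; rewrite pickleK.
  by case: unpickle => // i Fx; exists i.
apply: bigcupT_measurable => n; case: unpickle => // i.
by case: ifPn => // /set_mem; exact: mF.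
Qed.

Lemma rat_dense1 (x r : R) : 0 < r -> exists q : rat, ball x r (ratr q : R).
Proof.
move=> r0; have [q] : exists q : rat, (ratr q : R) \in `]x - r, x + r[.
  by apply: rat_in_itvoo; lra.
rewrite in_itv/= => qx; exists q; rewrite -ball_normE/= /ball_ /=.
by rewrite ltr_distlC.
Qed.

Definition rat3 (q : rat * rat * rat) : R * R * R :=
  (ratr q.1.1, ratr q.1.2, ratr q.2).

Lemma rat_dense2 (x : R * R) r : 0 < r ->
  exists q : rat * rat, ball x r (ratr q.1 : R, ratr q.2 : R).
Proof.
move=> r0; have [q1 ?] := rat_dense1 x.1 r0; have [q2 ?] := rat_dense1 x.2 r0.
by exists (q1, q2).
Qed.

Lemma rat_dense3 (x : R * R * R) r : 0 < r -> exists q, ball x r (rat3 q).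
Proof.
move=> r0; have [q1 ?] := rat_dense2 x.1 r0; have [q2 ?] := rat_dense1 x.2 r0.
by exists (q1, q2).
Qed.

Local Notation mR := (measurableTypeR R).

(** The measurable sets are those of the product sigma-algebra. Balls of the supremum norm are
    products of intervals, and an open set is a countable union of them. *)
Lemma open_measurable2 (U : set (R * R)) : open U -> measurable (U : set (mR * mR)).
Proof.
move=> oU; rewrite (open_bigcup_ball rat_dense2 oU).
apply: bigcup_countType_measurable => -[q k] _ /=.
rewrite (_ : ball _ _ = ball (ratr q.1 : R) k.+1%:R^-1 `*` ball (ratr q.2 : R) k.+1%:R^-1)//.
by apply: measurableX; exact: measurable_ball.
Qed.

Lemma open_measurable3 (U : set (R * R * R)) :
  open U -> measurable (U : set (mR * mR * mR)).
Proof.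
move=> oU; rewrite (open_bigcup_ball rat_dense3 oU).
apply: bigcup_countType_measurable => -[q k] _ /=.
rewrite (_ : ball _ _ = ball (ratr q.1.1 : R) k.+1%:R^-1 `*`
    ball (ratr q.1.2 : R) k.+1%:R^-1 `*` ball (ratr q.2 : R) k.+1%:R^-1)//.
by apply: measurableX; [apply: measurableX|]; exact: measurable_ball.
Qed.

Lemma continuous_measurable2 (f : R * R -> R) : continuous f ->
  measurable_fun [set: mR * mR] f.
Proof.
move=> /continuousP cf; apply: (measurability _ (RGenOpens.measurableE R)).
move=> _ [_ [a [b ->] <-]]; rewrite setTI.
by apply: open_measurable2; apply: cf; exact: interval_open.
Qed.

Lemma continuous_measurable3 (f : R * R * R -> R) : continuous f ->
  measurable_fun [set: mR * mR * mR] f.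
Proof.
move=> /continuousP cf; apply: (measurability _ (RGenOpens.measurableE R)).
move=> _ [_ [a [b ->] <-]]; rewrite setTI.
by apply: open_measurable3; apply: cf; exact: interval_open.
Qed.

End OpenMeasurable.

(** * Affine changes of variable on the line *)

Section AffineChange.
Context (R : realType).
Local Notation leb := (@lebesgue_measure R).
Local Notation mR := (measurableTypeR R).

Lemma measurable_affine (b c : R) :
  measurable_fun [set: mR] ((fun r => b + c * r) : mR -> mR).
Proof.
apply: continuous_measurable_fun => x; apply: cvgD; first exact: cvg_cst.
by apply: cvgMr; exact: cvg_id.
Qed.

Lemma affine_preimage_itv (b c x y : R) : c != 0 ->
  (leb (`]x, y]%classic : set mR) =
   `|c|%:E * leb ((fun r => (b + c * r)%R) @^-1` `]x, y]))%E.
Proof.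
move=> c0; have [cp|cn] : 0 < c \/ c < 0 by apply/orP; rewrite -neq_lt eq_sym.
- rewrite (_ : _ @^-1` _ = `](x - b) / c, (y - b) / c]%classic); last first.
    apply/seteqP; split => r /=; rewrite !in_itv/= ltr_pdivrMr// ler_pdivlMr//;
      by rewrite (mulrC c) ltrBlDl lerBrDl.
  rewrite !lebesgue_measure_itv/= !lte_fin ltr_pM2r ?invr_gt0// ltrD2r.
  case: ifPn => _; last by rewrite mule0.
  rewrite -!EFinB -EFinM; congr (_%:E); rewrite gtr0_norm//.
  by field; rewrite gt_eqF.
- rewrite (_ : _ @^-1` _ = `[(y - b) / c, (x - b) / c[%classic); last first.
    apply/seteqP; split => r /=; rewrite !in_itv/= ltr_ndivlMr// ler_ndivrMr//;
      by rewrite (mulrC c) ltrBlDl lerBrDl andbC.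
  rewrite !lebesgue_measure_itv/= !lte_fin ltr_nM2r ?invr_lt0// ltrD2r.
  case: ifPn => _; last by rewrite mule0.
  rewrite -!EFinB -EFinM; congr (_%:E); rewrite ltr0_norm//.
  by field; rewrite lt_eqF.
Qed.

Section integral_affine.
Variables (b c : R) (c0 : c != 0).
Let phi : mR -> mR := fun r => b + c * r.
Let mphi_mixin := isMeasurableFun.Build _ _ _ _ phi (measurable_affine b c).
Let mphi_pack : {mfun mR >-> mR} := HB.pack phi mphi_mixin.

(** The pushforward of Lebesgue measure, scaled by [|c|], agrees with Lebesgue measure on half-open
    intervals, hence on all measurable sets. *)
Lemma ge0_integral_affine (D : set mR) (f : R -> \bar R) : measurable D ->
  measurable_fun (D : set mR) f -> (forall x, D x -> 0 <= f x)%E ->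
  (\int[leb]_(x in D) f x =
   `|c|%:E * \int[leb]_(x in (fun r => (b + c * r)%R) @^-1` D) f (b + c * x)%R)%E.
Proof.
move=> mD mf f0.
have k0 : 0 <= `|c| by [].
rewrite -(@ge0_integral_pushforward _ _ _ _ _ phi (measurable_affine b c) leb D f)//;
  last by move=> x; rewrite inE; exact: f0.
rewrite -(@ge0_integral_mscale _ _ _ (pushforward leb mphi_pack) D mD (NngNum k0) f)//.
apply: eq_measure_integral => //= A mA AD.
by apply: lebesgue_measure_unique => // _ [[x y] /= _ <-]; exact: affine_preimage_itv.
Qed.

End integral_affine.

End AffineChange.

Section FatouBound.
Local Open Scope ereal_scope.
Context d (T : measurableType d) (R : realType) (mu : {measure set T -> \bar R}).

(** The form in which limits are passed below: convergence almost everywhere, and a bound on the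
    integrals that holds for large indices. *)
Lemma fatou_le (D : set T) (f : nat -> T -> \bar R) (g : T -> \bar R) (M : \bar R) :
  measurable D -> measurable_fun D g ->
  (forall n, measurable_fun D (f n)) -> (forall n x, D x -> 0 <= f n x) ->
  {ae mu, forall x, D x -> f n x @[n --> \oo] --> g x} ->
  (forall x, D x -> 0 <= g x) ->
  (\forall n \near \oo, \int[mu]_(x in D) f n x <= M) ->
  \int[mu]_(x in D) g x <= M.
Proof.
move=> mD mg mf f0 fg g0 fM.
have mlim : measurable_fun D (fun x => limn_einf (f^~ x)).
  rewrite (_ : (fun x => _) = (fun x => - limn_esup (fun n => - f n x))); last first.
    by apply/funext => x; rewrite -limn_einfN; congr limn_einf; apply/funext => n /=; rewrite oppeK.
  apply: measurableT_comp => //; apply: measurable_fun_limn_esup => n.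
  by apply: measurableT_comp => //.
have -> : \int[mu]_(x in D) g x = \int[mu]_(x in D) limn_einf (f^~ x).
  apply: ge0_ae_eq_integral => //.
  - move=> x Dx; rewrite limn_einf_lim; apply: lime_ge; first exact: is_cvg_einfs.
    by apply: nearW => n; apply: le_ereal_inf_tmp => _ [k /= _ <-]; exact: f0.
  - move: fg; apply: filterS => x fx Dx.
    by have [-> _] := cvg_limn_einf_sup (fx Dx).
apply: (le_trans (fatou _ _ _ _)) => //.
rewrite limn_einf_lim; apply: lime_le; first exact: is_cvg_einfs.
near=> n; apply: (@le_trans _ _ (\int[mu]_(x in D) f n x)).
  by apply: ereal_inf_lbound; exists n => /=.
by near: n; exact: fM.
Unshelve. all: end_near.
Qed.

End FatouBound.

(** * Semi-inner products and L^2 *)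

Section SemiInner.
Context (R : realType) (V : lmodType R) (S : V -> Prop) (B : V -> V -> R).
Hypothesis S0 : S 0.
Hypothesis Slin : forall a u v, S u -> S v -> S (a *: u + v).
Hypothesis Bsym : forall u v, S u -> S v -> B u v = B v u.
Hypothesis Blin : forall a u v w, S u -> S v -> S w ->
  B (a *: u + v) w = a * B u w + B v w.
Hypothesis Bge0 : forall u, S u -> 0 <= B u u.

(** Discriminant of a nonnegative quadratic. It serves for Cauchy-Schwarz, and in [riesz_sequence]
    with the gap to the infimum as constant term. A negative [A] is contradictory, and [A = 0]
    forces [D = 0]. *)
Lemma quadratic_ge0 (A D c : R) : (forall t, 0 <= c + 2 * t * D + t ^+ 2 * A) ->
  D ^+ 2 <= A * c.
Proof.
move=> H; have [A0|A0|A0] := ltgtP A 0.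
- have c0 : 0 <= c by have := H 0; rewrite expr0n/= mulr0 !mul0r !addr0.
  exfalso; have D0 : 0 <= `|D| by [].
  (* At this [t >= 1] the term [t * - A] exceeds [c + 2 * |D|], so that the quadratic is
     negative. *)
  pose t := (c + `|D| * 2 + 1) / (- A) + 1.
  have A0' : 0 < - A by rewrite oppr_gt0.
  have t1 : 1 <= t.
    by rewrite /t lerDr divr_ge0 ?ltW//; lra.
  have tA : t * (- A) = c + `|D| * 2 + 1 - A by rewrite /t mulrDl divfK ?gt_eqF// mul1r.
  have tD : 2 * t * D <= 2 * t * `|D| by rewrite ler_wpM2l ?ler_norm// mulr_ge0//; lra.
  have tc : c <= t * c by rewrite ler_peMl.
  have := H t; rewrite expr2.
  have : t * (t * (- A)) = t * (c + `|D| * 2 + 1 - A) by rewrite tA.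
  nra.
- have := H (- D / A).
  have -> : c + 2 * (- D / A) * D + (- D / A) ^+ 2 * A = c - D ^+ 2 / A.
    by field; rewrite gt_eqF.
  by rewrite subr_ge0 ler_pdivrMr// mulrC.
- rewrite A0 mul0r; have [->|D0] := eqVneq D 0; first by rewrite expr0n.
  exfalso; have := H (- (c + 1) / (2 * D)).
  rewrite A0 mulr0 addr0.
  have -> : c + 2 * (- (c + 1) / (2 * D)) * D = - 1 by field.
  by rewrite oppr_ge0 ler10.
Qed.

Lemma Slin1 u v : S u -> S v -> S (u + v).
Proof. by move=> Su Sv; rewrite -[u]scale1r; exact: Slin. Qed.

Lemma SZ a u : S u -> S (a *: u).
Proof. by move=> Su; rewrite -[_ *: _]addr0; exact: Slin. Qed.

Lemma SB u v : S u -> S v -> S (u - v).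
Proof. by move=> Su Sv; rewrite -scaleN1r addrC; exact: Slin. Qed.

Lemma BD u v w : S u -> S v -> S w -> B (u + v) w = B u w + B v w.
Proof. by move=> Su Sv Sw; rewrite -[u in LHS]scale1r Blin// mul1r. Qed.

Lemma B0l w : S w -> B 0 w = 0.
Proof.
move=> Sw; have := BD S0 S0 Sw; rewrite addr0 => H; lra.
Qed.

Lemma BZ a u w : S u -> S w -> B (a *: u) w = a * B u w.
Proof. by move=> Su Sw; rewrite -[_ *: _]addr0 Blin// B0l// addr0. Qed.

Lemma linB u v w : S u -> S v -> S w -> B (u - v) w = B u w - B v w.
Proof. by move=> Su Sv Sw; rewrite -scaleN1r addrC Blin// mulN1r addrC. Qed.

Lemma B_expand a u v : S u -> S v ->
  B (a *: u + v) (a *: u + v) = B v v + 2 * a * B u v + a ^+ 2 * B u u.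
Proof.
move=> Su Sv; have Sw := Slin a Su Sv.
rewrite Blin// (Bsym Su Sw) (Bsym Sv Sw) !Blin// (Bsym Sv Su); ring.
Qed.

Definition nrm u := Num.sqrt (B u u).

Lemma sqr_nrm u : S u -> nrm u ^+ 2 = B u u.
Proof. by move=> Su; rewrite sqr_sqrtr// Bge0. Qed.

Lemma nrm_ge0 u : 0 <= nrm u.
Proof. exact: sqrtr_ge0. Qed.

Lemma cauchy_schwarz u v : S u -> S v -> `|B u v| <= nrm u * nrm v.
Proof.
move=> Su Sv; rewrite -ler_sqr ?nnegrE ?mulr_ge0 ?nrm_ge0// exprMn !sqr_nrm//.
rewrite real_normK ?num_real//; apply: quadratic_ge0 => t.
by rewrite -B_expand//; apply/Bge0/Slin.
Qed.

Lemma nrm_triangle u v : S u -> S v -> nrm (u + v) <= nrm u + nrm v.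
Proof.
move=> Su Sv; rewrite -ler_sqr ?nnegrE ?addr_ge0 ?nrm_ge0//.
rewrite sqrrD !sqr_nrm//; last exact: Slin1.
rewrite -(scale1r u) B_expand// scale1r.
have := le_trans (ler_norm _) (cauchy_schwarz Su Sv).
lra.
Qed.

Lemma nrmZ a u : S u -> nrm (a *: u) = `|a| * nrm u.
Proof.
move=> Su; have Sa := SZ a Su; rewrite /nrm BZ// (Bsym Su Sa) BZ//.
by rewrite mulrA -expr2 sqrtrM ?sqr_ge0// sqrtr_sqr.
Qed.

Lemma nrmBC u v : S u -> S v -> nrm (u - v) = nrm (v - u).
Proof.
move=> Su Sv; have -> : u - v = (-1) *: (v - u) by rewrite scaleN1r opprB.
by rewrite nrmZ ?normrN1 ?mul1r//; exact: SB.
Qed.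

(** Minimisation of [J u = B u u - 2 F u] on the possibly incomplete [S], hence a sequence as
    outcome. If [J (u_ n)] is within [1 / (n + 1)] of the infimum, comparison with [t *: v + u_ n]
    for all [t] gives a nonnegative quadratic, whose discriminant is the third claim; this claim for
    [n] and for [m], with [v = u_ n - u_ m], gives the second. *)
Lemma riesz_sequence (F : V -> R) (K : R) :
  (forall a u v, S u -> S v -> F (a *: u + v) = a * F u + F v) ->
  (forall u, S u -> `|F u| <= K * nrm u) ->
  exists u_ : nat -> V, [/\ forall n, S (u_ n),
    forall n m, nrm (u_ n - u_ m) <= Num.sqrt n.+1%:R^-1 + Num.sqrt m.+1%:R^-1 &
    forall n v, S v -> `|B (u_ n) v - F v| <= Num.sqrt n.+1%:R^-1 * nrm v].
Proof.
move=> Flin FK.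
have F0 : F 0 = 0 by have := Flin 1 0 0 S0 S0; rewrite scale1r addr0 => H; lra.
pose J u := B u u - 2 * F u.
pose A := [set J u | u in [set u | S u]].
have A0 : A !=set0 by exists (J 0); exists 0.
have Alb : has_lbound A.
  (* [B u u - 2 F u] is at least [nrm u ^+ 2 - 2 K nrm u], and the square of [nrm u - K] is
     nonnegative. *)
  exists (- K ^+ 2) => _ [u /= Su <-]; rewrite /J -sqr_nrm//.
  have := le_trans (ler_norm _) (FK _ Su); have := sqr_ge0 (nrm u - K); lra.
have Ainf : has_inf A by [].
have /choice[u_ Hu] : forall n, exists u, S u /\ J u < inf A + n.+1%:R^-1.
  move=> n; have n0 : 0 < n.+1%:R^-1 :> R by rewrite invr_gt0.
  have [_ [u Su <-] Ju] := inf_adherent n0 Ainf.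
  by exists u.
have Hv n v : S v -> `|B (u_ n) v - F v| <= Num.sqrt n.+1%:R^-1 * nrm v.
  move=> Sv; have [Sun Jun] := Hu n.
  rewrite -ler_sqr ?nnegrE ?mulr_ge0 ?sqrtr_ge0// exprMn sqr_nrm// sqr_sqrtr//.
  rewrite real_normK ?num_real// mulrC; apply: quadratic_ge0 => t.
  have : inf A <= J (t *: v + u_ n).
    by apply: ge_inf => //; exists (t *: v + u_ n) => //; exact: Slin.
  rewrite /J B_expand// Flin// (Bsym Sv Sun).
  by move: Jun; rewrite /J; set x := _^-1; lra.
exists u_; split=> // [n|n m]; first by have [] := Hu n.
have [Sn _] := Hu n; have [Sm _] := Hu m.
have Sw : S (u_ n - u_ m) by exact: SB.
set w := u_ n - u_ m; set a := Num.sqrt _; set b := Num.sqrt _.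
have [w0|w0] := eqVneq (nrm w) 0; first by rewrite w0 addr_ge0// sqrtr_ge0.
have w0' : 0 < nrm w by rewrite lt_def w0 nrm_ge0.
rewrite -(ler_pM2r w0') -expr2 sqr_nrm// {1}/w linB//.
have := Hv n _ Sw; have := Hv m _ Sw; rewrite -/w -/a -/b !ler_norml.
move=> /andP[h1 h2] /andP[h3 h4]; lra.
Qed.

End SemiInner.

(** * The space L^2 and its completeness *)

Section L2Space.
Context d (T : measurableType d) (R : realType) (mu : {measure set T -> \bar R}).
Variables (D : set T) (mD : measurable D).
Implicit Types f g h : T -> R.

(** Square of the L^2 norm with extended real values: estimates can be stated before the integral is
    known to be finite, whereas [L2norm] reads an infinite integral as 0. *)
Definition E2 f : \bar R := (\int[mu]_(x in D) ((f x) ^+ 2)%:E)%E.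

Lemma measurable_sqr f : measurable_fun D f -> measurable_fun D (fun x => ((f x) ^+ 2)%:E).
Proof. by move=> mf; apply/measurable_EFinP; exact: measurable_funX. Qed.

Lemma E2_ge0 f : (0 <= E2 f)%E.
Proof. by apply: integral_ge0 => x _; rewrite lee_fin sqr_ge0. Qed.

Lemma measurable_lincomb (a : R) f g : measurable_fun D f -> measurable_fun D g ->
  measurable_fun D (fun x => a * f x + g x).
Proof.
move=> mf mg; apply: measurable_funD => //.
by apply: measurable_funM => //; exact: measurable_cst.
Qed.

Lemma E2_lincomb (a : R) f g : measurable_fun D f -> measurable_fun D g ->
  (E2 (fun x => a * f x + g x)%R <= (2 * a ^+ 2)%:E * E2 f + 2%:E * E2 g)%E.
Proof.
move=> mf mg.
have a0 : (0 <= (2 * a ^+ 2)%:E)%E by rewrite lee_fin mulr_ge0// sqr_ge0.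
have t0 : (0 <= 2%:E :> \bar R)%E by [].
rewrite /E2 -!ge0_integralZl//; try exact: measurable_sqr;
  try by move=> x _; rewrite lee_fin sqr_ge0.
rewrite -ge0_integralD//; first last.
- by apply: measurable_funeM; exact: measurable_sqr.
- by move=> x _; rewrite mule_ge0// lee_fin sqr_ge0.
- by apply: measurable_funeM; exact: measurable_sqr.
- by move=> x _; rewrite mule_ge0// lee_fin sqr_ge0.
apply: ge0_le_integral => //.
- by move=> x _; rewrite lee_fin sqr_ge0.
- by apply: measurable_sqr; exact: measurable_lincomb.
- by apply: emeasurable_funD; apply: measurable_funeM; exact: measurable_sqr.
- move=> x _; rewrite -!EFinM -EFinD lee_fin.
  have := sqr_ge0 (a * f x - g x); nra.
Qed.

Lemma E2B f g : measurable_fun D f -> measurable_fun D g ->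
  (E2 (fun x => f x - g x)%R <= 2%:E * E2 f + 2%:E * E2 g)%E.
Proof.
move=> mf mg; have := E2_lincomb (-1) mg mf; rewrite sqrrN expr1n mulr1 addeC.
by congr (_ <= _)%E; congr E2; apply/funext => x; rewrite mulN1r addrC.
Qed.

Lemma E2BC f g : E2 (fun x => f x - g x) = E2 (fun x => g x - f x).
Proof. by apply: eq_integral => x _; rewrite -sqrrN opprB. Qed.

Lemma L2_lincomb (a : R) f g : L2 mu D f -> L2 mu D g -> L2 mu D (fun x => a * f x + g x).
Proof.
move=> [mf If] [mg Ig]; split; first exact: measurable_lincomb.
apply: (le_lt_trans (E2_lincomb a mf mg)).
rewrite lte_add_pinfty// lte_mul_pinfty//.
- by rewrite lee_fin mulr_ge0// sqr_ge0.
Qed.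

Lemma L2_cst0 : L2 mu D (fun=> 0).
Proof.
split; first exact: measurable_cst.
by rewrite (eq_integral (cst 0%E)) ?integral0// => x _; rewrite expr0n.
Qed.

Lemma L2Z (a : R) f : L2 mu D f -> L2 mu D (fun x => a * f x).
Proof.
move=> /(L2_lincomb a)/(_ L2_cst0); congr (L2 _ _ _).
by apply/funext => x; rewrite addr0.
Qed.

Lemma L2B f g : L2 mu D f -> L2 mu D g -> L2 mu D (fun x => f x - g x).
Proof.
move=> Lf Lg; have := L2_lincomb (-1) Lg Lf; congr (L2 _ _ _).
by apply/funext => x; rewrite mulN1r addrC.
Qed.

Lemma L2D f g : L2 mu D f -> L2 mu D g -> L2 mu D (fun x => f x + g x).
Proof.
move=> Lf Lg; have := L2_lincomb 1 Lf Lg; congr (L2 _ _ _).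
by apply/funext => x; rewrite mul1r.
Qed.

Lemma L2_bounded_mul (k : R) f g : measurable_fun D g ->
  (forall x, D x -> `|g x| <= k) -> L2 mu D f -> L2 mu D (fun x => g x * f x).
Proof.
move=> mg gk [mf If]; split; first exact: measurable_funM.
apply: (@le_lt_trans _ _ ((k ^+ 2)%:E * E2 f)%E); last first.
  by rewrite lte_mul_pinfty// lee_fin sqr_ge0.
rewrite /E2 -ge0_integralZl//; first last.
- by rewrite lee_fin sqr_ge0.
- by move=> x _; rewrite lee_fin sqr_ge0.
- exact: measurable_sqr.
apply: ge0_le_integral => //.
- by move=> x _; rewrite lee_fin sqr_ge0.
- by apply: measurable_sqr; exact: measurable_funM.
- by apply: measurable_funeM; exact: measurable_sqr.
- move=> x Dx; rewrite -EFinM lee_fin exprMn ler_wpM2r ?sqr_ge0//.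
  by rewrite -[g x ^+ 2](real_normK (num_real _)) lerXn2r ?nnegrE// ?gk// (le_trans _ (gk _ Dx)).
Qed.

Lemma L2_integrable_mul f g : L2 mu D f -> L2 mu D g ->
  mu.-integrable D (fun x => (f x * g x)%:E).
Proof.
move=> [mf If] [mg Ig].
apply: (@le_integrable _ _ _ mu D mD _ (fun x => ((f x) ^+ 2)%:E + ((g x) ^+ 2)%:E)%E).
- by apply/measurable_EFinP; exact: measurable_funM.
- move=> x _; rewrite -EFinD !abse_EFin lee_fin normrM.
  rewrite (ger0_norm (addr_ge0 (sqr_ge0 _) (sqr_ge0 _))).
  rewrite -[f x ^+ 2](real_normK (num_real _)) -[g x ^+ 2](real_normK (num_real _)).
  have := normr_ge0 (f x); have := normr_ge0 (g x); nra.
- apply: integrableD => //.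
  + apply/integrableP; split; first exact: measurable_sqr.
    rewrite (eq_integral (fun x => ((f x) ^+ 2)%:E))// => x _.
    by rewrite gee0_abs// lee_fin sqr_ge0.
  + apply/integrableP; split; first exact: measurable_sqr.
    rewrite (eq_integral (fun x => ((g x) ^+ 2)%:E))// => x _.
    by rewrite gee0_abs// lee_fin sqr_ge0.
Qed.

Definition ip f g : R := \int[mu]_(x in D) (f x * g x).

Lemma ip_linl (a : R) f g h : L2 mu D f -> L2 mu D g -> L2 mu D h ->
  ip (fun x => a * f x + g x) h = a * ip f h + ip g h.
Proof.
move=> Lf Lg Lh; rewrite /ip.
rewrite -RintegralZl//; last exact: L2_integrable_mul.
rewrite -RintegralD//; last 2 first.
- under [EFin \o _]eq_fun do rewrite /= EFinM.
  by apply: integrableZl => //; exact: L2_integrable_mul.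
- exact: L2_integrable_mul.
by apply: eq_Rintegral => x _; rewrite mulrDl mulrA.
Qed.

Lemma ipC f g : ip f g = ip g f.
Proof. by apply: eq_Rintegral => x _; rewrite mulrC. Qed.

Lemma ip_linr (a : R) f g h : L2 mu D f -> L2 mu D g -> L2 mu D h ->
  ip h (fun x => a * f x + g x) = a * ip h f + ip h g.
Proof. by move=> Lf Lg Lh; rewrite ipC ip_linl// !(ipC h). Qed.

Lemma ip_ge0 f : 0 <= ip f f.
Proof. by apply: Rintegral_ge0 => x _; rewrite -expr2 sqr_ge0. Qed.

Lemma E2_ip f : L2 mu D f -> E2 f = (ip f f)%:E.
Proof.
move=> Lf; have := L2_integrable_mul Lf Lf => /integrable_fin_num -/(_ mD) fn.
by rewrite /ip /Rintegral fineK//.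
Qed.

Lemma E2_L2norm f : L2 mu D f -> E2 f = ((L2norm mu D f) ^+ 2)%:E.
Proof. by move=> Lf; rewrite E2_ip// sqr_sqrtr// ip_ge0. Qed.

Lemma L2norm_ge0 f : 0 <= L2norm mu D f.
Proof. exact: sqrtr_ge0. Qed.

Lemma ip_ae f f' g : measurable_fun D f -> measurable_fun D f' -> measurable_fun D g ->
  ae_eq mu D f f' -> ip f g = ip f' g.
Proof.
move=> mf mf' mg ff'; rewrite /ip /Rintegral; congr fine.
apply: ae_eq_integral => //.
- by apply/measurable_EFinP; exact: measurable_funM.
- by apply/measurable_EFinP; exact: measurable_funM.
- by move: ff'; apply: filterS => x H Dx; rewrite H.
Qed.

Lemma L2_ae f g : measurable_fun D g -> ae_eq mu D f g -> L2 mu D f -> L2 mu D g.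
Proof.
move=> mg fg [mf If]; split => //; move: If; congr (_ < _)%E.
apply: ae_eq_integral => //; [exact: measurable_sqr|exact: measurable_sqr|].
by move: fg; apply: filterS => x H Dx; rewrite H.
Qed.

Lemma L2_cauchy_schwarz f g : L2 mu D f -> L2 mu D g ->
  `|ip f g| <= L2norm mu D f * L2norm mu D g.
Proof.
apply: (@cauchy_schwarz R (T -> R) (L2 mu D) ip) => //.
- by move=> a u v; exact: L2_lincomb.
- by move=> u v _ _; exact: ipC.
- by move=> a u v w; exact: ip_linl.
- by move=> u _; exact: ip_ge0.
Qed.

Lemma L2norm_triangle f g : L2 mu D f -> L2 mu D g ->
  L2norm mu D (fun x => f x + g x) <= L2norm mu D f + L2norm mu D g.
Proof.
apply: (@nrm_triangle R (T -> R) (L2 mu D) ip) => //.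
- by move=> a u v; exact: L2_lincomb.
- by move=> u v _ _; exact: ipC.
- by move=> a u v w; exact: ip_linl.
- by move=> u _; exact: ip_ge0.
Qed.

Lemma L2normBC f g : L2norm mu D (fun x => f x - g x) = L2norm mu D (fun x => g x - f x).
Proof.
by rewrite /L2norm; congr Num.sqrt; apply: eq_Rintegral => x _; rewrite -sqrrN opprB.
Qed.

Lemma E2_eq0 f : measurable_fun D f -> E2 f = 0%E -> ae_eq mu D f (fun=> 0).
Proof.
move=> mf E0.
have : ae_eq mu D (fun x => ((f x) ^+ 2)%:E) (cst 0%E).
  apply/(ae_eq_integral_abs mu mD (measurable_sqr mf)).
  rewrite -[RHS]E0; apply: eq_integral => x _.
  by rewrite gee0_abs// lee_fin sqr_ge0.
apply: filterS => x H Dx.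
have /eqP := H Dx; rewrite eqe sqrf_eq0 => /eqP//.
Qed.

(** The sum of [4^k (a_(k+1) - a_k)^2] has integral at most the sum of [2^-(k+1)], so at almost
    every point it has a finite value [M]; there each increment is at most [sqrt M / 2^k], and the
    telescoping series converges absolutely. *)
Lemma ae_cvg_of_fast_cauchy (a : nat -> T -> R) :
  (forall k, measurable_fun D (a k)) ->
  (forall k, (E2 (fun x => a k.+1 x - a k x)%R <= (((4 ^+ k) * (2 ^ k.+1)%:R)^-1)%:E)%E) ->
  {ae mu, forall x, D x -> cvgn (fun k => a k x)}.
Proof.
move=> ma aE.
pose s k x : \bar R := ((4 ^+ k)%:E * ((a k.+1 x - a k x) ^+ 2)%:E)%E.
have s0 k x : D x -> (0 <= s k x)%E.
  by move=> _; rewrite mule_ge0// lee_fin ?sqr_ge0// exprn_ge0.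
have mda k : measurable_fun D (fun x => a k.+1 x - a k x) by exact: measurable_funB.
have ms k : measurable_fun D (s k).
  by apply: measurable_funeM; exact: measurable_sqr.
have Es k : (\int[mu]_(x in D) s k x <= (1 / (2 ^ (k + 1))%:R)%:E)%E.
  have k0 : (0 <= (4 ^+ k)%:E :> \bar R)%E by rewrite lee_fin exprn_ge0.
  rewrite (ge0_integralZl mu mD (measurable_sqr (mda k)) _ k0); last first.
    by move=> x _; rewrite lee_fin sqr_ge0.
  apply: (@le_trans _ _ ((4 ^+ k)%:E * (((4 ^+ k) * (2 ^ k.+1)%:R)^-1)%:E)%E).
    by rewrite lee_pmul2l// ?lte_fin ?exprn_gt0//; exact: aE.
  by rewrite -EFinM lee_fin invfM mulrA divff ?gt_eqF ?exprn_gt0// addn1.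
have mS : measurable_fun D (fun x => \sum_(0 <= k <oo) s k x)%E.
  by apply: ge0_emeasurable_sum => // k x Dx _; exact: s0.
have iS : mu.-integrable D (fun x => \sum_(0 <= k <oo) s k x)%E.
  apply/integrableP; split => //.
  rewrite (eq_integral (fun x => \sum_(0 <= k <oo) s k x)%E); last first.
    by move=> x /[!inE] Dx; rewrite gee0_abs// nneseries_ge0// => k _ _; exact: s0.
  rewrite integral_nneseries//.
  have := @cvg_geometric_eseries_half R 1 0 => /cvg_lim E.
  apply: (@le_lt_trans _ _ (\sum_(0 <= k <oo) (1 / (2 ^ (k + 1))%:R)%:E)%E).
    apply: lee_nneseries => [k _ _|k _]; last exact: Es.
    by apply: integral_ge0 => x Dx; exact: s0.
  by rewrite E// ltry.
have := integrable_ae mD iS; apply: filterS => x H Dx.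
have /fineK : (\sum_(0 <= k <oo) s k x)%E \is a fin_num by exact: H.
set M := fine _ => HM.
have M0 : 0 <= M by apply: fine_ge0; apply: nneseries_ge0 => k _ _; exact: s0.
have bnd k : `|a k.+1 x - a k x| <= Num.sqrt M * 2^-1 ^+ k.
  have : (s k x <= M%:E)%E.
    rewrite HM; apply: (@le_trans _ _ (\sum_(0 <= i < k.+1) s i x)%E).
      rewrite big_nat_recr//=; apply: leeDr; apply: sume_ge0 => i _; exact: s0.
    by apply: nneseries_lim_ge => i _ _; exact: s0.
  rewrite /s -EFinM lee_fin => sM.
  have h0 : 0 <= 2^-1 ^+ k :> R by rewrite exprn_ge0.
  rewrite -ler_sqr ?nnegrE ?mulr_ge0// real_normK ?num_real// exprMn sqr_sqrtr//.
  rewrite -exprM mulnC exprM -[2^-1 ^+ 2](_ : 4^-1 = _); last by field.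
  by rewrite exprVn ler_pdivlMr ?exprn_gt0// mulrC.
suff : cvgn (series (telescope (fun k => a k x))).
  rewrite telescopeK => C; rewrite (_ : (fun k => a k x) =
     (fun k => (a k x - a 0%N x) + a 0%N x)); last first.
    by apply/funext => k; rewrite subrK.
  by apply: is_cvgD => //; exact: is_cvg_cst.
apply: normed_cvg; apply: (@series_le_cvg _ _ (geometric (Num.sqrt M) 2^-1)) => //.
- by move=> n /=.
- by move=> n; rewrite /geometric /= mulr_ge0 ?sqrtr_ge0 ?exprn_ge0.
- by apply: is_cvg_geometric_series; rewrite ger0_norm//; lra.
Qed.

(** Riesz-Fischer: a fast subsequence converges almost everywhere, and Fatou's lemma in the second
    index gives convergence of the whole sequence. *)
Lemma L2_complete (f : nat -> T -> R) :
  (forall n, L2 mu D (f n)) ->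
  (forall e : R, 0 < e -> exists N, forall n m, (N <= n)%N -> (N <= m)%N ->
     (E2 (fun x => f n x - f m x)%R <= e%:E)%E) ->
  exists2 g, L2 mu D g & forall e : R, 0 < e ->
     \forall n \near \oo, (E2 (fun x => f n x - g x)%R <= e%:E)%E.
Proof.
move=> Lf cf.
have /choice[N HN] : forall k, exists N, forall n m, (N <= n)%N -> (N <= m)%N ->
     (E2 (fun x => f n x - f m x)%R <= (((4 ^+ k) * (2 ^ k.+1)%:R)^-1)%:E)%E.
  by move=> k; apply: cf; rewrite invr_gt0 mulr_gt0// ?exprn_gt0// ltr0n expn_gt0.
(* Strictly increasing, and at least [N k] at step [k]. *)
pose phi := fix phi k := if k is k'.+1 then maxn (phi k').+1 (N k) else N 0%N.
have phiN k : (N k <= phi k)%N by case: k => //= k; exact: leq_maxr.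
have phiS k : (phi k < phi k.+1)%N by rewrite /= leq_maxl.
have phik k : (k <= phi k)%N.
  by elim: k => // k IH; exact: leq_ltn_trans IH (phiS k).
pose a k := f (phi k).
have mf n : measurable_fun D (f n) by have [] := Lf n.
have acvg : {ae mu, forall x, D x -> cvgn (fun k => a k x)}.
  apply: ae_cvg_of_fast_cauchy => k; first exact: mf.
  by apply: HN => //; exact: leq_trans (phiN k) (ltnW (phiS k)).
(* The upper limit is measurable on all of [D], and it is the limit at the points where there is
   one. *)
pose g x := fine (limn_esup (fun k => (a k x)%:E)).
have mg : measurable_fun D g.
  apply: measurableT_comp => //; apply: measurable_fun_limn_esup => k.
  by apply/measurable_EFinP; exact: mf.
have ag : {ae mu, forall x, D x -> a k x @[k --> \oo] --> g x}.
  move: acvg; apply: filterS => x H Dx; have /cvg_ex[/= l al] := H Dx.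
  suff -> : g x = l by [].
  have ale : (fun k => (a k x)%:E) @ \oo --> l%:E by apply: cvg_EFin => //; exact: nearW.
  by rewrite /g; have [_ ->] := cvg_limn_einf_sup ale.
have main (e : R) : 0 < e -> \forall n \near \oo, (E2 (fun x => f n x - g x)%R <= e%:E)%E.
  move=> e0; have [M HM] := cf _ e0.
  exists M => // n /= Mn.
  apply: (fatou_le (f := fun k x => ((f n x - a k x) ^+ 2)%:E)) => //.
  - by apply: measurable_sqr; exact: measurable_funB.
  - by move=> k; apply: measurable_sqr; apply: measurable_funB; exact: mf.
  - by move=> k x _; rewrite lee_fin sqr_ge0.
  - move: ag; apply: filterS => x H Dx; apply: cvg_EFin; first exact: nearW.
    rewrite [X in _ --> X](_ : _ = (f n x - g x) * (f n x - g x))//.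
    by apply: cvgM; apply: cvgB; (exact: cvg_cst || exact: H).
  - by move=> x _; rewrite lee_fin sqr_ge0.
  - exists M => // k /= Mk; apply: HM => //.
    exact: leq_trans Mk (phik k).
exists g => //.
(* [g] is square integrable because it is at finite distance from one [f n]. *)
have [n _ /(_ n (leqnn n)) En] := main 1 ltr01.
have Lfg : L2 mu D (fun x => f n x - g x).
  by split; [exact: measurable_funB|apply: (le_lt_trans En); rewrite ltry].
have := L2B (Lf n) Lfg; congr (L2 _ _ _).
by apply/funext => x; rewrite opprB addrC subrK.
Qed.

End L2Space.

(** * Weak derivatives on the cylinder *)

Section Boxes.
Context (R : realType).
Local Notation pt := (R * R * R)%type.
Local Notation mR := (measurableTypeR R).
Local Notation mpt := (mR * mR * mR)%type.

Lemma ball_obox (c : pt) (r : R) : ball c r =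
  obox (c.1.1 - r, c.1.2 - r, c.2 - r) (c.1.1 + r, c.1.2 + r, c.2 + r).
Proof.
apply/seteqP; split => p /=.
  move=> [[/= p1 p2] p3]; move: p1 p2 p3.
  rewrite -!ball_normE/= /ball_/= !ltr_distlC => p1 p2 p3.
  by split; [split|]; rewrite /= in_itv.
move=> [[/= p1 p2] p3]; move: p1 p2 p3; rewrite !in_itv/= => p1 p2 p3.
by split; [split|]; rewrite /= -!ball_normE/= /ball_/= !ltr_distlC.
Qed.

Lemma cbox_ball (c : pt) (r : R) : 0 < r ->
  cbox (c.1.1 - r, c.1.2 - r, c.2 - r) (c.1.1 + r, c.1.2 + r, c.2 + r) `<=`
  ball c (2 * r).
Proof.
move=> r0 p [[/= p1 p2] p3]; move: p1 p2 p3; rewrite !in_itv/=.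
move=> /andP[? ?] /andP[? ?] /andP[? ?].
by split; [split|]; rewrite /= -!ball_normE/= /ball_/= !ltr_distlC; apply/andP; split; lra.
Qed.

Lemma measurable_obox (a b : pt) : measurable (obox a b : set mpt).
Proof. by apply: measurableX => //; apply: measurableX. Qed.

Definition oboxes : set (set mpt) := [set A | exists a b, A = obox a b].

Lemma obox_cap (a b c d : pt) : obox a b `&` obox c d =
  obox (Num.max a.1.1 c.1.1, Num.max a.1.2 c.1.2, Num.max a.2 c.2)
       (Num.min b.1.1 d.1.1, Num.min b.1.2 d.1.2, Num.min b.2 d.2).
Proof.
apply/seteqP; split => p /=.
  move=> [[[/= p1 p2] p3] [[/= q1 q2] q3]].
  move: p1 p2 p3 q1 q2 q3; rewrite !in_itv/=.
  move=> /andP[? ?] /andP[? ?] /andP[? ?] /andP[? ?] /andP[? ?] /andP[? ?].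
  split; [split|]; rewrite /= in_itv/= gt_max lt_min; apply/andP; split; exact/andP.
move=> [[/= p1 p2] p3]; move: p1 p2 p3; rewrite !in_itv/= !gt_max !lt_min.
move=> /andP[/andP[? ?] /andP[? ?]] /andP[/andP[? ?] /andP[? ?]] /andP[/andP[? ?] /andP[? ?]].
by split; split; [split| |split|]; rewrite /= in_itv/=; exact/andP.
Qed.

Lemma open_oboxes (U : set pt) : open U -> <<s oboxes >> (U : set mpt).
Proof.
move=> oU; rewrite (open_bigcup_ball (@rat_dense3 R) oU).
pose T' := g_sigma_algebraType oboxes.
apply: (@bigcup_countType_measurable _ T') => -[q k] _ /=.
apply: sub_sigma_algebra; rewrite ball_obox; eexists; eexists; reflexivity.
Qed.

(** Open boxes are stable under intersection, so this opens the way to Dynkin's theorem. For the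
    main inclusion, the identity from the sigma-algebra of boxes is measurable because the three
    coordinates are continuous and open sets are countable unions of boxes. *)
Lemma measurable_ptE : @measurable _ mpt = <<s oboxes >>.
Proof.
apply/seteqP; split; last first.
  apply: smallest_sub; first exact: sigma_algebra_measurable.
  move=> _ [a [b ->]]; exact: measurable_obox.
move=> A mA.
pose T' := g_sigma_algebraType oboxes.
have mc (f : pt -> R) : continuous f -> measurable_fun [set: T'] (f : T' -> mR).
  move=> /continuousP cf; apply: (measurability _ (RGenOpens.measurableE R)).
  move=> _ [_ [a [b ->] <-]]; rewrite setTI.
  by apply: open_oboxes; apply: cf; exact: interval_open.
have m1 : measurable_fun [set: T'] (fun p : T' => (p : pt).1 : mR * mR).
  apply/measurable_fun_pairP; split.
    exact: mc (@continuous_coord1 R).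
  exact: mc (@continuous_coord2 R).
have mid : measurable_fun [set: T'] (fun p : T' => p : mpt).
  apply/measurable_fun_pairP; split; first exact: m1.
  exact: mc (@continuous_coord3 R).
by have := mid measurableT A mA; rewrite setTI.
Qed.

End Boxes.

(** * The fundamental lemma of the calculus of variations *)

Section FundamentalLemma.
Context (R : realType).
Local Notation pt := (R * R * R)%type.
Local Notation mR := (measurableTypeR R).
Local Notation mpt := (mR * mR * mR)%type.
Local Notation mu := (@leb3 R).
Variables (D U : set mpt) (w : pt -> R).
Hypothesis mD : measurable D.
Hypothesis UD : U `<=` D.
Hypothesis iw : mu.-integrable D (EFin \o w).
Hypothesis w0 : forall psi, test_fun (U : set pt) psi ->
  \int[mu]_(p in D) (w p * psi p) = 0.

Let mw : measurable_fun D w.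
Proof. by apply/measurable_EFinP; case/integrableP : iw. Qed.

Lemma sub_obox_cbox (a b : pt) : obox a b `<=` cbox a b.
Proof.
move=> p [[/= p1 p2] p3]; move: p1 p2 p3; rewrite !in_itv/=.
move=> /andP[/ltW p1 /ltW p1'] /andP[/ltW p2 /ltW p2'] /andP[/ltW p3 /ltW p3'].
by split; [split|]; rewrite /= in_itv/=; exact/andP.
Qed.

(** Bumps supported in the closed box tend to the indicator of the open one, with [|w|] as
    dominating function. *)
Lemma integral_test_box (a b : pt) : cbox a b `<=` U ->
  (\int[mu]_(p in obox a b) (w p)%:E = 0)%E.
Proof.
move=> abU.
have obD : obox a b `<=` D.
  by move=> p /sub_obox_cbox pab; apply/UD/abU.
have mB : measurable (obox a b : set mpt) by exact: measurable_obox.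
have mi : measurable_fun D (\1_(obox a b) : mpt -> R).
  by apply: measurable_funTS; exact: measurable_indic.
have mbump n : measurable_fun D (box_bump a b n : mpt -> R).
  apply: measurable_funTS; apply: continuous_measurable3; apply: smooth_cont.
  exact: smooth_box_bump.
have fcvg : {ae mu, forall p, D p -> (w p * box_bump a b n p)%:E @[n --> \oo] -->
    (w p * \1_(obox a b) p)%:E}.
  apply: aeW => p Dp; apply: cvg_EFin; first exact: nearW.
  by apply: cvgM; [exact: cvg_cst|exact: box_bump_cvg].
have fdom : {ae mu, forall p, forall n : nat, D p ->
    (`|(w p * box_bump a b n p)%:E| <= (`|w p|)%:E)%E}.
  apply: aeW => p n Dp; rewrite abse_EFin lee_fin normrM.
  have /andP[b0 b1] := box_bump_01 a b n p.
  by rewrite (ger0_norm b0) ler_piMr.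
have [_ _] := dominated_convergence mD
   (fun n => (measurable_EFinP _ _).2 (measurable_funM mw (mbump n)))
   ((measurable_EFinP _ _).2 (measurable_funM mw mi)) fcvg (integrable_abse iw) fdom.
set L := [sequence _]_n.
have -> : L = (fun=> 0%E).
  apply/funext => n; rewrite /L /=.
  have := w0 (test_fun_box_bump n abU).
  rewrite /Rintegral => /eqP; rewrite fine_eq0; first by move/eqP.
  apply: integrable_fin_num => //.
  apply: (le_integrable mD _ _ iw).
    by apply/measurable_EFinP; exact: measurable_funM.
  move=> p _; rewrite !abse_EFin lee_fin normrM.
  have /andP[b0 b1] := box_bump_01 a b n p.
  by rewrite (ger0_norm b0) ler_piMr.
move=> /cvg_lim; rewrite lim_cst// => /(_ (@ereal_hausdorff R)) ->.
rewrite (@integral_mkcond _ mpt R mu (obox a b)) (@integral_mkcond _ mpt R mu D).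
apply: eq_integral => p _.
rewrite !patchE /= indicE; case: ifPn => pB.
  rewrite ifT ?mulr1//; apply/mem_set/obD; exact: set_mem pB.
by rewrite mulr0; case: ifP.
Qed.

(** The sets [A] such that [w] has integral 0 over the part of [A] in the box contain all open boxes
    and form a Dynkin class, so every measurable set is among them. *)
Lemma ae0_test_box (a b : pt) : cbox a b `<=` U -> ae_eq mu (obox a b) w (fun=> 0).
Proof.
move=> abU.
have obD : obox a b `<=` D.
  by move=> p /sub_obox_cbox pab; apply/UD/abU.
have mB : measurable (obox a b : set mpt) by exact: measurable_obox.
have iB : mu.-integrable (obox a b) (EFin \o w) by exact: integrableS mD mB obD iw.
have key : forall A : set mpt, measurable A ->
   (\int[mu]_(p in A `&` obox a b) (w p)%:E = 0)%E.
  move=> A; rewrite (@measurable_ptE R); move: A.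
  apply: (@dynkin_induction _ mpt (@oboxes R)
    (fun A => (\int[mu]_(p in A `&` obox a b) (w p)%:E = 0)%E)).
  - exact: measurable_ptE.
  - by move=> _ _ [c [d ->]] [e [f ->]]; rewrite obox_cap; eexists; eexists.
  - by rewrite setTI; exact: integral_test_box.
  - move=> _ [c [d ->]]; rewrite obox_cap; apply: integral_test_box.
    move=> p [[/= p1 p2] p3]; apply: abU; move: p1 p2 p3; rewrite !in_itv/= !ge_max !le_min.
    move=> /andP[/andP[? ?] /andP[? ?]] /andP[/andP[? ?] /andP[? ?]] /andP[/andP[? ?] /andP[? ?]].
    by split; [split|]; rewrite /= in_itv/=; exact/andP.
  - move=> A mA HA.
    have := integral_test_box abU.
    have E : obox a b = (A `&` obox a b) `|` (~` A `&` obox a b).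
      by rewrite -setIUl setUv setTI.
    rewrite {1}E integral_setU//.
    + by rewrite HA add0e.
    + exact: measurableI.
    + by apply: measurableI => //; exact: measurableC.
    + by rewrite -E; apply/measurable_EFinP; exact: measurable_funS mw.
    + apply/disj_set2P; rewrite -subset0 => p [[? _] [? _]] //.
  - move=> F mF tF HF; rewrite setI_bigcupl integral_bigcup//.
    + by apply: eseries0 => n _ _; exact: HF.
    + exact: trivIset_setIr.
    + by move=> k; exact: measurableI.
    + apply: integrableS iB => //; rewrite -?setI_bigcupl.
        by apply: measurableI => //; exact: bigcupT_measurable.
      exact: subIsetr.
have : ae_eq mu (obox a b) (EFin \o w) (cst 0%E).
  apply: integral_ae_eq => // E EB mE.
  rewrite integral0 -(setIidl EB); exact: key.
by apply: filterS => p H pB; case: (H pB).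
Qed.

Hypothesis oU : open (U : set pt).
Hypothesis DU0 : mu (D `\` U) = 0%E.

Lemma fundamental_lemma : ae_eq mu D w (fun=> 0).
Proof.
(* Enumeration of the rational cubes whose doubles lie in [U], with the empty set at the other
   indices. *)
pose G (n : nat) : set mpt := if @unpickle (rat * rat * rat * nat)%type n is Some s then
  (if pselect (ball (@rat3 R s.1) (2 * s.2.+1%:R^-1) `<=` U) then
     ball (@rat3 R s.1) (s.2.+1%:R^-1) else set0) else set0.
have GP n : {ae mu, forall p, G n p -> w p = 0}.
  rewrite /G; case: unpickle => [[q k]|]; last by apply: aeW.
  case: pselect => /= H; last by apply: aeW.
  rewrite ball_obox; apply: ae0_test_box => p Hp; apply: H.
  by apply: cbox_ball Hp; rewrite invr_gt0.
have UG p : U p -> exists n, G n p.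
  rewrite {1}(open_bigcup_ball (@rat_dense3 R) oU) => -[[q k] /= H pB].
  by exists (pickle (q, k)); rewrite /G pickleK /=; case: pselect.
have GA := ae_foralln GP.
have : {ae mu, forall p, ~ (D `\` U) p}.
  exists (D `\` U); split => //.
    by apply: measurableD => //; exact: open_measurable3.
  by move=> p /= /contrapT.
apply: filterS2 GA => p Hp NDU Dp.
have [Up|nUp] := pselect (U p); last by exfalso; apply: NDU.
by have [n /Hp] := UG p Up.
Qed.

End FundamentalLemma.

Section Cyl.
Context (R : realType).
Local Notation pt := (R * R * R)%type.
Local Notation mR := (measurableTypeR R).
Local Notation mpt := (mR * mR * mR)%type.
Local Notation mu := (@leb3 R).
Variables (Omega : set (R * R)) (h : R).
Hypothesis oOmega : open Omega.
Hypothesis bOmega : bounded_set Omega.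
Hypothesis h0 : 0 < h.
Local Notation C := (cyl Omega h).
Local Notation U := (Omega `*` `]0, h[).

Lemma domain_bound : exists2 M : R, 0 < M &
  forall q, Omega q -> `|q.1| <= M /\ `|q.2| <= M.
Proof.
have [M [_ HM]] := bOmega.
exists (Num.max M 0 + 1); first by rewrite ltr_wpDl// le_max lexx orbT.
move=> q /(HM (Num.max M 0 + 1)) => /(_ _)/wrap[].
  by rewrite ltr_pwDr// le_max lexx.
by rewrite /Num.norm /= ge_max => /andP[].
Qed.

Lemma measurable_domain : measurable (Omega : set (mR * mR)).
Proof. exact: open_measurable2. Qed.

Lemma measurable_cyl : measurable (C : set mpt).
Proof. by apply: measurableX => //; exact: measurable_domain. Qed.

Lemma cyl_cbox : exists2 M : R, 0 < M & C `<=` cbox (- M, - M, 0) (M, M, h).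
Proof.
have [M M0 HM] := domain_bound; exists M => // p [/= /HM[p1 p2] p3].
by split; [split|] => //=; rewrite in_itv/= -ler_norml.
Qed.

Lemma leb3X (A : set (mR * mR)) (B : set mR) : measurable A -> measurable B ->
  mu (A `*` B) = (@leb2 R A * @lebesgue_measure R B)%E.
Proof. exact: product_measure1E. Qed.

Lemma leb2X (A B : set mR) : measurable A -> measurable B ->
  @leb2 R (A `*` B) = (@lebesgue_measure R A * @lebesgue_measure R B)%E.
Proof. exact: product_measure1E. Qed.

Lemma leb3_cbox (a b : pt) : (mu (cbox a b) < +oo)%E.
Proof.
rewrite leb3X//; last exact: measurableX.
rewrite leb2X// !lebesgue_measure_itv/=.
by do 3 (case: ifP => _; rewrite ?mul0e ?mule0 -?EFinB -?EFinM ?ltry ?ltr0y//).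
Qed.

Lemma measurable_cbox (a b : pt) : measurable (cbox a b : set mpt).
Proof. by apply: measurableX => //; apply: measurableX. Qed.

Lemma cyl_finite : (mu C < +oo)%E.
Proof.
have [M M0 CM] := cyl_cbox; apply: le_lt_trans (leb3_cbox (- M, - M, 0) (M, M, h)).
apply: le_measure; rewrite ?inE//; [exact: measurable_cyl|exact: measurable_cbox].
Qed.

Lemma open_U : open (U : set pt).
Proof.
have -> : U = (fst @^-1` Omega) `&` (snd @^-1` `]0, h[) by apply/seteqP; split.
apply: openI; apply: open_comp => //; try exact: interval_open.
  by move=> x _; exact: cvg_fst.
by move=> x _; exact: cvg_snd.
Qed.

Lemma sub_U_cyl : U `<=` C.
Proof.
move=> p [p1 /= p2]; split => //=; move: p2; rewrite !in_itv/= => /andP[/ltW-> /ltW->//].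
Qed.

(** Integrals are taken over the cylinder with its two ends, while test functions live on the open
    cylinder; [fundamental_lemma] asks that the difference be a null set. *)
Lemma cylDU_null : mu (C `\` U) = 0%E.
Proof.
apply/eqP; rewrite -measure_le0.
apply: (@le_trans _ _ (mu ((Omega `*` [set 0 : R]) `|` (Omega `*` [set h])))).
  apply: le_measure; rewrite ?inE.
  - apply: measurableD; first exact: measurable_cyl.
    by apply: open_measurable3; exact: open_U.
  - by apply: measurableU; apply: measurableX => //; exact: measurable_domain.
  - move=> p [[/= p1]]; rewrite in_itv/= => /andP[p2 p3] H.
    have [->|p0] := eqVneq p.2 0; first by left; split.
    have [->|ph] := eqVneq p.2 h; first by right; split.
    exfalso; apply: H; split => //=; rewrite in_itv/= !lt_def p2 p3 p0 eq_sym ph//.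
apply: (le_trans (measureU2 _ _ _)).
- by apply: measurableX => //; exact: measurable_domain.
- by apply: measurableX => //; exact: measurable_domain.
- have E z : mu (Omega `*` [set z]) = 0%E.
    apply: etrans (@leb3X Omega [set z] measurable_domain (measurable_set1 z)) _.
    by rewrite lebesgue_measure_set1 mule0.
  have H : (mu (Omega `*` [set 0%R]) + mu (Omega `*` [set h]) <= 0)%E by rewrite !E adde0.
  exact: H.
Qed.

Lemma continuous_bounded_cyl (f : pt -> R) : continuous f ->
  exists k, forall p, C p -> `|f p| <= k.
Proof.
move=> cf; have [M M0 CM] := cyl_cbox.
have [k [_ Hk]] := compact_bounded (continuous_compact
  (continuous_subspaceT cf) (@compact_cbox R (- M, - M, 0) (M, M, h))).
exists (k + 1) => p /CM Cp; apply: (Hk (k + 1)); first by rewrite ltrDl.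
by exists p.
Qed.

Lemma bounded_L2 (f : pt -> R) (k : R) : measurable_fun C f ->
  (forall p, C p -> `|f p| <= k) -> L2 mu C f.
Proof.
move=> mf fk; split => //.
apply: (@le_lt_trans _ _ (\int[mu]_(p in C) (k ^+ 2)%:E)%E).
  apply: ge0_le_integral => //.
  - exact: measurable_cyl.
  - by move=> p _; rewrite lee_fin sqr_ge0.
  - by apply: measurable_sqr.
  - move=> p Cp; rewrite lee_fin -[_ ^+ 2](real_normK (num_real _)).
    by rewrite lerXn2r ?nnegrE// ?fk// (le_trans _ (fk _ Cp)).
rewrite integral_cst ?lte_mul_pinfty//; last exact: measurable_cyl.
- by rewrite lee_fin sqr_ge0.
- exact: cyl_finite.
Qed.

Lemma cont_L2 (f : pt -> R) : continuous f -> L2 mu C f.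
Proof.
move=> cf; have [k Hk] := continuous_bounded_cyl cf.
by apply: (bounded_L2 (k := k)) => //; apply: measurable_funTS; exact: continuous_measurable3.
Qed.

End Cyl.

(** * Fubini and Tonelli in the plane and in space *)

Section FubiniWrappers.
Context (R : realType).
Local Notation mR := (measurableTypeR R).
Local Notation mpt := (mR * mR * mR)%type.
Local Notation mu := (@leb3 R).
Local Notation leb := (@lebesgue_measure R).
(** [leb3] is the product of the planar measure with the line, and its iterated integrals call for a
    sigma-finite first factor, here exhausted by squares. *)
Lemma leb2_sigma_finite : sigma_finite [set: (mR * mR)%type] (leb \x leb)%E.
Proof.
exists (fun n => `[- n%:R, n%:R]%classic `*` `[- n%:R, n%:R]%classic).
  apply/seteqP; split => // p _.
  exists (Num.truncn (`|p.1| + `|p.2|)).+1 => //.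
  have : `|p.1| + `|p.2| < (Num.truncn (`|p.1| + `|p.2|)).+1%:R.
    by apply: truncnS_gt; rewrite addr_ge0.
  set n := _.+1; move=> H.
  have n1 := normr_ge0 p.1; have n2 := normr_ge0 p.2.
  by split; rewrite /= in_itv/= -ler_norml; lra.
move=> n; split; first exact: measurableX.
rewrite (_ : (leb \x leb)%E _ = (leb `[(- n%:R)%R, n%:R] * leb `[(- n%:R)%R, n%:R])%E);
  last exact: product_measure1E.
rewrite !lebesgue_measure_itv/=.
by case: ifP => _; rewrite ?mul0e ?mule0 -?EFinB -?EFinM ?ltry ?ltr0y.
Qed.

Let sf_mixin := Measure_isSigmaFinite.Build _ _ _ (leb \x leb)%E leb2_sigma_finite.
Definition leb2_sf : {sigma_finite_measure set (mR * mR)%type -> \bar R} :=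
  HB.pack (leb \x leb)%E sf_mixin.

Lemma leb3_Fubini12 (f : mpt -> \bar R) : mu.-integrable [set: mpt] f ->
  (\int[mu]_p f p = \int[@leb2 R]_q \int[leb]_z f (q, z))%E.
Proof. by move=> i; apply/esym; exact: (@integral12_prod_meas1 _ _ _ _ R leb2_sf leb f i). Qed.

Lemma leb3_Fubini21 (f : mpt -> \bar R) : mu.-integrable [set: mpt] f ->
  (\int[mu]_p f p = \int[leb]_z \int[@leb2 R]_q f (q, z))%E.
Proof. by move=> i; apply/esym; exact: (@integral21_prod_meas1 _ _ _ _ R leb2_sf leb f i). Qed.

Lemma leb2_Fubini12 (f : (mR * mR)%type -> \bar R) : (@leb2 R).-integrable [set: (mR * mR)%type] f ->
  (\int[@leb2 R]_p f p = \int[leb]_x \int[leb]_y f (x, y))%E.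
Proof. by move=> i; apply/esym; exact: (@integral12_prod_meas1 _ _ _ _ R leb leb f i). Qed.

Lemma leb2_Fubini21 (f : (mR * mR)%type -> \bar R) : (@leb2 R).-integrable [set: (mR * mR)%type] f ->
  (\int[@leb2 R]_p f p = \int[leb]_y \int[leb]_x f (x, y))%E.
Proof. by move=> i; apply/esym; exact: (@integral21_prod_meas1 _ _ _ _ R leb leb f i). Qed.

Lemma leb3_Tonelli12 (f : mpt -> \bar R) : measurable_fun [set: mpt] f -> (forall p, 0 <= f p)%E ->
  (\int[mu]_p f p = \int[@leb2 R]_q \int[leb]_z f (q, z))%E.
Proof. exact: (@fubini_tonelli1 _ _ _ _ R leb2_sf leb f). Qed.

Lemma leb3_Tonelli21 (f : mpt -> \bar R) : measurable_fun [set: mpt] f -> (forall p, 0 <= f p)%E ->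
  (\int[mu]_p f p = \int[leb]_z \int[@leb2 R]_q f (q, z))%E.
Proof. exact: (@fubini_tonelli2 _ _ _ _ R leb2_sf leb f). Qed.

Lemma leb2_Tonelli12 (f : (mR * mR)%type -> \bar R) : measurable_fun [set: (mR * mR)%type] f -> (forall p, 0 <= f p)%E ->
  (\int[@leb2 R]_p f p = \int[leb]_x \int[leb]_y f (x, y))%E.
Proof. exact: (@fubini_tonelli1 _ _ _ _ R leb leb f). Qed.

Lemma leb2_Tonelli21 (f : (mR * mR)%type -> \bar R) : measurable_fun [set: (mR * mR)%type] f -> (forall p, 0 <= f p)%E ->
  (\int[@leb2 R]_p f p = \int[leb]_y \int[leb]_x f (x, y))%E.
Proof. exact: (@fubini_tonelli2 _ _ _ _ R leb leb f). Qed.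

End FubiniWrappers.

(** * Derivatives of compactly supported functions have integral zero *)

Section CompactSupport.
Context (R : realType).
Local Notation pt := (R * R * R)%type.
Local Notation mR := (measurableTypeR R).
Local Notation mpt := (mR * mR * mR)%type.
Local Notation mu := (@leb3 R).
Local Notation leb := (@lebesgue_measure R).

Lemma bounded_support_integrable d (T : measurableType d)
    (m : {measure set T -> \bar R}) (A : set T) (f : T -> R) (k : R) :
  measurable A -> (m A < +oo)%E -> measurable_fun [set: T] f ->
  (forall x, A x -> `|f x| <= k) -> (forall x, ~ A x -> f x = 0) ->
  m.-integrable [set: T] (EFin \o f).
Proof.
move=> mA mAoo mf fk f0.
have -> : EFin \o f = (EFin \o f) \_ A.
  apply/funext => x; rewrite patchE; case: ifPn => // /negP xA /=.
  by rewrite f0// => Ax; apply: xA; exact/mem_set.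
apply: (proj1 (integrable_mkcond (EFin \o f) mA)).
  apply: measurable_bounded_integrable => //.
  exact: measurable_funTS.
exists k; split; first exact: num_real.
by move=> M kM x /= Ax; rewrite (le_trans (fk _ Ax))// ltW.
Qed.

Lemma cont_support_integrable3 (f : pt -> R) (a b : pt) : continuous f ->
  (forall p, ~ cbox a b p -> f p = 0) -> mu.-integrable [set: mpt] (EFin \o f).
Proof.
move=> cf f0.
have [k [_ Hk]] := compact_bounded (continuous_compact
  (continuous_subspaceT cf) (@compact_cbox R a b)).
apply: (@bounded_support_integrable _ mpt mu (cbox a b) f (k + 1)) => //.
- exact: measurable_cbox.
- exact: leb3_cbox.
- exact: continuous_measurable3.
- by move=> p Cp; apply: (Hk (k + 1)); [rewrite ltrDl|exists p].
Qed.

Lemma cont_support_integrable2 (f : R * R -> R) (a b : R * R) : continuous f ->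
  (forall p, ~ (`[a.1, b.1] `*` `[a.2, b.2]) p -> f p = 0) ->
  (@leb2 R).-integrable [set: mR * mR] (EFin \o f).
Proof.
move=> cf f0.
have cK : compact (`[a.1, b.1] `*` `[a.2, b.2]).
  by apply: compact_setX; exact: segment_compact.
have [k [_ Hk]] := compact_bounded (continuous_compact (continuous_subspaceT cf) cK).
apply: (@bounded_support_integrable _ (mR * mR)%type (@leb2 R)
  (`[a.1, b.1] `*` `[a.2, b.2]) f (k + 1)) => //.
- exact: measurableX.
- rewrite leb2X// !lebesgue_measure_itv/=.
  by do 2 (case: ifP => _; rewrite ?mul0e ?mule0 -?EFinB -?EFinM ?ltry ?ltr0y//).
- exact: continuous_measurable2.
- by move=> p Cp; apply: (Hk (k + 1)); [rewrite ltrDl|exists p].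
Qed.

Lemma add_ez (q : R * R) (z s : R) : (q, z) + s *: @ez R = (q, z + s).
Proof.
case: q => x y; rewrite -[_ *: _]/(s *: 0, s *: 0, s *: 1).
rewrite -[_ + _]/(x + s *: 0, y + s *: 0, z + s *: 1).
by rewrite !scaler0 !addr0 -[s *: 1]/(s * 1) mulr1.
Qed.

Lemma add_ey (x y z s : R) : (x, y, z) + s *: @ey R = (x, y + s, z).
Proof.
rewrite -[_ *: _]/(s *: 0, s *: 1, s *: 0).
rewrite -[_ + _]/(x + s *: 0, y + s *: 1, z + s *: 0).
by rewrite !scaler0 !addr0 -[s *: 1]/(s * 1) mulr1.
Qed.

Lemma add_ex (x y z s : R) : (x, y, z) + s *: @ex R = (x + s, y, z).
Proof.
rewrite -[_ *: _]/(s *: 1, s *: 0, s *: 0).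
rewrite -[_ + _]/(x + s *: 1, y + s *: 0, z + s *: 0).
by rewrite !scaler0 !addr0 -[s *: 1]/(s * 1) mulr1.
Qed.

Section dirzero.
Variables (F : pt -> R) (K : set pt).
Hypothesis sF : smooth F.
Hypothesis cK : compact K.
Hypothesis FK : forall p, ~ K p -> F p = 0.

Lemma derive_support (v p : pt) : ~ K p -> 'D_v F p = 0.
Proof.
move=> Kp.
have oK : open (~` K).
  apply: closed_openC; apply: compact_closed cK; exact: norm_hausdorff.
have Fnear : \near p, F p = cst 0 p.
  by near=> q; apply: FK; near: q; exact: open_nbhs_nbhs.
have [-> |v0] := eqVneq v 0; first by rewrite derive0.
by rewrite (near_eq_derive v Fnear) derive_cst.
Unshelve. all: by end_near.
Qed.

Lemma support_bound : exists2 M : R, 0 < M &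
  forall p, ~ cbox (- M, - M, - M) (M, M, M) p -> ~ K p.
Proof.
have [M [_ HM]] := compact_bounded cK.
exists (`|M| + 1) => [|p nCp Kp]; first by rewrite ltr_wpDl.
apply: nCp; have := HM (`|M| + 1) _ p Kp.
rewrite ltr_pwDr ?ler_norm// => /(_ isT).
rewrite /Num.norm/= ge_max => /andP[]; rewrite {1}/Num.norm/= ge_max => /andP[p1 p2] p3.
by split; [split|]; rewrite /= in_itv/= -ler_norml.
Qed.

Lemma line_integral_zero (v p : pt) (M : R) : 0 < M ->
  (forall s, ~ (- M <= s <= M) -> ~ K (p + s *: v)) ->
  (\int[leb]_s ('D_v F (p + s *: v))%:E = 0)%E.
Proof.
move=> M0 HM.
(* The segment exceeds [[- M, M]] by 1 on each side, so that [F] vanishes at both of its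
   endpoints. *)
have -> : (fun s : R => ('D_v F (p + s *: v))%:E) =
    (fun s : R => ('D_v F (p + s *: v))%:E) \_ `[- M - 1, M + 1].
  apply/funext => s; rewrite patchE; case: ifPn => //; rewrite notin_setE/= in_itv/=.
  move=> H; rewrite derive_support//; apply: HM => /andP[H1 H2]; apply: H.
  by apply/andP; split; lra.
rewrite -integral_mkcond line_FTC//; last by lra.
by rewrite !FK ?subrr//; apply: HM; apply/negP; rewrite negb_and -!ltNge; apply/orP; lra.
Qed.

(** Here and in the next two cases the coordinate of the derivative is integrated first, along a
    line that leaves the support. General directions are combinations of the axes
    ([derive_decomp]). *)
Lemma integral_D3 : (\int[mu]_p ('D_(@ez R) F p)%:E = 0)%E.
Proof.
have [M M0 HM] := support_bound.
have cD : continuous ('D_(@ez R) F) by apply: smooth_cont; exact: smooth_derive.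
have iD := cont_support_integrable3 cD (fun p Hp => derive_support (@ez R) (HM p Hp)).
rewrite (leb3_Fubini12 iD) (eq_integral (fun=> 0%E)) ?integral0// => q _.
transitivity (\int[leb]_s ('D_(@ez R) F ((q, 0%R) + s *: @ez R)%R)%:E)%E.
  by apply: eq_integral => z _; rewrite add_ez add0r.
apply: (line_integral_zero M0) => s Hs; apply: HM; rewrite add_ez add0r.
by move=> [_ /=]; rewrite in_itv/= => H; exact: Hs.
Qed.

Lemma continuous_slice (f : pt -> R) (z : R) : continuous f -> continuous (fun q => f (q, z)).
Proof.
move=> cf q; apply: (@continuous_comp _ _ _ (fun q : R * R => (q, z)) f); last exact: cf.
by apply: (cvg_pair (F := nbhs q) (G := nbhs q) (H := nbhs z)); [exact: cvg_id|exact: cvg_cst].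
Qed.

Lemma integral_D2 : (\int[mu]_p ('D_(@ey R) F p)%:E = 0)%E.
Proof.
have [M M0 HM] := support_bound.
have cD : continuous ('D_(@ey R) F) by apply: smooth_cont; exact: smooth_derive.
have iD := cont_support_integrable3 cD (fun p Hp => derive_support (@ey R) (HM p Hp)).
rewrite (leb3_Fubini21 iD) (eq_integral (fun=> 0%E)) ?integral0// => z _.
have i2 : (@leb2 R).-integrable [set: mR * mR] (EFin \o (fun q => 'D_(@ey R) F (q, z))).
  apply: (@cont_support_integrable2 _ (- M, - M) (M, M)); first exact: (continuous_slice (z := z) cD).
  by move=> q Hq; apply: derive_support; apply: HM => -[/= Hq' _]; exact: Hq.
rewrite (leb2_Fubini12 i2) (eq_integral (fun=> 0%E)) ?integral0// => x _.
transitivity (\int[leb]_s ('D_(@ey R) F ((x, 0%R, z) + s *: @ey R)%R)%:E)%E.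
  by apply: eq_integral => y _; rewrite add_ey add0r.
apply: (line_integral_zero M0) => s Hs; apply: HM; rewrite add_ey add0r.
by move=> [[_ /= + _]]; rewrite in_itv/= => H; exact: Hs.
Qed.

Lemma integral_D1 : (\int[mu]_p ('D_(@ex R) F p)%:E = 0)%E.
Proof.
have [M M0 HM] := support_bound.
have cD : continuous ('D_(@ex R) F) by apply: smooth_cont; exact: smooth_derive.
have iD := cont_support_integrable3 cD (fun p Hp => derive_support (@ex R) (HM p Hp)).
rewrite (leb3_Fubini21 iD) (eq_integral (fun=> 0%E)) ?integral0// => z _.
have i2 : (@leb2 R).-integrable [set: mR * mR] (EFin \o (fun q => 'D_(@ex R) F (q, z))).
  apply: (@cont_support_integrable2 _ (- M, - M) (M, M)); first exact: (continuous_slice (z := z) cD).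
  by move=> q Hq; apply: derive_support; apply: HM => -[/= Hq' _]; exact: Hq.
rewrite (leb2_Fubini21 i2) (eq_integral (fun=> 0%E)) ?integral0// => y _.
transitivity (\int[leb]_s ('D_(@ex R) F ((0%R, y, z) + s *: @ex R)%R)%:E)%E.
  by apply: eq_integral => x _; rewrite add_ex add0r.
apply: (line_integral_zero M0) => s Hs; apply: HM; rewrite add_ex add0r.
by move=> [[/= + _ _]]; rewrite in_itv/= => H; exact: Hs.
Qed.

End dirzero.

Lemma pt_decomp (v : pt) : v = v.1.1 *: @ex R + v.1.2 *: @ey R + v.2 *: @ez R.
Proof.
case: v => [[a b] c] /=.
have <- : ((0, 0, 0) : pt) + a *: @ex R + b *: @ey R + c *: @ez R = (a, b, c).
  by rewrite add_ex add_ey add_ez !add0r.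
by rewrite -[(0, 0, 0)]/(0 : pt) add0r.
Qed.

Lemma derive_decomp (f : pt -> R) (v p : pt) : smooth f ->
  'D_v f p = v.1.1 * 'D_(@ex R) f p + v.1.2 * 'D_(@ey R) f p + v.2 * 'D_(@ez R) f p.
Proof.
move=> sf; rewrite {1}(pt_decomp v) !deriveD_dir// !deriveZ_dir//.
Qed.

End CompactSupport.

Section InnerProductScale.
Context d (T : measurableType d) (R : realType) (m : {measure set T -> \bar R}).
Variables (D : set T) (mD : measurable D).

Lemma ipZl (a : R) f g : L2 m D f -> L2 m D g ->
  ip m D (fun x => a * f x) g = a * ip m D f g.
Proof.
move=> Lf Lg; rewrite /ip -RintegralZl//; last exact: L2_integrable_mul.
by apply: eq_Rintegral => x _; rewrite mulrA.
Qed.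

Lemma ipZr (a : R) f g : L2 m D f -> L2 m D g ->
  ip m D g (fun x => a * f x) = a * ip m D g f.
Proof. by move=> Lf Lg; rewrite ipC ipZl// ipC. Qed.

Lemma ipBl f g k : L2 m D f -> L2 m D g -> L2 m D k ->
  ip m D (fun x => f x - g x) k = ip m D f k - ip m D g k.
Proof.
move=> Lf Lg Lk; have := ip_linl mD (-1) Lg Lf Lk; rewrite mulN1r addrC => <-.
by apply: eq_Rintegral => x _; rewrite mulN1r [_ + f x]addrC.
Qed.

Lemma ip0l f : ip m D (fun=> 0) f = 0.
Proof.
rewrite /ip /Rintegral (eq_integral (cst 0%E)) ?integral0// => x _.
by rewrite mul0r.
Qed.

End InnerProductScale.

(** * Weak derivatives: existence for smooth functions, uniqueness, linearity *)

Section WeakDer.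
Context (R : realType).
Local Notation pt := (R * R * R)%type.
Local Notation mR := (measurableTypeR R).
Local Notation mpt := (mR * mR * mR)%type.
Local Notation mu := (@leb3 R).
Variables (Omega : set (R * R)) (h : R).
Hypothesis oOmega : open Omega.
Hypothesis bOmega : bounded_set Omega.
Hypothesis h0 : 0 < h.
Local Notation C := (cyl Omega h).
Local Notation U := (Omega `*` `]0, h[).
Local Notation ipC := (@ip _ _ R mu C).
Local Notation L2C := (L2 mu C).
Local Notation wd := (is_weak_der Omega h).
Local Notation D := (wder Omega h).
Local Notation ex := (@ex R).
Local Notation ey := (@ey R).
Local Notation ez := (@ez R).

Let mC : measurable (C : set mpt) := measurable_cyl h oOmega.

Lemma smooth_L2 (f : pt -> R) : smooth f -> L2C f.
Proof. by move=> sf; apply: cont_L2 => //; exact: smooth_cont. Qed.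

Lemma test_L2 psi : test_fun (U : set pt) psi -> L2C psi.
Proof. by move=> [s _]; exact: smooth_L2. Qed.

Lemma test_derive_L2 (v : pt) psi : test_fun (U : set pt) psi -> L2C ('D_v psi).
Proof. by move=> [s _]; apply: smooth_L2; exact: smooth_derive. Qed.

(** The product [f * psi] inherits the compact support of [psi], so the integral of its derivative
    vanishes, and the product rule gives the identity. *)
Lemma weak_der_smooth_basis (e : pt) (f : pt -> R) :
  (forall F K, smooth F -> compact K -> (forall p, ~ K p -> F p = 0) ->
     (\int[mu]_p ('D_e F p)%:E = 0)%E) ->
  smooth f -> wd e f ('D_e f).
Proof.
move=> He sf; split; first by apply: smooth_L2; exact: smooth_derive.
move=> psi tpsi; have [sp [K [cK KU psi0]]] := tpsi.
have Lf := smooth_L2 sf; have LDf := smooth_L2 (smooth_derive e sf).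
have Lp := test_L2 tpsi; have LDp := test_derive_L2 e tpsi.
have FK p : ~ K p -> f p * psi p = 0 by move=> /psi0 ->; rewrite mulr0.
have := He _ _ (smoothM sf sp) cK FK.
have -> : (fun p => ('D_e (fun x => f x * psi x) p)%:E) =
          (fun p => (f p * 'D_e psi p + 'D_e f p * psi p)%:E) \_ C.
  apply/funext => p; rewrite patchE; case: ifPn => [|/negP pC].
    move=> _; rewrite (deriveM (@smooth_derivable R _ f p e sf) (@smooth_derivable R _ psi p e sp)).
    by rewrite -![_ *: _]/(_ * _) (mulrC (psi p)).
  rewrite (derive_support cK FK)// => Kp; apply: pC.
  by apply/mem_set/sub_U_cyl/KU.
rewrite -integral_mkcond => H.
have := @RintegralD _ _ _ mu C (fun p => f p * 'D_e psi p) (fun p => 'D_e f p * psi p) mC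
  (L2_integrable_mul mC Lf LDp) (L2_integrable_mul mC LDf Lp).
rewrite {1}/Rintegral /= H /= => /esym/eqP; rewrite addr_eq0 => /eqP; exact.
Qed.

Lemma weak_der_ip (v : pt) (u w psi : pt -> R) : wd v u w -> test_fun (U : set pt) psi ->
  ipC u ('D_v psi) = - ipC w psi.
Proof. by move=> [_ H] t; exact: H. Qed.

Lemma weak_derI (v : pt) (u w : pt -> R) : L2C w ->
  (forall psi, test_fun (U : set pt) psi -> ipC u ('D_v psi) = - ipC w psi) -> wd v u w.
Proof. by move=> Lw H; split. Qed.

Lemma comb_opp (x y z a b c a' b' c' : R) : a = - a' -> b = - b' -> c = - c' ->
  x * a + (y * b + z * c) = - (x * a' + (y * b' + z * c')).
Proof. by move=> -> -> ->; ring. Qed.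

(** [H1] asks for a weak derivative in every direction; those along the three axes produce them
    all. *)
Lemma weak_der_comb (v : pt) (u w1 w2 w3 : pt -> R) : L2C u ->
  wd ex u w1 -> wd ey u w2 -> wd ez u w3 ->
  wd v u (fun p => v.1.1 * w1 p + (v.1.2 * w2 p + v.2 * w3 p)).
Proof.
move=> Lu W1 W2 W3; have [L1 _] := W1; have [L2' _] := W2; have [L3 _] := W3.
have L3' := L2Z mC v.2 L3.
have L23 := L2_lincomb mC v.1.2 L2' L3'.
apply: weak_derI; first exact: L2_lincomb.
move=> psi tpsi; have Lp := test_L2 tpsi; have [sp _] := tpsi.
have Dpsi : 'D_v psi = (fun p => v.1.1 * 'D_ex psi p +
    (v.1.2 * 'D_ey psi p + v.2 * 'D_ez psi p)).
  by apply/funext => p; rewrite derive_decomp// addrA.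
have T e := test_derive_L2 e tpsi.
have TZ := L2Z mC v.2 (T ez).
have T23 := L2_lincomb mC v.1.2 (T ey) TZ.
rewrite Dpsi.
rewrite !ip_linl ?ip_linr//.
rewrite ipZr// ipZl//.
exact: comb_opp (weak_der_ip W1 tpsi) (weak_der_ip W2 tpsi) (weak_der_ip W3 tpsi).
Qed.

Lemma weak_der_smooth (v : pt) (f : pt -> R) : smooth f -> wd v f ('D_v f).
Proof.
move=> sf; have -> : 'D_v f = (fun p => v.1.1 * 'D_ex f p +
    (v.1.2 * 'D_ey f p + v.2 * 'D_ez f p)).
  by apply/funext => p; rewrite derive_decomp// addrA.
apply: weak_der_comb; first exact: smooth_L2.
- by apply: weak_der_smooth_basis => // F K sF cK FK; exact: integral_D1 cK FK.
- by apply: weak_der_smooth_basis => // F K sF cK FK; exact: integral_D2 cK FK.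
- by apply: weak_der_smooth_basis => // F K sF cK FK; exact: integral_D3 cK FK.
Qed.

Lemma weak_der_lincomb (v : pt) (a : R) (u u' w w' : pt -> R) : L2C u -> L2C u' ->
  wd v u w -> wd v u' w' -> wd v (fun p => a * u p + u' p) (fun p => a * w p + w' p).
Proof.
move=> Lu Lu' W W'; have [Lw _] := W; have [Lw' _] := W'.
apply: weak_derI; first exact: L2_lincomb.
move=> psi tpsi; have Lp := test_L2 tpsi; have LDp := test_derive_L2 v tpsi.
rewrite !ip_linl// (weak_der_ip W tpsi) (weak_der_ip W' tpsi).
by move: (ipC w psi) (ipC w' psi) => b c; ring.
Qed.

Lemma L2_fundamental (w : pt -> R) : L2C w ->
  (forall psi, test_fun (U : set pt) psi -> ipC w psi = 0) ->
  ae_eq mu C w (fun=> 0).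
Proof.
move=> Lw H; have [mw _] := Lw; apply: (@fundamental_lemma R C U w mC) => //.
- exact: sub_U_cyl.
- have := L2_integrable_mul mC Lw (smooth_L2 (smooth_cst (V := pt) 1)).
  by congr (_.-integrable _ _); apply/funext => p; rewrite mulr1.
- exact: open_U.
- exact: cylDU_null.
Qed.

Lemma weak_der_unique (v : pt) (u w w' : pt -> R) :
  wd v u w -> wd v u w' -> ae_eq mu C w w'.
Proof.
move=> W W'; have [Lw _] := W; have [Lw' _] := W'.
have : ae_eq mu C (fun p => w p - w' p) (fun=> 0).
  apply: L2_fundamental; first exact: L2B.
  move=> psi tpsi; rewrite ipBl//; last exact: test_L2.
  have := weak_der_ip W tpsi; rewrite (weak_der_ip W' tpsi) => /oppr_inj ->.
  by rewrite subrr.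
by apply: filterS => p E Cp; apply/eqP; rewrite -subr_eq0 E.
Qed.

Lemma wderP (v : pt) (u : pt -> R) : H1 Omega h u -> wd v u (D v u).
Proof. by move=> [_ /(_ v) ex]; exact: xgetPex ex. Qed.

Lemma wder_L2 (v : pt) (u : pt -> R) : H1 Omega h u -> L2C (D v u).
Proof. by move=> /(wderP v)[]. Qed.

Lemma H1_L2 (u : pt -> R) : H1 Omega h u -> L2C u.
Proof. by case. Qed.

Lemma H1_smooth (u : pt -> R) : smooth u -> H1 Omega h u.
Proof. by move=> su; split; [exact: smooth_L2|move=> v; exists ('D_v u); exact: weak_der_smooth]. Qed.

Lemma H1_lincomb (a : R) (u u' : pt -> R) : H1 Omega h u -> H1 Omega h u' ->
  H1 Omega h (fun p => a * u p + u' p).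
Proof.
move=> H H'; split; first by apply: L2_lincomb => //; exact: H1_L2.
move=> v; exists (fun p => a * D v u p + D v u' p).
by apply: weak_der_lincomb; (exact: H1_L2 || exact: wderP).
Qed.

Lemma H1B (u u' : pt -> R) : H1 Omega h u -> H1 Omega h u' -> H1 Omega h (u \- u').
Proof.
move=> Hu Hu'; have := H1_lincomb (-1) Hu' Hu; congr (H1 _ _ _).
by apply/funext => p; rewrite mulN1r addrC.
Qed.

(** This is how the choice made by [wder] is eliminated: any explicit weak derivative may replace
    the selected one up to a null set. *)
Lemma wder_ae (v : pt) (u w : pt -> R) : wd v u w -> H1 Omega h u -> ae_eq mu C (D v u) w.
Proof. by move=> vw Hu; apply: weak_der_unique vw; exact: wderP. Qed.

Lemma wder_smooth (v : pt) (u : pt -> R) : smooth u -> ae_eq mu C (D v u) ('D_v u).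
Proof. by move=> su; apply: wder_ae; [exact: weak_der_smooth|exact: H1_smooth]. Qed.

Lemma wder_lincomb (v : pt) (a : R) (u u' : pt -> R) : H1 Omega h u -> H1 Omega h u' ->
  ae_eq mu C (D v (fun p => a * u p + u' p)) (fun p => a * D v u p + D v u' p).
Proof.
move=> H H'; apply: wder_ae; last exact: H1_lincomb.
by apply: weak_der_lincomb; (exact: H1_L2 || exact: wderP).
Qed.

Lemma wder_decomp (v : pt) (u : pt -> R) : H1 Omega h u ->
  ae_eq mu C (D v u) (fun p => v.1.1 * D ex u p + (v.1.2 * D ey u p + v.2 * D ez u p)).
Proof.
move=> H; apply: wder_ae => //.
by apply: weak_der_comb; (exact: H1_L2 || exact: wderP).
Qed.

End WeakDer.

(** * Hardy's inequality and the Gagliardo seminorm along a curve *)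

Section OneDim.
Context (R : realType).
Local Notation leb := (@lebesgue_measure R).
Local Notation mR := (measurableTypeR R).

Lemma cont_measurable1 (f : R -> R) (D : set mR) : continuous f -> measurable_fun D f.
Proof. by move=> cf; apply: measurable_funTS; exact: continuous_measurable_fun. Qed.

Lemma cont_integrable_itv (f : R -> R) (a b : R) : continuous f ->
  leb.-integrable `[a, b] (EFin \o f).
Proof.
move=> cf; apply: continuous_compact_integrable; first exact: segment_compact.
exact: continuous_subspaceT.
Qed.

Lemma continuous_sqr (f : R -> R) : continuous f -> continuous (fun x => f x ^+ 2).
Proof. by move=> cf x; apply: cvgM; exact: cf. Qed.

Lemma cont_L2_itv (f : R -> R) (a b : R) : continuous f -> L2 leb `[a, b] f.
Proof.
move=> cf; split; first exact: cont_measurable1.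
have := integrable_fin_num _ (cont_integrable_itv a b (continuous_sqr cf)).
by move=> /(_ (measurable_itv _)); rewrite fin_numElt => /andP[].
Qed.

Variables (g g' : R -> R).
Hypothesis dg : forall s, is_derive s (1 : R) g (g' s).
Hypothesis cg' : continuous g'.

Lemma diff_continuous1 : continuous g.
Proof.
move=> x; apply: differentiable_continuous; apply/derivable1_diffP.
by have [] := dg x.
Qed.

(** The increment is the integral of [g'], to which Cauchy-Schwarz against the constant 1
    applies. *)
Lemma increment_sqr_le (a b : R) : a <= b ->
  (((g b - g a) ^+ 2)%:E <= (b - a)%:E * \int[leb]_(s in `[a, b]) ((g' s) ^+ 2)%:E)%E.
Proof.
move=> ab; have mI : measurable (`[a, b]%classic : set mR) by exact: measurable_itv.
have Lg := cont_L2_itv a b cg'.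
have L1 := cont_L2_itv a b (@cst_continuous R R 1).
have F := FTC_is_derive dg cg' ab.
have CS := L2_cauchy_schwarz mI Lg L1.
have I1 : ip leb `[a, b] g' (cst 1) = g b - g a.
  rewrite /ip /Rintegral (eq_integral (fun s : mR => (g' s)%:E)) ?F// => s _.
  by rewrite mulr1.
have N1 : L2norm leb `[a, b] (cst (1 : R)) ^+ 2 = b - a.
  rewrite sqr_sqrtr; last by apply: Rintegral_ge0 => x _; exact: sqr_ge0.
  rewrite /Rintegral (eq_integral (cst 1%E : mR -> _)) ?integral_cst//; last first.
    by move=> x _; rewrite expr1n.
  rewrite mul1e; have := lebesgue_measure_itv `[a, b]; rewrite /= => ->.
  move: ab; rewrite le_eqVlt => /predU1P[->|]; first by rewrite lte_fin ltxx subrr.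
  by rewrite lte_fin => ->.
rewrite -[X in (_ <= _ * X)%E]/(E2 leb `[a, b] g') (E2_L2norm mI Lg) -EFinM lee_fin.
rewrite -N1 -exprMn -I1 -real_normK ?num_real// lerXn2r// ?nnegrE ?mulr_ge0 ?sqrtr_ge0//.
by rewrite mulrC.
Qed.

Lemma increment_sqr_le_itv (a b s t : R) : a <= s -> s <= t -> t <= b ->
  (((g t - g s) ^+ 2)%:E <= (b - a)%:E * \int[leb]_(r in `[a, b]) ((g' r) ^+ 2)%:E)%E.
Proof.
move=> as_ st tb; apply: (le_trans (increment_sqr_le st)).
apply: lee_pmul.
- by rewrite lee_fin subr_ge0.
- by apply: integral_ge0 => x _; rewrite lee_fin sqr_ge0.
- by rewrite lee_fin; lra.
- apply: ge0_subset_integral => //.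
  + by apply/measurable_EFinP; apply: cont_measurable1; exact: continuous_sqr.
  + by move=> x _; rewrite lee_fin sqr_ge0.
  + move=> x /=; rewrite !in_itv/= => /andP[sx xt].
    by rewrite (le_trans as_ sx) (le_trans xt tb).
Qed.

(** The inequality [g(0)^2 <= 2 g(s)^2 + 2 (g(s) - g(0))^2] is integrated over [s] in [[0, L]]; the
    squared increment is at most [L] times the integral of [g'^2]. *)
Lemma end_trace_1d (L : R) : 0 <= L ->
  (L%:E * ((g 0%R) ^+ 2)%:E <= 2%:E * \int[leb]_(s in `[0%R, L]) ((g s) ^+ 2)%:E +
    (2 * L ^+ 2)%:E * \int[leb]_(s in `[0%R, L]) ((g' s) ^+ 2)%:E)%E.
Proof.
move=> L0.
set G := (\int[leb]_(s in `[0%R, L]) ((g' s) ^+ 2)%:E)%E.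
have LI : leb (`[0, L]%classic : set mR) = L%:E.
  have := lebesgue_measure_itv `[0, L]; rewrite /= => ->.
  move: L0; rewrite le_eqVlt => /predU1P[<-|]; first by rewrite lte_fin ltxx.
  by rewrite lte_fin oppr0 addr0 => ->.
have G0 : (0 <= G)%E by apply: integral_ge0 => x _; rewrite lee_fin sqr_ge0.
have mg : measurable_fun (`[0, L] : set mR) (fun s => ((g s) ^+ 2)%:E).
  by apply/measurable_EFinP; apply: cont_measurable1; apply: continuous_sqr; exact: diff_continuous1.
have -> : (L%:E * ((g 0%R) ^+ 2)%:E = \int[leb]_(s in `[0%R, L]) ((g 0%R) ^+ 2)%:E)%E.
  by rewrite integral_cst//= LI muleC.
have -> : (2%:E * \int[leb]_(s in `[0%R, L]) ((g s) ^+ 2)%:E + (2 * L ^+ 2)%:E * G =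
   \int[leb]_(s in `[0%R, L]) (2%:E * ((g s) ^+ 2)%:E + 2%:E * (L%:E * G)))%E.
  rewrite ge0_integralD//.
  - rewrite ge0_integralZl//; last by move=> x _; rewrite lee_fin sqr_ge0.
    congr (_ + _)%E; rewrite integral_cst//= LI.
    by rewrite -!muleA (muleC G) !muleA -!EFinM expr2; congr (_%:E * _)%E; ring.
  - by move=> x _; rewrite mule_ge0// lee_fin sqr_ge0.
  - exact: measurable_funeM.
  - by move=> x _; rewrite !mule_ge0// lee_fin.
apply: ge0_le_integral => //.
- by move=> x _; rewrite lee_fin sqr_ge0.
- by apply: emeasurable_funD => //; exact: measurable_funeM.
move=> s /=; rewrite in_itv/= => /andP[s0 sL].
apply: (@le_trans _ _ (2%:E * ((g s) ^+ 2)%:E + 2%:E * ((g s - g 0%R) ^+ 2)%:E)%E).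
  rewrite -!EFinM -EFinD lee_fin; have := sqr_ge0 (2 * g s - g 0); nra.
apply: leeD => //; apply: lee_pmul => //; first by rewrite lee_fin sqr_ge0.
by have := increment_sqr_le_itv (lexx 0) s0 sL; rewrite subr0.
Qed.

End OneDim.

(** The derivative is assumed to the right of [a] only, because the primitive in Hardy's inequality
    involves [|r|]. *)
Lemma FTC_oo (R : realType) (F f : R -> R) (a b : R) : a < b ->
  (forall s, a < s -> is_derive s (1 : R) F (f s)) -> continuous F -> continuous f ->
  (\int[@lebesgue_measure R]_(s in `[a, b]) (f s)%:E = (F b - F a)%:E)%E.
Proof.
move=> ab dF cF cf; rewrite EFinB; apply: continuous_FTC2 => //.
- exact: continuous_subspaceT.
- split.
  + by move=> s; rewrite in_itv/= => /andP[s0 _]; have [] := dF s s0.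
  + exact: cvg_at_right_filter (cF a).
  + exact: cvg_at_left_filter (cF b).
- by move=> s; rewrite in_itv/= => /andP[s0 _]; rewrite derive1E; have [_ ->] := dF s s0.
Qed.

(** Inversion, with [0^-1 = 0], is the pointwise limit of the continuous functions
    [x / (x^2 + 1 / (n + 1))]. *)
Lemma measurable_invr (R : realType) : measurable_fun [set: measurableTypeR R] (@GRing.inv R).
Proof.
apply: (@measurable_fun_cvg _ (measurableTypeR R) R setT
  (fun n x => x * (x ^+ 2 + n.+1%:R^-1)^-1)) => [n|x _].
  apply: continuous_measurable_fun => x; apply: cvgM; first exact: cvg_id.
  apply: cvgV; first by rewrite gt_eqF// ltr_wpDl ?sqr_ge0// invr_gt0.
  by apply: cvgD; [exact: exprn_continuous|exact: cvg_cst].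
have [->|x0] := eqVneq x 0.
  by rewrite invr0; under eq_fun do rewrite mul0r; exact: cvg_cst.
have -> : x^-1 = x * (x ^+ 2 + 0)^-1 by rewrite addr0; field.
apply: cvgMr; apply: cvgV; first by rewrite addr0 expf_neq0.
by apply: cvgD; [exact: cvg_cst|exact: cvg_harmonic].
Qed.

Section Hardy.
Context (R : realType).
Local Notation leb := (@lebesgue_measure R).
Local Notation mR := (measurableTypeR R).
Variables (g g' : R -> R).
Hypothesis dg : forall s, is_derive s (1 : R) g (g' s).
Hypothesis cg' : continuous g'.
Hypothesis g0 : g 0 = 0.

Let cg : continuous g := diff_continuous1 dg.

Section eps.
Variables (L e : R).
Hypothesis L0 : 0 <= L.
Hypothesis e0 : 0 < e.

Let w (r : R) := `|r| + e.
Let w_gt0 r : 0 < w r. Proof. by rewrite /w ltr_wpDl. Qed.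
Let cwV : continuous (fun r => (w r)^-1).
Proof.
move=> r; apply: cvgV; first by rewrite (gt_eqF (w_gt0 r)).
by apply: cvgD; [exact: norm_continuous|exact: cvg_cst].
Qed.

Let X (r : R) := g r / w r.
Let cX : continuous X. Proof. by move=> r; apply: cvgM; [exact: cg|exact: cwV]. Qed.

Let f (r : R) := 2 * X r * g' r - X r ^+ 2.
Let cf : continuous f.
Proof.
move=> r; apply: cvgB; last exact: continuous_sqr.
by apply: cvgM; [apply: cvgMr; exact: cX|exact: cg'].
Qed.

Let F (r : R) := g r ^+ 2 / w r.
Let cF : continuous F.
Proof. by move=> r; apply: cvgM; [exact: continuous_sqr|exact: cwV]. Qed.

Let dF (r : R) : 0 < r -> is_derive r (1 : R) F (f r).
Proof.
move=> r0.
apply: (@near_eq_is_derive _ _ _ (fun r : R => g r ^+ 2 * (r + e)^-1)).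
  near=> y; rewrite /F /w ger0_norm//; apply: ltW; near: y; exact: lt_nbhsr.
have re : r + e != 0 by rewrite gt_eqF// addr_gt0.
have d1 : is_derive r (1 : R) (fun r : R => r + e) 1.
  by apply: is_derive_eq; rewrite addr0.
have d2 : is_derive r (1 : R) (fun r : R => (r + e)^-1) (- (r + e) ^- 2).
  have [di dE] := d1.
  apply: DeriveDef; first exact: (@derivableV R R (fun r => r + e)).
  rewrite (@deriveV R R (fun r => r + e) r 1 re di) dE.
  by rewrite -[_ *: _]/(_ * _) mulr1.
have dgr := dg r.
have d3 : is_derive r (1 : R) (fun r : R => g r ^+ 2) (2 * g r * g' r).
  have := is_deriveM dgr dgr => d; apply: (is_derive_eq (f := g * g)).
  by rewrite -![_ *: _]/(_ * _); ring.
have d4 := is_deriveM d3 d2.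
apply: (is_derive_eq (f := (fun r : R => g r ^+ 2) * (fun r => (r + e)^-1))).
rewrite /f /X /w (gtr0_norm r0) -![_ *: _]/(_ * _).
by field.
Unshelve. all: by end_near.
Qed.

(** With [w = |r| + e], [X = g / w] and [F = g^2 / w], the derivative [f] of [F] on the positive
    axis satisfies [X^2 <= 4 g'^2 - 2 f], which is [(2 g' - X)^2 >= 0]. The integral of [f] is
    [F L - F 0 >= 0]. The shift by [e] keeps the quotients continuous at 0. *)
Lemma hardy_eps :
  (\int[leb]_(r in `[0%R, L]) ((g r / (`|r| + e)) ^+ 2)%:E <=
   4%:E * \int[leb]_(r in `[0%R, L]) ((g' r) ^+ 2)%:E)%E.
Proof.
have mI : measurable (`[0, L]%classic : set mR) by exact: measurable_itv.
have [L00|Lgt0] : L = 0 \/ 0 < L.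
  by move: L0; rewrite le_eqVlt => /predU1P[->|]; [left|right].
  by rewrite L00 set_itv1 !integral_set1 mule0.
have HF : (\int[leb]_(r in `[0%R, L]) (f r)%:E = (F L - F 0)%:E)%E.
  exact: (FTC_oo Lgt0 dF cF cf).
have iX := cont_integrable_itv 0 L (continuous_sqr cX).
have ig := cont_integrable_itv 0 L (continuous_sqr cg').
have if_ := cont_integrable_itv 0 L cf.
apply: (@le_trans _ _ (\int[leb]_(r in `[0%R, L]) (4%:E * ((g' r) ^+ 2)%:E - 2%:E * (f r)%:E))%E).
  apply: le_integral => //.
  - by apply: integrableB => //; exact: integrableZl.
  - move=> r _; rewrite -!EFinM -EFinB lee_fin.
    rewrite -/(w r) -/(X r) /f; have := sqr_ge0 (2 * g' r - X r); nra.
rewrite integralB//; [|exact: integrableZl|exact: integrableZl].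
rewrite integralZl// integralZl// HF.
have : 0 <= F L - F 0 by rewrite /F g0 expr0n/= mul0r subr0 divr_ge0 ?sqr_ge0// ltW.
move=> H; rewrite leeBlDr// leeDl// -EFinM lee_fin mulr_ge0//.
Qed.

End eps.

(** Fatou's lemma as the shift tends to 0; at [r = 0] all the quotients are 0 because [g 0 = 0]. *)
Lemma hardy (L : R) : 0 <= L ->
  (\int[leb]_(r in `[0%R, L]) ((g r / r) ^+ 2)%:E <=
   4%:E * \int[leb]_(r in `[0%R, L]) ((g' r) ^+ 2)%:E)%E.
Proof.
move=> L0; have mI : measurable (`[0, L]%classic : set mR) by exact: measurable_itv.
have mg : measurable_fun (`[0, L] : set mR) g by exact: cont_measurable1.
apply: (@fatou_le _ mR R leb `[0, L] (fun n r => ((g r / (`|r| + n.+1%:R^-1)) ^+ 2)%:E)) => //.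
- apply: measurable_sqr; apply: measurable_funM => //.
  by apply: measurable_funTS; exact: measurable_invr.
- move=> n; apply: measurable_sqr; apply: cont_measurable1 => r; apply: cvgM; first exact: cg.
  apply: cvgV; first by rewrite gt_eqF// ltr_wpDl// invr_gt0.
  by apply: cvgD; [exact: norm_continuous|exact: cvg_cst].
- by move=> n r _; rewrite lee_fin sqr_ge0.
- apply: aeW => r; rewrite /= in_itv/= => /andP[r0 _].
  apply: cvg_EFin; first exact: nearW.
  have [->|rn0] := eqVneq r 0.
    rewrite g0 mul0r expr0n/=.
    rewrite (_ : (fun n => _) = (fun=> 0)); first exact: cvg_cst.
    by apply/funext => n; rewrite mul0r expr0n.
  suff H : (g r / (`|r| + n.+1%:R^-1)) @[n --> \oo] --> g r / r by apply: cvgM; exact: H.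
  apply: cvgMr; apply: cvgV => //.
  rewrite -[X in _ --> X]addr0 -{2}(ger0_norm r0); apply: cvgD; first exact: cvg_cst.
  exact: cvg_harmonic.
- by move=> r _; rewrite lee_fin sqr_ge0.
- by apply: nearW => n; apply: hardy_eps.
Qed.

End Hardy.

Lemma ereal_eq_le (R : realType) (x y : \bar R) : x = y -> (x <= y)%E.
Proof. by move=> ->. Qed.

Lemma combine_eight (R : realType) (a b x y : \bar R) : (0 <= x -> 0 <= y ->
  a <= 4%:E * x -> b <= 4%:E * y -> 2%:E * a + 2%:E * b <= 8%:E * (x + y))%E.
Proof.
move=> x0 y0 ax bY.
have E8 (z : \bar R) : (8%:E * z = 2%:E * (4%:E * z))%E.
  by rewrite muleA -EFinM; congr (_%:E * _)%E; ring.
rewrite ge0_muleDr// !E8; apply: leeD; exact: lee_wpmul2l.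
Qed.

Section Sections2.
Context (R : realType).
Local Notation leb := (@lebesgue_measure R).
Local Notation mR := (measurableTypeR R).
Local Notation mR2 := (mR * mR)%type.

Lemma leb2_section12 (A : set mR2) (F : mR2 -> \bar R) : measurable A ->
  measurable_fun [set: mR2] F -> (forall p, 0 <= F p)%E ->
  (\int[@leb2 R]_(p in A) F p = \int[leb]_x \int[leb]_(y in [set y | A (x, y)]) F (x, y))%E.
Proof.
move=> mA mF F0; rewrite (@integral_mkcond _ _ _ (@leb2 R) A F) leb2_Tonelli12.
- by apply: eq_integral => x _; rewrite [RHS]integral_mkcond.
- by apply: (measurable_restrictT F mA).1; exact: measurable_funTS.
- by move=> p; rewrite patchE; case: ifP.
Qed.

Lemma leb2_section21 (A : set mR2) (F : mR2 -> \bar R) : measurable A ->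
  measurable_fun [set: mR2] F -> (forall p, 0 <= F p)%E ->
  (\int[@leb2 R]_(p in A) F p = \int[leb]_y \int[leb]_(x in [set x | A (x, y)]) F (x, y))%E.
Proof.
move=> mA mF F0; rewrite (@integral_mkcond _ _ _ (@leb2 R) A F) leb2_Tonelli21.
- by apply: eq_integral => y _; rewrite [RHS]integral_mkcond.
- by apply: (measurable_restrictT F mA).1; exact: measurable_funTS.
- by move=> p; rewrite patchE; case: ifP.
Qed.

Lemma leb2_le12 (A B : set mR2) (F G : mR2 -> \bar R) : measurable A -> measurable B ->
  measurable_fun [set: mR2] F -> (forall p, 0 <= F p)%E ->
  measurable_fun [set: mR2] G -> (forall p, 0 <= G p)%E ->
  (forall x, \int[leb]_(y in [set y | A (x, y)]) F (x, y) <=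
             \int[leb]_(y in [set y | B (x, y)]) G (x, y))%E ->
  (\int[@leb2 R]_(p in A) F p <= \int[@leb2 R]_(p in B) G p)%E.
Proof.
move=> mA mB mF F0 mG G0 H.
have patch_meas (C : set mR2) (K : mR2 -> \bar R) : measurable C -> measurable_fun [set: mR2] K ->
    measurable_fun [set: mR2] (K \_ C).
  by move=> mC mK; apply: (measurable_restrictT K mC).1; exact: measurable_funTS.
have patch_ge0 (C : set mR2) (K : mR2 -> \bar R) : (forall p, 0 <= K p)%E -> forall p, (0 <= (K \_ C) p)%E.
  by move=> K0 p; rewrite patchE; case: ifP.
rewrite (leb2_section12 mA mF F0) (leb2_section12 mB mG G0).
have E (C : set mR2) (K : mR2 -> \bar R) x : (\int[leb]_(y in [set y | C (x, y)]) K (x, y) =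
    fubini_F leb (K \_ C) x)%E.
  by rewrite (@integral_mkcond _ mR R leb [set y | C (x, y)]).
under eq_integral do rewrite E; under [leRHS]eq_integral do rewrite E.
apply: ge0_le_integral.
- exact: measurableT.
- by move=> x _; apply: integral_ge0 => y _; exact: patch_ge0.
- by apply: (@measurable_fun_fubini_tonelli_F _ _ mR mR R leb); [exact: patch_meas|exact: patch_ge0].
- by apply: (@measurable_fun_fubini_tonelli_F _ _ mR mR R leb); [exact: patch_meas|exact: patch_ge0].
- by move=> x _; rewrite -!E; exact: H.
Qed.

Lemma leb2_le21 (A B : set mR2) (F G : mR2 -> \bar R) : measurable A -> measurable B ->
  measurable_fun [set: mR2] F -> (forall p, 0 <= F p)%E ->
  measurable_fun [set: mR2] G -> (forall p, 0 <= G p)%E ->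
  (forall y, \int[leb]_(x in [set x | A (x, y)]) F (x, y) <=
             \int[leb]_(x in [set x | B (x, y)]) G (x, y))%E ->
  (\int[@leb2 R]_(p in A) F p <= \int[@leb2 R]_(p in B) G p)%E.
Proof.
move=> mA mB mF F0 mG G0 H.
have patch_meas (C : set mR2) (K : mR2 -> \bar R) : measurable C -> measurable_fun [set: mR2] K ->
    measurable_fun [set: mR2] (K \_ C).
  by move=> mC mK; apply: (measurable_restrictT K mC).1; exact: measurable_funTS.
have patch_ge0 (C : set mR2) (K : mR2 -> \bar R) : (forall p, 0 <= K p)%E -> forall p, (0 <= (K \_ C) p)%E.
  by move=> K0 p; rewrite patchE; case: ifP.
rewrite (leb2_section21 mA mF F0) (leb2_section21 mB mG G0).
have E (C : set mR2) (K : mR2 -> \bar R) y : (\int[leb]_(x in [set x | C (x, y)]) K (x, y) =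
    fubini_G leb (K \_ C) y)%E.
  by rewrite (@integral_mkcond _ mR R leb [set x | C (x, y)]).
under eq_integral do rewrite E; under [leRHS]eq_integral do rewrite E.
apply: ge0_le_integral.
- exact: measurableT.
- by move=> x _; apply: integral_ge0 => y _; exact: patch_ge0.
- by apply: (@measurable_fun_fubini_tonelli_G _ _ mR mR R leb); [exact: patch_meas|exact: patch_ge0].
- by apply: (@measurable_fun_fubini_tonelli_G _ _ mR mR R leb); [exact: patch_meas|exact: patch_ge0].
- by move=> x _; rewrite -!E; exact: H.
Qed.

End Sections2.

(** * The Gagliardo quotient as a difference of two Hardy quotients *)

Section GagliardoTrace.
Context (R : realType).
Local Notation leb := (@lebesgue_measure R).
Local Notation mR := (measurableTypeR R).
Local Notation mR2 := (mR * mR)%type.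
Local Notation pt := (R * R * R)%type.
Local Notation ez := (@ez R).
Variables (h : R).
Hypothesis h0 : 0 < h.

(** The half of the square on which the depth [z' - z] of the meeting point lies in [[0, h]]; the
    other half is its mirror image. *)
Definition triangle : set mR2 := [set p | 0 <= p.1 /\ p.1 <= p.2 /\ p.2 <= h].

Local Notation Tr := triangle.

Lemma measurable_triangle : measurable Tr.
Proof.
have -> : Tr = [set p : mR2 | 0 <= p.1] `&` ([set p : mR2 | p.1 <= p.2] `&` [set p : mR2 | p.2 <= h]).
  by apply/seteqP; split => p /=.
have m1 : measurable_fun [set: mR2] (fst : mR2 -> R) by exact: measurable_fst.
have m2 : measurable_fun [set: mR2] (snd : mR2 -> R) by exact: measurable_snd.
apply: measurableI; [|apply: measurableI]; rewrite -[X in measurable X]setTI.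
- by apply: (measurable_fun_ler (f := cst 0)).
- exact: measurable_fun_ler.
- by apply: (measurable_fun_ler (g := cst h)).
Qed.

Lemma triangle_row (z : R) : 0 <= z -> [set z' | Tr (z, z')] = `[z, h]%classic.
Proof.
move=> z0; apply/seteqP; split => z' /=; rewrite in_itv/=.
  by move=> [_ [? ?]]; exact/andP.
by move=> /andP[? ?].
Qed.

Lemma triangle_row0 (z : R) : z < 0 -> [set z' | Tr (z, z')] = set0.
Proof.
move=> z0; apply/seteqP; split => z' //= [H _].
by move: (lt_le_trans z0 H); rewrite ltxx.
Qed.

Lemma triangle_col (z' : R) : z' <= h -> [set z | Tr (z, z')] = `[0, z']%classic.
Proof.
move=> zh; apply/seteqP; split => z /=; rewrite in_itv/=.
  by move=> [? [? _]]; exact/andP.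
by move=> /andP[].
Qed.

Lemma triangle_col0 (z' : R) : h < z' -> [set z | Tr (z, z')] = set0.
Proof.
move=> z0; apply/seteqP; split => z //= [_ [_ H]].
by move: (lt_le_trans z0 H); rewrite ltxx.
Qed.

Lemma ge0_integral_shift (f : R -> R) (z b : R) : measurable_fun [set: mR] f ->
  (\int[leb]_(x in `[z, b]) (f (x - z) ^+ 2)%:E = \int[leb]_(r in `[0%R, (b - z)%R]) (f r ^+ 2)%:E)%E.
Proof.
move=> mf.
rewrite (@ge0_integral_affine R z 1 (oner_neq0 _))//.
- rewrite normr1 mul1e.
  have -> : (fun r : R => z + 1 * r) @^-1` `[z, b] = `[0, b - z]%classic.
    by apply/seteqP; split => r /=; rewrite !in_itv/= mul1r; move=> /andP[? ?]; apply/andP; split; lra.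
  by apply: eq_integral => r _; rewrite mul1r addrC addKr.
- apply/measurable_EFinP; apply: measurable_funX; apply: (measurableT_comp mf).
  by apply: cont_measurable1 => x; apply: cvgB; [exact: cvg_id|exact: cvg_cst].
- by move=> x _; rewrite lee_fin sqr_ge0.
Qed.

Lemma ge0_integral_reflect (f : R -> R) (z : R) : measurable_fun [set: mR] f ->
  (\int[leb]_(x in `[0%R, z]) (f (z - x) ^+ 2)%:E = \int[leb]_(r in `[0%R, z]) (f r ^+ 2)%:E)%E.
Proof.
move=> mf.
have N1 : -1 != 0 :> R by rewrite oppr_eq0 oner_neq0.
rewrite (@ge0_integral_affine R z (-1) N1)//.
- rewrite normrN1 mul1e.
  have -> : (fun r : R => z + -1 * r) @^-1` `[0, z] = `[0, z]%classic.
    by apply/seteqP; split => r /=; rewrite !in_itv/= mulN1r; move=> /andP[? ?]; apply/andP; split; lra.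
  by apply: eq_integral => r _; rewrite mulN1r opprB addrC subrK.
- apply/measurable_EFinP; apply: measurable_funX; apply: (measurableT_comp mf).
  by apply: cont_measurable1 => x; apply: cvgB; [exact: cvg_cst|exact: cvg_id].
- by move=> x _; rewrite lee_fin sqr_ge0.
Qed.

Section Curve.
Variables (w : pt -> R) (p0 sg : pt) (c : R -> R).
Hypothesis sw : smooth w.
Hypothesis cw : forall z, 0 <= z <= h -> c z = w (p0 + z *: ez).

(** In the application [p0 + z *: ez] runs along a vertical line of the lateral boundary, and [r] is
    the depth in the inward direction [sg]. For [z <= z'] the point at depth [z' - z] and height
    [z'] is reached from [P 0 z] along [sg + ez] and from [P 0 z'] along [sg], both times at
    parameter [z' - z]. *)
Definition curve (r z : R) : pt := p0 + r *: sg + z *: ez.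
Local Notation P := curve.

Definition curve_der (v : pt) (p : mR2) : R := 'D_v w (P (p.2 - p.1) p.2).

Lemma continuous_curve (a b : R * R -> R) : continuous a -> continuous b ->
  continuous (fun p => P (a p) (b p)).
Proof.
move=> ca cb p; apply: cvgD; last by apply: cvgZl; exact: cb.
by apply: cvgD; [exact: cvg_cst|apply: cvgZl; exact: ca].
Qed.

Let cfst : continuous (fun p : R * R => p.1). Proof. by move=> p; exact: cvg_fst. Qed.
Let csnd : continuous (fun p : R * R => p.2). Proof. by move=> p; exact: cvg_snd. Qed.
Let cdiff : continuous (fun p : R * R => p.2 - p.1).
Proof. by move=> p; apply: cvgB; [exact: csnd|exact: cfst]. Qed.

Local Notation E := curve_der.

Let cE v : continuous (E v).
Proof.
move=> p; apply: (@continuous_comp _ _ _ (fun p : R * R => P (p.2 - p.1) p.2) ('D_v w)).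
  exact: (continuous_curve cdiff csnd).
by apply: smooth_cont; exact: smooth_derive.
Qed.

Let mE v : measurable_fun [set: mR2] (fun p => (E v p ^+ 2)%:E).
Proof. by apply: measurable_sqr; exact: continuous_measurable2. Qed.

Let E_ge0 v p : (0 <= (E v p ^+ 2)%:E)%E.
Proof. by rewrite lee_fin sqr_ge0. Qed.

Definition square : set mR2 := `[0, h] `*` `[0, h].

Lemma measurable_square : measurable square.
Proof. by apply: measurableX; exact: measurable_itv. Qed.

Lemma square_col (z : R) : 0 <= z <= h -> [set r | square (r, z)] = `[0, h]%classic.
Proof.
move=> zh; apply/seteqP; by split => [r []//|r r0]; split.
Qed.

Let G v (p : mR2) : R := 'D_v w (P p.1 p.2).

Let cG v : continuous (G v).
Proof.
move=> p; apply: (@continuous_comp _ _ _ (fun p : R * R => P p.1 p.2) ('D_v w)).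
  exact: (continuous_curve cfst csnd).
by apply: smooth_cont; exact: smooth_derive.
Qed.

(** For fixed [z'] the substitution [r = z' - z] maps the column of the triangle to [[0, z']], which
    is then enlarged to [[0, h]]. *)
Lemma triangle_bound v : (\int[@leb2 R]_(p in Tr) (E v p ^+ 2)%:E <=
  \int[@leb2 R]_(p in square) ('D_v w (P p.1 p.2) ^+ 2)%:E)%E.
Proof.
have mG : measurable_fun [set: mR2] (fun p => (G v p ^+ 2)%:E).
  by apply: measurable_sqr; exact: continuous_measurable2 (@cG v).
apply: (leb2_le21 measurable_triangle measurable_square (mE v) (E_ge0 v) mG).
  by move=> p; rewrite lee_fin sqr_ge0.
move=> z; have [zh|zh] := leP z h; last first.
  rewrite (triangle_col0 zh) integral_set0; apply: integral_ge0 => r _.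
  by rewrite lee_fin sqr_ge0.
rewrite (triangle_col zh); have [z0|z0] := leP 0 z; last first.
  have zn : ~~ (BLeft 0 < BRight z)%O by rewrite -leNgt bnd_simp.
  rewrite (set_itv_ge zn) integral_set0; apply: integral_ge0 => r _.
  by rewrite lee_fin sqr_ge0.
have zb : 0 <= z <= h by rewrite z0 zh.
rewrite (square_col zb).
have mg : measurable_fun [set: mR] (fun r => 'D_v w (P r z)).
  apply: cont_measurable1 => r; apply: (@continuous_comp _ _ _ (fun r => P r z) ('D_v w)).
    apply: cvgD; last exact: cvg_cst.
    by apply: cvgD; [exact: cvg_cst|apply: cvgZl; exact: cvg_id].
  by apply: smooth_cont; exact: smooth_derive.
rewrite (ge0_integral_reflect z mg).
apply: ge0_subset_integral.
- exact: measurable_itv.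
- exact: measurable_itv.
- by apply: measurable_sqr; exact: measurable_funTS.
- by move=> r _; rewrite lee_fin sqr_ge0.
- by move=> r /=; rewrite !in_itv/= => /andP[-> rz]; exact: le_trans zh.
Qed.

Let line_deriv (p v : pt) (s : R) :
  is_derive s (1 : R) (fun r : R => w (p + r *: v) - w p) ('D_v w (p + s *: v)).
Proof.
have d := is_derive_line p v s sw.
have c0 := is_derive_cst (w p) s (1 : R).
by have := is_deriveB d c0; rewrite subr0.
Qed.

Let line_cont (p v : pt) : continuous (fun s : R => 'D_v w (p + s *: v)).
Proof.
apply: (@continuous_line _ _ ('D_v w)); apply: smooth_cont; exact: smooth_derive.
Qed.

Let line_zero (p v : pt) : w (p + 0 *: v) - w p = 0.
Proof. by rewrite scale0r addr0 subrr. Qed.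

Let mquot (g : R -> R) : continuous g -> measurable_fun [set: mR] (fun r => g r / r).
Proof.
move=> cg; apply: measurable_funM; first exact: cont_measurable1.
exact: measurable_invr.
Qed.

Lemma curve_diag (z z' : R) : P (z' - z) z' = P 0 z + (z' - z) *: (sg + ez).
Proof.
rewrite /P scale0r addr0 scalerDr -!addrA; congr (_ + _).
rewrite addrCA; congr (_ + _).
by rewrite -scalerDl addrC subrK.
Qed.

Lemma curve_side (r z : R) : P r z = P 0 z + r *: sg.
Proof. by rewrite /P scale0r addr0 addrAC. Qed.

(** Hardy's inequality in [z'], for fixed [z], along the diagonal through [P 0 z]. *)
Lemma hardy_diag (z : R) :
  (\int[leb]_(z' in [set z' | Tr (z, z')])
     (((w (P (z' - z) z') - w (P 0 z)) / (z' - z)) ^+ 2)%:E <=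
   4%:E * \int[leb]_(z' in [set z' | Tr (z, z')]) (E (sg + ez) (z, z') ^+ 2)%:E)%E.
Proof.
have [zn|zp] := ltP z 0; first by rewrite (triangle_row0 zn) !integral_set0 mule0.
rewrite (triangle_row zp).
have [zh|zh] := ltP h z.
  by rewrite set_itv_ge ?integral_set0 ?mule0// -ltNge.
pose v := sg + ez; pose g r := w (P 0 z + r *: v) - w (P 0 z).
pose g' r := 'D_v w (P 0 z + r *: v).
have dg s : is_derive s (1 : R) g (g' s) by exact: line_deriv.
have cg' : continuous g' by exact: line_cont.
have cg := diff_continuous1 dg.
have S1 := ge0_integral_shift z h (mquot cg).
have S2 := ge0_integral_shift z h (cont_measurable1 (D := setT) cg').
have zh0 : 0 <= h - z by rewrite subr_ge0.
have H := hardy dg cg' (line_zero _ _) zh0.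
rewrite -S1 -S2 in H; apply: (le_trans _ (le_trans H _)).
  apply: ereal_eq_le; apply: eq_integral => z' _.
  by rewrite /g -curve_diag.
apply: ereal_eq_le; apply: (f_equal (fun X => 4%:E * X)%E); apply: eq_integral => z' _.
by rewrite /g' -curve_diag.
Qed.

(** Hardy's inequality in [z], for fixed [z'], along the transverse segment through [P 0 z']. *)
Lemma hardy_side (z' : R) :
  (\int[leb]_(z in [set z | Tr (z, z')])
     (((w (P (z' - z) z') - w (P 0 z')) / (z' - z)) ^+ 2)%:E <=
   4%:E * \int[leb]_(z in [set z | Tr (z, z')]) (E sg (z, z') ^+ 2)%:E)%E.
Proof.
have [zn|zp] := ltP h z'; first by rewrite (triangle_col0 zn) !integral_set0 mule0.
rewrite (triangle_col zp).
have [z0|z0] := ltP z' 0.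
  by rewrite set_itv_ge ?integral_set0 ?mule0// -ltNge.
pose g r := w (P 0 z' + r *: sg) - w (P 0 z').
pose g' r := 'D_sg w (P 0 z' + r *: sg).
have dg s : is_derive s (1 : R) g (g' s) by exact: line_deriv.
have cg' : continuous g' by exact: line_cont.
have cg := diff_continuous1 dg.
have S1 := ge0_integral_reflect z' (mquot cg).
have S2 := ge0_integral_reflect z' (cont_measurable1 (D := setT) cg').
have H := hardy dg cg' (line_zero _ _) z0.
rewrite -S1 -S2 in H; apply: (le_trans _ (le_trans H _)).
  apply: ereal_eq_le; apply: eq_integral => z _.
  by rewrite /g -curve_side.
apply: ereal_eq_le; apply: (f_equal (fun X => 4%:E * X)%E); apply: eq_integral => z _.
by rewrite /g' -curve_side.
Qed.

(** [Q] is the Gagliardo quotient of the boundary values. It equals [Qd - Qs], in which the values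
    of [w] at the meeting point cancel. *)
Let Q (p : mR2) : R := (w (P 0 p.1) - w (P 0 p.2)) / (p.1 - p.2).
Let Qd (p : mR2) : R := (w (P (p.2 - p.1) p.2) - w (P 0 p.1)) / (p.2 - p.1).
Let Qs (p : mR2) : R := (w (P (p.2 - p.1) p.2) - w (P 0 p.2)) / (p.2 - p.1).

Let cwP (a b : R * R -> R) : continuous a -> continuous b ->
  continuous (fun p => w (P (a p) (b p))).
Proof.
move=> ca cb p; apply: (@continuous_comp _ _ _ (fun p : R * R => P (a p) (b p)) w).
  exact: (continuous_curve ca cb).
exact: smooth_cont.
Qed.

Let c0 : continuous (fun _ : R * R => 0 : R). Proof. by move=> p; exact: cvg_cst. Qed.

Let mdivdiff (f d : R * R -> R) : continuous f -> continuous d ->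
  measurable_fun [set: mR2] (fun p => ((f p / d p) ^+ 2)%:E).
Proof.
move=> cf cd; apply: measurable_sqr; apply: measurable_funM; first exact: continuous_measurable2.
by apply: (measurableT_comp (@measurable_invr R)); exact: continuous_measurable2.
Qed.

Let mQ : measurable_fun [set: mR2] (fun p => (Q p ^+ 2)%:E).
Proof.
apply: mdivdiff => p; apply: cvgB; (exact: cfst || exact: csnd || exact: (cwP c0)).
Qed.

Let mQd : measurable_fun [set: mR2] (fun p => (Qd p ^+ 2)%:E).
Proof.
by apply: mdivdiff => p; apply: cvgB; [exact: (cwP cdiff csnd)|exact: (cwP c0 cfst)|exact: csnd|exact: cfst].
Qed.

Let mQs : measurable_fun [set: mR2] (fun p => (Qs p ^+ 2)%:E).
Proof.
by apply: mdivdiff => p; apply: cvgB; [exact: (cwP cdiff csnd)|exact: (cwP c0 csnd)|exact: csnd|exact: cfst].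
Qed.

Let Gsum : \bar R :=
  (\int[@leb2 R]_(p in square) ('D_(sg + ez) w (P p.1 p.2) ^+ 2)%:E +
   \int[@leb2 R]_(p in square) ('D_sg w (P p.1 p.2) ^+ 2)%:E)%E.

Let mE4 v : measurable_fun [set: mR2] (fun p => 4%:E * (E v p ^+ 2)%:E)%E.
Proof. by apply: measurable_funeM; exact: mE. Qed.

Let E4_ge0 v p : (0 <= 4%:E * (E v p ^+ 2)%:E)%E.
Proof. by rewrite mule_ge0// lee_fin. Qed.

Let mE_slice12 v x : measurable_fun [set: mR] (fun y => (E v (x, y) ^+ 2)%:E).
Proof. exact: (measurableT_comp (mE v) (pair1_measurable x)). Qed.

Let mE_slice21 v y : measurable_fun [set: mR] (fun x => (E v (x, y) ^+ 2)%:E).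
Proof. exact: (measurableT_comp (mE v) (pair2_measurable y)). Qed.

Let four_ge0 : (0 <= 4%:E :> \bar R)%E. Proof. by rewrite lee_fin. Qed.

Let eight_ge0 : (0 <= 8%:E :> \bar R)%E. Proof. by rewrite lee_fin. Qed.

Let measurable_row x : measurable ([set y | Tr (x, y)] : set mR).
Proof.
have [x0|x0] := ltP x 0; first by rewrite (triangle_row0 x0).
by rewrite (triangle_row x0); exact: measurable_itv.
Qed.

Let measurable_col y : measurable ([set x | Tr (x, y)] : set mR).
Proof.
have [y0|y0] := ltP h y; first by rewrite (triangle_col0 y0).
by rewrite (triangle_col y0); exact: measurable_itv.
Qed.

Let diag_bound : (\int[@leb2 R]_(p in Tr) (Qd p ^+ 2)%:E <=
  4%:E * \int[@leb2 R]_(p in square) ('D_(sg + ez) w (P p.1 p.2) ^+ 2)%:E)%E.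
Proof.
apply: (@le_trans _ _ (4%:E * \int[@leb2 R]_(p in Tr) (E (sg + ez) p ^+ 2)%:E)%E); last first.
  exact: (lee_wpmul2l four_ge0 (triangle_bound _)).
rewrite -(ge0_integralZl (@leb2 R) measurable_triangle (measurable_funTS (mE _)) (fun p _ => E_ge0 _ p) four_ge0).
apply: (leb2_le12 measurable_triangle measurable_triangle mQd _ (mE4 _) (E4_ge0 _)).
  by move=> p; rewrite lee_fin sqr_ge0.
move=> x; rewrite (ge0_integralZl leb (measurable_row x) (measurable_funTS (mE_slice12 _ x))
  (fun y _ => E_ge0 _ (x, y)) four_ge0).
exact: hardy_diag.
Qed.

Let side_bound : (\int[@leb2 R]_(p in Tr) (Qs p ^+ 2)%:E <=
  4%:E * \int[@leb2 R]_(p in square) ('D_sg w (P p.1 p.2) ^+ 2)%:E)%E.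
Proof.
apply: (@le_trans _ _ (4%:E * \int[@leb2 R]_(p in Tr) (E sg p ^+ 2)%:E)%E); last first.
  exact: (lee_wpmul2l four_ge0 (triangle_bound _)).
rewrite -(ge0_integralZl (@leb2 R) measurable_triangle (measurable_funTS (mE _)) (fun p _ => E_ge0 _ p) four_ge0).
apply: (leb2_le21 measurable_triangle measurable_triangle mQs _ (mE4 _) (E4_ge0 _)).
  by move=> p; rewrite lee_fin sqr_ge0.
move=> y; rewrite (ge0_integralZl leb (measurable_col y) (measurable_funTS (mE_slice21 _ y))
  (fun x _ => E_ge0 _ (x, y)) four_ge0).
exact: hardy_side.
Qed.

Let Q_bound : (\int[@leb2 R]_(p in Tr) (Q p ^+ 2)%:E <= 8%:E * Gsum)%E.
Proof.
have mQd' : measurable_fun Tr Qd.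
  apply: measurable_funTS; apply: measurable_funM.
    by apply: continuous_measurable2 => p; apply: cvgB; [exact: (cwP cdiff csnd)|exact: (cwP c0 cfst)].
  by apply: (measurableT_comp (@measurable_invr R)); exact: continuous_measurable2.
have mQs' : measurable_fun Tr Qs.
  apply: measurable_funTS; apply: measurable_funM.
    by apply: continuous_measurable2 => p; apply: cvgB; [exact: (cwP cdiff csnd)|exact: (cwP c0 csnd)].
  by apply: (measurableT_comp (@measurable_invr R)); exact: continuous_measurable2.
have := E2B (@leb2 R) measurable_triangle mQd' mQs'.
have -> : E2 (@leb2 R) Tr (fun p => Qd p - Qs p) = (\int[@leb2 R]_(p in Tr) (Q p ^+ 2)%:E)%E.
  apply: eq_integral => p _; congr ((_ ^+ 2)%:E); rewrite /Qd /Qs /Q.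
  by rewrite -[p.1 - p.2]opprB invrN mulrN -mulNr -mulrBl; congr (_ / _); ring.
move=> /le_trans; apply.
have I_ge0 v : (0 <= \int[@leb2 R]_(p in square) ('D_v w (P p.1 p.2) ^+ 2)%:E)%E.
  by apply: integral_ge0 => p _; rewrite lee_fin sqr_ge0.
exact: combine_eight (I_ge0 _) (I_ge0 _) diag_bound side_bound.
Qed.

(** The factor 16 is 4 from Hardy's inequality, 2 from the square of a difference and 2 from the two
    halves of the square. *)
Lemma gagliardo_curve : (gagliardo h c <= 16%:E *
  (\int[@leb2 R]_(p in square) ('D_(sg + ez) w (P p.1 p.2) ^+ 2)%:E +
   \int[@leb2 R]_(p in square) ('D_sg w (P p.1 p.2) ^+ 2)%:E))%E.
Proof.
pose Tr' : set mR2 := [set p | Tr (p.2, p.1)].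
have mTr' : measurable Tr'.
  have := measurable_fun_pair (@measurable_snd _ _ mR mR) (@measurable_fst _ _ mR mR).
  by move=> /(_ measurableT _ measurable_triangle); rewrite setTI.
have Q0 p : (0 <= (Q p ^+ 2)%:E)%E by rewrite lee_fin sqr_ge0.
have EQ : (\int[@leb2 R]_(p in Tr') (Q p ^+ 2)%:E = \int[@leb2 R]_(p in Tr) (Q p ^+ 2)%:E)%E.
  rewrite (leb2_section21 mTr' mQ Q0) (leb2_section12 measurable_triangle mQ Q0).
  apply: eq_integral => y _; apply: eq_integral => x _; congr (_%:E).
  rewrite /Q /= -[x - y]opprB invrN mulrN sqrrN -[w (P 0 x) - _]opprB mulNr sqrrN//.
have -> : gagliardo h c = (\int[@leb2 R]_(p in square) (Q p ^+ 2)%:E)%E.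
  apply: eq_integral => p; rewrite inE => -[/= p1 p2].
  move: p1 p2; rewrite !in_itv/= => p1 p2.
  by rewrite /Q !cw// /P scale0r addr0.
apply: (@le_trans _ _ (\int[@leb2 R]_(p in Tr) (Q p ^+ 2)%:E + \int[@leb2 R]_(p in Tr') (Q p ^+ 2)%:E)%E).
  rewrite (@integral_mkcond _ _ _ (@leb2 R) square) (@integral_mkcond _ _ _ (@leb2 R) Tr)
    (@integral_mkcond _ _ _ (@leb2 R) Tr').
  have mp (C : set mR2) : measurable C ->
      measurable_fun [set: mR2] ((fun p => (Q p ^+ 2)%:E) \_ C).
    by move=> mC; apply: (measurable_restrictT _ mC).1; exact: measurable_funTS.
  have pge0 (C : set mR2) p : (0 <= ((fun p => (Q p ^+ 2)%:E) \_ C) p)%E.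
    by rewrite patchE; case: ifP.
  rewrite -(ge0_integralD (@leb2 R) measurableT (fun p _ => pge0 Tr p) (mp _ measurable_triangle)
    (fun p _ => pge0 Tr' p) (mp _ mTr')).
  apply: ge0_le_integral.
  - exact: measurableT.
  - by move=> p _; exact: pge0.
  - exact: mp measurable_square.
  - exact: (emeasurable_funD (mp _ measurable_triangle) (mp _ mTr')).
  - move=> p _; rewrite {1}patchE; case: ifPn => [|_]; last exact: (adde_ge0 (pge0 Tr p) (pge0 Tr' p)).
    rewrite inE => -[/=]; rewrite !in_itv/= => /andP[p10 p1h] /andP[p20 p2h].
    have [p12|p12] := leP p.1 p.2.
      rewrite [X in (_ <= X + _)%E]patchE mem_set; last by split.
      by apply: leeDl; exact: pge0.
    rewrite [X in (_ <= _ + X)%E]patchE mem_set; last by split => //=; split => //; exact: ltW.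
    by apply: leeDr; exact: pge0.
rewrite EQ; apply: (le_trans (leeD Q_bound Q_bound)).
rewrite -/Gsum; apply: ereal_eq_le; rewrite -(ge0_muleDl _ eight_ge0 eight_ge0) -EFinD.
by congr (_%:E * _)%E; ring.
Qed.

End Curve.
End GagliardoTrace.

(** * End traces and the Poincare inequality *)

Section CylinderTonelli.
Context (R : realType).
Local Notation leb := (@lebesgue_measure R).
Local Notation mu := (@leb3 R).
Local Notation mR := (measurableTypeR R).
Local Notation mR2 := (mR * mR)%type.
Local Notation mpt := (mR * mR * mR)%type.
Variables (A : set mR2) (B : set mR) (F : mpt -> \bar R).
Hypothesis mA : measurable A.
Hypothesis mB : measurable B.
Hypothesis mF : measurable_fun [set: mpt] F.
Hypothesis F0 : forall p, (0 <= F p)%E.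

Let mAB : measurable (A `*` B). Proof. exact: measurableX. Qed.
Let mP : measurable_fun [set: mpt] (F \_ (A `*` B)).
Proof. by apply: (measurable_restrictT F mAB).1; exact: measurable_funTS. Qed.
Let P0 p : (0 <= (F \_ (A `*` B)) p)%E. Proof. by rewrite patchE; case: ifP. Qed.

Lemma measurable_slice12 q : measurable_fun [set: mR] (fun z => F (q, z)).
Proof. exact: (measurableT_comp mF (pair1_measurable q)). Qed.

Lemma prod_Tonelli12 : (\int[mu]_(p in A `*` B) F p =
  \int[@leb2 R]_(q in A) \int[leb]_(z in B) F (q, z))%E.
Proof.
rewrite (@integral_mkcond _ _ _ mu (A `*` B)) (leb3_Tonelli12 mP P0).
rewrite [RHS](@integral_mkcond _ _ _ (@leb2 R) A); apply: eq_integral => q _.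
rewrite patchE; case: ifPn => [/set_mem Aq|/negP Aq].
  rewrite (@integral_mkcond _ _ _ leb B); apply: eq_integral => z _.
  rewrite !patchE; case: ifPn => [/set_mem[_ /= Bz]|/negP Bz]; first by rewrite mem_set.
  by case: ifPn => // /set_mem Bz'; exfalso; apply: Bz; apply/mem_set.
rewrite -[RHS](@integral0 _ mR R leb setT); apply: eq_integral => z _.
rewrite patchE; case: ifPn => // /set_mem[/= Aq' _]; exfalso; apply: Aq; exact/mem_set.
Qed.

Lemma prod_Tonelli21 : (\int[mu]_(p in A `*` B) F p =
  \int[leb]_(z in B) \int[@leb2 R]_(q in A) F (q, z))%E.
Proof.
rewrite (@integral_mkcond _ _ _ mu (A `*` B)) (leb3_Tonelli21 mP P0).
rewrite [RHS](@integral_mkcond _ _ _ leb B); apply: eq_integral => z _.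
rewrite patchE; case: ifPn => [/set_mem Bz|/negP Bz].
  rewrite (@integral_mkcond _ _ _ (@leb2 R) A); apply: eq_integral => q _.
  rewrite !patchE; case: ifPn => [/set_mem[/= Aq _]|/negP Bq]; first by rewrite mem_set.
  by case: ifPn => // /set_mem Bz'; exfalso; apply: Bq; apply/mem_set.
rewrite -[RHS](@integral0 _ mR2 R (@leb2 R) setT); apply: eq_integral => q _.
rewrite patchE; case: ifPn => // /set_mem[/= _ Aq']; exfalso; apply: Bz; exact/mem_set.
Qed.

(** Only the integrated variable is restricted, so that the partial integral is measurable on the
    whole of the other factor. *)
Lemma measurable_partial12 :
  measurable_fun [set: mR2] (fun q => \int[leb]_(z in B) F (q, z))%E.
Proof.
have mTB : measurable ([set: mR2] `*` B) by exact: measurableX.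
have m1 : measurable_fun [set: mpt] (F \_ ([set: mR2] `*` B)).
  by apply: (measurable_restrictT F mTB).1; exact: measurable_funTS.
have p1 p : (0 <= (F \_ ([set: mR2] `*` B)) p)%E by rewrite patchE; case: ifP.
have := @measurable_fun_fubini_tonelli_F _ _ mR2 mR R leb _ m1 p1.
congr measurable_fun; apply/funext => q.
rewrite (@integral_mkcond _ _ _ leb B); apply: eq_integral => z _.
rewrite !patchE; case: ifPn => [/set_mem[_ /= Bz]|/negP Bz]; first by rewrite mem_set.
by case: ifPn => // /set_mem Bz'; exfalso; apply: Bz; apply/mem_set.
Qed.

Lemma measurable_partial21 :
  measurable_fun [set: mR] (fun z => \int[@leb2 R]_(q in A) F (q, z))%E.
Proof.
have mTA : measurable (A `*` [set: mR]) by exact: measurableX.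
have m1 : measurable_fun [set: mpt] (F \_ (A `*` [set: mR])).
  by apply: (measurable_restrictT F mTA).1; exact: measurable_funTS.
have p1 p : (0 <= (F \_ (A `*` [set: mR])) p)%E by rewrite patchE; case: ifP.
have := @measurable_fun_fubini_tonelli_G _ _ mR2 mR R (leb2_sf R) _ m1 p1.
congr measurable_fun; apply/funext => z.
rewrite (@integral_mkcond _ _ _ (@leb2 R) A); apply: eq_integral => q _.
rewrite !patchE; case: ifPn => [/set_mem[/= Aq _]|/negP Aq]; first by rewrite mem_set.
by case: ifPn => // /set_mem Aq'; exfalso; apply: Aq; apply/mem_set.
Qed.

End CylinderTonelli.

Lemma lebesgue_itv0 (R : realType) (h : R) : 0 <= h ->
  @lebesgue_measure R (`[0, h]%classic) = h%:E.
Proof.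
move=> h0; have := lebesgue_measure_itv `[0, h]; rewrite /= => ->.
rewrite lte_fin; move: h0; rewrite le_eqVlt => /predU1P[<-|->]; first by rewrite ltxx.
by rewrite oppr0 addr0.
Qed.

Lemma integral_cst_itv0 (R : realType) (k : \bar R) (h : R) : 0 <= h ->
  (\int[@lebesgue_measure R]_(z in `[0%R, h]) k = k * h%:E)%E.
Proof.
move=> h0; rewrite integral_cst; last exact: measurable_itv.
by congr (_ * _)%E; exact: lebesgue_itv0.
Qed.

Section DomainInequalities.
Context (R : realType).
Local Notation pt := (R * R * R)%type.
Local Notation leb := (@lebesgue_measure R).
Local Notation mu := (@leb3 R).
Local Notation mR := (measurableTypeR R).
Local Notation mR2 := (mR * mR)%type.
Local Notation mpt := (mR * mR * mR)%type.
Local Notation ez := (@ez R).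
Variables (Omega : set (R * R)) (h : R).
Hypothesis oOmega : open Omega.
Hypothesis bOmega : bounded_set Omega.
Hypothesis h0 : 0 < h.
Local Notation C := (cyl Omega h).
Local Notation E2C := (E2 mu C).

Let mC : measurable (C : set mpt) := measurable_cyl h oOmega.
Let mOm : measurable (Omega : set mR2) := measurable_domain oOmega.
Let mI : measurable (`[0, h]%classic : set mR). Proof. exact: measurable_itv. Qed.

Section smoothfun.
Variable w : pt -> R.
Hypothesis sw : smooth w.

Lemma cont_der v : continuous ('D_v w).
Proof. by apply: smooth_cont; exact: smooth_derive. Qed.

Lemma measurable_sqr3 (f : pt -> R) : continuous f ->
  measurable_fun [set: mpt] (fun p => (f p ^+ 2)%:E).
Proof. by move=> cf; apply: measurable_sqr; exact: continuous_measurable3. Qed.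

Lemma measurable_sqr2 (f : R * R -> R) : continuous f ->
  measurable_fun [set: mR2] (fun p => (f p ^+ 2)%:E).
Proof. by move=> cf; apply: measurable_sqr; exact: continuous_measurable2. Qed.

Lemma sqr_ge0E (x : R) : (0 <= (x ^+ 2)%:E)%E.
Proof. by rewrite lee_fin sqr_ge0. Qed.

Lemma E2_cyl12 (f : pt -> R) : continuous f ->
  E2C f = (\int[@leb2 R]_(q in Omega) \int[leb]_(z in `[0%R, h]) (f (q, z) ^+ 2)%:E)%E.
Proof.
by move=> cf; exact: (prod_Tonelli12 mOm mI (measurable_sqr3 cf) (fun p => sqr_ge0E (f p))).
Qed.

Lemma E2_cyl21 (f : pt -> R) : continuous f ->
  E2C f = (\int[leb]_(z in `[0%R, h]) \int[@leb2 R]_(q in Omega) (f (q, z) ^+ 2)%:E)%E.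
Proof.
by move=> cf; exact: (prod_Tonelli21 mOm mI (measurable_sqr3 cf) (fun p => sqr_ge0E (f p))).
Qed.

Lemma measurable_zpartial (f : pt -> R) : continuous f ->
  measurable_fun (Omega : set mR2) (fun q => \int[leb]_(z in `[0%R, h]) (f (q, z) ^+ 2)%:E)%E.
Proof.
move=> cf; apply: measurable_funTS.
exact: (measurable_partial12 mI (measurable_sqr3 cf) (fun p => sqr_ge0E (f p))).
Qed.

Lemma partial_ge0 (f : pt -> R) q : (0 <= \int[leb]_(z in `[0%R, h]) (f (q, z) ^+ 2)%:E)%E.
Proof. by apply: integral_ge0 => z _; exact: sqr_ge0E. Qed.

(** A trace inequality on each vertical line is integrated over [Omega]; shared by the bottom and
    the top. *)
Lemma trace_le_of_pointwise (f0 : R * R -> R) : continuous f0 ->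
  (forall q, h%:E * (f0 q ^+ 2)%:E <=
     2%:E * \int[leb]_(z in `[0%R, h]) (w (q, z) ^+ 2)%:E +
     (2 * h ^+ 2)%:E * \int[leb]_(z in `[0%R, h]) ('D_ez w (q, z) ^+ 2)%:E)%E ->
  (h%:E * \int[@leb2 R]_(q in Omega) (f0 q ^+ 2)%:E <=
  2%:E * E2C w + (2 * h ^+ 2)%:E * E2C ('D_ez w))%E.
Proof.
move=> cf0 H.
have cw : continuous w := smooth_cont sw.
have cD : continuous ('D_ez w) := @cont_der ez.
have h0' : (0 <= h%:E)%E by rewrite lee_fin ltW.
have t0 : (0 <= 2%:E :> \bar R)%E by rewrite lee_fin.
have th0 : (0 <= (2 * h ^+ 2)%:E)%E by rewrite lee_fin mulr_ge0// sqr_ge0.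
have m0 : measurable_fun (Omega : set mR2) (fun q : R * R => (f0 q ^+ 2)%:E).
  by apply: measurable_funTS; exact: measurable_sqr2.
rewrite (E2_cyl12 cw) (E2_cyl12 cD).
rewrite -(ge0_integralZl (@leb2 R) mOm m0 (fun q _ => sqr_ge0E _) h0').
rewrite -(ge0_integralZl (@leb2 R) mOm (measurable_zpartial cw) (fun q _ => partial_ge0 _ _) t0).
rewrite -(ge0_integralZl (@leb2 R) mOm (measurable_zpartial cD) (fun q _ => partial_ge0 _ _) th0).
have mZ (k : \bar R) (f : pt -> R) : continuous f -> measurable_fun (Omega : set mR2)
   (fun q => k * \int[leb]_(z in `[0%R, h]) (f (q, z) ^+ 2)%:E)%E.
  by move=> cf; exact: (measurable_funeM k (measurable_zpartial cf)).
have Z0 (k : \bar R) (f : pt -> R) q : (0 <= k -> 0 <= k * \int[leb]_(z in `[0%R, h]) (f (q, z) ^+ 2)%:E)%E.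
  by move=> k0; exact: (mule_ge0 k0 (partial_ge0 f q)).
rewrite -(ge0_integralD (@leb2 R) mOm (fun q _ => Z0 _ w q t0) (mZ _ _ cw)
  (fun q _ => Z0 _ ('D_ez w) q th0) (mZ _ _ cD)).
apply: ge0_le_integral.
- exact: mOm.
- by move=> q _; apply: mule_ge0 => //; exact: sqr_ge0E.
- exact: measurable_funeM.
- exact: (emeasurable_funD (mZ _ _ cw) (mZ _ _ cD)).
by move=> q _; exact: H.
Qed.

Let line_cont (p v : pt) : continuous (fun s : R => 'D_v w (p + s *: v)).
Proof. exact: (@continuous_line _ _ ('D_v w) p v (@cont_der v)). Qed.

Lemma bottom_trace_le : (h%:E * \int[@leb2 R]_(q in Omega) (w (q, 0%R) ^+ 2)%:E <=
  2%:E * E2C w + (2 * h ^+ 2)%:E * E2C ('D_ez w))%E.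
Proof.
have cw : continuous w := smooth_cont sw.
apply: (trace_le_of_pointwise (continuous_slice (z := 0) cw)) => q.
have E (f : pt -> R) : (\int[leb]_(s in `[0%R, h]) (f ((q, 0) + s *: ez)%R ^+ 2)%:E =
    \int[leb]_(s in `[0%R, h]) (f (q, s) ^+ 2)%:E)%E.
  by apply: eq_integral => s _; rewrite add_ez add0r.
have H := end_trace_1d (fun s => is_derive_line (q, 0) ez s sw) (@line_cont (q, 0) ez) (ltW h0).
rewrite scale0r addr0 in H; apply: (le_trans H); apply: leeD; apply: ereal_eq_le.
- exact: (f_equal (fun X => 2%:E * X)%E (E w)).
- exact: (f_equal (fun X => (2 * h ^+ 2)%:E * X)%E (E ('D_ez w))).
Qed.

Lemma derN_ez p : 'D_(- ez) w p ^+ 2 = 'D_ez w p ^+ 2.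
Proof. by rewrite -scaleN1r deriveZ_dir// mulN1r sqrrN. Qed.

(** The vertical line is run downwards from the top, in the direction [- ez]; a reflection of the
    height restores the integrals over the cylinder. *)
Lemma top_trace_le : (h%:E * \int[@leb2 R]_(q in Omega) (w (q, h) ^+ 2)%:E <=
  2%:E * E2C w + (2 * h ^+ 2)%:E * E2C ('D_ez w))%E.
Proof.
have cw : continuous w := smooth_cont sw.
apply: (trace_le_of_pointwise (continuous_slice (z := h) cw)) => q.
have mslice (f : pt -> R) : continuous f -> measurable_fun [set: mR] (fun z => f (q, z)).
  move=> cf; exact: (measurableT_comp (continuous_measurable3 cf) (pair1_measurable q)).
have P s : (q, h) + s *: - ez = (q, h - s) by rewrite scalerN -scaleNr add_ez.
have H := end_trace_1d (fun s => is_derive_line (q, h) (- ez) s sw) (@line_cont (q, h) (- ez)) (ltW h0).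
rewrite scale0r addr0 in H; apply: (le_trans H); apply: leeD; apply: ereal_eq_le.
- apply: (f_equal (fun X => 2%:E * X)%E).
  apply: etrans (ge0_integral_reflect h (mslice _ cw)).
  by apply: eq_integral => s _; rewrite P.
- apply: (f_equal (fun X => (2 * h ^+ 2)%:E * X)%E).
  apply: etrans (ge0_integral_reflect h (mslice _ (@cont_der ez))).
  by apply: eq_integral => s _; rewrite P derN_ez.
Qed.

(** One factor [h] comes from Cauchy-Schwarz on a vertical line, the other from the integration over
    [z]. *)
Lemma vertical_increment (z' : R) : 0 <= z' <= h ->
  (E2C (fun p => w p - w (p.1, z'))%R <= (h ^+ 2)%:E * E2C ('D_ez w))%E.
Proof.
move=> /andP[z0 zh].
have cw : continuous w := smooth_cont sw.
have cD : continuous ('D_ez w) := @cont_der ez.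
have cf : continuous (fun p : pt => w p - w (p.1, z')).
  move=> p; apply: cvgB; first exact: cw.
  apply: (@continuous_comp _ _ _ (fun p : pt => p.1) (fun q => w (q, z'))).
    exact: cvg_fst.
  exact: (continuous_slice (z := z') cw).
have h2 : (0 <= (h ^+ 2)%:E)%E by exact: sqr_ge0E.
rewrite (E2_cyl12 cf) (E2_cyl12 cD).
rewrite -(ge0_integralZl (@leb2 R) mOm (measurable_zpartial cD) (fun q _ => partial_ge0 _ _) h2).
apply: ge0_le_integral.
- exact: mOm.
- by move=> q _; exact: (partial_ge0 (fun p => w p - w (p.1, z')) q).
- exact: (measurable_zpartial cf).
- exact: (measurable_funeM _ (measurable_zpartial cD)).
move=> q _.
set I := (\int[leb]_(z in `[0%R, h]) ('D_ez w (q, z) ^+ 2)%:E)%E.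
apply: (@le_trans _ _ (\int[leb]_(z in `[0%R, h]) (h%:E * I))%E).
  apply: ge0_le_integral.
  - exact: mI.
  - by move=> z _; exact: sqr_ge0E.
  - apply: measurable_funTS.
    exact: (measurable_slice12 (measurable_sqr3 cf) q).
  - exact: measurable_cst.
  move=> z /=; rewrite in_itv/= => /andP[z1 z2].
  have inc a b : 0 <= a -> a <= b -> b <= h -> (((w (q, b) - w (q, a)) ^+ 2)%:E <= h%:E * I)%E.
    move=> a0 ab bh.
    have H := increment_sqr_le_itv (fun s => is_derive_line (q, 0) ez s sw)
      (@line_cont (q, 0) ez) a0 ab bh.
    rewrite !add_ez !add0r subr0 in H; apply: (le_trans H); apply: ereal_eq_le.
    apply: (f_equal (fun X => h%:E * X)%E); apply: eq_integral => s _.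
    by rewrite add_ez add0r.
  have [zz|zz] := leP z z'; last by apply: inc => //; exact: ltW.
  by rewrite -sqrrN opprB; exact: inc.
rewrite (integral_cst_itv0 _ (ltW h0)) expr2 EFinM muleC muleA; exact: lexx.
Qed.

End smoothfun.
End DomainInequalities.

(** * The Poincare inequality *)

Section Poincare.
Context (R : realType).
Local Notation pt := (R * R * R)%type.
Local Notation leb := (@lebesgue_measure R).
Local Notation mR := (measurableTypeR R).
Local Notation mR2 := (mR * mR)%type.
Local Notation mpt := (mR * mR * mR)%type.
Local Notation ex := (@ex R).
Variables (Omega : set (R * R)) (h : R).
Hypothesis oOmega : open Omega.
Hypothesis bOmega : bounded_set Omega.
Hypothesis h0 : 0 < h.
Local Notation C := (cyl Omega h).

Let mC : measurable (C : set mpt) := measurable_cyl h oOmega.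
Let mOm : measurable (Omega : set mR2) := measurable_domain oOmega.
Let mI : measurable (`[0, h]%classic : set mR). Proof. exact: measurable_itv. Qed.

Lemma open_row y : open [set x | Omega (x, y)].
Proof.
apply: (@open_comp _ _ (fun x : R => (x, y))) => // x _.
by apply: (cvg_pair (F := nbhs x) (G := nbhs x) (H := nbhs y)); [exact: cvg_id|exact: cvg_cst].
Qed.

Lemma open_column x : open [set y | Omega (x, y)].
Proof.
apply: (@open_comp _ _ (fun y : R => (x, y))) => // y _.
by apply: (cvg_pair (F := nbhs y) (G := nbhs x) (H := nbhs y)); [exact: cvg_cst|exact: cvg_id].
Qed.

(** [x0] is the supremum of the points of the row up to [x] that lie outside [Omega]. It is outside
    because the row of [Omega] is open, and in the closure because everything between it and [x] is
    inside. The length bound holds since [- M - 1] is outside and [x <= M]. *)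
Lemma exit_point (M x y : R) : (forall q, Omega q -> `|q.1| <= M /\ `|q.2| <= M) ->
  Omega (x, y) -> exists x0, [/\ x0 < x, x - x0 <= 2 * M + 1, boundary Omega (x0, y) &
    forall s, x0 < s -> s <= x -> Omega (s, y)].
Proof.
move=> HM xO.
pose S := [set s | s <= x /\ ~ Omega (s, y)].
have xM : - M <= x <= M by have [+ _] := HM _ xO; rewrite /= ler_norml.
have SM : S (- M - 1).
  split; first by move: xM => /andP[]; lra.
  by move=> /HM[/= + _]; rewrite ler_norml => /andP[]; lra.
have supS : has_sup S.
  by split; [exists (- M - 1)|exists x => s []].
have Sx0 := sup_upper_bound supS.
set x0 := sup S in Sx0 *.
have x0x : x0 <= x by apply: sup_le_ub; [exists (- M - 1)|move=> s []].
have above s : x0 < s -> s <= x -> Omega (s, y).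
  move=> x0s sx; apply: contrapT => nO.
  have : s <= x0 by apply: Sx0.
  by rewrite leNgt x0s.
have x0O : ~ Omega (x0, y).
  move=> Hx0.
  have /nbhs_ballP[e /= e0 He] : nbhs x0 [set s | Omega (s, y)].
    by apply: open_nbhs_nbhs; split => //; exact: open_row.
  have [s Ss Hs] := sup_adherent e0 supS.
  have sx0 : s <= x0 by exact: Sx0.
  have [_ nO] := Ss; apply: nO; apply: He.
  by rewrite -ball_normE /ball_/= ger0_norm ?subr_ge0//; move: Hs; rewrite -/x0; lra.
have x0x' : x0 < x by rewrite lt_neqAle x0x andbT; apply/eqP => E; apply: x0O; rewrite E.
exists x0; split => //.
- have := Sx0 _ SM; move: xM => /andP[]; lra.
- split; last by move=> /interior_subset.
  move=> B /nbhs_ballP[e /= e0 He].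
  pose s := x0 + Num.min (e / 2) (x - x0).
  have d0 : 0 < Num.min (e / 2) (x - x0) by rewrite lt_min divr_gt0// subr_gt0.
  exists (s, y); split.
    apply: above; first by rewrite /s ltrDl.
    by rewrite /s -lerBrDl ge_min lexx orbT.
  apply: He; split => /=; last exact: ballxx.
  rewrite -ball_normE /ball_/= /s opprD addrA subrr sub0r normrN gtr0_norm//.
  by rewrite gt_min ltr_pdivrMr// ltr_pMr// ltr1n.
Qed.

Section smoothfun.
Variable w : pt -> R.
Hypothesis sw : smooth w.

Let cD (v : pt) : continuous ('D_v w).
Proof. by apply: smooth_cont; exact: smooth_derive. Qed.

Let row_meas (f : pt -> R) (y z : R) : continuous f ->
  measurable_fun [set: mR] (fun x => f (x, y, z)).
Proof.
move=> cf; have m2 := continuous_measurable2 (continuous_slice (z := z) cf).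
exact: (measurableT_comp m2 (pair2_measurable y)).
Qed.

(** Each point of the row is joined to an exit point, where [w] is [k], by a segment of length at
    most [2 * M + 1] inside the domain; the row itself has measure at most [2 * M]. *)
Lemma poincare_row (M k y z : R) :
  (forall q, Omega q -> `|q.1| <= M /\ `|q.2| <= M) ->
  (forall q, boundary Omega q -> w (q, z) = k) -> 0 <= M ->
  (\int[leb]_(x in [set x | Omega (x, y)]) ((w (x, y, z) - k) ^+ 2)%:E <=
   \int[leb]_(x in [set x | Omega (x, y)])
     (((2 * M + 1) * (2 * M))%:E * ('D_ex w (x, y, z) ^+ 2)%:E))%E.
Proof.
move=> HM wk M0.
set A := [set x | Omega (x, y)].
have mA : measurable (A : set mR) by apply: open_measurable; exact: open_row.
have cw : continuous w := smooth_cont sw.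
have mD : measurable_fun A (fun x => ('D_ex w (x, y, z) ^+ 2)%:E).
  by apply: measurable_sqr; apply: measurable_funTS; exact: (row_meas _ _ (@cD ex)).
set I := (\int[leb]_(x in A) ('D_ex w (x, y, z) ^+ 2)%:E)%E.
have I0 : (0 <= I)%E by apply: integral_ge0 => x _; exact: sqr_ge0E.
have L0 : 0 <= 2 * M + 1 by lra.
have L0E : (0 <= (2 * M + 1)%:E)%E by rewrite lee_fin.
have leA : (leb A <= (2 * M)%:E)%E.
  apply: (@le_trans _ _ (leb (`[- M, M]%classic))).
    apply: le_measure; rewrite ?inE//.
    by move=> x /HM[/= + _]; rewrite in_itv/= ler_norml.
  have := lebesgue_measure_itv `[- M, M]; rewrite /= => ->.
  by case: ifP => _; rewrite lee_fin; lra.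
apply: (@le_trans _ _ (\int[leb]_(x in A) ((2 * M + 1)%:E * I))%E).
  apply: ge0_le_integral.
  - exact: mA.
  - by move=> x _; exact: sqr_ge0E.
  - apply: measurable_sqr; apply: measurable_funB; last exact: measurable_cst.
    by apply: measurable_funTS; exact: (row_meas _ _ cw).
  - exact: measurable_cst.
  move=> x Ax; have [x0 [x0x xx0 bx0 Hs]] := exit_point HM Ax.
  rewrite -(wk _ bx0).
  have dg (s : R) := is_derive_line (0, y, z) ex s sw.
  have cg : continuous (fun s : R => 'D_ex w ((0, y, z) + s *: ex)).
    exact: (@continuous_line _ _ ('D_ex w) (0, y, z) ex (@cD ex)).
  have H := increment_sqr_le dg cg (ltW x0x).
  rewrite !add_ex !add0r in H; apply: (le_trans H).
  apply: lee_pmul.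
  - by rewrite lee_fin subr_ge0 ltW.
  - by apply: integral_ge0 => s _; exact: sqr_ge0E.
  - by rewrite lee_fin.
  (* The exit point is outside [Omega], so it is removed before the segment is compared with the
     row. *)
  rewrite -integral_itv_obnd_cbnd; last first.
    by apply: measurable_sqr; apply: measurable_funTS; apply: cont_measurable1.
  apply: (@le_trans _ _ (\int[leb]_(s in `]x0, x]) ('D_ex w (s, y, z) ^+ 2)%:E)%E).
    by apply: ereal_eq_le; apply: eq_integral => s _; rewrite add_ex add0r.
  apply: ge0_subset_integral.
  - exact: measurable_itv.
  - exact: mA.
  - exact: mD.
  - by move=> s _; exact: sqr_ge0E.
  - by move=> s /=; rewrite in_itv/= => /andP[? ?]; exact: Hs.
rewrite integral_cst; last exact: mA.
have k0 : (0 <= ((2 * M + 1) * (2 * M))%:E)%E by rewrite lee_fin !mulr_ge0.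
rewrite (ge0_integralZl leb mA mD (fun x _ => sqr_ge0E _) k0) -/I.
rewrite EFinM -muleA -muleA; apply: lee_wpmul2l => //.
by rewrite muleC; apply: lee_wpmul2r.
Qed.

Lemma poincare_slice (M k z : R) :
  (forall q, Omega q -> `|q.1| <= M /\ `|q.2| <= M) ->
  (forall q, boundary Omega q -> w (q, z) = k) -> 0 <= M ->
  (\int[@leb2 R]_(q in Omega) ((w (q, z) - k) ^+ 2)%:E <=
   ((2 * M + 1) * (2 * M))%:E * \int[@leb2 R]_(q in Omega) ('D_ex w (q, z) ^+ 2)%:E)%E.
Proof.
move=> HM wk M0.
have cw : continuous w := smooth_cont sw.
have k0 : (0 <= ((2 * M + 1) * (2 * M))%:E)%E by rewrite lee_fin !mulr_ge0//; lra.
have mD : measurable_fun [set: mR2] (fun q => ('D_ex w (q, z) ^+ 2)%:E).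
  by apply: measurable_sqr2; exact: (continuous_slice (z := z) (@cD ex)).
rewrite -(ge0_integralZl (@leb2 R) mOm (measurable_funTS mD) (fun q _ => sqr_ge0E _) k0).
have mw : measurable_fun [set: mR2] (fun q => ((w (q, z) - k) ^+ 2)%:E).
  apply: measurable_sqr2 => q; apply: cvgB; last exact: cvg_cst.
  exact: (continuous_slice (z := z) cw).
apply: (leb2_le21 mOm mOm mw (fun q => sqr_ge0E _) (measurable_funeM _ mD)).
  by move=> q; apply: mule_ge0 => //; exact: sqr_ge0E.
by move=> y; exact: poincare_row.
Qed.

End smoothfun.
End Poincare.

Section PoincareMean.
Context (R : realType).
Local Notation pt := (R * R * R)%type.
Local Notation leb := (@lebesgue_measure R).
Local Notation mu := (@leb3 R).
Local Notation mR := (measurableTypeR R).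
Local Notation mR2 := (mR * mR)%type.
Local Notation mpt := (mR * mR * mR)%type.
Local Notation ex := (@ex R).
Local Notation ez := (@ez R).
Variables (Omega : set (R * R)) (h : R).
Hypothesis oOmega : open Omega.
Hypothesis bOmega : bounded_set Omega.
Hypothesis h0 : 0 < h.
Local Notation C := (cyl Omega h).
Local Notation E2C := (E2 mu C).
Local Notation L2C := (L2 mu C).
Local Notation N := (L2norm mu C).
Local Notation ipU := (@ip _ _ R mu C).

Let mC : measurable (C : set mpt) := measurable_cyl h oOmega.
Let mOm : measurable (Omega : set mR2) := measurable_domain oOmega.
Let mI : measurable (`[0, h]%classic : set mR). Proof. exact: measurable_itv. Qed.

(** A function of mean zero is orthogonal to the constants, so subtracting one cannot decrease its
    norm. *)
Lemma mean_zero_le (f : pt -> R) (k : R) : L2C f -> \int[mu]_(p in C) f p = 0 ->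
  (E2C f <= E2C (fun p => f p - k)%R)%E.
Proof.
move=> Lf f0.
have L1 : L2C (fun=> 1) by apply: smooth_L2 => //; exact: smooth_cst.
have Lk : L2C (fun p => - k * (fun=> 1) p + f p) by exact: L2_lincomb.
have -> : (fun p => f p - k) = (fun p => - k * (fun=> 1) p + f p).
  by apply/funext => p; rewrite mulr1 addrC.
rewrite (E2_ip mC Lf) (E2_ip mC Lk) lee_fin.
have I1 : ipU (fun=> 1) f = 0.
  by rewrite -[RHS]f0; apply: eq_Rintegral => p _; rewrite mul1r.
have I11 : 0 <= ipU (fun=> 1) (fun=> 1) by exact: ip_ge0.
rewrite (ip_linl mC (- k) L1 Lf Lk) (ip_linr mC (- k) L1 Lf L1) (ip_linr mC (- k) L1 Lf Lf).
rewrite (ipC mu C f (fun=> 1)) I1 mulr0 add0r addr0 mulrA.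
by rewrite -[leLHS]add0r lerD2r mulr_ge0// mulrNN -expr2 sqr_ge0.
Qed.

Lemma poincare_arith (e a b k K1 : R) : 0 < k -> 0 <= K1 -> 0 <= a -> 0 <= b ->
  e * k <= 2 * k ^+ 2 * a * k + 2 * k * K1 * b -> e <= (2 * k ^+ 2 + 2 * K1) * (b + a).
Proof.
move=> k0 K10 a0 b0.
have -> : 2 * k ^+ 2 * a * k + 2 * k * K1 * b = (2 * k ^+ 2 * a + 2 * K1 * b) * k by ring.
rewrite ler_pM2r// => /le_trans; apply.
rewrite mulrDr !mulrDl.
have := mulr_ge0 (mulr_ge0 (ler0n R 2) (sqr_ge0 k)) b0.
have := mulr_ge0 (mulr_ge0 (ler0n R 2) K10) a0.
lra.
Qed.

(** At each height [z], the zero mean bounds the norm of [al] by that of [al - c z], which splits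
    into the vertical increment from height [z] and the slice of [al] at [z] minus [c z];
    [poincare_slice] applies to the latter. Integration over [z] turns the slices into the
    cylinder. *)
Lemma poincare_preH : exists2 K : R, 0 <= K & forall al, preH Omega h al ->
  N al ^+ 2 <= K * (N ('D_ex al) ^+ 2 + N ('D_ez al) ^+ 2).
Proof.
have [M M0 HM] := domain_bound bOmega.
set K1 := (2 * M + 1) * (2 * M).
have K10 : 0 <= K1 by rewrite mulr_ge0//; lra.
exists (2 * h ^+ 2 + 2 * K1) => [|al [sal mal [c cal]]].
  by rewrite addr_ge0// mulr_ge0// sqr_ge0.
have cal0 : continuous al := smooth_cont sal.
have cx : continuous ('D_ex al) by apply: smooth_cont; exact: smooth_derive.
have Lal : L2C al by exact: smooth_L2.
have LDx : L2C ('D_ex al) by exact: (smooth_L2 _ _ _ (smooth_derive ex sal)).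
have LDz : L2C ('D_ez al) by exact: (smooth_L2 _ _ _ (smooth_derive ez sal)).
pose G z := (\int[@leb2 R]_(q in Omega) ('D_ex al (q, z) ^+ 2)%:E)%E.
have G0 z : (0 <= G z)%E by apply: integral_ge0 => q _; exact: sqr_ge0E.
have key z : 0 <= z <= h ->
    (E2C al <= (2 * h ^+ 2)%:E * E2C ('D_ez al) + (2 * h * K1)%:E * G z)%E.
  move=> zh.
  have cslice : continuous (fun p : pt => al (p.1, z)).
    move=> p; apply: (@continuous_comp _ _ _ (fun p : pt => p.1) (fun q => al (q, z))).
      exact: cvg_fst.
    exact: (continuous_slice (z := z) cal0).
  apply: (le_trans (mean_zero_le (c z) Lal mal)).
  have m1 : measurable_fun C (fun p : pt => al (p.1, z) - al p).
    apply: measurable_funTS; apply: continuous_measurable3 => p.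
    by apply: cvgB; [exact: cslice|exact: cal0].
  have cs2 : continuous (fun p : pt => al (p.1, z) - c z).
    by move=> p; apply: cvgB; [exact: cslice|exact: cvg_cst].
  have m2 : measurable_fun C (fun p : pt => al (p.1, z) - c z).
    by apply: measurable_funTS; exact: continuous_measurable3.
  have := E2B mu mC m2 m1.
  have -> : (fun p : pt => al (p.1, z) - c z - (al (p.1, z) - al p)) = (fun p => al p - c z).
    by apply/funext => p; ring.
  rewrite [X in (_ <= _ + _ * X)%E]E2BC addeC => /le_trans; apply; apply: leeD.
    apply: (le_trans (lee_wpmul2l _ (vertical_increment oOmega h0 sal zh))).
      by rewrite lee_fin.
    by rewrite muleA -EFinM; exact: lexx.
  rewrite (E2_cyl12 h oOmega cs2) /=.
  have -> : (\int[@leb2 R]_(q in Omega) \int[leb]_(z0 in `[0%R, h]) ((al (q, z) - c z) ^+ 2)%:E =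
    h%:E * \int[@leb2 R]_(q in Omega) ((al (q, z) - c z) ^+ 2)%:E)%E.
    rewrite -(ge0_integralZl (@leb2 R) mOm _ (fun q _ => sqr_ge0E _)).
    - apply: eq_integral => q _.
      by rewrite (integral_cst_itv0 _ (ltW h0)) muleC.
    - apply: measurable_funTS; apply: measurable_sqr2 => q.
      by apply: cvgB; [exact: (continuous_slice (z := z) cal0)|exact: cvg_cst].
    - by rewrite lee_fin ltW.
  have P : forall q, boundary Omega q -> al (q, z) = c z by move=> q bq; exact: cal.
  have H := poincare_slice oOmega sal HM P (ltW M0).
  have h0E : (0 <= h%:E)%E by rewrite lee_fin ltW.
  have t0E : (0 <= 2%:E :> \bar R)%E by rewrite lee_fin.
  apply: (le_trans (lee_wpmul2l t0E (lee_wpmul2l h0E H))).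
  by rewrite !muleA -!EFinM; exact: lexx.
have c1 : (0 <= (2 * h ^+ 2)%:E)%E by rewrite lee_fin mulr_ge0// sqr_ge0.
have c2 : (0 <= (2 * h * K1)%:E)%E.
  by rewrite lee_fin; apply: mulr_ge0 => //; apply: mulr_ge0 => //; exact: ltW.
have mG : measurable_fun (`[0, h]%classic : set mR) G.
  apply: measurable_funTS.
  exact: (measurable_partial21 mOm (measurable_sqr3 cx) (fun p => sqr_ge0E _)).
have := @ge0_le_integral _ mR R leb `[0, h] mI (fun=> E2C al)
  (fun z => (2 * h ^+ 2)%:E * E2C ('D_ez al) + (2 * h * K1)%:E * G z)%E
  (fun z _ => E2_ge0 _ _ _) (measurable_cst _) (emeasurable_funD (measurable_cst _)
    (measurable_funeM _ mG)).
have hyp z : (`[0, h]%classic : set mR) z ->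
    (E2C al <= (2 * h ^+ 2)%:E * E2C ('D_ez al) + (2 * h * K1)%:E * G z)%E.
  by rewrite /= in_itv; exact: key.
move=> /(_ hyp).
rewrite (integral_cst_itv0 _ (ltW h0)).
rewrite (ge0_integralD leb mI (fun z _ => mule_ge0 c1 (E2_ge0 _ _ _)) (measurable_cst _)
  (fun z _ => mule_ge0 c2 (G0 z)) (measurable_funeM _ mG)).
rewrite (integral_cst_itv0 _ (ltW h0)) (ge0_integralZl leb mI mG (fun z _ => G0 z) c2).
rewrite -(E2_cyl21 h oOmega cx).
rewrite (E2_L2norm mC Lal) (E2_L2norm mC LDx) (E2_L2norm mC LDz).
rewrite -!EFinM -EFinD lee_fin.
exact: poincare_arith h0 K10 (sqr_ge0 _) (sqr_ge0 _).
Qed.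

End PoincareMean.

(** * Lateral boundary charts *)

Section Unorient.
Context (R : realType).
Implicit Types (swap flip : bool) (t s : R).

(** Inverse of [reorient]: [t] is the coordinate along the boundary and [s] the one in which [Omega]
    is an epigraph. *)
Definition unorient swap flip t s : R * R :=
  let s' := if flip then - s else s in if swap then (s', t) else (t, s').

Lemma reorientK swap flip t s : reorient swap flip (unorient swap flip t s) = (t, s).
Proof. by case: swap; case: flip; rewrite /reorient /unorient //= opprK. Qed.

Lemma unorientK swap flip (q : R * R) :
  unorient swap flip (reorient swap flip q).1 (reorient swap flip q).2 = q.
Proof. by case: q => a b; case: swap; case: flip; rewrite /reorient /unorient //= opprK. Qed.

Lemma unorient_add swap flip t s r :
  unorient swap flip t (s + r) = unorient swap flip t s + r *: unorient swap flip 0 1.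
Proof.
case: swap; case: flip; rewrite /unorient.
- rewrite -[r *: _]/(r *: -1, r *: 0) -[X in _ = X]/(- s + r *: -1, t + r *: 0).
  by rewrite scaler0 addr0 -[r *: -1]/(r * -1) mulrN1 opprD.
- rewrite -[r *: _]/(r *: 1, r *: 0) -[X in _ = X]/(s + r *: 1, t + r *: 0).
  by rewrite scaler0 addr0 -[r *: 1]/(r * 1) mulr1.
- rewrite -[r *: _]/(r *: 0, r *: -1) -[X in _ = X]/(t + r *: 0, - s + r *: -1).
  by rewrite scaler0 addr0 -[r *: -1]/(r * -1) mulrN1 opprD.
- rewrite -[r *: _]/(r *: 0, r *: 1) -[X in _ = X]/(t + r *: 0, s + r *: 1).
  by rewrite scaler0 addr0 -[r *: 1]/(r * 1) mulr1.
Qed.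

Lemma ball_unorient swap flip t s t' s' (r : R) :
  ball (unorient swap flip t s) r (unorient swap flip t' s') <->
  `|t - t'| < r /\ `|s - s'| < r.
Proof.
have E (a b : R) : ball a r b <-> `|a - b| < r by rewrite -ball_normE.
have N (a b : R) : `|- a - - b| = `|a - b| by rewrite -normrN opprD !opprK.
case: swap; case: flip; rewrite /unorient; (split=> [[/= /E + /E]|[H1 H2]]; last
  by split; apply/E => /=; rewrite ?N); rewrite ?N; by split.
Qed.

Variables (T : topologicalType) (f g : T -> R).
Lemma continuous_unorient swap flip : continuous f -> continuous g ->
  continuous (fun x => unorient swap flip (f x) (g x)).
Proof.
move=> cf cg x.
have cNg : (fun x => - g x) @ x --> - g x by apply: cvgN; exact: cg.
case: swap; case: flip; rewrite /unorient.
- exact: (cvg_pair (F := nbhs x) (G := nbhs (- g x)) (H := nbhs (f x)) cNg (cf x)).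
- exact: (cvg_pair (F := nbhs x) (G := nbhs (g x)) (H := nbhs (f x)) (cg x) (cf x)).
- exact: (cvg_pair (F := nbhs x) (G := nbhs (f x)) (H := nbhs (- g x)) (cf x) cNg).
- exact: (cvg_pair (F := nbhs x) (G := nbhs (f x)) (H := nbhs (g x)) (cf x) (cg x)).
Qed.

End Unorient.

Section Chart.
Context (R : realType).
Variables (Omega : set (R * R)) (h : R).
Hypothesis h0 : 0 < h.

(** The chart sits at an exit point of a row. Its depth is rescaled by [k] to range over []0, h]],
    because the Gagliardo argument uses differences of two heights in [[0, h]] as depths. *)
Lemma boundary_chart : smooth_bounded_domain Omega ->
  exists (swap flip : bool) (psi : R -> R) (a b k : R),
  [/\ a < b, 0 < k, smooth psi,
      forall t, a <= t <= b -> boundary Omega (unorient swap flip t (psi t)) &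
      forall t r, a <= t <= b -> 0 < r <= h ->
        Omega (unorient swap flip t (psi t + k * r))].
Proof.
move=> [oO [[x y] Oxy] bO sO].
have [M M0 HM] := domain_bound bO.
have [x0 [_ _ bx0 _]] := exit_point oO HM Oxy.
have [swap [flip [r [psi [r0 spsi Hq]]]]] := sO _ bx0.
move: bx0 Hq; rewrite -(unorientK swap flip (x0, y)).
set p1 := (reorient _ _ _).1; set p2 := (reorient _ _ _).2 => bp Hq.
have cpsi : continuous psi := smooth_cont spsi.
have HU t s : `|p1 - t| < r -> `|p2 - s| < r -> Omega (unorient swap flip t s) <-> psi t < s.
  move=> tr sr; have := Hq (unorient swap flip t s); rewrite reorientK /=; apply.
  exact/ball_unorient.
have r2 : 0 < r / 2 by rewrite divr_gt0.
(* Above the graph the boundary point would be interior; below it, a whole neighbourhood would miss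
   [Omega] by continuity of [psi]. *)
have psip : psi p1 = p2.
  have [cp nip] := bp.
  have le1 : p2 <= psi p1.
    rewrite leNgt; apply/negP => H; apply: nip.
    have : nbhs (unorient swap flip p1 p2) Omega.
      apply: open_nbhs_nbhs; split => //.
      by apply/HU => //; rewrite subrr normr0.
    by [].
  apply/eqP; rewrite eq_le le1 andbT leNgt; apply/negP => lt1.
  pose e := (psi p1 - p2) / 2.
  have e0 : 0 < e by rewrite divr_gt0// subr_gt0.
  have /cvgrPdist_lt/(_ _ e0)/nbhs_ballP[d /= d0 Hd] := cpsi p1.
  pose m := Num.min d (Num.min e r).
  have m0 : 0 < m by rewrite !lt_min d0 e0 r0.
  have [q [Oq bq]] := cp _ (nbhsx_ballx _ _ m0).
  move: bq Oq; rewrite /= -(unorientK swap flip q).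
  set t := (reorient _ _ _).1; set s := (reorient _ _ _).2 => /ball_unorient[].
  rewrite /= !lt_min => /andP[td /andP[te tr]] /andP[sd /andP[se sr]].
  move=> /(HU _ _ tr sr) lt2.
  have : `|psi p1 - psi t| < e by apply: Hd; rewrite -ball_normE.
  move: se; rewrite !ltr_norml => /andP[s1 s2] /andP[s3 s4].
  by move: lt2 s1 s2 s3 s4; rewrite /e; lra.
have r20 : 0 < r / 4 by rewrite divr_gt0.
have /cvgrPdist_lt/(_ _ r20)/nbhs_ballP[d /= d0 Hd] := cpsi p1.
(* On this range [psi t] is within [r / 4] of [p2], so heights up to [r / 2] above the graph stay in
   the ball of radius [r]. *)
pose m := Num.min d r / 2.
have m0 : 0 < m by rewrite divr_gt0// lt_min d0 r0.
have mt t : p1 - m <= t <= p1 + m -> `|p1 - t| < r /\ `|p2 - psi t| < r / 4.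
  move=> /andP[t1 t2].
  have : `|p1 - t| < Num.min d r.
    rewrite ltr_norml; move: m0 t1 t2; rewrite /m; set x' := Num.min d r => *.
    by apply/andP; split; lra.
  rewrite lt_min => /andP[td tr]; split => //.
  by rewrite -psip; apply: Hd; rewrite -ball_normE.
have inO t s : p1 - m <= t <= p1 + m -> 0 < s -> s < r / 2 ->
    Omega (unorient swap flip t (psi t + s)).
  move=> /mt[tr pr] s0 sr; apply/HU => //; last by rewrite ltrDl.
  by move: pr; rewrite !ltr_norml => /andP[? ?]; apply/andP; split; lra.
(* With [k = r / (4 * h)] the height [k * s] is at most [r / 4] for [s <= h]. *)
exists swap, flip, psi, (p1 - m), (p1 + m), (r / (4 * h)); split => //.
- by lra.
- by rewrite divr_gt0// mulr_gt0.
- move=> t tm; have [tr pr] := mt t tm; split.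
    move=> B /nbhs_ballP[e /= e0 He].
    pose s := Num.min e r / 4.
    have s0 : 0 < s by rewrite divr_gt0// lt_min e0 r0.
    have se : s < e.
      have : Num.min e r <= e by rewrite ge_min lexx.
      by move: s0; rewrite /s; lra.
    have sr : s < r / 2.
      have : Num.min e r <= r by rewrite ge_min lexx orbT.
      by move: s0; rewrite /s; lra.
    exists (unorient swap flip t (psi t + s)); split; first exact: inO.
    apply: He; apply/ball_unorient; split; first by rewrite subrr normr0.
    by rewrite opprD addrA subrr sub0r normrN gtr0_norm.
  move=> /interior_subset.
  have pr' : `|p2 - psi t| < r by lra.
  by move=> /(HU _ _ tr pr'); rewrite ltxx.
- move=> t s tm /andP[s0 sh]; apply: inO => //.
    by rewrite mulr_gt0// divr_gt0// mulr_gt0.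
  rewrite -mulrA; have : (4 * h)^-1 * s <= 4^-1.
    by rewrite invfM -mulrA ler_piMr// mulrC ler_pdivrMr// mul1r.
  by move=> H; have := ler_wpM2l (ltW r0) H; lra.
Qed.

End Chart.

Section PlaneTonelli.
Context (R : realType).
Local Notation leb := (@lebesgue_measure R).
Local Notation mR := (measurableTypeR R).
Local Notation mR2 := (mR * mR)%type.
Variables (S : set mR2) (F : mR2 -> \bar R).
Hypothesis mS : measurable S.
Hypothesis mF : measurable_fun [set: mR2] F.
Hypothesis F0 : forall p, (0 <= F p)%E.

Let mP : measurable_fun [set: mR2] (F \_ S).
Proof. by apply: (measurable_restrictT F mS).1; exact: measurable_funTS. Qed.
Let P0 p : (0 <= (F \_ S) p)%E. Proof. by rewrite patchE; case: ifP. Qed.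

Lemma measurable_section12 :
  measurable_fun [set: mR] (fun x => \int[leb]_(y in [set y | S (x, y)]) F (x, y))%E.
Proof.
have := @measurable_fun_fubini_tonelli_F _ _ mR mR R leb _ mP P0.
congr measurable_fun; apply/funext => x.
by rewrite (@integral_mkcond _ mR R leb [set y | S (x, y)]).
Qed.

Lemma measurable_section21 :
  measurable_fun [set: mR] (fun y => \int[leb]_(x in [set x | S (x, y)]) F (x, y))%E.
Proof.
have := @measurable_fun_fubini_tonelli_G _ _ mR mR R leb _ mP P0.
congr measurable_fun; apply/funext => y.
by rewrite (@integral_mkcond _ mR R leb [set x | S (x, y)]).
Qed.

End PlaneTonelli.

Section PlaneProduct.
Context (R : realType).
Local Notation leb := (@lebesgue_measure R).
Local Notation mR := (measurableTypeR R).
Local Notation mR2 := (mR * mR)%type.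
Variables (A B : set mR) (F : mR2 -> \bar R).
Hypothesis mA : measurable A.
Hypothesis mB : measurable B.
Hypothesis mF : measurable_fun [set: mR2] F.
Hypothesis F0 : forall p, (0 <= F p)%E.

Let mTB : measurable ([set: mR] `*` B). Proof. exact: measurableX. Qed.

Lemma plane_Tonelli12 : (\int[@leb2 R]_(p in A `*` B) F p =
  \int[leb]_(x in A) \int[leb]_(y in B) F (x, y))%E.
Proof.
rewrite (leb2_section12 (measurableX mA mB) mF F0).
rewrite [RHS](@integral_mkcond _ mR R leb A); apply: eq_integral => x _.
rewrite patchE; case: ifPn => [/set_mem Ax|/negP Ax].
  by congr (integral _ _ _); apply/seteqP; split => y //= [].
rewrite (_ : [set y | _] = set0) ?integral_set0//.
by apply/seteqP; split => y //= [Ax' _]; apply: Ax; exact/mem_set.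
Qed.

Lemma plane_Tonelli21 : (\int[@leb2 R]_(p in A `*` B) F p =
  \int[leb]_(y in B) \int[leb]_(x in A) F (x, y))%E.
Proof.
rewrite (leb2_section21 (measurableX mA mB) mF F0).
rewrite [RHS](@integral_mkcond _ mR R leb B); apply: eq_integral => y _.
rewrite patchE; case: ifPn => [/set_mem By|/negP By].
  by congr (integral _ _ _); apply/seteqP; split => x //= [].
rewrite (_ : [set x | _] = set0) ?integral_set0//.
by apply/seteqP; split => x //= [_ By']; apply: By; exact/mem_set.
Qed.

Lemma plane_measurable12 :
  measurable_fun [set: mR] (fun x => \int[leb]_(y in B) F (x, y))%E.
Proof.
have := measurable_section12 mTB mF F0; congr measurable_fun; apply/funext => x.
by congr (integral _ _ _); apply/seteqP; split => y //= [].
Qed.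

End PlaneProduct.

(** * Change of variables in a boundary chart *)

Section Fibres.
Context (R : realType).
Local Notation leb := (@lebesgue_measure R).
Local Notation mR := (measurableTypeR R).
Local Notation mR2 := (mR * mR)%type.

(** Affine substitution on one line. The endpoint [r = 0], a boundary point in the application, is
    dropped from the interval first. *)
Lemma line_image_le (A : set R) (g : R -> R) (b c h : R) : c != 0 ->
  measurable (A : set mR) -> measurable_fun [set: mR] g ->
  (forall r, 0 < r <= h -> A (b + c * r)) ->
  (`|c|%:E * \int[leb]_(r in `[0%R, h]) (g (b + c * r)%R ^+ 2)%:E <=
   \int[leb]_(s in A) (g s ^+ 2)%:E)%E.
Proof.
move=> c0 mA mg HA.
have ms : measurable_fun [set: mR] (fun s => (g s ^+ 2)%:E) by exact: measurable_sqr.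
have mphi := measurable_affine b c.
have mgphi : measurable_fun [set: mR] (fun r => (g (b + c * r)%R ^+ 2)%:E).
  exact: (measurableT_comp ms mphi).
rewrite (@ge0_integral_affine R b c c0 A _ mA (measurable_funTS ms) (fun s _ => sqr_ge0E _)).
apply: lee_wpmul2l; first by rewrite lee_fin.
rewrite -integral_itv_obnd_cbnd; last exact: measurable_funTS.
apply: ge0_subset_integral.
- exact: measurable_itv.
- by have := mphi measurableT A mA; rewrite setTI.
- exact: measurable_funTS.
- by move=> r _; exact: sqr_ge0E.
- by move=> r /=; rewrite in_itv/=; exact: HA.
Qed.

Variables (Omega : set (R * R)) (H : R * R -> R).
Hypothesis oOmega : open Omega.
Hypothesis cH : continuous H.

(** Coordinate lines are parametrised without the flip, which reappears as the sign [sgn] of the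
    slope in the affine substitution. *)
Definition fibre (swap : bool) (t : R) : set R := [set s | Omega (unorient swap false t s)].
Definition fibre_int (swap : bool) (t : R) : \bar R :=
  (\int[leb]_(s in fibre swap t) (H (unorient swap false t s) ^+ 2)%:E)%E.

Lemma fibre_measurable swap t : measurable (fibre swap t : set mR).
Proof. by case: swap; apply: open_measurable; [exact: open_row|exact: open_column]. Qed.

Lemma domain_fibre swap :
  (\int[@leb2 R]_(q in Omega) (H q ^+ 2)%:E = \int[leb]_t fibre_int swap t)%E /\
  measurable_fun [set: mR] (fibre_int swap).
Proof.
have mH := measurable_sqr2 cH; have mO : measurable (Omega : set mR2) by exact: open_measurable2.
case: swap; split.
- exact: (leb2_section21 mO mH (fun q => sqr_ge0E (H q))).
- exact: (measurable_section21 mO mH (fun q => sqr_ge0E (H q))).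
- exact: (leb2_section12 mO mH (fun q => sqr_ge0E (H q))).
- exact: (measurable_section12 mO mH (fun q => sqr_ge0E (H q))).
Qed.

Variables (swap flip : bool) (psi : R -> R) (a b k h : R).
Hypothesis k0 : 0 < k.
Hypothesis cpsi : continuous psi.
Hypothesis inO : forall t r, a <= t <= b -> 0 < r <= h ->
  Omega (unorient swap flip t (psi t + k * r)).

Let sgn : R := if flip then -1 else 1.

Lemma unorient_sign t s : unorient swap flip t s = unorient swap false t (sgn * s).
Proof. by rewrite /unorient /sgn; case: flip; rewrite ?mulN1r ?mul1r. Qed.

Lemma chart_continuous : continuous (fun p : R * R => unorient swap flip p.1 (psi p.1 + k * p.2)).
Proof.
apply: continuous_unorient => p; first exact: cvg_fst.
apply: cvgD; last by apply: cvgMr; exact: cvg_snd.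
by apply: (@continuous_comp _ _ _ fst psi); [exact: cvg_fst|exact: cpsi].
Qed.

(** The chart is a shear with Jacobian [k] up to sign; by Tonelli's theorem it is enough to
    substitute on each line of constant [t], where the map is affine in [r]. *)
Lemma chart_int_le :
  (k%:E * \int[@leb2 R]_(p in `[a, b] `*` `[0%R, h])
     (H (unorient swap flip p.1 (psi p.1 + k * p.2)%R) ^+ 2)%:E <=
   \int[@leb2 R]_(q in Omega) (H q ^+ 2)%:E)%E.
Proof.
have [E mfib] := domain_fibre swap; rewrite E.
have mab : measurable (`[a, b]%classic : set mR) by exact: measurable_itv.
have mI : measurable (`[0, h]%classic : set mR) by exact: measurable_itv.
have k0E : (0 <= k%:E)%E by rewrite lee_fin ltW.
have cHc : continuous (fun p : R * R => H (unorient swap flip p.1 (psi p.1 + k * p.2))).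
  move=> p; apply: (@continuous_comp _ _ _
    (fun p : R * R => unorient swap flip p.1 (psi p.1 + k * p.2)) H); last exact: cH.
  exact: chart_continuous.
have mHc := measurable_sqr2 cHc.
have Hc0 p := sqr_ge0E (H (unorient swap flip p.1 (psi p.1 + k * p.2))).
have mpart := plane_measurable12 mI mHc Hc0.
rewrite (plane_Tonelli12 mab mI mHc Hc0).
have part0 x : (0 <= \int[leb]_(y in `[0%R, h])
    (H (unorient swap flip (x, y).1 (psi (x, y).1 + k * (x, y).2)%R) ^+ 2)%:E)%E.
  by apply: integral_ge0 => y _; exact: sqr_ge0E.
rewrite -(ge0_integralZl leb mab (measurable_funTS mpart) (fun x _ => part0 x) k0E).
have fib0 t : (0 <= fibre_int swap t)%E by apply: integral_ge0 => s _; exact: sqr_ge0E.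
apply: (@le_trans _ _ (\int[leb]_(t in `[a, b]) fibre_int swap t)%E); last first.
  by apply: ge0_subset_integral.
apply: ge0_le_integral.
- exact: mab.
- by move=> t _; exact: (mule_ge0 k0E (part0 t)).
- exact: (measurable_funeM _ (measurable_funTS mpart)).
- exact: measurable_funTS.
move=> t /=; rewrite in_itv/= => tab.
have c0 : sgn * k != 0 by rewrite /sgn; case: flip; rewrite ?mulN1r ?mul1r ?oppr_eq0 gt_eqF.
have nc : `|sgn * k| = k.
  by rewrite /sgn; case: flip; rewrite ?mulN1r ?mul1r ?normrN gtr0_norm.
have cu : continuous (fun s => unorient swap false t s).
  by apply: continuous_unorient => s; [exact: cvg_cst|exact: cvg_id].
have mg : measurable_fun [set: mR] (fun s => H (unorient swap false t s)).
  apply: cont_measurable1 => s; apply: (@continuous_comp _ _ _ (unorient swap false t) H).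
    exact: cu.
  exact: cH.
have aff s : sgn * (psi t + k * s) = sgn * psi t + sgn * k * s by rewrite mulrDr mulrA.
have HA r : 0 < r <= h -> fibre swap t (sgn * psi t + sgn * k * r).
  by move=> rh; have := inO tab rh; rewrite unorient_sign aff.
have := line_image_le c0 (fibre_measurable swap t) mg HA; rewrite nc.
move/(le_trans _); apply; apply: ereal_eq_le; apply: (f_equal (fun X => k%:E * X)%E).
by apply: eq_integral => s _; rewrite unorient_sign aff.
Qed.

End Fibres.

Section ChartBounds.
Context (R : realType).
Local Notation pt := (R * R * R)%type.
Local Notation leb := (@lebesgue_measure R).
Local Notation mu := (@leb3 R).
Local Notation mR := (measurableTypeR R).
Local Notation mR2 := (mR * mR)%type.
Local Notation mpt := (mR * mR * mR)%type.
Local Notation ez := (@ez R).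
Variables (Omega : set (R * R)) (h : R).
Hypothesis oOmega : open Omega.
Hypothesis h0 : 0 < h.
Local Notation C := (cyl Omega h).
Local Notation E2C := (E2 mu C).

Let mC : measurable (C : set mpt) := measurable_cyl h oOmega.
Let mOm : measurable (Omega : set mR2) := measurable_domain oOmega.
Let mI : measurable (`[0, h]%classic : set mR). Proof. exact: measurable_itv. Qed.

Variables (swap flip : bool) (psi : R -> R) (a b k : R).
Hypothesis ab : a < b.
Hypothesis k0 : 0 < k.
Hypothesis cpsi : continuous psi.
Hypothesis inO : forall t r, a <= t <= b -> 0 < r <= h ->
  Omega (unorient swap flip t (psi t + k * r)).

Let mab : measurable (`[a, b]%classic : set mR). Proof. exact: measurable_itv. Qed.
Let k0E : (0 <= k%:E)%E. Proof. by rewrite lee_fin ltW. Qed.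

Definition chart (t r : R) : R * R := unorient swap flip t (psi t + k * r).

(** Derivative of the chart in the depth [r], lifted to space. It is constant: the depth lines are
    straight. *)
Definition chart_dir : pt := (k *: unorient swap flip 0 1, 0).

Lemma chart_line t r z : (chart t 0, z) + r *: chart_dir = (chart t r, z).
Proof.
rewrite /chart /chart_dir mulr0 addr0 unorient_add mulrC -scalerA.
rewrite -[r *: (_, _)]/(r *: (k *: unorient swap flip 0 1), r *: 0).
by rewrite -[LHS]/(_ + _, z + r *: 0) scaler0 addr0.
Qed.

Section fixf.
Variable f : pt -> R.
Hypothesis cf : continuous f.

Let G3 (p : pt) : R := f (chart p.1.1 p.1.2, p.2).

Let cG3 : continuous G3.
Proof.
move=> p; apply: (@continuous_comp _ _ _ (fun p : pt => (chart p.1.1 p.1.2, p.2)) f); last exact: cf.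
apply: (cvg_pair (F := nbhs p) (G := nbhs (chart p.1.1 p.1.2)) (H := nbhs p.2)); last exact: cvg_snd.
apply: (@continuous_comp _ _ _ (fun p : pt => p.1) (fun p : R * R => chart p.1 p.2)).
  exact: cvg_fst.
exact: (@chart_continuous R swap flip psi k cpsi).
Qed.

Let m3 := measurable_sqr3 cG3.
Let G30 p := sqr_ge0E (G3 p).

(** Integral over the section of the cylinder transverse to the boundary at [t], in the coordinates
    depth and height; [gagliardo_curve] is applied in one such section. *)
Definition slab (t : R) : \bar R :=
  (\int[@leb2 R]_(p in square h) (f (chart t p.1, p.2) ^+ 2)%:E)%E.

Let slice_cont t : continuous (fun p : R * R => f (chart t p.1, p.2)).
Proof.
move=> p; apply: (@continuous_comp _ _ _ (fun p : R * R => ((t, p.1), p.2)) G3); last exact: cG3.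
apply: (cvg_pair (F := nbhs p) (G := nbhs (t, p.1)) (H := nbhs p.2)); last exact: cvg_snd.
apply: (cvg_pair (F := nbhs p) (G := nbhs t) (H := nbhs p.1)); first exact: cvg_cst.
exact: cvg_fst.
Qed.

Let K (q : mR2) : \bar R := (\int[leb]_(z in `[0%R, h]) (G3 (q, z) ^+ 2)%:E)%E.

Let mK : measurable_fun [set: mR2] K.
Proof. exact: (measurable_partial12 mI m3 G30). Qed.

Let K0 q : (0 <= K q)%E. Proof. by apply: integral_ge0 => z _; exact: G30. Qed.

Lemma slab12 t : slab t = (\int[leb]_(r in `[0%R, h]) \int[leb]_(z in `[0%R, h])
  (f (chart t r, z) ^+ 2)%:E)%E.
Proof. exact: (plane_Tonelli12 mI mI (measurable_sqr2 (@slice_cont t)) (fun p => sqr_ge0E _)). Qed.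

Lemma slab21 t : slab t = (\int[leb]_(z in `[0%R, h]) \int[leb]_(r in `[0%R, h])
  (f (chart t r, z) ^+ 2)%:E)%E.
Proof. exact: (plane_Tonelli21 mI mI (measurable_sqr2 (@slice_cont t)) (fun p => sqr_ge0E _)). Qed.

Lemma slab_ge0 t : (0 <= slab t)%E.
Proof. by apply: integral_ge0 => p _; exact: sqr_ge0E. Qed.

Lemma measurable_slab : measurable_fun [set: mR] slab.
Proof.
rewrite (_ : slab = fun t => \int[leb]_(r in `[0%R, h]) K (t, r))%E.
  exact: (plane_measurable12 mI mK K0).
by apply/funext => t; rewrite slab12.
Qed.

Lemma slab_col_measurable t :
  measurable_fun [set: mR] (fun z => \int[leb]_(r in `[0%R, h]) (f (chart t r, z) ^+ 2)%:E)%E.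
Proof.
have m := measurable_section21 (measurableX mI measurableT) (measurable_sqr2 (@slice_cont t))
  (fun p => sqr_ge0E _).
move: m; congr measurable_fun; apply/funext => z.
by congr (integral _ _ _); apply/seteqP; split => r //= [].
Qed.

Lemma slab_le : (k%:E * \int[leb]_(t in `[a, b]) slab t <= E2C f)%E.
Proof.
have -> : (\int[leb]_(t in `[a, b]) slab t =
    \int[leb]_(z in `[0%R, h]) \int[@leb2 R]_(q in `[a, b] `*` `[0%R, h]) (G3 (q, z) ^+ 2)%:E)%E.
  rewrite -(prod_Tonelli21 (measurableX mab mI) mI m3 G30).
  rewrite (prod_Tonelli12 (measurableX mab mI) mI m3 G30).
  rewrite (plane_Tonelli12 mab mI mK K0).
  by apply: eq_integral => t _; rewrite slab12.
have mp := measurable_partial21 (measurableX mab mI) m3 G30.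
have p0 z : (0 <= \int[@leb2 R]_(q in `[a, b] `*` `[0%R, h]) (G3 (q, z) ^+ 2)%:E)%E.
  by apply: integral_ge0 => q _; exact: G30.
rewrite -(ge0_integralZl leb mI (measurable_funTS mp) (fun z _ => p0 z) k0E).
rewrite (E2_cyl21 h oOmega cf).
apply: ge0_le_integral.
- exact: mI.
- by move=> z _; exact: (mule_ge0 k0E (p0 z)).
- exact: (measurable_funeM _ (measurable_funTS mp)).
- exact: (measurable_funTS (measurable_partial21 mOm (measurable_sqr3 cf) (fun p => sqr_ge0E _))).
move=> z _.
exact: (chart_int_le oOmega (continuous_slice (z := z) cf) k0 cpsi inO).
Qed.

End fixf.

Variable w : pt -> R.
Hypothesis sw : smooth w.

Let cw : continuous w := smooth_cont sw.
Let cD (v : pt) : continuous ('D_v w).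
Proof. by apply: smooth_cont; exact: smooth_derive. Qed.

(** [end_trace_1d] along the depth lines, integrated over the chart; [k] is the Jacobian. *)
Lemma lateral_trace_le :
  (k%:E * (h%:E * \int[@leb2 R]_(s in `[a, b] `*` `[0%R, h]) (w (chart s.1 0, s.2) ^+ 2)%:E) <=
   2%:E * E2C w + (2 * h ^+ 2)%:E * E2C ('D_chart_dir w))%E.
Proof.
have h0E : (0 <= h%:E)%E by rewrite lee_fin ltW.
have t0 : (0 <= 2%:E :> \bar R)%E by rewrite lee_fin.
have th0 : (0 <= (2 * h ^+ 2)%:E)%E by rewrite lee_fin mulr_ge0// sqr_ge0.
have cE : continuous (fun s : R * R => w (chart s.1 0, s.2)).
  move=> p; apply: (@continuous_comp _ _ _ (fun p : R * R => (chart p.1 0, p.2)) w); last exact: cw.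
  apply: (cvg_pair (F := nbhs p) (G := nbhs (chart p.1 0)) (H := nbhs p.2)); last exact: cvg_snd.
  apply: (@continuous_comp _ _ _ (fun p : R * R => (p.1, 0)) (fun p : R * R => chart p.1 p.2)).
    apply: (cvg_pair (F := nbhs p) (G := nbhs p.1) (H := nbhs 0)); [exact: cvg_fst|exact: cvg_cst].
  exact: (@chart_continuous R swap flip psi k cpsi).
have mE := measurable_sqr2 cE.
have E0 p := sqr_ge0E (w (chart p.1 0, p.2)).
have mEp := plane_measurable12 mI mE E0.
rewrite (plane_Tonelli12 mab mI mE E0).
have Ep0 t : (0 <= \int[leb]_(y in `[0%R, h]) (w (chart (t, y).1 0, (t, y).2) ^+ 2)%:E)%E.
  by apply: integral_ge0 => z _; exact: sqr_ge0E.
have Lw := slab_le cw; have LD := slab_le (@cD chart_dir).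
have ms := measurable_funTS (D := `[a, b]) (measurable_slab cw).
have mD := measurable_funTS (D := `[a, b]) (measurable_slab (@cD chart_dir)).
have key : (h%:E * \int[leb]_(x in `[a, b]) \int[leb]_(y in `[0%R, h])
     (w (chart (x, y).1 0, (x, y).2) ^+ 2)%:E <=
   2%:E * \int[leb]_(t in `[a, b]) slab w t +
   (2 * h ^+ 2)%:E * \int[leb]_(t in `[a, b]) slab ('D_chart_dir w) t)%E.
  rewrite -(ge0_integralZl leb mab (measurable_funTS mEp) (fun t _ => Ep0 t) h0E).
  rewrite -(ge0_integralZl leb mab ms (fun t _ => slab_ge0 w t) t0).
  rewrite -(ge0_integralZl leb mab mD (fun t _ => slab_ge0 _ t) th0).
  rewrite -(ge0_integralD leb mab (fun t _ => mule_ge0 t0 (slab_ge0 w t)) (measurable_funeM _ ms)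
    (fun t _ => mule_ge0 th0 (slab_ge0 _ t)) (measurable_funeM _ mD)).
  apply: ge0_le_integral.
  - exact: mab.
  - by move=> t _; exact: (mule_ge0 h0E (Ep0 t)).
  - exact: (measurable_funeM _ (measurable_funTS mEp)).
  - exact: (emeasurable_funD (measurable_funeM _ ms) (measurable_funeM _ mD)).
  move=> t _; rewrite (slab21 cw) (slab21 (@cD chart_dir)).
  have mz (f : pt -> R) (cf : continuous f) :=
    measurable_funTS (D := `[0, h]) (slab_col_measurable cf t).
  have z0 (f : pt -> R) z : (0 <= \int[leb]_(r in `[0%R, h]) (f (chart t r, z) ^+ 2)%:E)%E.
    by apply: integral_ge0 => r _; exact: sqr_ge0E.
  have mw : measurable_fun (`[0, h]%classic : set mR) (fun z => (w (chart t 0, z) ^+ 2)%:E).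
    exact: (measurable_funTS (measurableT_comp mE (pair1_measurable t))).
  rewrite -(ge0_integralZl leb mI mw (fun z _ => sqr_ge0E _) h0E).
  rewrite -(ge0_integralZl leb mI (mz _ cw) (fun z _ => z0 w z) t0).
  rewrite -(ge0_integralZl leb mI (mz _ (@cD chart_dir)) (fun z _ => z0 _ z) th0).
  rewrite -(ge0_integralD leb mI (fun z _ => mule_ge0 t0 (z0 w z)) (measurable_funeM _ (mz _ cw))
    (fun z _ => mule_ge0 th0 (z0 _ z)) (measurable_funeM _ (mz _ (@cD chart_dir)))).
  apply: ge0_le_integral.
  - exact: mI.
  - by move=> z _; apply: mule_ge0 => //; exact: sqr_ge0E.
  - exact: (measurable_funeM _ mw).
  - exact: (emeasurable_funD (measurable_funeM _ (mz _ cw)) (measurable_funeM _ (mz _ (@cD chart_dir)))).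
  move=> z _.
  have cg : continuous (fun s : R => 'D_chart_dir w ((chart t 0, z) + s *: chart_dir)).
    exact: (@continuous_line _ _ ('D_chart_dir w) (chart t 0, z) chart_dir (@cD chart_dir)).
  have E (f : pt -> R) : (\int[leb]_(s in `[0%R, h]) (f ((chart t 0, z) + s *: chart_dir)%R ^+ 2)%:E =
      \int[leb]_(s in `[0%R, h]) (f (chart t s, z) ^+ 2)%:E)%E.
    by apply: eq_integral => s _; rewrite chart_line.
  have H := end_trace_1d (fun s => is_derive_line (chart t 0, z) chart_dir s sw) cg (ltW h0).
  rewrite scale0r addr0 in H; apply: (le_trans H); apply: leeD; apply: ereal_eq_le.
  - exact: (f_equal (fun X => 2%:E * X)%E (E w)).
  - exact: (f_equal (fun X => (2 * h ^+ 2)%:E * X)%E (E ('D_chart_dir w))).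
apply: (le_trans (lee_wpmul2l k0E key)).
have I0 f : (0 <= \int[leb]_(t in `[a, b]) slab f t)%E.
  by apply: integral_ge0 => t _; exact: slab_ge0.
rewrite (ge0_muleDr _ (mule_ge0 t0 (I0 w)) (mule_ge0 th0 (I0 _))) (muleCA k%:E 2%:E)
  (muleCA k%:E (2 * h ^+ 2)%:E).
by apply: leeD; apply: lee_wpmul2l.
Qed.

(** The same [c] is seen from every [t], so [gagliardo_curve] can be integrated over [t] in
    [[a, b]], which costs the factor [b - a] and turns transverse squares into a part of the
    cylinder. *)
Lemma gagliardo_chart_le (c : R -> R) :
  (forall t z, a <= t <= b -> 0 <= z <= h -> c z = w (chart t 0, z)) ->
  ((k * (b - a))%:E * gagliardo h c <=
   16%:E * (E2C ('D_(chart_dir + ez)%R w) + E2C ('D_chart_dir w)))%E.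
Proof.
move=> cE.
have s0 : (0 <= 16%:E :> \bar R)%E by rewrite lee_fin.
have g0 : (0 <= gagliardo h c)%E by apply: integral_ge0 => p _; exact: sqr_ge0E.
have m1 := measurable_funTS (D := `[a, b]) (measurable_slab (@cD (chart_dir + ez))).
have m2 := measurable_funTS (D := `[a, b]) (measurable_slab (@cD chart_dir)).
have S0 v t : (0 <= slab ('D_v w) t)%E by exact: slab_ge0.
have key : ((b - a)%:E * gagliardo h c <= 16%:E *
   (\int[leb]_(t in `[a, b]) slab ('D_(chart_dir + ez)%R w) t +
    \int[leb]_(t in `[a, b]) slab ('D_chart_dir w) t))%E.
  rewrite -(ge0_integralD leb mab (fun t _ => S0 _ t) m1 (fun t _ => S0 _ t) m2).
  rewrite -(ge0_integralZl leb mab (emeasurable_funD m1 m2)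
     (fun t _ => adde_ge0 (S0 _ t) (S0 _ t)) s0).
  have -> : ((b - a)%:E * gagliardo h c = \int[leb]_(t in `[a, b]) gagliardo h c)%E.
    rewrite integral_cst; last exact: mab.
    rewrite muleC; congr (_ * _)%E; have := lebesgue_measure_itv `[a, b]; rewrite /= => ->.
    by rewrite lte_fin ab.
  apply: ge0_le_integral.
  - exact: mab.
  - by move=> t _.
  - exact: measurable_cst.
  - exact: (measurable_funeM _ (emeasurable_funD m1 m2)).
  move=> t /=; rewrite in_itv/= => tab.
  have cw' z : 0 <= z <= h -> c z = w ((chart t 0, 0) + z *: ez).
    by move=> zh; rewrite add_ez add0r; exact: cE.
  have P r z : (chart t 0, 0) + r *: chart_dir + z *: ez = (chart t r, z).
    by rewrite chart_line add_ez add0r.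
  have H := gagliardo_curve chart_dir sw cw'.
  have E v : (\int[@leb2 R]_(p in square h) ('D_v w (curve (chart t 0, 0) chart_dir p.1 p.2) ^+ 2)%:E =
      slab ('D_v w) t)%E.
    by apply: eq_integral => p _; congr ((_ ^+ 2)%:E); rewrite /curve P.
  apply: (le_trans H); apply: ereal_eq_le.
  exact: (f_equal2 (fun X Y => 16%:E * (X + Y))%E (E _) (E _)).
have I0 f : (0 <= \int[leb]_(t in `[a, b]) slab f t)%E.
  by apply: integral_ge0 => t _; exact: slab_ge0.
rewrite EFinM -muleA; apply: (le_trans (lee_wpmul2l k0E key)).
rewrite muleCA; apply: lee_wpmul2l => //.
rewrite (ge0_muleDr _ (I0 _) (I0 _)).
by apply: leeD; exact: slab_le.
Qed.

End ChartBounds.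

(** * The energy space *)

Section IntegralSums.
Context d (T : measurableType d) (R : realType) (mu : {measure set T -> \bar R}).
Variables (D : set T) (mD : measurable D).

Lemma Rintegral_sum3 (a1 a2 b1 b2 c1 c2 : T -> R) : L2 mu D a1 -> L2 mu D a2 ->
  L2 mu D b1 -> L2 mu D b2 -> L2 mu D c1 -> L2 mu D c2 ->
  \int[mu]_(x in D) (a1 x * a2 x + b1 x * b2 x + c1 x * c2 x) =
  ip mu D a1 a2 + ip mu D b1 b2 + ip mu D c1 c2.
Proof.
move=> La1 La2 Lb1 Lb2 Lc1 Lc2.
have Ia := L2_integrable_mul mD La1 La2; have Ib := L2_integrable_mul mD Lb1 Lb2.
have Ic := L2_integrable_mul mD Lc1 Lc2.
rewrite /ip -(RintegralD mD Ia Ib).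
have Iab : mu.-integrable D (fun x => (a1 x * a2 x + b1 x * b2 x)%:E).
  exact: (integrableD mD Ia Ib).
exact: (RintegralD mD Iab Ic).
Qed.

Lemma ip_le_weight (m : R) (f g : T -> R) : L2 mu D f -> L2 mu D g ->
  (forall x, D x -> m * (f x * f x) <= g x * f x) -> m * ip mu D f f <= ip mu D g f.
Proof.
move=> Lf Lg H; rewrite -(ipZl mD m Lf Lf) /ip.
apply: le_Rintegral; [exact: mD| | |].
- exact: (L2_integrable_mul mD (L2Z mD m Lf) Lf).
- exact: (L2_integrable_mul mD Lg Lf).
by move=> x Dx; rewrite -mulrA; exact: H.
Qed.

Lemma ip_ge_weight (m : R) (f g : T -> R) : L2 mu D f -> L2 mu D g ->
  (forall x, D x -> g x * f x <= m * (f x * f x)) -> ip mu D g f <= m * ip mu D f f.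
Proof.
move=> Lf Lg H; rewrite -(ipZl mD m Lf Lf) /ip.
apply: le_Rintegral; [exact: mD| | |].
- exact: (L2_integrable_mul mD Lg Lf).
- exact: (L2_integrable_mul mD (L2Z mD m Lf) Lf).
by move=> x Dx; rewrite -mulrA; exact: H.
Qed.

Lemma L2norm_sqr (f : T -> R) : L2 mu D f -> L2norm mu D f ^+ 2 = ip mu D f f.
Proof. by move=> Lf; have := E2_L2norm mD Lf; rewrite (E2_ip mD Lf) => -[]. Qed.

Lemma L2norm_ae (f g : T -> R) : L2 mu D f -> L2 mu D g -> ae_eq mu D f g ->
  L2norm mu D f = L2norm mu D g.
Proof.
move=> Lf Lg fg; have gf := ae_eq_sym fg.
have : L2norm mu D f ^+ 2 = L2norm mu D g ^+ 2.
  rewrite (L2norm_sqr Lf) (L2norm_sqr Lg) (ip_ae mD Lf.1 Lg.1 Lf.1 fg).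
  by rewrite ipC (ip_ae mD Lf.1 Lg.1 Lg.1 fg).
by move/eqP; rewrite eqrXn2// ?L2norm_ge0// => /eqP.
Qed.

Lemma L2norm_Z (a : R) (f : T -> R) : L2 mu D f ->
  L2norm mu D (fun x => a * f x) = `|a| * L2norm mu D f.
Proof.
move=> Lf; have Lg := L2Z mD a Lf.
apply/eqP; rewrite -(@eqrXn2 _ 2)// ?mulr_ge0// ?L2norm_ge0//.
rewrite exprMn real_normK ?num_real// (L2norm_sqr Lg) (L2norm_sqr Lf).
by rewrite (ipZl mD a Lf Lg) (ipZr mD a Lf Lf) mulrA expr2.
Qed.

Lemma L2norm0 : L2norm mu D (fun=> 0) = 0.
Proof.
have L0 := @L2_cst0 _ T R mu D.
by apply/eqP; rewrite -sqrf_eq0 (L2norm_sqr L0) ip0l.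
Qed.

End IntegralSums.

Section Energy.
Context (R : realType).
Local Notation mR := (measurableTypeR R).
Local Notation mpt := (mR * mR * mR)%type.
Local Notation mu := (@leb3 R).
Local Notation ex := (@ex R).
Local Notation ey := (@ey R).
Local Notation ez := (@ez R).
Variables (Omega : set (R * R)) (h : R) (lambda : R -> R) (Lam : R).
Hypothesis oOmega : open Omega.
Hypothesis bOmega : bounded_set Omega.
Hypothesis h0 : 0 < h.
Hypothesis clambda : continuous lambda.
Hypothesis Lam0 : 0 < Lam.
Hypothesis lambda_bounds : forall z, 0 <= z <= h -> Lam^-1 <= lambda z <= Lam.
Local Notation C := (cyl Omega h).
Local Notation ipU := (@ip _ _ R mu C).
Local Notation L2C := (L2 mu C).
Local Notation N := (L2norm mu C).
Local Notation D := (wder Omega h).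
Local Notation H1C := (H1 Omega h).
Local Notation dot := (dotH Omega h lambda).
Local Notation nH := (normH Omega h lambda).
Let mC : measurable (C : set mpt) := measurable_cyl h oOmega.

Lemma lambda_cyl p : C p -> Lam^-1 <= lambda p.2 <= Lam.
Proof. by move=> [_ /=]; rewrite in_itv/=; exact: lambda_bounds. Qed.

Lemma lambda_mul_L2 f : L2C f -> L2C (fun p => lambda p.2 * f p).
Proof.
apply: (@L2_bounded_mul _ _ R mu C mC Lam) => [|p /lambda_cyl/andP[l1 l2]].
  apply: measurable_funTS; apply: continuous_measurable3 => p.
  by apply: (@continuous_comp _ _ _ snd lambda); [exact: cvg_snd|exact: clambda].
by rewrite ger0_norm// (le_trans _ l1)// invr_ge0 ltW.
Qed.

Lemma dotHE u v : H1C u -> H1C v ->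
  dot u v = ipU (D ex u) (D ex v) + ipU (D ey u) (D ey v) +
            ipU (fun p => lambda p.2 * D ez u p) (D ez v).
Proof.
move=> Hu Hv; rewrite /dotH /grad_dot.
have W e w : H1C w -> L2C (D e w) by exact: wder_L2.
exact: (Rintegral_sum3 mC (W ex u Hu) (W ex v Hv) (W ey u Hu) (W ey v Hv)
  (lambda_mul_L2 (W ez u Hu)) (W ez v Hv)).
Qed.

Lemma weighted_dotC (x1 y1 x2 y2 l x3 y3 : R) :
  x1 * y1 + x2 * y2 + l * x3 * y3 = y1 * x1 + y2 * x2 + l * y3 * x3.
Proof. ring. Qed.

Lemma dotHC u v : dot u v = dot v u.
Proof. by apply: eq_Rintegral => p _; exact: weighted_dotC. Qed.

Lemma dotH_arith (a x1 y1 x2 y2 x3 y3 s1 s2 s3 : R) :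
  s1 = a * x1 + y1 -> s2 = a * x2 + y2 -> s3 = a * x3 + y3 ->
  s1 + s2 + s3 = a * (x1 + x2 + x3) + (y1 + y2 + y3).
Proof. by move=> -> -> ->; ring. Qed.

Lemma dotH_lin (a : R) u v w : H1C u -> H1C v -> H1C w ->
  dot (a *: u + v) w = a * dot u w + dot v w.
Proof.
move=> Hu Hv Hw.
have W e w' : H1C w' -> L2C (D e w') by exact: wder_L2.
have Hs : H1C (fun p => a * u p + v p) by exact: H1_lincomb.
have E e : ipU (D e (fun p => a * u p + v p)) (D e w) =
    a * ipU (D e u) (D e w) + ipU (D e v) (D e w).
  rewrite -(ip_linl mC a (W e u Hu) (W e v Hv) (W e w Hw)).
  apply: (ip_ae mC (W e _ Hs).1 _ (W e w Hw).1); first exact: (L2_lincomb mC a (W e u Hu) (W e v Hv)).1.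
  exact: wder_lincomb.
have El : ipU (fun p => lambda p.2 * D ez (fun p => a * u p + v p) p) (D ez w) =
    a * ipU (fun p => lambda p.2 * D ez u p) (D ez w) + ipU (fun p => lambda p.2 * D ez v p) (D ez w).
  have Lu := lambda_mul_L2 (W ez u Hu); have Lv := lambda_mul_L2 (W ez v Hv).
  rewrite -(ip_linl mC a Lu Lv (W ez w Hw)).
  apply: (ip_ae mC (lambda_mul_L2 (W ez _ Hs)).1 (L2_lincomb mC a Lu Lv).1 (W ez w Hw).1).
  have := wder_lincomb oOmega bOmega ez a Hu Hv; apply: filterS => p H Cp.
  by rewrite (H Cp) mulrDr mulrCA.
rewrite (dotHE Hs Hw) (dotHE Hu Hw) (dotHE Hv Hw).
exact: (dotH_arith (E ex) (E ey) El).
Qed.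

Let grad_lower u : H1C u -> Lam^-1 * ipU (D ez u) (D ez u) <= ipU (fun p => lambda p.2 * D ez u p) (D ez u).
Proof.
move=> Hu; have W := wder_L2 ez Hu.
apply: (ip_le_weight mC W (lambda_mul_L2 W)) => p /lambda_cyl/andP[l1 _].
by rewrite -mulrA; apply: ler_wpM2r => //; rewrite -expr2 sqr_ge0.
Qed.

Let grad_upper u : H1C u -> ipU (fun p => lambda p.2 * D ez u p) (D ez u) <= Lam * ipU (D ez u) (D ez u).
Proof.
move=> Hu; have W := wder_L2 ez Hu.
apply: (ip_ge_weight mC W (lambda_mul_L2 W)) => p /lambda_cyl/andP[_ l1].
by rewrite -mulrA; apply: ler_wpM2r => //; rewrite -expr2 sqr_ge0.
Qed.

Let weighted_ge0 u : H1C u -> 0 <= ipU (fun p => lambda p.2 * D ez u p) (D ez u).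
Proof.
move=> Hu; apply: le_trans (grad_lower Hu).
by apply: mulr_ge0; [rewrite invr_ge0 ltW|exact: ip_ge0].
Qed.

Lemma dotH_ge0 u : H1C u -> 0 <= dot u u.
Proof.
move=> Hu; rewrite (dotHE Hu Hu).
by apply: addr_ge0; [apply: addr_ge0; exact: ip_ge0|exact: weighted_ge0].
Qed.

Lemma energy_arith (x y z m d d' L n1 n2 n3 : R) : d' = d -> 0 < L -> 0 <= x -> 0 <= y -> 0 <= z ->
  L^-1 * z <= m -> m <= L * z -> d = x + y + m -> n1 = x -> n2 = y -> n3 = z ->
  [/\ n1 <= d', n2 <= d', n3 <= L * d' & d' <= n1 + n2 + L * n3].
Proof.
move=> -> L0 x0 y0 z0 zm mz -> -> -> ->.
have m0 : 0 <= m by apply: le_trans zm; rewrite mulr_ge0// invr_ge0 ltW.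
split; [lra|lra| |lra].
have : z <= L * m by rewrite -ler_pdivrMl.
move=> /le_trans; apply; rewrite ler_pM2l//; lra.
Qed.

(** The two bounds on [lambda] make the energy equivalent to the L^2 norm of the gradient. *)
Lemma energy_bounds u : H1C u ->
  [/\ N (D ex u) ^+ 2 <= nH u ^+ 2, N (D ey u) ^+ 2 <= nH u ^+ 2,
      N (D ez u) ^+ 2 <= Lam * nH u ^+ 2 &
      nH u ^+ 2 <= N (D ex u) ^+ 2 + N (D ey u) ^+ 2 + Lam * N (D ez u) ^+ 2].
Proof.
move=> Hu.
have W e : L2C (D e u) by exact: wder_L2.
have E e : N (D e u) ^+ 2 = ipU (D e u) (D e u).
  exact: (L2norm_sqr mC (W e)).
have Es : nH u ^+ 2 = dot u u := sqr_sqrtr (dotH_ge0 Hu).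
exact: (energy_arith Es Lam0 (ip_ge0 _ _ _) (ip_ge0 _ _ _) (ip_ge0 _ _ _) (grad_lower Hu)
  (grad_upper Hu) (dotHE Hu Hu) (E ex) (E ey) (E ez)).
Qed.

End Energy.

Section SquareComparison.
Context (R : realType).

Lemma le_of_sqr (a b : R) : 0 <= b -> a ^+ 2 <= b ^+ 2 -> a <= b.
Proof.
move=> b0 ab; have [//|ba] := leP a b.
have := mulr_gt0 (le_lt_trans b0 ba) (le_lt_trans b0 ba); nra.
Qed.

(** [1 + L] stands in for the square root of [L]; constants such as [1 + Lam] below originate
    here. *)
Lemma le_of_sqr_scale (a b L : R) : 0 <= L -> 0 <= b -> a ^+ 2 <= L * b ^+ 2 -> a <= (1 + L) * b.
Proof.
move=> L0 b0 ab; apply: le_of_sqr; first by rewrite mulr_ge0// addr_ge0.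
apply: (le_trans ab); rewrite exprMn; apply: ler_wpM2r; first exact: sqr_ge0.
by rewrite sqrrD expr1n mul1r; have := sqr_ge0 L; lra.
Qed.

Lemma sqr_sum_le (x y z n L : R) : 0 <= L -> 0 <= x -> 0 <= y -> 0 <= z ->
  n ^+ 2 <= x ^+ 2 + y ^+ 2 + L * z ^+ 2 -> n <= x + y + (1 + L) * z.
Proof.
move=> L0 x0 y0 z0 b; apply: le_of_sqr.
  by rewrite !addr_ge0// mulr_ge0// addr_ge0.
apply: (le_trans b).
have := mulr_ge0 x0 y0; have := mulr_ge0 x0 z0; have := mulr_ge0 y0 z0.
have := mulr_ge0 L0 (sqr_ge0 z); have := sqr_ge0 (L * z); have := mulr_ge0 L0 (mulr_ge0 x0 z0).
have := mulr_ge0 L0 (mulr_ge0 y0 z0); have := sqr_ge0 z; nra.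
Qed.

End SquareComparison.

Section EnergyNorm.
Context (R : realType).
Local Notation pt := (R * R * R)%type.
Local Notation mR := (measurableTypeR R).
Local Notation mpt := (mR * mR * mR)%type.
Local Notation mu := (@leb3 R).
Local Notation ex := (@ex R).
Local Notation ey := (@ey R).
Local Notation ez := (@ez R).
Variables (Omega : set (R * R)) (h : R) (lambda : R -> R) (Lam : R).
Hypothesis oOmega : open Omega.
Hypothesis bOmega : bounded_set Omega.
Hypothesis h0 : 0 < h.
Hypothesis clambda : continuous lambda.
Hypothesis Lam0 : 0 < Lam.
Hypothesis lambda_bounds : forall z, 0 <= z <= h -> Lam^-1 <= lambda z <= Lam.
Local Notation C := (cyl Omega h).
Local Notation L2C := (L2 mu C).
Local Notation N := (L2norm mu C).
Local Notation D := (wder Omega h).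
Local Notation H1C := (H1 Omega h).
Local Notation dot := (dotH Omega h lambda).
Local Notation nH := (normH Omega h lambda).
Let mC : measurable (C : set mpt) := measurable_cyl h oOmega.

Let Slin (a : R) (u v : pt -> R) : H1C u -> H1C v -> H1C (a *: u + v).
Proof. exact: H1_lincomb. Qed.

Let Bsym (u v : pt -> R) : H1C u -> H1C v -> dot u v = dot v u.
Proof. by move=> _ _; exact: dotHC. Qed.

Let Blin (a : R) (u v w : pt -> R) : H1C u -> H1C v -> H1C w ->
  dot (a *: u + v) w = a * dot u w + dot v w.
Proof. exact: (dotH_lin oOmega bOmega clambda Lam0 lambda_bounds). Qed.

Let Bge0 (u : pt -> R) : H1C u -> 0 <= dot u u.
Proof. exact: (dotH_ge0 oOmega clambda Lam0 lambda_bounds). Qed.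

Lemma H1_cst (k : R) : H1C (fun=> k).
Proof. by apply: H1_smooth => //; exact: smooth_cst. Qed.

Let S0 : H1C 0.
Proof. exact: (H1_cst 0). Qed.

Lemma dotH_cauchy_schwarz (u v : pt -> R) : H1C u -> H1C v -> `|dot u v| <= nH u * nH v.
Proof. exact: (cauchy_schwarz Slin Bsym Blin Bge0). Qed.

Lemma normH_triangle (u v : pt -> R) : H1C u -> H1C v -> nH (u \+ v) <= nH u + nH v.
Proof. exact: (nrm_triangle Slin Bsym Blin Bge0). Qed.

Lemma normHBC (u v : pt -> R) : H1C u -> H1C v -> nH (u \- v) = nH (v \- u).
Proof. exact: (nrmBC S0 Slin Bsym Blin). Qed.

Lemma normHZ (a : R) (u : pt -> R) : H1C u -> nH (fun p => a * u p) = `|a| * nH u.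
Proof. exact: (nrmZ S0 Slin Bsym Blin). Qed.

Lemma dotHB (u v w : pt -> R) : H1C u -> H1C v -> H1C w ->
  dot (u \- v) w = dot u w - dot v w.
Proof. move=> Hu Hv Hw; exact: (linB Blin Hu Hv Hw). Qed.

Lemma normH_ge0 (u : pt -> R) : 0 <= nH u.
Proof. exact: sqrtr_ge0. Qed.

Lemma normH_sqr (u : pt -> R) : H1C u -> nH u ^+ 2 = dot u u.
Proof. by move=> Hu; exact: (sqr_sqrtr (Bge0 Hu)). Qed.

Lemma wder_le_normH (v : pt) : exists2 K : R, 0 <= K &
  forall u, H1C u -> N (D v u) <= K * nH u.
Proof.
pose K1 : R := 1 + Lam; exists (`|v.1.1| + (`|v.1.2| + `|v.2| * K1)).
  by rewrite !addr_ge0// mulr_ge0// addr_ge0// ltW.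
move=> u Hu.
have W e : L2C (D e u) by exact: wder_L2.
have [b1 b2 b3 _] := energy_bounds oOmega clambda Lam0 lambda_bounds Hu.
have n0 := normH_ge0 u.
have c1 : N (D ex u) <= nH u by exact: (le_of_sqr n0 b1).
have c2 : N (D ey u) <= nH u by exact: (le_of_sqr n0 b2).
have c3 : N (D ez u) <= K1 * nH u by exact: (le_of_sqr_scale (ltW Lam0) n0 b3).
have L1 := L2Z mC v.1.1 (W ex); have L2' := L2Z mC v.1.2 (W ey).
have L3 := L2Z mC v.2 (W ez).
have dec := wder_decomp oOmega bOmega v Hu.
rewrite (L2norm_ae mC (W v) (L2D mC L1 (L2D mC L2' L3)) dec).
apply: (le_trans (L2norm_triangle mC L1 (L2D mC L2' L3))).
apply: (le_trans (lerD (lexx _) (L2norm_triangle mC L2' L3))).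
rewrite !mulrDl; apply: lerD; last apply: lerD.
- by apply: (le_trans _ (ler_wpM2l (normr_ge0 v.1.1) c1)); rewrite (L2norm_Z mC v.1.1 (W ex)).
- by apply: (le_trans _ (ler_wpM2l (normr_ge0 v.1.2) c2)); rewrite (L2norm_Z mC v.1.2 (W ey)).
- rewrite -mulrA.
  by apply: (le_trans _ (ler_wpM2l (normr_ge0 v.2) c3)); rewrite (L2norm_Z mC v.2 (W ez)).
Qed.

Lemma normH_le (u : pt -> R) : H1C u ->
  nH u <= N (D ex u) + N (D ey u) + (1 + Lam) * N (D ez u).
Proof.
move=> Hu; have [_ _ _ b] := energy_bounds oOmega clambda Lam0 lambda_bounds Hu.
exact: (sqr_sum_le (ltW Lam0) (L2norm_ge0 _ _ _) (L2norm_ge0 _ _ _) (L2norm_ge0 _ _ _) b).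
Qed.

End EnergyNorm.

Section NullSequences.
Context (R : realType).
Implicit Types f g : nat -> R.

Lemma squeeze0 f g (K : R) : (forall n, 0 <= f n) -> (forall n, f n <= K * g n) ->
  g n @[n --> \oo] --> (0 : R) -> f n @[n --> \oo] --> (0 : R).
Proof.
move=> f0 fg g0; apply: (@squeeze_cvgr _ _ _ _ (fun=> 0) (fun n => K * g n)).
- by apply: nearW => n; rewrite f0 fg.
- exact: cvg_cst.
- by rewrite -[X in _ --> X](mulr0 K); apply: cvgMr.
Qed.

Lemma null_add f g : f n @[n --> \oo] --> (0 : R) -> g n @[n --> \oo] --> (0 : R) ->
  f n + g n @[n --> \oo] --> (0 : R).
Proof. by move=> f0 g0; rewrite -[X in _ --> X](addr0 0); apply: cvgD. Qed.

Lemma null_scale f (K : R) : f n @[n --> \oo] --> (0 : R) -> K * f n @[n --> \oo] --> (0 : R).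
Proof. by move=> f0; rewrite -[X in _ --> X](mulr0 K); apply: cvgMr. Qed.

Lemma le_of_null f (a b : R) : (forall n, a <= b + f n) -> f n @[n --> \oo] --> (0 : R) -> a <= b.
Proof.
move=> ab f0; rewrite -[leRHS]addr0.
have c : b + f n @[n --> \oo] --> b + 0 by apply: cvgD => //; exact: cvg_cst.
by rewrite -(cvg_lim _ c)//; apply: limr_ge; [apply/cvg_ex; exists (b + 0)|exact: nearW].
Qed.

Lemma eq_of_null f (a b : R) : (forall n, `|a - b| <= f n) -> f n @[n --> \oo] --> (0 : R) -> a = b.
Proof.
move=> ab f0; apply/eqP; rewrite -subr_eq0 -normr_le0.
by apply: (@le_of_null f) => // n; rewrite add0r.
Qed.

Lemma null_near f (e : R) : f n @[n --> \oo] --> (0 : R) -> 0 < e ->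
  exists M, forall n, (M <= n)%N -> f n <= e.
Proof.
move=> f0 e0; have /cvgrPdist_le/(_ e e0) [M _ H] := f0.
exists M => n Mn; have := H n Mn; rewrite sub0r normrN; exact: le_trans (ler_norm _).
Qed.

Lemma nullP f : (forall n, 0 <= f n) -> (forall e, 0 < e -> \forall n \near \oo, f n <= e) ->
  f n @[n --> \oo] --> (0 : R).
Proof.
move=> f0 H; apply/cvgrPdist_le => e e0; have := H e e0; apply: filterS => n.
by rewrite sub0r normrN ger0_norm.
Qed.

End NullSequences.

Section EnergySpace.
Context (R : realType).
Local Notation pt := (R * R * R)%type.
Local Notation mR := (measurableTypeR R).
Local Notation mpt := (mR * mR * mR)%type.
Local Notation mu := (@leb3 R).
Local Notation ex := (@ex R).
Local Notation ez := (@ez R).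
Variables (Omega : set (R * R)) (h : R) (lambda : R -> R) (Lam : R).
Hypothesis oOmega : open Omega.
Hypothesis bOmega : bounded_set Omega.
Hypothesis h0 : 0 < h.
Hypothesis clambda : continuous lambda.
Hypothesis Lam0 : 0 < Lam.
Hypothesis lambda_bounds : forall z, 0 <= z <= h -> Lam^-1 <= lambda z <= Lam.
Local Notation C := (cyl Omega h).
Local Notation L2C := (L2 mu C).
Local Notation N := (L2norm mu C).
Local Notation D := (wder Omega h).
Local Notation H1C := (H1 Omega h).
Local Notation nH := (normH Omega h lambda).
Local Notation pre := (preH Omega h).
Let mC : measurable (C : set mpt) := measurable_cyl h oOmega.

Definition preH_approx (al : nat -> pt -> R) (u : pt -> R) : Prop :=
  [/\ forall n, pre (al n), nH (al n \- u) @[n --> \oo] --> (0 : R) &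
      N (al n \- u) @[n --> \oo] --> (0 : R)].

Lemma preH_H1 al : pre al -> H1C al.
Proof. by move=> [sal _ _]; apply: H1_smooth. Qed.

Lemma preH_lincomb (a : R) u v : pre u -> pre v -> pre (fun p => a * u p + v p).
Proof.
move=> [su u0 [c hc]] [sv v0 [c' hc']]; split; first exact: smooth_lincomb.
- have L1 : L2C (fun=> 1) := smooth_L2 h oOmega bOmega (@smooth_cst R pt 1).
  have Lu : L2C u := smooth_L2 h oOmega bOmega su.
  have Lv : L2C v := smooth_L2 h oOmega bOmega sv.
  have I f : \int[mu]_(p in C) f p = ip mu C f (fun=> 1).
    by apply: eq_Rintegral => p _; rewrite mulr1.
  move: u0 v0; rewrite (I u) (I v) (I (fun p => a * u p + v p)) => u0 v0.
  by rewrite (ip_linl mC a Lu Lv L1) u0 v0 mulr0 addr0.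
- by exists (fun z => a * c z + c' z) => q z bq hz; rewrite hc// hc'.
Qed.

Lemma preHB u v : pre u -> pre v -> pre (u \- v).
Proof.
move=> pu pv; have := preH_lincomb (-1) pv pu; congr preH.
by apply/funext => p; rewrite mulN1r addrC.
Qed.

Lemma preH_approx_lincomb (a : R) al u be v : H1C u -> H1C v ->
  preH_approx al u -> preH_approx be v ->
  preH_approx (fun n p => a * al n p + be n p) (fun p => a * u p + v p).
Proof.
move=> Hu Hv [pal nal Nal] [pbe nbe Nbe].
have E n : (fun p => a * al n p + be n p) \- (fun p => a * u p + v p) =
    (fun p => a * (al n \- u) p) \+ (be n \- v).
  by apply/funext => p /=; rewrite mulrBr opprD addrACA.
have Hau n : H1C (al n \- u) by apply: (H1B oOmega bOmega (preH_H1 (pal n)) Hu).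
have Hbv n : H1C (be n \- v) by apply: (H1B oOmega bOmega (preH_H1 (pbe n)) Hv).
have Haau n : H1C (fun p => a * (al n \- u) p).
  have := H1_lincomb oOmega bOmega a (Hau n) (H1_cst h oOmega bOmega 0).
  by congr (H1 _ _ _); apply/funext => p; rewrite addr0.
split.
- by move=> n; exact: preH_lincomb.
- apply: (@squeeze0 _ _ (fun n => `|a| * nH (al n \- u) + nH (be n \- v)) 1).
  + by move=> n; exact: normH_ge0.
  + move=> n; rewrite mul1r E.
    rewrite -(normHZ oOmega bOmega clambda Lam0 lambda_bounds a (Hau n)).
    exact: (normH_triangle oOmega bOmega clambda Lam0 lambda_bounds (Haau n) (Hbv n)).
  + exact: (null_add (null_scale _ nal) nbe).
- apply: (@squeeze0 _ _ (fun n => `|a| * N (al n \- u) + N (be n \- v)) 1).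
  + by move=> n; exact: L2norm_ge0.
  + move=> n; rewrite mul1r E -(L2norm_Z mC a (H1_L2 (Hau n))).
    exact: (L2norm_triangle mC (H1_L2 (Haau n)) (H1_L2 (Hbv n))).
  + exact: (null_add (null_scale _ Nal) Nbe).
Qed.

Lemma HH_lincomb (a : R) u v : HH Omega h lambda u -> HH Omega h lambda v ->
  HH Omega h lambda (fun p => a * u p + v p).
Proof.
move=> [Hu [al al_u]] [Hv [be be_v]]; split; first exact: (H1_lincomb oOmega bOmega a Hu Hv).
by exists (fun n p => a * al n p + be n p); apply: preH_approx_lincomb.
Qed.

Lemma HHB u v : HH Omega h lambda u -> HH Omega h lambda v -> HH Omega h lambda (u \- v).
Proof.
move=> pu pv; have := HH_lincomb (-1) pv pu; congr HH.
by apply/funext => p; rewrite mulN1r addrC.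
Qed.

(** [HH] is defined by limits in energy, traces by convergence of the derivative in every direction;
    the energy controls all these derivatives. *)
Lemma preH_approx_H1 al u : H1C u -> preH_approx al u -> H1_approx Omega h al u.
Proof.
move=> Hu [pal nal Nal]; split => //; first by move=> n; have [] := pal n.
move=> e; have [K K0 HK] := wder_le_normH oOmega bOmega clambda Lam0 lambda_bounds e.
apply: (@squeeze0 _ _ (fun n => nH (al n \- u)) K) => //.
  by move=> n; exact: L2norm_ge0.
by move=> n; apply: HK; exact: (H1B oOmega bOmega (preH_H1 (pal n)) Hu).
Qed.

Lemma L2norm_wder_smooth (v : pt) al : smooth al -> N ('D_v al) = N (D v al).
Proof.
move=> sal; apply: (L2norm_ae mC).
- by apply: smooth_L2 => //; exact: smooth_derive.
- by apply: wder_L2; exact: H1_smooth.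
- by apply: ae_eq_sym; exact: wder_smooth.
Qed.

Lemma poincare_normH : exists2 K : R, 0 <= K & forall al, pre al -> N al <= K * nH al.
Proof.
have [K K0 HK] := @poincare_preH R Omega h oOmega bOmega h0.
exists (1 + K * (1 + Lam)); first by rewrite addr_ge0// mulr_ge0// addr_ge0// ltW.
move=> al pal; have [sal _ _] := pal; have Hal := preH_H1 pal.
have [b1 _ b3 _] := energy_bounds oOmega clambda Lam0 lambda_bounds Hal.
apply: le_of_sqr_scale.
- by rewrite mulr_ge0// addr_ge0// ltW.
- exact: normH_ge0.
apply: (le_trans (HK al pal)); rewrite -mulrA; apply: ler_wpM2l => //.
rewrite (L2norm_wder_smooth ex sal) (L2norm_wder_smooth ez sal) mulrDl mul1r.
exact: lerD.
Qed.

(** The inequality on [preH] passes to limits in energy and L^2. As [normH] sees the gradient only,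
    this is what turns zero energy into vanishing almost everywhere. *)
Lemma poincare_HH : exists2 K : R, 0 <= K & forall u, HH Omega h lambda u -> N u <= K * nH u.
Proof.
have [K K0 HK] := poincare_normH; exists K => // u [Hu [al [pal nal Nal]]].
apply: (@le_of_null _ (fun n => K * nH (al n \- u) + N (al n \- u))); last first.
  exact: (null_add (null_scale _ nal) Nal).
move=> n; have Hal := preH_H1 (pal n).
have Hd : H1C (al n \- u) := H1B oOmega bOmega Hal Hu.
have Hd' : H1C (u \- al n) := H1B oOmega bOmega Hu Hal.
have t1 := L2norm_triangle mC (H1_L2 Hd') (H1_L2 Hal).
have t2 := normH_triangle oOmega bOmega clambda Lam0 lambda_bounds Hd Hu.
have E1 : (fun p => (u \- al n) p + al n p) = u by apply/funext => p /=; rewrite subrK.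
have E2' : (al n \- u) \+ u = al n by apply/funext => p /=; rewrite subrK.
rewrite E1 in t1; rewrite E2' in t2.
have t3 := HK _ (pal n).
have t4 : N (u \- al n) = N (al n \- u) by exact: L2normBC.
move: t1 t2 t3 t4; set a := N u; set b := nH u; set c := N (al n \- u); set d := nH (al n \- u).
set e := N (al n); set f := nH (al n); set g := N (u \- al n) => t1 t2 t3 t4.
have := ler_wpM2l K0 t2; rewrite mulrDr; lra.
Qed.

End EnergySpace.

(** * Traces *)

Section L2Limits.
Context d (T : measurableType d) (R : realType) (mu : {measure set T -> \bar R}).
Variables (D : set T) (mD : measurable D).
Local Notation N := (L2norm mu D).

Lemma E2_le_sqr (f : T -> R) (e : R) : L2 mu D f -> 0 <= e ->
  (E2 mu D f <= (e ^+ 2)%:E)%E <-> N f <= e.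
Proof.
move=> Lf e0; rewrite (E2_L2norm mD Lf) lee_fin; split; first exact: le_of_sqr.
by move=> fe; apply: lerXn2r => //; rewrite nnegrE ?L2norm_ge0.
Qed.

(** Traces are defined by extended real integrals tending to 0, the estimates are for real norms;
    this passes from one to the other. *)
Lemma null_E2 (f : nat -> T -> R) : (forall n, L2 mu D (f n)) ->
  E2 mu D (f n) @[n --> \oo] --> 0%E <-> N (f n) @[n --> \oo] --> (0 : R).
Proof.
move=> Lf; split => H.
- apply: nullP => [n|e e0]; first exact: L2norm_ge0.
  have e20 : 0 < e ^+ 2 by exact: exprn_gt0.
  have H' : (fun n => fine (E2 mu D (f n))) @ \oo --> (0 : R) by apply: fine_cvg.
  have [M HM] := null_near H' e20; exists M => // n Mn.
  apply/(E2_le_sqr (Lf n) (ltW e0)).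
  by rewrite (E2_L2norm mD (Lf n)) lee_fin; have := HM n Mn; rewrite (E2_L2norm mD (Lf n)).
- have -> : (fun n => E2 mu D (f n)) = (fun n => (N (f n) ^+ 2)%:E).
    by apply/funext => n; rewrite (E2_L2norm mD (Lf n)).
  apply: cvg_EFin; first exact: nearW.
  rewrite -[X in _ --> X](mulr0 (0 : R)).
  have -> : fine \o (fun n => (N (f n) ^+ 2)%:E) = (fun n => N (f n) * N (f n)).
    by apply/funext => n; rewrite /= expr2.
  exact: cvgM.
Qed.

Lemma L2_dist (f g k : T -> R) : L2 mu D f -> L2 mu D g -> L2 mu D k ->
  N (fun x => f x - g x) <= N (fun x => f x - k x) + N (fun x => g x - k x).
Proof.
move=> Lf Lg Lk; rewrite (L2normBC mu D g k).
have := L2norm_triangle mD (L2B mD Lf Lk) (L2B mD Lk Lg).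
have -> // : (fun x => f x - k x + (k x - g x)) = (fun x => f x - g x).
by apply/funext => x; rewrite addrA subrK.
Qed.

Lemma L2_complete_norm (f : nat -> T -> R) (b : nat -> R) : (forall n, L2 mu D (f n)) ->
  (forall n m, N (fun x => f n x - f m x) <= b n + b m) -> b n @[n --> \oo] --> (0 : R) ->
  exists2 g, L2 mu D g & N (fun x => f n x - g x) @[n --> \oo] --> (0 : R).
Proof.
move=> Lf fb b0.
have cauchy : forall e : R, 0 < e -> exists M, forall n m, (M <= n)%N -> (M <= m)%N ->
    (E2 mu D (fun x => f n x - f m x)%R <= e%:E)%E.
  move=> e e0; have s0 : 0 < Num.sqrt e by rewrite sqrtr_gt0.
  have s20 : 0 < Num.sqrt e / 2 by rewrite divr_gt0.
  have [M HM] := null_near b0 s20; exists M => n m Mn Mm.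
  have L := L2B mD (Lf n) (Lf m).
  rewrite -(sqr_sqrtr (ltW e0)); apply/(E2_le_sqr L (ltW s0)).
  apply: (le_trans (fb n m)); rewrite [leRHS]splitr.
  by apply: lerD; apply: HM.
have [g Lg Hg] := L2_complete mD Lf cauchy; exists g => //.
apply: nullP => [n|e e0]; first exact: L2norm_ge0.
have := Hg (e ^+ 2) (exprn_gt0 _ e0); apply: filterS => n.
by move/(E2_le_sqr (L2B mD (Lf n) Lg) (ltW e0)).
Qed.

Lemma L2_ae_of_norm0 (f g : T -> R) : L2 mu D f -> L2 mu D g ->
  N (fun x => f x - g x) <= 0 -> ae_eq mu D f g.
Proof.
move=> Lf Lg fg; have L := L2B mD Lf Lg.
have z : E2 mu D (fun x => f x - g x)%R = 0%E.
  apply/eqP; rewrite eq_le E2_ge0 andbT.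
  by have /(E2_le_sqr L (lexx 0)) := fg; rewrite expr0n.
have := E2_eq0 mD L.1 z; apply: filterS => x H Dx.
by apply/eqP; rewrite -subr_eq0 (H Dx).
Qed.

End L2Limits.

(** * Traces as L^2 limits independent of the approximating sequence *)

Section TraceLimit.
Context (R : realType).
Local Notation pt := (R * R * R)%type.
Local Notation mR := (measurableTypeR R).
Local Notation mpt := (mR * mR * mR)%type.
Local Notation mu := (@leb3 R).
Variables (Omega : set (R * R)) (h : R).
Hypothesis oOmega : open Omega.
Hypothesis bOmega : bounded_set Omega.
Local Notation C := (cyl Omega h).
Local Notation N := (L2norm mu C).
Local Notation D := (wder Omega h).
Local Notation H1C := (H1 Omega h).
Let mC : measurable (C : set mpt) := measurable_cyl h oOmega.

Lemma wder_normB (e : pt) u v : H1C u -> H1C v -> N (D e (u \- v)) <= N (D e u) + N (D e v).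
Proof.
move=> Hu Hv; have Wu := wder_L2 e Hu; have Wv := wder_L2 e Hv.
have W := wder_L2 e (H1B oOmega bOmega Hu Hv).
have E : u \- v = (fun p => -1 * v p + u p).
  by apply/funext => p; rewrite mulN1r addrC.
have ae : ae_eq mu C (D e (u \- v)) (fun p => D e u p - D e v p).
  have := wder_lincomb oOmega bOmega e (-1) Hv Hu; rewrite E; apply: filterS => p H Cp.
  by rewrite (H Cp) mulN1r addrC.
rewrite (L2norm_ae mC W (L2B mC Wu Wv) ae).
have := L2norm_triangle mC Wu (L2Z mC (-1) Wv).
rewrite (L2norm_Z mC (-1) Wv) normrN1 mul1r; congr (_ <= _); congr L2norm.
by apply/funext => p; rewrite mulN1r.
Qed.

Context d (T : measurableType d) (nu : {measure set T -> \bar R}).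
Variables (A : set T) (mA : measurable A) (rho : T -> pt).
Variables (S : (pt -> R) -> Prop) (e : pt) (K : R).
Hypothesis K0 : 0 <= K.
Hypothesis SB : forall u v, S u -> S v -> S (u \- v).
Hypothesis SH : forall u, S u -> H1C u.
Hypothesis SL : forall u, S u -> L2 nu A (u \o rho).
Hypothesis bound : forall u, S u -> L2norm nu A (u \o rho) <= K * (N u + N (D e u)).

Let dist (v : nat -> pt -> R) u n := K * (N (v n \- u) + N (D e (v n \- u))).

Let dist0 v u : H1_approx Omega h v u -> dist v u n @[n --> \oo] --> (0 : R).
Proof. by move=> [_ _ v1 v2]; apply: null_scale; apply: null_add. Qed.

Let dist_le v v' u n m : H1C u -> S (v n) -> S (v' m) ->
  L2norm nu A (fun x => v n (rho x) - v' m (rho x)) <= dist v u n + dist v' u m.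
Proof.
move=> Hu Sn Sm; apply: (le_trans (bound (SB Sn Sm))).
have E : v n \- v' m = (v n \- u) \- (v' m \- u).
  by apply/funext => p /=; rewrite opprB addrA subrK.
have Hn := H1B oOmega bOmega (SH Sn) Hu; have Hm := H1B oOmega bOmega (SH Sm) Hu.
rewrite /dist -mulrDr; apply: ler_wpM2l => //; rewrite addrACA; apply: lerD.
  exact: (L2_dist mC (H1_L2 (SH Sn)) (H1_L2 (SH Sm)) (H1_L2 Hu)).
by rewrite E; exact: wder_normB.
Qed.

(** [rho] parametrises a piece of the boundary and [bound] is a trace inequality on the class [S].
    By it the restrictions of an approximating sequence are Cauchy, and two sequences that
    approximate the same [u] have restrictions with the same limit. It serves for the ends and for
    the lateral chart. *)
Lemma trace_limit v u : (forall n, S (v n)) -> H1_approx Omega h v u ->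
  exists2 g, L2 nu A g & forall v', (forall n, S (v' n)) -> H1_approx Omega h v' u ->
    L2norm nu A (fun x => v' n (rho x) - g x) @[n --> \oo] --> (0 : R).
Proof.
move=> Sv vu; have Hu : H1C u by case: vu.
have Lv n : L2 nu A (v n \o rho) by exact: SL.
have [g Lg Hg] := L2_complete_norm mA Lv (fun n m => dist_le Hu (Sv n) (Sv m)) (dist0 vu).
exists g => // v' Sv' v'u.
apply: (@squeeze0 _ _ (fun n => dist v' u n + dist v u n +
    L2norm nu A (fun x => v n (rho x) - g x)) 1).
- by move=> n; exact: L2norm_ge0.
- move=> n; rewrite mul1r; have Lv' : L2 nu A (v' n \o rho) by exact: SL.
  apply: (le_trans (L2_dist mA Lv' Lg (Lv n))).
  apply: lerD; first exact: (dist_le Hu (Sv' n) (Sv n)).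
  by rewrite L2normBC.
- by apply: null_add => //; apply: null_add; exact: dist0.
Qed.

End TraceLimit.

Section L2LimitUniqueness.
Context d (T : measurableType d) (R : realType) (mu : {measure set T -> \bar R}).
Variables (D : set T) (mD : measurable D).
Local Notation N := (L2norm mu D).

(** Square integrability of the limit is part of the conclusion: some [v n - f] already has finite
    norm. *)
Lemma L2_of_null (v : nat -> T -> R) (f : T -> R) : (forall n, L2 mu D (v n)) ->
  measurable_fun D f ->
  E2 mu D (fun x => v n x - f x)%R @[n --> \oo] --> 0%E ->
  L2 mu D f /\ N (fun x => v n x - f x) @[n --> \oo] --> (0 : R).
Proof.
move=> Lv mf H.
have Lf : L2 mu D f.
  have mv n : measurable_fun D (fun x => v n x - f x) by apply: measurable_funB => //; exact: (Lv n).1.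
  have [n Ln] : exists n, L2 mu D (fun x => v n x - f x).
    have [M _ /(_ M (leqnn M)) HM] : \forall n \near \oo, (E2 mu D (fun x => v n x - f x)%R < 1)%E.
      have I1 : nbhs (0 : \bar R)%E [set x : \bar R | (x < 1)%E].
        by apply: open_nbhs_nbhs; split; [exact: open_ereal_lt_ereal|exact: lte01].
      exact: (H _ I1).
    by exists M; split; [exact: mv|exact: (lt_trans HM (ltry 1))].
  have := L2B mD (Lv n) Ln; congr (L2 _ _ _).
  by apply/funext => x; rewrite opprB addrC subrK.
split => //.
by apply/(null_E2 mD) => // n; apply: L2B.
Qed.

Lemma L2_limit_unique (v : nat -> T -> R) (f g : T -> R) : (forall n, L2 mu D (v n)) ->
  L2 mu D f -> L2 mu D g ->
  N (fun x => v n x - f x) @[n --> \oo] --> (0 : R) ->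
  N (fun x => v n x - g x) @[n --> \oo] --> (0 : R) -> N (fun x => f x - g x) <= 0.
Proof.
move=> Lv Lf Lg vf vg; apply: (@le_of_null _ (fun n => N (fun x => v n x - f x) + N (fun x => v n x - g x))).
  move=> n; rewrite add0r (L2normBC mu D (v n) f) (L2normBC mu D (v n) g).
  exact: (L2_dist mD Lf Lg (Lv n)).
exact: null_add.
Qed.

Lemma L2_limit_change (v : nat -> T -> R) (f g : T -> R) : (forall n, L2 mu D (v n)) ->
  L2 mu D f -> L2 mu D g -> N (fun x => f x - g x) <= 0 ->
  N (fun x => v n x - f x) @[n --> \oo] --> (0 : R) ->
  N (fun x => v n x - g x) @[n --> \oo] --> (0 : R).
Proof.
move=> Lv Lf Lg fg vf; apply: (squeeze0 (K := 1) _ _ vf) => [n|n]; first exact: L2norm_ge0.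
rewrite mul1r -[leRHS]addr0; apply: (le_trans (L2_dist mD (Lv n) Lg Lf)).
by rewrite lerD2l L2normBC.
Qed.

Lemma L2_of_scaled_le (f : T -> R) (k x : R) : 0 < k -> measurable_fun D f ->
  (k%:E * E2 mu D f <= x%:E)%E -> L2 mu D f /\ k * N f ^+ 2 <= x.
Proof.
move=> k0 mf H.
have Lf : L2 mu D f.
  split => //; rewrite ltey; apply/negP => /eqP E; move: H; rewrite /E2 E.
  by rewrite mulry gtr0_sg// mul1e leye_eq.
by split => //; move: H; rewrite (E2_L2norm mD Lf) -EFinM lee_fin.
Qed.

(** Origin of the constants [1 + (c1 + c2) / k] in the trace inequalities, namely [Ke], [side_const]
    and [gag_const]. *)
Lemma scaled_sqr_arith (k n a b c1 c2 : R) : 0 < k -> 0 <= a -> 0 <= b -> 0 <= c1 -> 0 <= c2 ->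
  k * n ^+ 2 <= c1 * a ^+ 2 + c2 * b ^+ 2 -> n <= (1 + (c1 + c2) / k) * (a + b).
Proof.
move=> k0 a0 b0 c10 c20 H; apply: le_of_sqr_scale.
- by rewrite divr_ge0// ?addr_ge0// ltW.
- exact: addr_ge0.
rewrite -mulrA mulrCA ler_pdivlMl// (le_trans H)//.
have ab := mulr_ge0 a0 b0; have := mulr_ge0 c10 ab; have := mulr_ge0 c20 ab.
have := mulr_ge0 c10 (sqr_ge0 b); have := mulr_ge0 c20 (sqr_ge0 a); nra.
Qed.

End L2LimitUniqueness.

Section EndTraces.
Context (R : realType).
Local Notation pt := (R * R * R)%type.
Local Notation mR := (measurableTypeR R).
Local Notation mR2 := (mR * mR)%type.
Local Notation mpt := (mR * mR * mR)%type.
Local Notation mu := (@leb3 R).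
Local Notation ez := (@ez R).
Variables (Omega : set (R * R)) (h : R).
Hypothesis oOmega : open Omega.
Hypothesis bOmega : bounded_set Omega.
Hypothesis h0 : 0 < h.
Local Notation C := (cyl Omega h).
Local Notation L2C := (L2 mu C).
Local Notation N := (L2norm mu C).
Local Notation D := (wder Omega h).
Local Notation NO := (L2norm (@leb2 R) Omega).
Local Notation L2O := (L2 (@leb2 R) Omega).
Local Notation approx := (H1_approx Omega h).
Let mC : measurable (C : set mpt) := measurable_cyl h oOmega.
Let mOm : measurable (Omega : set mR2) := measurable_domain oOmega.

Let Ke : R := 1 + (2 + 2 * h ^+ 2) / h.

Lemma end_trace_bound z (w : pt -> R) : z = 0 \/ z = h -> smooth w ->
  L2O (fun q => w (q, z)) /\ NO (fun q => w (q, z)) <= Ke * (N w + N (D ez w)).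
Proof.
move=> hz sw.
have Lw : L2C w := smooth_L2 h oOmega bOmega sw.
have LD : L2C ('D_ez w) := smooth_L2 h oOmega bOmega (smooth_derive ez sw).
have H : (h%:E * E2 (@leb2 R) Omega (fun q => w (q, z)) <=
    (2 * N w ^+ 2 + 2 * h ^+ 2 * N ('D_ez w) ^+ 2)%:E)%E.
  apply: (le_trans (y := (2%:E * E2 mu C w + (2 * h ^+ 2)%:E * E2 mu C ('D_ez w))%E)); last first.
    by rewrite (E2_L2norm mC Lw) (E2_L2norm mC LD).
  case: hz => ->; first exact: (bottom_trace_le oOmega h0 sw).
  exact: (top_trace_le oOmega h0 sw).
have mw : measurable_fun (Omega : set mR2) (fun q => w (q, z)).
  apply: measurable_funTS; apply: continuous_measurable2.
  exact: (continuous_slice (smooth_cont sw)).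
have [LO HN] := L2_of_scaled_le mOm h0 mw H; split => //.
rewrite -(L2norm_wder_smooth h oOmega bOmega ez sw).
apply: (scaled_sqr_arith h0 (L2norm_ge0 _ _ _) (L2norm_ge0 _ _ _) _ _ HN) => //.
by rewrite mulr_ge0// sqr_ge0.
Qed.

Let Ke0 : 0 <= Ke.
Proof.
have h2 : 0 <= 2 * h ^+ 2 by rewrite mulr_ge0// sqr_ge0.
by apply: addr_ge0 => //; apply: divr_ge0; [exact: addr_ge0|exact: ltW].
Qed.

Lemma end_trace_limit z v u : z = 0 \/ z = h -> approx v u ->
  exists2 g, L2O g & forall v', approx v' u ->
    NO (fun q => v' n (q, z) - g q) @[n --> \oo] --> (0 : R).
Proof.
move=> hz vu; have [_ sv _ _] := vu.
have [||||g Lg Hg] := @trace_limit R Omega h oOmega bOmega _ _ (@leb2 R) Omega mOm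
  (fun q => (q, z)) (@smooth R pt) ez Ke Ke0 _ _ _ _ v u sv vu.
- by move=> a b sa sb; exact: smoothB.
- by move=> a sa; exact: H1_smooth.
- by move=> a sa; have [] := end_trace_bound hz sa.
- by move=> a sa; have [] := end_trace_bound hz sa.
by exists g => // v' v'u; apply: Hg => //; case: v'u.
Qed.

Lemma measurable_end (t : pt -> R) z : measurable_fun [set: mpt] t ->
  measurable_fun [set: mR2] (fun q => t (q, z)).
Proof. by move=> mt; apply: (measurableT_comp mt); exact: pair2_measurable. Qed.

Lemma L2_patch (g : mR2 -> R) : L2O g ->
  measurable_fun [set: mR2] (g \_ Omega) /\ L2O (g \_ Omega) /\
  (forall q, Omega q -> (g \_ Omega) q = g q).
Proof.
move=> Lg; have E q : Omega q -> (g \_ Omega) q = g q.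
  by move=> Oq; rewrite patchE mem_set.
have m : measurable_fun [set: mR2] (g \_ Omega) by apply/(measurable_restrictT g mOm); exact: Lg.1.
split => //; split => //; apply: (L2_ae mOm (measurable_funTS m) _ Lg).
by apply: aeW => q Oq; rewrite E.
Qed.

Lemma is_trace_ends_exists v u : approx v u -> exists t, is_trace_ends Omega h u t.
Proof.
move=> vu; have [_ sv _ _] := vu.
have [g0 Lg0 Hg0] := end_trace_limit (or_introl (erefl 0)) vu.
have [g1 Lg1 Hg1] := end_trace_limit (or_intror (erefl h)) vu.
have [m0 [L0 E0]] := L2_patch Lg0; have [m1 [L1 E1]] := L2_patch Lg1.
(* The two end traces are glued, and extended by 0 outside [Omega], since a trace has to be
   measurable on the whole space. *)
exists (fun p => if p.2 == h then (g1 \_ Omega) p.1 else (g0 \_ Omega) p.1); split.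
  apply: measurable_fun_ifT.
  - apply: (@measurable_fun_bool _ _ _ _ true) => //.
    rewrite setTI (_ : _ @^-1` _ = [set: mR2] `*` [set h]); first exact: measurableX.
    by apply/seteqP; split => p /=; [move=> /eqP ->|move=> [_ ->]; rewrite eqxx].
  - exact: (measurableT_comp m1 measurable_fst).
  - exact: (measurableT_comp m0 measurable_fst).
exists v; split => // z hz.
have key g' g : L2O g -> (forall q, Omega q -> (g \_ Omega) q = g q) ->
    NO (fun q => v n (q, z) - g q) @[n --> \oo] --> (0 : R) ->
    (forall q, g' q = (g \_ Omega) q) ->
    (\int[@leb2 R]_(q in Omega) ((v n (q, z) - g' q) ^+ 2)%:E)%E @[n --> \oo] --> 0%E.
  move=> Lg Eg H Eg'.
  have Lv n : L2O (fun q => v n (q, z)) by have [] := end_trace_bound hz (sv n).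
  have H2 := (null_E2 mOm (fun n => L2B mOm (Lv n) Lg)).2 H.
  have -> // : (fun n => \int[@leb2 R]_(q in Omega) ((v n (q, z) - g' q) ^+ 2)%:E)%E =
      (fun n => E2 (@leb2 R) Omega (fun q => v n (q, z) - g q)%R).
  by apply/funext => n; apply: eq_integral => q /set_mem Oq; rewrite Eg' Eg.
case: (hz) => Ez; subst z.
- apply: (key _ _ Lg0 E0 (Hg0 v vu)) => q /=.
  by rewrite (lt_eqF h0).
- by apply: (key _ _ Lg1 E1 (Hg1 v vu)) => q /=; rewrite eqxx.
Qed.

(** The selected trace comes with an approximating sequence [v0] of its own; the limit in
    [end_trace_limit], common to all sequences, carries the convergence over to [v]. *)
Lemma trace_endsP v u z : approx v u -> z = 0 \/ z = h ->
  L2O (fun q => trace_ends Omega h u (q, z)) /\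
  NO (fun q => v n (q, z) - trace_ends Omega h u (q, z)) @[n --> \oo] --> (0 : R).
Proof.
move=> vu hz; set t := trace_ends Omega h u.
have [mt [v0 [v0u Hv0]]] : is_trace_ends Omega h u t.
  by have [t0 Ht0] := is_trace_ends_exists vu; exact: (xgetPex (fun=> 0) (ex_intro _ t0 Ht0)).
have L (w : nat -> pt -> R) : approx w u -> forall n, L2O (fun q => w n (q, z)).
  by move=> [_ sw _ _] n; have [] := end_trace_bound hz (sw n).
have [g Lg Hg] := end_trace_limit hz vu.
have [Lt Ht] := L2_of_null mOm (L v0 v0u) (measurable_funTS (measurable_end z mt)) (Hv0 z hz).
split => //; apply: (L2_limit_change mOm (L v vu) Lg Lt _ (Hg v vu)).
exact: (L2_limit_unique mOm (L v0 v0u) Lg Lt (Hg v0 v0u) Ht).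
Qed.

End EndTraces.

(** * Lateral values in H^(1/2) *)

Section HalfSobolevTheory.
Context (R : realType).
Local Notation leb := (@lebesgue_measure R).
Local Notation mR := (measurableTypeR R).
Local Notation mR2 := (mR * mR)%type.
Variable h : R.
Hypothesis h0 : 0 < h.
Local Notation I := (`[0%R, h]%classic : set mR).
Local Notation S := (`[0%R, h] `*` `[0%R, h] : set mR2).
Local Notation NI := (L2norm (@leb1 R) I).
Local Notation NS := (L2norm (@leb2 R) S).
Local Notation L2I := (L2 (@leb1 R) I).
Local Notation L2S := (L2 (@leb2 R) S).

Let mI : measurable I. Proof. exact: measurable_itv. Qed.
Let mS : measurable S. Proof. exact: measurableX. Qed.
Let h0E : (0 <= h%:E)%E. Proof. by rewrite lee_fin ltW. Qed.

Definition quotient (phi : R -> R) (p : mR2) : R := (phi p.1 - phi p.2) / (p.1 - p.2).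

Lemma measurable_coords (phi : mR -> R) : measurable_fun I phi ->
  measurable_fun S (fun p => phi p.1) /\ measurable_fun S (fun p => phi p.2).
Proof.
move=> mphi; have m : measurable_fun [set: mR] (phi \_ I).
  by apply/(measurable_restrictT phi mI).
split.
- apply: (@eq_measurable_fun _ _ _ _ S (fun p => (phi \_ I) p.1)).
    by move=> p /set_mem[p1 _]; rewrite patchE mem_set.
  exact: (measurable_funTS (measurableT_comp m measurable_fst)).
- apply: (@eq_measurable_fun _ _ _ _ S (fun p => (phi \_ I) p.2)).
    by move=> p /set_mem[_ p2]; rewrite patchE mem_set.
  exact: (measurable_funTS (measurableT_comp m measurable_snd)).
Qed.

Lemma measurable_increment (phi : mR -> R) : measurable_fun I phi ->
  measurable_fun S (fun p => phi p.1 - phi p.2).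
Proof. by move=> /measurable_coords[m1 m2]; exact: measurable_funB. Qed.

Lemma measurable_quotient (phi : mR -> R) : measurable_fun I phi ->
  measurable_fun S (quotient phi).
Proof.
move=> /measurable_increment m; apply: (measurable_funM m).
apply: (measurableT_comp (@measurable_invr R)); apply: measurable_funTS.
apply: measurable_funB; [exact: measurable_fst|exact: measurable_snd].
Qed.

Lemma E2_coord1 (phi : mR -> R) : measurable_fun I phi ->
  E2 (@leb2 R) S (fun p => phi p.1) = (h%:E * E2 (@leb1 R) I phi)%E.
Proof.
move=> mphi; have m : measurable_fun [set: mR] (phi \_ I).
  by apply/(measurable_restrictT phi mI).
have ms : measurable_fun [set: mR2] (fun p => ((phi \_ I) p.1 ^+ 2)%:E).
  apply/measurable_EFinP; apply: measurable_funX.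
  exact: (measurableT_comp m measurable_fst).
transitivity (\int[@leb2 R]_(p in S) ((phi \_ I) p.1 ^+ 2)%:E)%E.
  by apply: eq_integral => p /set_mem[p1 _]; rewrite patchE mem_set.
rewrite (plane_Tonelli12 mI mI ms (fun p => sqr_ge0E _)).
have E x : (\int[leb]_(y in I) ((phi \_ I) (x, y).1 ^+ 2)%:E = ((phi \_ I) x ^+ 2)%:E * h%:E)%E.
  exact: (@integral_cst_itv0 R ((phi \_ I) x ^+ 2)%:E h (ltW h0)).
rewrite (eq_integral (fun x => h%:E * (phi x ^+ 2)%:E)%E); last first.
  by move=> x Ix; rewrite E muleC patchE Ix.
exact: (ge0_integralZl leb mI (measurable_sqr mphi) (fun x _ => sqr_ge0E _) h0E).
Qed.

Lemma E2_strip (a b : R) (phi : mR -> R) : a <= b -> measurable_fun I phi ->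
  E2 (@leb2 R) (`[a, b] `*` I) (fun p => phi p.2) = ((b - a)%:E * E2 (@leb1 R) I phi)%E.
Proof.
move=> ab mphi; have m : measurable_fun [set: mR] (phi \_ I).
  by apply/(measurable_restrictT phi mI).
have mab : measurable (`[a, b]%classic : set mR) by exact: measurable_itv.
have ab0 : (0 <= (b - a)%:E)%E by rewrite lee_fin subr_ge0.
have ms : measurable_fun [set: mR2] (fun p => ((phi \_ I) p.2 ^+ 2)%:E).
  apply/measurable_EFinP; apply: measurable_funX.
  exact: (measurableT_comp m measurable_snd).
transitivity (\int[@leb2 R]_(p in `[a, b] `*` I) ((phi \_ I) p.2 ^+ 2)%:E)%E.
  by apply: eq_integral => p /set_mem[_ p1]; rewrite patchE mem_set.
rewrite (plane_Tonelli21 mab mI ms (fun p => sqr_ge0E _)).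
have E x : (\int[leb]_(y in `[a, b]) ((phi \_ I) (y, x).2 ^+ 2)%:E =
    ((phi \_ I) x ^+ 2)%:E * (b - a)%:E)%E.
  rewrite (@integral_cst _ _ _ leb _ mab ((phi \_ I) x ^+ 2)%:E); congr (_ * _)%E.
  have := lebesgue_measure_itv `[a, b]; rewrite /= => ->; rewrite lte_fin.
  by case: ltgtP ab => // -> _; rewrite subrr.
rewrite (eq_integral (fun x => (b - a)%:E * (phi x ^+ 2)%:E)%E); last first.
  by move=> x Ix; rewrite E muleC patchE Ix.
exact: (ge0_integralZl leb mI (measurable_sqr mphi) (fun x _ => sqr_ge0E _) ab0).
Qed.

Lemma E2_coord2 (phi : mR -> R) : measurable_fun I phi ->
  E2 (@leb2 R) S (fun p => phi p.2) = (h%:E * E2 (@leb1 R) I phi)%E.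
Proof. by move=> mphi; have := E2_strip (ltW h0) mphi; rewrite subr0. Qed.

Lemma L2_increment (phi : mR -> R) : L2I phi ->
  L2S (fun p => phi p.1 - phi p.2) /\
  NS (fun p => phi p.1 - phi p.2) <= (1 + 4 * h) * NI phi.
Proof.
move=> Lphi; have [m1 m2] := measurable_coords Lphi.1.
have md := measurable_increment Lphi.1.
have H := E2B (@leb2 R) mS m1 m2.
rewrite (E2_coord1 Lphi.1) (E2_coord2 Lphi.1) (E2_L2norm mI Lphi) in H.
have H' : (1%:E * E2 (@leb2 R) S (fun p => phi p.1 - phi p.2)%R <= (4 * h * NI phi ^+ 2)%:E)%E.
  rewrite mul1e; apply: (le_trans H); rewrite -!EFinM -EFinD lee_fin.
  by set x := _ ^+ 2; lra.
have [L B] := L2_of_scaled_le mS ltr01 md H'; split => //.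
apply: le_of_sqr_scale; [|exact: L2norm_ge0|by rewrite -[leLHS]mul1r].
by rewrite mulr_ge0// ltW.
Qed.

Lemma H12P (phi : R -> R) : H12 h phi <-> L2I phi /\ L2S (quotient phi).
Proof.
split=> [[L1 g]|[L1 [_ g]]]; split => //.
by split => //; exact: (measurable_quotient L1.1).
Qed.

Lemma H12normE (phi : R -> R) : H12 h phi ->
  H12norm h phi ^+ 2 = NI phi ^+ 2 + NS (quotient phi) ^+ 2.
Proof.
move=> /H12P[L1 L2']; rewrite /H12norm.
have -> : fine (gagliardo h phi) = NS (quotient phi) ^+ 2.
  by rewrite -[RHS]/(fine (NS (quotient phi) ^+ 2)%:E) -(E2_L2norm mS L2').
by rewrite sqr_sqrtr// addr_ge0// sqr_ge0.
Qed.

Lemma H12norm_ge0 (phi : R -> R) : 0 <= H12norm h phi.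
Proof. exact: sqrtr_ge0. Qed.

Lemma H12norm_le (phi : R -> R) : H12 h phi -> H12norm h phi <= NI phi + NS (quotient phi).
Proof.
move=> Hphi; have a0 : 0 <= NI phi by exact: L2norm_ge0.
have b0 : 0 <= NS (quotient phi) by exact: L2norm_ge0.
apply: le_of_sqr; first exact: addr_ge0.
rewrite (H12normE Hphi) sqrrD lerD2r lerDl mulrn_wge0//.
exact: mulr_ge0.
Qed.

Lemma quotient_lincomb (a : R) (phi psi : R -> R) :
  quotient (fun z => a * phi z + psi z) = (fun p => a * quotient phi p + quotient psi p).
Proof. by apply/funext => p; rewrite /quotient mulrA -mulrDl; congr (_ / _); ring. Qed.

Lemma H12_lincomb (a : R) (phi psi : R -> R) : H12 h phi -> H12 h psi ->
  H12 h (fun z => a * phi z + psi z).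
Proof.
move=> /H12P[L1 L2'] /H12P[L3 L4]; apply/H12P; split; first exact: L2_lincomb.
by rewrite quotient_lincomb; exact: L2_lincomb.
Qed.

Lemma quotient_cst (k : R) : quotient (fun=> k) = (fun=> 0).
Proof. by apply/funext => p; rewrite /quotient subrr mul0r. Qed.

Lemma H12_cst (k : R) : H12 h (fun=> k).
Proof.
apply/H12P; split; last by rewrite quotient_cst; exact: L2_cst0.
by apply: cont_L2_itv => x; exact: cvg_cst.
Qed.

Lemma H12Z (a : R) (phi : R -> R) : H12 h phi -> H12 h (fun z => a * phi z).
Proof.
move=> Hp; have := H12_lincomb a Hp (H12_cst 0).
by congr H12; apply/funext => z; rewrite addr0.
Qed.

Lemma H12normZ (a : R) (phi : R -> R) : H12 h phi ->
  H12norm h (fun z => a * phi z) = `|a| * H12norm h phi.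
Proof.
move=> Hp; have Ha := H12Z a Hp; have [L1 L2'] := (H12P phi).1 Hp.
have E : quotient (fun z => a * phi z) = (fun p => a * quotient phi p).
  by apply/funext => p; rewrite /quotient -mulrBr mulrA.
apply/eqP; rewrite -(@eqrXn2 _ 2) ?mulr_ge0 ?H12norm_ge0//.
rewrite exprMn (H12normE Ha) (H12normE Hp) E (L2norm_Z mI a L1) (L2norm_Z mS a L2').
by rewrite !exprMn mulrDr.
Qed.

(** [H12dualnorm] is a supremum over the unit ball, finite by the bound in [H12dual]; homogeneity of
    [j] extends it to all of [H12]. *)
Lemma H12dual_bound (j : (R -> R) -> R) : H12dual h j ->
  0 <= H12dualnorm h j /\
  forall phi, H12 h phi -> `|j phi| <= H12dualnorm h j * H12norm h phi.
Proof.
move=> [jlin [M HM]].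
pose X := [set r | exists phi, [/\ H12 h phi, H12norm h phi <= 1 & r = `|j phi|]].
have ubX : has_ubound X.
  exists `|M| => r [phi [Hp np ->]]; apply: (le_trans (HM phi Hp)).
  apply: (le_trans (ler_wpM2r (H12norm_ge0 phi) (ler_norm M))).
  by rewrite -[leRHS]mulr1; apply: ler_wpM2l.
have supX phi : H12 h phi -> H12norm h phi <= 1 -> `|j phi| <= H12dualnorm h j.
  by move=> Hp np; apply: (ub_le_sup ubX); exists phi.
have jZ a phi : H12 h phi -> j (fun z => a * phi z) = a * j phi.
  move=> Hp; have j0 : j (fun=> 0) = 0.
    have := jlin 1 _ _ (H12_cst 0) (H12_cst 0).
    rewrite (_ : (fun=> _) = (fun=> 0)) => [|]; last by apply/funext => z; rewrite mulr0 addr0.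
    by rewrite mul1r; set y := j _ => H; lra.
  have := jlin a _ _ Hp (H12_cst 0); rewrite j0 addr0 => <-; congr j.
  by apply/funext => z; rewrite addr0.
split.
  apply: le_trans (supX (fun=> 0) (H12_cst 0) _); first exact: normr_ge0.
  have Z := H12normZ 0 (H12_cst 0); rewrite normr0 mul0r in Z.
  by rewrite Z mul0r.
(* At norm 0 there is no rescaling to the unit ball; the bound in [H12dual] gives [j phi = 0]
   directly. *)
move=> phi Hp; have [n0|n0] := eqVneq (H12norm h phi) 0.
  by have := HM phi Hp; rewrite n0 !mulr0.
have npos : 0 < H12norm h phi by rewrite lt_neqAle eq_sym n0 H12norm_ge0.
have := supX _ (H12Z (H12norm h phi)^-1 Hp).
rewrite (H12normZ _ Hp) (jZ _ _ Hp) normrM ger0_norm ?invr_ge0 ?H12norm_ge0//.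
by rewrite mulVf// => /(_ (lexx 1)); rewrite ler_pdivrMl// mulrC.
Qed.

End HalfSobolevTheory.

(** * Lower semicontinuity of the Gagliardo seminorm *)

Section GagliardoLimit.
Context (R : realType).
Local Notation mR := (measurableTypeR R).
Local Notation mR2 := (mR * mR)%type.
Variable h : R.
Hypothesis h0 : 0 < h.
Local Notation I := (`[0%R, h]%classic : set mR).
Local Notation S := (`[0%R, h] `*` `[0%R, h] : set mR2).
Local Notation NI := (L2norm (@leb1 R) I).
Local Notation NS := (L2norm (@leb2 R) S).
Local Notation L2I := (L2 (@leb1 R) I).
Local Notation L2S := (L2 (@leb2 R) S).

Let mI : measurable I. Proof. exact: measurable_itv. Qed.
Let mS : measurable S. Proof. exact: measurableX. Qed.

Let kern (m : nat) (p : mR2) : R := (`|p.1 - p.2| + m.+1%:R^-1)^-1.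
Let reg (m : nat) (phi : R -> R) (p : mR2) : R := kern m p * (phi p.1 - phi p.2).

Let mkern m : measurable_fun S (kern m).
Proof.
apply: (measurableT_comp (@measurable_invr R)); apply: measurable_funTS.
apply: continuous_measurable2 => p; apply: cvgD; last exact: cvg_cst.
by apply: cvg_norm; apply: cvgB; [exact: cvg_fst|exact: cvg_snd].
Qed.

Let kern_pos m (p : mR2) : 0 < `|p.1 - p.2 : R| + (m.+1%:R^-1 : R).
Proof. by rewrite ltr_wpDl// invr_gt0. Qed.

Let kern_le m p : `|kern m p| <= m.+1%:R.
Proof.
rewrite ger0_norm; last by rewrite invr_ge0 ltW.
rewrite -[leRHS]invrK lef_pV2 ?posrE ?invr_gt0//.
by rewrite lerDr.
Qed.

Let L2_reg m phi : L2I phi -> L2S (reg m phi).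
Proof.
move=> /(L2_increment h0)[L _].
exact: (L2_bounded_mul mS (mkern m) (fun p _ => kern_le m p) L).
Qed.

Let sqr_le_norm (x y : R) : `|x| <= `|y| -> x ^+ 2 <= y ^+ 2.
Proof. by move=> xy; rewrite -[leLHS]real_normK ?num_real// -[leRHS]real_normK ?num_real// lerXn2r ?nnegrE. Qed.

Lemma L2norm_le_pointwise d (T : measurableType d) (nu : {measure set T -> \bar R}) (A : set T)
    (f g : T -> R) : measurable A -> L2 nu A f -> L2 nu A g ->
  (forall x, A x -> `|f x| <= `|g x|) -> L2norm nu A f <= L2norm nu A g.
Proof.
move=> mA Lf Lg H; apply/(E2_le_sqr mA Lf (L2norm_ge0 _ _ _)).
rewrite -(E2_L2norm mA Lg); apply: ge0_le_integral => //.
- by move=> x _; rewrite lee_fin sqr_ge0.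
- by apply: measurable_sqr; exact: Lf.1.
- by apply: measurable_sqr; exact: Lg.1.
by move=> x Ax; rewrite lee_fin; apply: sqr_le_norm; exact: H.
Qed.

Let reg_le_quotient m phi p : `|reg m phi p| <= `|quotient phi p|.
Proof.
have [d|d] := eqVneq (p.1 - p.2) 0.
  by move/eqP: (d); rewrite subr_eq0 /reg => /eqP ->; rewrite subrr mulr0 normr0.
rewrite /reg /quotient !normrM [leLHS]mulrC !normfV; apply: ler_wpM2l => //.
rewrite (gtr0_norm (kern_pos m p)) lef_pV2 ?posrE ?normr_gt0//.
by rewrite lerDl invr_ge0.
Qed.

Let reg_cvg phi p : (reg m phi p) ^+ 2 @[m --> \oo] --> quotient phi p ^+ 2.
Proof.
have [d|d] := eqVneq (p.1 - p.2) 0.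
  move/eqP: (d); rewrite subr_eq0 /reg /quotient => /eqP ->; rewrite subrr mul0r.
  by under eq_fun do rewrite mulr0; exact: cvg_cst.
have c : kern m p @[m --> \oo] --> `|p.1 - p.2|^-1.
  apply: cvgV; first by rewrite (@normr_eq0 _ R).
  rewrite -[X in _ --> X]addr0; apply: cvgD; [exact: cvg_cst|exact: cvg_harmonic].
have E : quotient phi p ^+ 2 = (`|p.1 - p.2|^-1 * (phi p.1 - phi p.2)) ^+ 2.
  by rewrite /quotient [in RHS]mulrC !exprMn !exprVn real_normK ?num_real.
have c2 : reg m phi p @[m --> \oo] --> `|p.1 - p.2|^-1 * (phi p.1 - phi p.2).
  by apply: cvgMl.
by rewrite E expr2; under eq_fun do rewrite expr2; exact: cvgM.
Qed.

(* For each [m] the regularised seminorm is continuous in L^2, and it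
   increases to the Gagliardo seminorm as [m] grows. *)
Lemma gagliardo_limit (c_ : nat -> R -> R) (c : R -> R) (A : R) (b : nat -> R) :
  (forall n, H12 h (c_ n)) -> L2I c ->
  NI (fun z => c_ n z - c z) @[n --> \oo] --> (0 : R) ->
  (forall n, NS (quotient (c_ n)) <= A + b n) -> b n @[n --> \oo] --> (0 : R) ->
  H12 h c /\ NS (quotient c) <= A.
Proof.
move=> Hc Lc cc cb b0.
(* For fixed [m] the kernel is at most [m + 1], so the error [reg m (c_ n - c)] is controlled by the
   L^2 distance and vanishes as [n] grows. *)
have regA m : NS (reg m c) <= A.
  apply: (@le_of_null _ (fun n => b n + (m.+1%:R * (1 + 4 * h)) * NI (fun z => c_ n z - c z))); last first.
    by apply: null_add => //; exact: null_scale.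
  move=> n; have [Ln Lq] := (H12P h (c_ n)).1 (Hc n).
  have Ld := L2B mI Ln Lc.
  have [Li Bi] := L2_increment h0 Ld.
  have Lrd := L2_reg m Ld; have Lrn := L2_reg m Ln.
  have t1 : NS (reg m (c_ n)) <= NS (quotient (c_ n)).
    by apply: (L2norm_le_pointwise mS Lrn Lq) => p _; exact: reg_le_quotient.
  have t2 : NS (reg m (fun z => c_ n z - c z)) <= m.+1%:R * ((1 + 4 * h) * NI (fun z => c_ n z - c z)).
    apply: (le_trans _ (ler_wpM2l (ler0n R m.+1) Bi)).
    rewrite -[m.+1%:R in leRHS]normr_nat -(L2norm_Z mS _ Li).
    apply: (L2norm_le_pointwise mS Lrd (L2Z mS _ Li)) => p _.
    by rewrite /reg !normrM normr_nat; apply: ler_wpM2r.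
  have t3 := L2norm_triangle mS Lrn (L2Z mS (-1) Lrd).
  rewrite (L2norm_Z mS (-1) Lrd) normrN1 mul1r in t3.
  have E : (fun x => reg m (c_ n) x + -1 * reg m (fun z => c_ n z - c z) x) = reg m c.
    by apply/funext => p; rewrite /reg; ring.
  rewrite E in t3; have := cb n; rewrite -mulrA; move: t1 t2 t3.
  set n1 := NS (reg m (c_ n)); set n2 := NS (quotient (c_ n)); set n3 := NS (reg m c).
  set n4 := NS (reg m (fun z => _)); set n5 := _ * (_ * _); lra.
have A0 : 0 <= A by apply: le_trans (regA 0); exact: L2norm_ge0.
have mq := measurable_quotient Lc.1.
have G : (E2 (@leb2 R) S (quotient c) <= (A ^+ 2)%:E)%E.
  apply: (@fatou_le _ mR2 R (@leb2 R) S (fun m p => (reg m c p ^+ 2)%:E)).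
  - exact: mS.
  - exact: measurable_sqr.
  - by move=> m; apply: measurable_sqr; exact: (L2_reg m Lc).1.
  - by move=> m p _; exact: sqr_ge0E.
  - apply: aeW => p _; apply: cvg_EFin; first exact: nearW.
    exact: reg_cvg.
  - by move=> p _; exact: sqr_ge0E.
  - apply: nearW => m; exact: (E2_le_sqr mS (L2_reg m Lc) A0).2.
have Lq : L2S (quotient c) by split => //; exact: (le_lt_trans G (ltry _)).
split; first exact/H12P.
exact: (E2_le_sqr mS Lq A0).1.
Qed.

End GagliardoLimit.

Section Arcs.
Context (R : realType).

Lemma smooth_id : smooth (fun t : R => t).
Proof.
apply: (@smooth_coind R R (fun f => f = (fun t => t) \/ exists k, f = fun=> k)); last by left.
move=> f [->|[k ->]]; split.
- by move=> x; exact: cvg_id.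
- by move=> x v; exact: derivable_id.
- by move=> v; right; exists v; apply/funext => x; rewrite derive_id.
- by move=> x; exact: cvg_cst.
- by move=> x v; exact: derivable_cst.
- by move=> v; right; exists 0; apply/funext => x; rewrite derive_cst.
Qed.

Lemma derive1_smooth (x : R -> R) : derive1 x = 'D_1 x.
Proof. by apply/funext => t; rewrite derive1E. Qed.

Lemma continuous_speed (x y : R -> R) : smooth x -> smooth y -> continuous (speed x y).
Proof.
move=> sx sy t; have cx := smooth_cont (smooth_derive (1 : R) sx).
have cy := smooth_cont (smooth_derive (1 : R) sy).
apply: (@continuous_comp _ _ _ (fun t => derive1 x t ^+ 2 + derive1 y t ^+ 2) (@Num.sqrt R)).
  by rewrite !derive1_smooth; apply: cvgD; [apply: (continuous_sqr cx)|apply: (continuous_sqr cy)].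
exact: sqrt_continuous.
Qed.

Variables (Omega : set (R * R)) (swap flip : bool) (psi : R -> R) (a b k : R).
Hypothesis ab : a < b.
Hypothesis spsi : smooth psi.
Hypothesis bpsi : forall t, a <= t <= b -> boundary Omega (unorient swap flip t (psi t)).

Definition arc1 (t : R) : R := (chart swap flip psi k t 0).1.
Definition arc2 (t : R) : R := (chart swap flip psi k t 0).2.

Lemma chart0 t : chart swap flip psi k t 0 = unorient swap flip t (psi t).
Proof. by rewrite /chart mulr0 addr0. Qed.

Lemma arc_pair t : (arc1 t, arc2 t) = unorient swap flip t (psi t).
Proof. by rewrite /arc1 /arc2 chart0; case: (unorient _ _ _ _). Qed.

Let smooth_arc : smooth arc1 /\ smooth arc2 /\ (arc1 = (fun t => t) \/ arc2 = (fun t => t)).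
Proof.
have E : forall t, chart swap flip psi k t 0 = unorient swap flip t (psi t) := chart0.
have sN : smooth (fun t => if flip then - psi t else psi t).
  by case: flip; [exact: smoothN|exact: spsi].
rewrite /arc1 /arc2.
have -> : (fun t => (chart swap flip psi k t 0).1) = (fun t => (unorient swap flip t (psi t)).1).
  by apply/funext => t; rewrite E.
have -> : (fun t => (chart swap flip psi k t 0).2) = (fun t => (unorient swap flip t (psi t)).2).
  by apply/funext => t; rewrite E.
rewrite /unorient; case: swap => /=.
  by split; [exact: sN|split; [exact: smooth_id|right]].
by split; [exact: smooth_id|split; [exact: sN|left]].
Qed.

(** One coordinate of the arc is its parameter. The bound allows the weight [speed] in the
    definition of the lateral trace to be dropped. *)
Lemma speed_chart_ge1 t : 1 <= speed arc1 arc2 t.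
Proof.
have [_ [_ H]] := smooth_arc.
have D1 : derive1 (fun t : R => t) t = 1 by rewrite derive1E derive_id.
rewrite /speed -[leLHS](@sqrtr1 R) ler_sqrt ?addr_ge0 ?sqr_ge0//.
by case: H => ->; rewrite D1 expr1n ?lerDl ?lerDr sqr_ge0.
Qed.

Lemma chart_arc : boundary_arc Omega a b arc1 arc2.
Proof.
have [s1 [s2 H]] := smooth_arc; split => //.
- move=> t s _ _; case: H => -> [e1 e2] //.
- by move=> t tab; rewrite arc_pair; exact: bpsi.
Qed.

End Arcs.

(** * Bounds for the lateral value of smooth functions *)

Section LateralBounds.
Context (R : realType).
Local Notation pt := (R * R * R)%type.
Local Notation mR := (measurableTypeR R).
Local Notation mR2 := (mR * mR)%type.
Local Notation mpt := (mR * mR * mR)%type.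
Local Notation mu := (@leb3 R).
Local Notation ez := (@ez R).
Variables (Omega : set (R * R)) (h : R) (lambda : R -> R) (Lam : R).
Hypothesis oOmega : open Omega.
Hypothesis bOmega : bounded_set Omega.
Hypothesis h0 : 0 < h.
Hypothesis clambda : continuous lambda.
Hypothesis Lam0 : 0 < Lam.
Hypothesis lambda_bounds : forall z, 0 <= z <= h -> Lam^-1 <= lambda z <= Lam.
Local Notation C := (cyl Omega h).
Local Notation L2C := (L2 mu C).
Local Notation N := (L2norm mu C).
Local Notation D := (wder Omega h).
Local Notation nH := (normH Omega h lambda).
Local Notation pre := (preH Omega h).
Local Notation I := (`[0%R, h]%classic : set mR).
Local Notation S := (`[0%R, h] `*` `[0%R, h] : set mR2).
Local Notation NI := (L2norm (@leb1 R) I).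
Local Notation NS := (L2norm (@leb2 R) S).
Local Notation L2I := (L2 (@leb1 R) I).
Local Notation L2S := (L2 (@leb2 R) S).
Let mC : measurable (C : set mpt) := measurable_cyl h oOmega.
Let mI : measurable I. Proof. exact: measurable_itv. Qed.
Let mS : measurable S. Proof. exact: measurableX. Qed.

Variables (swap flip : bool) (psi : R -> R) (a b k : R).
Hypothesis ab : a < b.
Hypothesis k0 : 0 < k.
Hypothesis spsi : smooth psi.
Hypothesis bpsi : forall t, a <= t <= b -> boundary Omega (unorient swap flip t (psi t)).
Hypothesis inO : forall t r, a <= t <= b -> 0 < r <= h ->
  Omega (unorient swap flip t (psi t + k * r)).
Local Notation ch := (chart swap flip psi k).
Local Notation dir := (chart_dir swap flip k).
Local Notation A := (`[a, b] `*` `[0%R, h] : set mR2).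
Local Notation NA := (L2norm (@leb2 R) A).
Local Notation L2A := (L2 (@leb2 R) A).
Let cpsi : continuous psi := smooth_cont spsi.
Let mA : measurable A. Proof. by apply: measurableX; exact: measurable_itv. Qed.

Definition side (s : mR2) : pt := (ch s.1 0, s.2).

Lemma continuous_side : continuous (side : R * R -> pt).
Proof.
move=> p; apply: (cvg_pair (F := nbhs p) (G := nbhs (ch p.1 0)) (H := nbhs p.2)); last exact: cvg_snd.
apply: (@continuous_comp _ _ _ (fun p : R * R => (p.1, 0)) (fun p : R * R => ch p.1 p.2)).
  apply: (cvg_pair (F := nbhs p) (G := nbhs p.1) (H := nbhs 0)); [exact: cvg_fst|exact: cvg_cst].
exact: (@chart_continuous R swap flip psi k cpsi).
Qed.

Lemma continuous_on_side (w : pt -> R) : continuous w -> continuous (fun s : R * R => w (side s)).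
Proof.
by move=> cw p; apply: (@continuous_comp _ _ _ side w); [exact: continuous_side|exact: cw].
Qed.

Definition side_const : R := 1 + (2 + 2 * h ^+ 2) / (k * h).

Lemma side_const_ge0 : 0 <= side_const.
Proof.
have h2 : 0 <= 2 * h ^+ 2 by rewrite mulr_ge0// sqr_ge0.
apply: addr_ge0 => //; apply: divr_ge0; first exact: addr_ge0.
by rewrite mulr_ge0// ltW.
Qed.

Let lateral_trace (w : pt -> R) : smooth w ->
  ((k * h)%:E * E2 (@leb2 R) A (fun s => w (side s)) <=
   (2 * N w ^+ 2 + 2 * h ^+ 2 * N ('D_dir w) ^+ 2)%:E)%E.
Proof.
move=> sw; have Lw : L2C w := smooth_L2 h oOmega bOmega sw.
have LD : L2C ('D_dir w) := smooth_L2 h oOmega bOmega (smooth_derive dir sw).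
rewrite EFinM -muleA.
have H := lateral_trace_le oOmega h0 k0 cpsi inO sw; apply: (le_trans H).
by rewrite (E2_L2norm mC Lw) (E2_L2norm mC LD).
Qed.

Lemma side_bound (w : pt -> R) : smooth w ->
  L2A (fun s => w (side s)) /\ NA (fun s => w (side s)) <= side_const * (N w + N (D dir w)).
Proof.
move=> sw.
have mw : measurable_fun A (fun s => w (side s)).
  apply: measurable_funTS; apply: continuous_measurable2.
  exact: continuous_on_side (smooth_cont sw).
have kh : 0 < k * h by exact: mulr_gt0.
have [LO HN] := L2_of_scaled_le mA kh mw (lateral_trace sw); split => //.
rewrite -(L2norm_wder_smooth h oOmega bOmega dir sw).
apply: (scaled_sqr_arith kh (L2norm_ge0 _ _ _) (L2norm_ge0 _ _ _) _ _ HN) => //.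
by rewrite mulr_ge0// sqr_ge0.
Qed.

(** The lateral value, read on the vertical line above the first point of the chart; for an element
    of [preH] every boundary point gives the same value at heights in [[0, h]]. *)
Definition lat (al : pt -> R) (z : R) : R := al (ch a 0, z).

Let aab t : a <= t <= b -> boundary Omega (ch t 0).
Proof. by move=> tab; rewrite chart0; exact: bpsi. Qed.
Let a_in : a <= a <= b. Proof. by rewrite lexx ltW. Qed.

Lemma lat_boundary al q z : pre al -> boundary Omega q -> 0 <= z <= h -> al (q, z) = lat al z.
Proof. by move=> [_ _ [c hc]] bq hz; rewrite /lat hc// hc//; exact: (aab a_in). Qed.

Lemma continuous_lat al : smooth al -> continuous (lat al).
Proof.
move=> /smooth_cont cal z; apply: (@continuous_comp _ _ _ (fun z : R => (ch a 0, z)) al); last exact: cal.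
apply: (cvg_pair (F := nbhs z) (G := nbhs (ch a 0)) (H := nbhs z)); [exact: cvg_cst|exact: cvg_id].
Qed.

(** A function of [z] alone has on the strip [b - a] times its squared norm on [[0, h]]; division
    recovers the one-dimensional norm from a bound on the chart. *)
Lemma NA_strip (c : mR -> R) : L2A (fun s => c s.2) -> measurable_fun I c ->
  L2I c /\ NI c <= (1 + (b - a)^-1) * NA (fun s => c s.2).
Proof.
move=> LA mc; have E := E2_strip (ltW ab) mc.
have ba : 0 < b - a by rewrite subr_gt0.
have H : ((b - a)%:E * E2 (@leb1 R) I c <= (NA (fun s => c s.2) ^+ 2)%:E)%E.
  by rewrite -E (E2_L2norm mA LA).
have [L B] := L2_of_scaled_le mI ba mc H; split => //.
apply: le_of_sqr_scale; [by rewrite invr_ge0 ltW|exact: L2norm_ge0|].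
by rewrite -ler_pdivrMl ?invr_gt0// invrK.
Qed.

Lemma lat_L2 al : pre al ->
  L2I (lat al) /\ NI (lat al) <= (1 + (b - a)^-1) * side_const * (N al + N (D dir al)).
Proof.
move=> pal; have [sal _ _] := pal; have [LA BA] := side_bound sal.
have E : {in A, (fun s => al (side s)) =1 (fun s => lat al s.2)}.
  move=> s /set_mem[/= s1 s2]; apply: lat_boundary => //.
  by apply: aab; move: s1; rewrite in_itv/=.
have mlat : measurable_fun I (lat al).
  by apply: measurable_funTS; apply: cont_measurable1; exact: continuous_lat.
have LA' : L2A (fun s => lat al s.2).
  apply: (L2_ae mA _ _ LA); first exact: (eq_measurable_fun _ E LA.1).
  by apply: aeW => s As; apply: E; exact/mem_set.
have [L B] := NA_strip LA' mlat; split => //.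
apply: (le_trans B); rewrite -mulrA; apply: ler_wpM2l.
  by rewrite addr_ge0// invr_ge0 subr_ge0 ltW.
apply: le_trans BA; rewrite (L2norm_ae mA LA' LA)//.
by apply: aeW => s As; rewrite E//; exact/mem_set.
Qed.

Definition gag_const : R := 1 + (16 + 16) / (k * (b - a)).

Lemma lat_gagliardo al : pre al -> L2S (quotient (lat al)) /\
  NS (quotient (lat al)) <= gag_const * (N (D (dir + ez) al) + N (D dir al)).
Proof.
move=> pal; have [sal _ _] := pal.
have L v : L2C ('D_v al) := smooth_L2 h oOmega bOmega (smooth_derive v sal).
have kba : 0 < k * (b - a) by rewrite mulr_gt0// subr_gt0.
have H : ((k * (b - a))%:E * E2 (@leb2 R) S (quotient (lat al)) <=
    (16 * N ('D_(dir + ez)%R al) ^+ 2 + 16 * N ('D_dir al) ^+ 2)%:E)%E.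
  have c t z : a <= t <= b -> 0 <= z <= h -> lat al z = al (ch t 0, z).
    by move=> tab hz; rewrite (lat_boundary pal (aab tab) hz).
  have := gagliardo_chart_le oOmega ab k0 cpsi inO sal c.
  rewrite (E2_L2norm mC (L _)) (E2_L2norm mC (L dir)) => /le_trans; apply.
  by rewrite -EFinD -EFinM lee_fin mulrDr.
have mlat : measurable_fun S (quotient (lat al)).
  apply: measurable_quotient; apply: measurable_funTS; apply: cont_measurable1.
  exact: continuous_lat.
have [LS HN] := L2_of_scaled_le mS kba mlat H; split => //.
have E : N ('D_(dir + ez) al) + N ('D_dir al) = N (D (dir + ez) al) + N (D dir al).
  exact: (f_equal2 +%R (L2norm_wder_smooth h oOmega bOmega (dir + ez) sal)
    (L2norm_wder_smooth h oOmega bOmega dir sal)).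
have c16 : 0 <= 16 :> R by [].
have B := scaled_sqr_arith kba (L2norm_ge0 _ _ _) (L2norm_ge0 _ _ _) c16 c16 HN.
exact: (eq_ind _ (fun t => NS (quotient (lat al)) <= gag_const * t) B _ E).
Qed.

Lemma bound_arith (x c p q L1 L2 e n : R) : 0 <= c -> 0 <= e -> 0 <= n ->
  x <= c * (p + q) -> p <= L1 * n -> q <= L2 * n -> x <= (c * (L1 + L2) + e) * n.
Proof.
move=> c0 e0 n0 H p1 q1; apply: (le_trans H).
rewrite mulrDl -mulrA mulrDl -[leLHS]addr0; apply: lerD; last exact: mulr_ge0.
by apply: ler_wpM2l => //; exact: lerD.
Qed.

(** The trace inequality in H^(1/2): composed with [j], it makes the lateral term of the variational
    problem bounded in the energy norm. *)
Lemma lat_bound : exists2 K : R, 0 <= K & forall al, pre al ->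
  [/\ H12 h (lat al), NI (lat al) <= K * nH al & NS (quotient (lat al)) <= K * nH al].
Proof.
have [K1 K10 HK1] := poincare_normH oOmega bOmega h0 clambda Lam0 lambda_bounds.
have [K2 K20 HK2] := wder_le_normH oOmega bOmega clambda Lam0 lambda_bounds dir.
have [K3 K30 HK3] := wder_le_normH oOmega bOmega clambda Lam0 lambda_bounds (dir + ez).
pose a1 := (1 + (b - a)^-1) * side_const.
have a10 : 0 <= a1.
  by apply: mulr_ge0; [rewrite addr_ge0// invr_ge0 subr_ge0 ltW|exact: side_const_ge0].
have a20 : 0 <= gag_const.
  by rewrite addr_ge0// divr_ge0// mulr_ge0// ?subr_ge0 ltW.
exists (a1 * (K1 + K2) + gag_const * (K3 + K2)).
  by apply: addr_ge0; apply: mulr_ge0 => //; exact: addr_ge0.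
move=> al pal; have Hal := preH_H1 oOmega bOmega pal.
have [L1 B1] := lat_L2 pal; have [L2' B2] := lat_gagliardo pal.
have n0 := normH_ge0 Omega h lambda al.
have := HK1 _ pal; have := HK2 _ Hal; have := HK3 _ Hal => b3 b2 b1.
split; first exact/H12P.
- by apply: (bound_arith a10 _ n0 B1 b1 b2); apply: mulr_ge0 => //; exact: addr_ge0.
- rewrite addrC.
  by apply: (bound_arith a20 _ n0 B2 b3 b2); apply: mulr_ge0 => //; exact: addr_ge0.
Qed.

End LateralBounds.

Section LateralValue.
Context (R : realType).
Local Notation mR := (measurableTypeR R).
Local Notation mR2 := (mR * mR)%type.
Local Notation mpt := (mR * mR * mR)%type.
Variables (Omega : set (R * R)) (h : R) (lambda : R -> R) (Lam : R).
Hypothesis oOmega : open Omega.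
Hypothesis bOmega : bounded_set Omega.
Hypothesis h0 : 0 < h.
Hypothesis clambda : continuous lambda.
Hypothesis Lam0 : 0 < Lam.
Hypothesis lambda_bounds : forall z, 0 <= z <= h -> Lam^-1 <= lambda z <= Lam.
Local Notation C := (cyl Omega h).
Local Notation H1C := (H1 Omega h).
Local Notation I := (`[0%R, h]%classic : set mR).
Local Notation S := (`[0%R, h] `*` `[0%R, h] : set mR2).
Local Notation NI := (L2norm (@leb1 R) I).
Local Notation L2I := (L2 (@leb1 R) I).
Let mC : measurable (C : set mpt) := measurable_cyl h oOmega.
Let mI : measurable I. Proof. exact: measurable_itv. Qed.
Let mS : measurable S. Proof. exact: measurableX. Qed.

Variables (swap flip : bool) (psi : R -> R) (a b k : R).
Hypothesis ab : a < b.
Hypothesis k0 : 0 < k.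
Hypothesis spsi : smooth psi.
Hypothesis bpsi : forall t, a <= t <= b -> boundary Omega (unorient swap flip t (psi t)).
Hypothesis inO : forall t r, a <= t <= b -> 0 < r <= h ->
  Omega (unorient swap flip t (psi t + k * r)).
Local Notation A := (`[a, b] `*` `[0%R, h] : set mR2).
Let cpsi : continuous psi := smooth_cont spsi.
Let mA : measurable A. Proof. by apply: measurableX; exact: measurable_itv. Qed.

Local Notation papprox := (preH_approx Omega h lambda).
Local Notation lt := (lat swap flip psi a k).

Let ba : 0 < b - a. Proof. by rewrite subr_gt0. Qed.

Lemma speed_bounded (a' b' : R) (x y : R -> R) : smooth x -> smooth y ->
  exists2 M : R, 0 <= M & forall t, a' <= t <= b' -> speed x y t <= M.
Proof.
move=> sx sy; have cs := continuous_speed sx sy.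
have [M [_ HM]] := @compact_bounded _ R^o _ (continuous_compact (continuous_subspaceT cs) (@segment_compact R a' b')).
exists (`|M + 1|) => // t tab; apply: le_trans (ler_norm _) _.
apply: (@le_trans _ _ (M + 1)); last exact: ler_norm.
apply: HM; first by rewrite ltrDl.
by exists t => //=; rewrite in_itv.
Qed.

(** A lateral trace is tested on every boundary arc, not only on the chart. On any arc [al n] equals
    its lateral value, so the error is the squared one-dimensional one times the length of the
    parameter interval and a bound [M] for the speed. *)
Lemma lateral_value_of_limit al u (c : mR -> R) : H1C u -> papprox al u ->
  measurable_fun [set: mR] c -> L2I c ->
  NI (fun z => lt (al n) z - c z) @[n --> \oo] --> (0 : R) -> lateral_value Omega h u c.
Proof.
move=> Hu alu mc Lc H; exists (fun p => c p.2); split; last by [].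
split; first exact: (measurableT_comp mc measurable_snd).
exists al; split; first exact: (preH_approx_H1 oOmega bOmega clambda Lam0 lambda_bounds Hu alu).
have [pal _ _] := alu.
move=> a' b' x y [ab' sx sy _ bxy].
have Llat n : L2I (lt (al n)) by have [] := lat_L2 oOmega bOmega h0 ab k0 spsi bpsi inO (pal n).
have Ld n := L2B mI (Llat n) Lc.
have [M M0 HM] := speed_bounded a' b' sx sy.
have mA' : measurable (`[a', b'] `*` `[0%R, h] : set mR2).
  by apply: measurableX; exact: measurable_itv.
pose F n (s : mR2) : \bar R := ((lt (al n) s.2 - c s.2) ^+ 2 * speed x y s.1)%:E.
pose G n (s : mR2) : \bar R := (M%:E * ((lt (al n) s.2 - c s.2) ^+ 2)%:E)%E.
have mlat n : measurable_fun [set: mR2] (fun s => lt (al n) s.2 - c s.2).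
  apply: measurable_funB; last exact: (measurableT_comp mc measurable_snd).
  have [sal _ _] := pal n.
  exact: (measurableT_comp (cont_measurable1 (continuous_lat (psi := psi) sal)) measurable_snd).
have msq n : measurable_fun [set: mR2] (fun s => (lt (al n) s.2 - c s.2) ^+ 2).
  exact: measurable_funX.
have mEq n : measurable_fun [set: mR2] (fun s => ((lt (al n) s.2 - c s.2) ^+ 2)%:E).
  by apply/measurable_EFinP; exact: msq.
have msp : measurable_fun [set: mR2] (fun s => speed x y s.1).
  exact: (measurableT_comp (cont_measurable1 (continuous_speed sx sy)) measurable_fst).
have mF n : measurable_fun (`[a', b'] `*` `[0%R, h] : set mR2) (F n).
  by apply: measurable_funTS; apply/measurable_EFinP; exact: measurable_funM.
have mG n : measurable_fun (`[a', b'] `*` `[0%R, h] : set mR2) (G n).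
  by apply: measurable_funTS; apply: measurable_funeM; exact: mEq.
have E n : (\int[@leb2 R]_(s in `[a', b'] `*` `[0%R, h])
    ((al n (x s.1, y s.1, s.2) - c (x s.1, y s.1, s.2).2) ^+ 2 * speed x y s.1)%:E =
    \int[@leb2 R]_(s in `[a', b'] `*` `[0%R, h]) F n s)%E.
  apply: eq_integral => s /set_mem[/= s1 s2]; congr (((_ - _) ^+ 2 * _)%:E).
  apply: (lat_boundary k ab bpsi (pal n)); last by move: s2; rewrite in_itv.
  by apply: bxy; move: s1; rewrite in_itv.
under eq_fun do rewrite E.
have FG n : (\int[@leb2 R]_(s in `[a', b'] `*` `[0%R, h]) F n s <=
    (M * ((b' - a') * NI (fun z => lt (al n) z - c z) ^+ 2))%:E)%E.
  apply: (@le_trans _ _ (\int[@leb2 R]_(s in `[a', b'] `*` `[0%R, h]) G n s)%E).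
    apply: ge0_le_integral => //.
    - by move=> s _; rewrite lee_fin mulr_ge0// ?sqr_ge0// sqrtr_ge0.
    move=> s [/= s1 _]; rewrite /F /G -EFinM lee_fin mulrC; apply: ler_wpM2r; first exact: sqr_ge0.
    by apply: HM; move: s1; rewrite in_itv.
  rewrite /G (ge0_integralZl (@leb2 R) mA' (measurable_funTS (mEq n))
     (fun s _ => sqr_ge0E _)) ?lee_fin//.
  rewrite EFinM; apply: lee_wpmul2l; first by rewrite lee_fin.
  have := E2_strip (ltW ab') (Ld n).1; rewrite (E2_L2norm mI (Ld n)) -EFinM => <-.
  exact: lexx.
apply: (@squeeze_cvge _ _ _ _ (fun=> 0%E) _
  (fun n => (M * ((b' - a') * NI (fun z => lt (al n) z - c z) ^+ 2))%:E)).
- apply: nearW => n; rewrite FG andbT; apply: integral_ge0 => s _.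
  by rewrite lee_fin mulr_ge0// ?sqr_ge0// sqrtr_ge0.
- exact: cvg_cst.
- apply: cvg_EFin; first exact: nearW.
  have -> : fine \o (fun n => (M * ((b' - a') * NI (fun z => lt (al n) z - c z) ^+ 2))%:E) =
      (fun n => M * ((b' - a') * (NI (fun z => lt (al n) z - c z) * NI (fun z => lt (al n) z - c z)))).
    by apply/funext => n; rewrite /= expr2.
  do 2 apply: null_scale; rewrite -[X in _ --> X](mulr0 (0 : R)); exact: cvgM.
Qed.

End LateralValue.

(** * Convergence of lateral values in H^(1/2) *)

Section LateralLimit.
Context (R : realType).
Local Notation pt := (R * R * R)%type.
Local Notation mR := (measurableTypeR R).
Local Notation mR2 := (mR * mR)%type.
Local Notation mpt := (mR * mR * mR)%type.
Local Notation mu := (@leb3 R).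
Variables (Omega : set (R * R)) (h : R) (lambda : R -> R) (Lam : R).
Hypothesis oOmega : open Omega.
Hypothesis bOmega : bounded_set Omega.
Hypothesis h0 : 0 < h.
Hypothesis clambda : continuous lambda.
Hypothesis Lam0 : 0 < Lam.
Hypothesis lambda_bounds : forall z, 0 <= z <= h -> Lam^-1 <= lambda z <= Lam.
Local Notation C := (cyl Omega h).
Local Notation N := (L2norm mu C).
Local Notation H1C := (H1 Omega h).
Local Notation nH := (normH Omega h lambda).
Local Notation pre := (preH Omega h).
Local Notation I := (`[0%R, h]%classic : set mR).
Local Notation S := (`[0%R, h] `*` `[0%R, h] : set mR2).
Local Notation NI := (L2norm (@leb1 R) I).
Local Notation NS := (L2norm (@leb2 R) S).
Local Notation L2I := (L2 (@leb1 R) I).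
Let mC : measurable (C : set mpt) := measurable_cyl h oOmega.
Let mI : measurable I. Proof. exact: measurable_itv. Qed.
Let mS : measurable S. Proof. exact: measurableX. Qed.

Variables (swap flip : bool) (psi : R -> R) (a b k : R).
Hypothesis ab : a < b.
Hypothesis k0 : 0 < k.
Hypothesis spsi : smooth psi.
Hypothesis bpsi : forall t, a <= t <= b -> boundary Omega (unorient swap flip t (psi t)).
Hypothesis inO : forall t r, a <= t <= b -> 0 < r <= h ->
  Omega (unorient swap flip t (psi t + k * r)).
Local Notation A := (`[a, b] `*` `[0%R, h] : set mR2).
Local Notation L2A := (L2 (@leb2 R) A).
Let cpsi : continuous psi := smooth_cont spsi.
Let mA : measurable A. Proof. by apply: measurableX; exact: measurable_itv. Qed.

Local Notation papprox := (preH_approx Omega h lambda).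
Local Notation sd := (side swap flip psi k).
Local Notation lt := (lat swap flip psi a k).
Local Notation x0 := (arc1 swap flip psi k).
Local Notation y0 := (arc2 swap flip psi k).

Let ba : 0 < b - a. Proof. by rewrite subr_gt0. Qed.

Lemma normH_dist (u v w : pt -> R) : H1C u -> H1C v -> H1C w ->
  nH (u \- v) <= nH (u \- w) + nH (v \- w).
Proof.
move=> Hu Hv Hw; rewrite (normHBC oOmega bOmega clambda Lam0 lambda_bounds Hv Hw).
have := normH_triangle oOmega bOmega clambda Lam0 lambda_bounds
  (H1B oOmega bOmega Hu Hw) (H1B oOmega bOmega Hw Hv).
by rewrite (_ : (u \- w) \+ (w \- v) = u \- v)//; apply/funext => p /=; rewrite addrA subrK.
Qed.

Section sequence.
Variables (al : nat -> pt -> R) (u : pt -> R).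
Hypothesis Hu : H1C u.
Hypothesis alu : papprox al u.

Let pal n : pre (al n). Proof. by case: alu. Qed.
Let Hal n : H1C (al n) := preH_H1 oOmega bOmega (pal n).
Let al_cvg : nH (al n \- u) @[n --> \oo] --> (0 : R). Proof. by case: alu. Qed.
Let Llat n : L2I (lt (al n)).
Proof. by have [] := lat_L2 oOmega bOmega h0 ab k0 spsi bpsi inO (pal n). Qed.

(** L^2 convergence is upgraded to H^(1/2). For fixed [n] the lateral values of [al n - al m] tend
    to [lat (al n) - c] as [m] grows, with seminorms at most [K] times the sum of the energy
    distances of [al n] and [al m] to [u]; lower semicontinuity bounds the limit by [K] times the
    distance of [al n] alone. *)
Lemma H12_lat_limit (c : mR -> R) : L2I c ->
  NI (fun z => lt (al n) z - c z) @[n --> \oo] --> (0 : R) ->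
  H12 h c /\ H12norm h (fun z => lt (al n) z - c z) @[n --> \oo] --> (0 : R).
Proof.
move=> Lc H.
have [K K0 HK] := lat_bound oOmega bOmega h0 clambda Lam0 lambda_bounds ab k0 spsi bpsi inO.
have Hlat n : H12 h (lt (al n)) by have [] := HK _ (pal n).
have Kc : (fun m => K * nH (al m \- u)) m @[m --> \oo] --> (0 : R) by exact: null_scale.
have Hc : H12 h c.
  have B m : NS (quotient (lt (al m))) <= K * nH u + K * nH (al m \- u).
    have [_ _ /le_trans] := HK _ (pal m); apply; rewrite -mulrDr; apply: ler_wpM2l => //.
    rewrite addrC; have Hd := H1B oOmega bOmega (Hal m) Hu.
    have := normH_triangle oOmega bOmega clambda Lam0 lambda_bounds Hd Hu.
    by rewrite (_ : (al m \- u) \+ u = al m)//; apply/funext => p /=; rewrite subrK.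
  exact: (gagliardo_limit h0 Hlat Lc H B Kc).1.
split => //.
have Q n : H12 h (fun z => lt (al n) z - c z) /\
    NS (quotient (fun z => lt (al n) z - c z)) <= K * nH (al n \- u).
  have pd m : pre (al n \- al m) := preHB oOmega bOmega (pal n) (pal m).
  have Hd m : H12 h (lt (al n \- al m)) by have [] := HK _ (pd m).
  have cd : NI (fun z => lt (al n \- al m) z - (lt (al n) z - c z)) @[m --> \oo] --> (0 : R).
    have E m : NI (fun z => lt (al n \- al m) z - (lt (al n) z - c z)) =
        NI (fun z => lt (al m) z - c z).
      rewrite (L2normBC (@leb1 R) I (lt (al m))); congr L2norm; apply/funext => z.
      by rewrite /lat /=; ring.
    by under eq_fun do rewrite E.
  have B m : NS (quotient (lt (al n \- al m))) <= K * nH (al n \- u) + K * nH (al m \- u).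
    have [_ _ /le_trans] := HK _ (pd m); apply; rewrite -mulrDr; apply: ler_wpM2l => //.
    exact: normH_dist.
  exact: (gagliardo_limit h0 Hd (L2B mI (Llat n) Lc) cd B Kc).
apply: (squeeze0 (K := 1) _ _ (null_add H Kc)) => [n|n]; first exact: H12norm_ge0.
have [HQ BQ] := Q n; rewrite mul1r; apply: (le_trans (H12norm_le HQ)).
by rewrite lerD2l.
Qed.

Lemma lateral_exists : exists c, H12 h c /\ lateral_value Omega h u c.
Proof.
have [K K0 HK] := lat_bound oOmega bOmega h0 clambda Lam0 lambda_bounds ab k0 spsi bpsi inO.
have Kc : (fun m => K * nH (al m \- u)) m @[m --> \oo] --> (0 : R) by exact: null_scale.
have B n m : NI (fun z => lt (al n) z - lt (al m) z) <= K * nH (al n \- u) + K * nH (al m \- u).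
  have [_ /le_trans B _] := HK _ (preHB oOmega bOmega (pal n) (pal m)).
  apply: B; rewrite -mulrDr; apply: ler_wpM2l => //; exact: normH_dist.
have [g Lg Hg] := L2_complete_norm mI Llat B Kc.
(* Extended by 0 outside [[0, h]], to be measurable on the whole line. *)
pose c : mR -> R := g \_ I.
have mc : measurable_fun [set: mR] c by apply/(measurable_restrictT g mI); exact: Lg.1.
have cg : ae_eq (@leb1 R) I g c by apply: aeW => z Iz; rewrite /c patchE mem_set.
have Lc : L2I c by exact: (L2_ae mI (measurable_funTS mc) cg Lg).
have gc0 : NI (fun z => g z - c z) <= 0.
  have ae0 : ae_eq (@leb1 R) I (fun z => g z - c z) (fun=> 0).
    by apply: aeW => z Iz; rewrite /c patchE mem_set// subrr.
  by rewrite (L2norm_ae mI (L2B mI Lg Lc) (L2_cst0 _ _) ae0) L2norm0.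
have Hc := L2_limit_change mI Llat Lg Lc gc0 Hg.
exists c; split; first by have [] := H12_lat_limit Lc Hc.
exact: (lateral_value_of_limit oOmega bOmega h0 clambda Lam0 lambda_bounds ab k0 spsi bpsi inO Hu alu mc Lc Hc).
Qed.

(** Uniqueness of the lateral value. The trace [t] is known along its own sequence [v] and with the
    weight [speed]; as the weight is at least 1 on the chart, [t] is a plain L^2 limit there, and
    [trace_limit] carries it over to [al]. On the chart both sides depend on [z] only, which brings
    the norm down to [[0, h]]. *)
Lemma lateral_value_limit (c : mR -> R) : lateral_value Omega h u c ->
  L2I c /\ NI (fun z => lt (al n) z - c z) @[n --> \oo] --> (0 : R).
Proof.
move=> [t [[mt [v [vu Hv]]] tc]]; have [_ sv _ _] := vu.
have [cA s1 s2 _ _] : boundary_arc Omega a b x0 y0 := chart_arc k ab spsi bpsi.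
have arcE s : (x0 s.1, y0 s.1, s.2) = sd s.
  by rewrite /side /arc1 /arc2; case: (chart _ _ _ _ _ _).
have LA (w : pt -> R) : smooth w -> L2A (fun s => w (sd s)).
  by move=> sw; have [] := side_bound oOmega bOmega h0 k0 spsi inO sw.
have bd s : A s -> boundary Omega (chart swap flip psi k s.1 0) /\ 0 <= s.2 <= h.
  move=> [/= i1 i2]; split; last by move: i2; rewrite in_itv.
  by rewrite chart0; apply: bpsi; move: i1; rewrite in_itv.
have mside : measurable_fun [set: mR2] (sd : mR2 -> mpt).
  apply: measurable_fun_pair; last exact: measurable_snd.
  have -> : (fun s : mR2 => chart swap flip psi k s.1 0) = (fun s : mR2 => (x0 s.1, y0 s.1)).
    by apply/funext => s; rewrite /arc1 /arc2; case: (chart _ _ _ _ _ _).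
  apply: measurable_fun_pair.
  - exact: (measurableT_comp (cont_measurable1 (smooth_cont s1)) measurable_fst).
  - exact: (measurableT_comp (cont_measurable1 (smooth_cont s2)) measurable_fst).
have mt' : measurable_fun [set: mR2] (fun s => t (sd s)) by exact: (measurableT_comp mt mside).
have mv n : measurable_fun [set: mR2] (fun s => v n (sd s)).
  by apply: continuous_measurable2; apply: (continuous_on_side spsi); exact: smooth_cont.
have vt : E2 (@leb2 R) A (fun s => v n (sd s) - t (sd s))%R @[n --> \oo] --> 0%E.
  apply: (@squeeze_cvge _ _ _ _ (fun=> 0%E) _ _ _ _ _ (Hv a b x0 y0 (chart_arc k ab spsi bpsi))); last exact: cvg_cst.
  apply: nearW => n; rewrite E2_ge0 /=.
  have -> : E2 (@leb2 R) A (fun s => v n (sd s) - t (sd s))%R =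
      (\int[@leb2 R]_(s in A) ((v n (x0 s.1, y0 s.1, s.2) - t (x0 s.1, y0 s.1, s.2)) ^+ 2)%:E)%E.
    by apply: eq_integral => s _; rewrite arcE.
  have md : measurable_fun [set: mR2] (fun s => v n (x0 s.1, y0 s.1, s.2) - t (x0 s.1, y0 s.1, s.2)).
    under eq_fun do rewrite arcE; exact: measurable_funB.
  have msp : measurable_fun [set: mR2] (fun s => speed x0 y0 s.1).
    exact: (measurableT_comp (cont_measurable1 (continuous_speed s1 s2)) measurable_fst).
  apply: ge0_le_integral.
  - exact: mA.
  - by move=> s _; exact: sqr_ge0E.
  - by apply: measurable_funTS; apply/measurable_EFinP; exact: measurable_funX.
  - apply: measurable_funTS; apply/measurable_EFinP.
    exact: (measurable_funM (measurable_funX _ md) msp).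
  - move=> s _; rewrite lee_fin -[leLHS]mulr1; apply: ler_wpM2l; first exact: sqr_ge0.
    exact: speed_chart_ge1.
have [Lt Ht] := L2_of_null mA (fun n => LA _ (sv n)) (measurable_funTS mt') vt.
have [||||g Lg Hg] := @trace_limit R Omega h oOmega bOmega _ _ (@leb2 R) A mA
  sd (@smooth R pt) (chart_dir swap flip k) (side_const h k) (side_const_ge0 h0 k0) _ _ _ _ v u sv vu.
- by move=> f g sf sg; exact: smoothB.
- by move=> f sf; exact: H1_smooth.
- by move=> f sf; exact: LA.
- by move=> f sf; have [] := side_bound oOmega bOmega h0 k0 spsi inO sf.
have sal n : smooth (al n) by have [] := pal n.
have ala := preH_approx_H1 oOmega bOmega clambda Lam0 lambda_bounds Hu alu.
have gt0 := L2_limit_unique mA (fun n => LA _ (sv n)) Lg Lt (Hg v sv vu) Ht.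
have alt := L2_limit_change mA (fun n => LA _ (sal n)) Lg Lt gt0 (Hg al sal ala).
have mc : measurable_fun I c.
  apply: (@eq_measurable_fun _ _ _ _ I (fun z => t (sd (a, z)))).
    move=> z /set_mem Iz; have [|b1 b2] := bd (a, z).
      by split => //=; rewrite in_itv/= lexx ltW.
    exact: tc.
  apply: measurable_funTS; exact: (measurableT_comp mt' (pair1_measurable a)).
have E n : ae_eq (@leb2 R) A (fun s => al n (sd s) - t (sd s)) (fun s => lt (al n) s.2 - c s.2).
  apply: aeW => s As; have [b1 b2] := bd s As.
  by rewrite /side (lat_boundary k ab bpsi (pal n) b1 b2) (tc _ _ b1 b2).
have md n : measurable_fun I (fun z => lt (al n) z - c z).
  by apply: measurable_funB => //; exact: (Llat n).1.
have Ld n : L2A (fun s => al n (sd s) - t (sd s)) := L2B mA (LA _ (sal n)) Lt.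
have Ld' n : L2A (fun s => lt (al n) s.2 - c s.2).
  apply: (L2_ae mA _ (E n) (Ld n)).
  apply: (@eq_measurable_fun _ _ _ _ A (fun s => al n (sd s) - t (sd s))); last exact: (Ld n).1.
  move=> s /set_mem As; have [b1 b2] := bd s As.
  by rewrite /side (lat_boundary k ab bpsi (pal n) b1 b2) (tc _ _ b1 b2).
have S1 n := NA_strip ab (Ld' n) (md n).
split.
  have E0 : c = (fun z => lt (al 0%N) z - (lt (al 0%N) z - c z)).
    by apply/funext => z; rewrite opprB addrC subrK.
  by rewrite E0; exact: (L2B mI (Llat 0) (S1 0%N).1).
apply: (@squeeze0 _ _ _ (1 + (b - a)^-1) _ _ alt) => [n|n]; first exact: L2norm_ge0.
apply: (le_trans (S1 n).2); apply: ler_wpM2l; first by rewrite addr_ge0// invr_ge0 ltW.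
by rewrite (L2norm_ae mA (Ld n) (Ld' n) (E n)).
Qed.

(** The choice made by [lateral] is eliminated here: some function satisfies both clauses, hence the
    selected one does, and every lateral value is the limit of those of [al]. *)
Lemma lateral_cvg : H12 h (lateral Omega h u) /\ lateral_value Omega h u (lateral Omega h u) /\
  H12norm h (fun z => lt (al n) z - lateral Omega h u z) @[n --> \oo] --> (0 : R).
Proof.
have [c0 Hc0] := lateral_exists.
have [Hl vl] : H12 h (lateral Omega h u) /\ lateral_value Omega h u (lateral Omega h u).
  exact: (@xgetPex _ (fun=> 0) [set c | H12 h c /\ lateral_value Omega h u c] (ex_intro _ c0 Hc0)).
have [Lc Nc] := lateral_value_limit vl.
by split => //; split => //; have [] := H12_lat_limit Lc Nc.
Qed.

End sequence.

End LateralLimit.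

(** * The variational problem *)

Section Representation.
Context (R : realType).
Local Notation pt := (R * R * R)%type.
Local Notation mR := (measurableTypeR R).
Local Notation mpt := (mR * mR * mR)%type.
Local Notation mu := (@leb3 R).
Local Notation ex := (@ex R).
Local Notation ey := (@ey R).
Local Notation ez := (@ez R).
Variables (Omega : set (R * R)) (h : R) (lambda : R -> R) (Lam : R).
Hypothesis oOmega : open Omega.
Hypothesis bOmega : bounded_set Omega.
Hypothesis h0 : 0 < h.
Hypothesis clambda : continuous lambda.
Hypothesis Lam0 : 0 < Lam.
Hypothesis lambda_bounds : forall z, 0 <= z <= h -> Lam^-1 <= lambda z <= Lam.
Local Notation C := (cyl Omega h).
Local Notation L2C := (L2 mu C).
Local Notation N := (L2norm mu C).
Local Notation D := (wder Omega h).
Local Notation wd := (is_weak_der Omega h).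
Local Notation H1C := (H1 Omega h).
Local Notation dot := (dotH Omega h lambda).
Local Notation nH := (normH Omega h lambda).
Local Notation pre := (preH Omega h).
Local Notation papprox := (preH_approx Omega h lambda).
Let mC : measurable (C : set mpt) := measurable_cyl h oOmega.

Lemma opp_arith (x y x' y' a b : R) : x = - y -> `|x' - x| <= a -> `|y' - y| <= b ->
  `|x' - - y'| <= a + b.
Proof.
move=> -> H1' H2; have -> : x' - - y' = (x' - - y) + (y' - y) by ring.
by apply: (le_trans (ler_normD _ _)); apply: lerD.
Qed.

(** Weak differentiation is a closed operator: by Cauchy-Schwarz both sides of the defining identity
    pass to L^2 limits. *)
Lemma weak_der_limit (e : pt) (u_ : nat -> pt -> R) (u w : pt -> R) :
  (forall n, H1C (u_ n)) -> L2C u -> L2C w ->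
  N (fun p => u_ n p - u p) @[n --> \oo] --> (0 : R) ->
  N (fun p => D e (u_ n) p - w p) @[n --> \oo] --> (0 : R) -> wd e u w.
Proof.
move=> Hu_ Lu Lw uu uw; apply: (weak_derI Lw) => psi tpsi.
have Lpsi := test_L2 oOmega bOmega tpsi.
have LDpsi := test_derive_L2 oOmega bOmega e tpsi.
apply: (@eq_of_null _ (fun n => N ('D_e psi) * N (fun p => u_ n p - u p) +
    N psi * N (fun p => D e (u_ n) p - w p))); last first.
  exact: (null_add (null_scale _ uu) (null_scale _ uw)).
move=> n; have Ln := H1_L2 (Hu_ n); have Wn := wder_L2 e (Hu_ n).
apply: (opp_arith (weak_der_ip (wderP e (Hu_ n)) tpsi)).
- rewrite -(ipBl mC Lu Ln LDpsi) mulrC (L2normBC mu C (u_ n) u).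
  exact: (L2_cauchy_schwarz mC (L2B mC Lu Ln) LDpsi).
- rewrite -(ipBl mC Lw Wn Lpsi) mulrC (L2normBC mu C (D e (u_ n)) w).
  exact: (L2_cauchy_schwarz mC (L2B mC Lw Wn) Lpsi).
Qed.

Let eps (n : nat) : R := Num.sqrt n.+1%:R^-1.

Let eps0 : eps n @[n --> \oo] --> (0 : R).
Proof.
rewrite -[X in _ --> X](@sqrtr0 R).
apply: (@cvg_comp _ _ _ (fun n : nat => n.+1%:R^-1 : R) (@Num.sqrt R)); last exact: sqrt_continuous.
exact: (@cvg_harmonic R).
Qed.

Lemma preH_0 : pre 0.
Proof.
split; first exact: (@smooth_cst R pt 0).
- by rewrite /Rintegral integral0.
- by exists (fun=> 0).
Qed.

Let Slin (a : R) (u v : pt -> R) : pre u -> pre v -> pre (a *: u + v).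
Proof. exact: preH_lincomb. Qed.

Let Bsym (u v : pt -> R) : pre u -> pre v -> dot u v = dot v u.
Proof. by move=> _ _; exact: dotHC. Qed.

Let Blin (a : R) (u v w : pt -> R) : pre u -> pre v -> pre w ->
  dot (a *: u + v) w = a * dot u w + dot v w.
Proof.
move=> /(preH_H1 oOmega bOmega) Hu /(preH_H1 oOmega bOmega) Hv /(preH_H1 oOmega bOmega) Hw.
exact: (dotH_lin oOmega bOmega clambda Lam0 lambda_bounds a Hu Hv Hw).
Qed.

Let Bge0 (u : pt -> R) : pre u -> 0 <= dot u u.
Proof.
by move=> /(preH_H1 oOmega bOmega) Hu; exact: (dotH_ge0 oOmega clambda Lam0 lambda_bounds Hu).
Qed.

Lemma wderB_ae (e : pt) (u v : pt -> R) : H1C u -> H1C v ->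
  ae_eq mu C (D e (u \- v)) (fun p => D e u p - D e v p).
Proof.
move=> Hu Hv; have E : u \- v = (fun p => -1 * v p + u p).
  by apply/funext => p; rewrite mulN1r addrC.
have := wder_lincomb oOmega bOmega e (-1) Hv Hu; rewrite E; apply: filterS => p H Cp.
by rewrite (H Cp) mulN1r addrC.
Qed.

Lemma L2norm_wderB (e : pt) (u v : pt -> R) : H1C u -> H1C v ->
  N (D e (u \- v)) = N (fun p => D e u p - D e v p).
Proof.
move=> Hu Hv; apply: (L2norm_ae mC); last exact: wderB_ae.
- exact: (wder_L2 e (H1B oOmega bOmega Hu Hv)).
- exact: (L2B mC (wder_L2 e Hu) (wder_L2 e Hv)).
Qed.

(** By the Poincare inequality an energy-Cauchy sequence is Cauchy in L^2 together with its
    derivatives; the limits of the derivatives are weak derivatives of the limit, so the limit is a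
    function and not an abstract element of a completion. *)
Lemma preH_complete (u_ : nat -> pt -> R) (b : nat -> R) :
  (exists2 K : R, 0 <= K & forall al, pre al -> N al <= K * nH al) ->
  (forall n, pre (u_ n)) -> (forall n m, nH (u_ n \- u_ m) <= b n + b m) ->
  b n @[n --> \oo] --> (0 : R) -> exists2 u, H1C u & papprox u_ u.
Proof.
move=> [K K0 HK] pu ub b0.
have Hu_ n : H1C (u_ n) := preH_H1 oOmega bOmega (pu n).
have [u Lu uu] : exists2 u, L2C u & N (fun p => u_ n p - u p) @[n --> \oo] --> (0 : R).
  apply: (@L2_complete_norm _ _ _ _ _ mC u_ (fun n => K * b n)) => [n|n m|].
  - exact: H1_L2.
  - apply: (le_trans (HK _ (preHB oOmega bOmega (pu n) (pu m)))).
    by rewrite -mulrDr; apply: ler_wpM2l.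
  - exact: null_scale.
have W e : exists2 w, L2C w & N (fun p => D e (u_ n) p - w p) @[n --> \oo] --> (0 : R).
  have [Ke Ke0 HKe] := wder_le_normH oOmega bOmega clambda Lam0 lambda_bounds e.
  apply: (@L2_complete_norm _ _ _ _ _ mC (fun n => D e (u_ n)) (fun n => Ke * b n)) => [n|n m|].
  - exact: wder_L2.
  - rewrite -(L2norm_wderB e (Hu_ n) (Hu_ m)).
    apply: (le_trans (HKe _ (H1B oOmega bOmega (Hu_ n) (Hu_ m)))).
    by rewrite -mulrDr; apply: ler_wpM2l.
  - exact: null_scale.
have wdW e w : L2C w -> N (fun p => D e (u_ n) p - w p) @[n --> \oo] --> (0 : R) -> wd e u w.
  by move=> Lw uw; exact: (weak_der_limit Hu_ Lu Lw uu uw).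
have Hu : H1C u.
  have [w1 L1 c1] := W ex; have [w2 L2' c2] := W ey; have [w3 L3 c3] := W ez.
  split => // v; exists (fun p => v.1.1 * w1 p + (v.1.2 * w2 p + v.2 * w3 p)).
  exact: (weak_der_comb oOmega bOmega v Lu (wdW ex w1 L1 c1) (wdW ey w2 L2' c2) (wdW ez w3 L3 c3)).
exists u => //.
have Dcvg e : N (D e (u_ n \- u)) @[n --> \oo] --> (0 : R).
  have [w Lw cw] := W e; have aew := wder_ae oOmega bOmega (wdW e w Lw cw) Hu.
  under eq_fun do rewrite (L2norm_wderB e (Hu_ _) Hu).
  have E n : N (fun p => D e (u_ n) p - D e u p) = N (fun p => D e (u_ n) p - w p).
    apply: (L2norm_ae mC).
    - exact: (L2B mC (wder_L2 e (Hu_ n)) (wder_L2 e Hu)).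
    - exact: (L2B mC (wder_L2 e (Hu_ n)) Lw).
    - by apply: filterS aew => p H Cp; rewrite (H Cp).
  by under eq_fun do rewrite E.
split => //.
apply: (@squeeze0 _ _ (fun n => N (D ex (u_ n \- u)) + N (D ey (u_ n \- u)) +
   (1 + Lam) * N (D ez (u_ n \- u))) 1).
- by move=> n; exact: normH_ge0.
- move=> n; rewrite mul1r.
  exact: (normH_le oOmega clambda Lam0 lambda_bounds (H1B oOmega bOmega (Hu_ n) Hu)).
- exact: (null_add (null_add (Dcvg ex) (Dcvg ey)) (null_scale _ (Dcvg ez))).
Qed.

Lemma le_of_sqr_le (x K : R) : 0 <= x -> 0 <= K -> x ^+ 2 <= K * x -> x <= K.
Proof. by rewrite le_eqVlt => /orP[/eqP <- //|x0] K0; rewrite expr2 ler_pM2r. Qed.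

Lemma energy_limit_arith (n2 K n d uu un fn nn : R) : n2 = uu -> un = fn -> 0 <= n -> 0 <= K ->
  `|uu - un| <= n * d -> `|fn| <= K * nn -> nn <= d + n -> n2 <= K * n + (n + K) * d.
Proof.
move=> -> -> n0 K0; rewrite ler_norml => /andP[_ b1]; rewrite ler_norml => /andP[_ b2] b3.
have := ler_wpM2l K0 b3; nra.
Qed.

(** [riesz_sequence] supplies near-solutions and [preH_complete] their limit [u]. For the norm
    bound, [dot u (u_ n) = F (u_ n)] tends to the square of the norm of [u] and is at most [K] times
    the norm of [u_ n]. *)
Lemma riesz_preH (F : (pt -> R) -> R) (K : R) : 0 <= K ->
  (exists2 K : R, 0 <= K & forall al, pre al -> N al <= K * nH al) ->
  (forall (a : R) u v, pre u -> pre v -> F (fun p => a * u p + v p) = a * F u + F v) ->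
  (forall u, pre u -> `|F u| <= K * nH u) ->
  exists u, [/\ H1C u, exists al, papprox al u, forall al, pre al -> dot u al = F al &
    nH u <= K].
Proof.
move=> K0 poincare Flin Fb.
have [u_ [pu ub uF]] := riesz_sequence preH_0 Slin Bsym Blin Bge0 Flin Fb.
have [u Hu uu] := preH_complete poincare pu ub eps0.
have Hu_ n : H1C (u_ n) := preH_H1 oOmega bOmega (pu n).
have [_ nu _] := uu.
have rep al : pre al -> dot u al = F al.
  move=> pal; have Hal := preH_H1 oOmega bOmega pal.
  apply: (@eq_of_null _ (fun n => nH al * nH (u_ n \- u) + nH al * eps n)); last first.
    exact: (null_add (null_scale _ nu) (null_scale _ eps0)).
  move=> n.
  have b1 : `|dot u al - dot (u_ n) al| <= nH al * nH (u_ n \- u).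
    rewrite distrC -(dotHB oOmega bOmega clambda Lam0 lambda_bounds (Hu_ n) Hu Hal) mulrC.
    exact: (dotH_cauchy_schwarz oOmega bOmega clambda Lam0 lambda_bounds (H1B oOmega bOmega (Hu_ n) Hu) Hal).
  have b2 : `|dot (u_ n) al - F al| <= nH al * eps n by rewrite mulrC; exact: uF.
  have -> : dot u al - F al = (dot u al - dot (u_ n) al) + (dot (u_ n) al - F al).
    by rewrite addrA subrK.
  by apply: (le_trans (ler_normD _ _)); apply: lerD.
exists u; split => //; first by exists u_.
apply: le_of_sqr_le => //; first exact: normH_ge0.
apply: (@le_of_null _ (fun n => (nH u + K) * nH (u_ n \- u))); last exact: null_scale.
move=> n; have Hd := H1B oOmega bOmega (Hu_ n) Hu.
have b1 : `|dot u u - dot u (u_ n)| <= nH u * nH (u_ n \- u).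
  rewrite distrC (dotHC Omega h lambda u (u_ n)).
  rewrite -(dotHB oOmega bOmega clambda Lam0 lambda_bounds (Hu_ n) Hu Hu) mulrC.
  exact: (dotH_cauchy_schwarz oOmega bOmega clambda Lam0 lambda_bounds Hd Hu).
have b3 : nH (u_ n) <= nH (u_ n \- u) + nH u.
  have := normH_triangle oOmega bOmega clambda Lam0 lambda_bounds Hd Hu.
  by rewrite (_ : (u_ n \- u) \+ u = u_ n)//; apply/funext => p /=; rewrite subrK.
exact: (energy_limit_arith (normH_sqr oOmega clambda Lam0 lambda_bounds Hu) (rep _ (pu n))
  (normH_ge0 _ _ _ _) K0 b1 (Fb _ (pu n)) b3).
Qed.

End Representation.

(** * Integration by parts in z *)

Section VerticalParts.
Context (R : realType).
Local Notation pt := (R * R * R)%type.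
Local Notation leb := (@lebesgue_measure R).
Local Notation mR := (measurableTypeR R).
Local Notation mpt := (mR * mR * mR)%type.
Local Notation mu := (@leb3 R).
Local Notation ez := (@ez R).
Variables (Omega : set (R * R)) (h : R).
Hypothesis oOmega : open Omega.
Hypothesis bOmega : bounded_set Omega.
Hypothesis h0 : 0 < h.
Local Notation C := (cyl Omega h).
Local Notation ipU := (@ip _ _ R mu C).
Local Notation N := (L2norm mu C).
Local Notation D := (wder Omega h).
Let mC : measurable (C : set mpt) := measurable_cyl h oOmega.
Let mI : measurable (`[0, h]%classic : set mR). Proof. exact: measurable_itv. Qed.

Lemma smooth_integrable (f : pt -> R) : smooth f -> mu.-integrable C (EFin \o f).
Proof.
move=> sf; have := L2_integrable_mul mC (smooth_L2 h oOmega bOmega sf)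
  (smooth_L2 h oOmega bOmega (@smooth_cst R pt 1)).
by congr (integrable _ _ _); apply/funext => p; rewrite /= mulr1.
Qed.

Lemma integral_vertical (F : pt -> R) : smooth F ->
  (forall q, F (q, 0) = 0 /\ F (q, h) = 0) ->
  (\int[mu]_(p in C) ('D_ez F p)%:E = 0)%E.
Proof.
move=> sF F0; have iF := smooth_integrable (smooth_derive ez sF).
have iP : mu.-integrable [set: mpt] ((EFin \o 'D_ez F) \_ C) by apply/(integrable_mkcond _ mC).
rewrite integral_mkcond (leb3_Fubini12 iP).
rewrite (@eq_integral _ _ _ _ _ (fun=> 0%E)) ?integral0// => q _.
have [Oq|nOq] := pselect (Omega q); last first.
  rewrite (@eq_integral _ _ _ _ _ (fun=> 0%E)) ?integral0// => z _.
  by rewrite patchE memNset// => -[].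
transitivity (\int[leb]_(z in `[0%R, h]) ('D_ez F ((q, 0) + z *: ez)%R)%:E)%E.
  rewrite [RHS](@integral_mkcond _ mR R leb `[0%R, h]); apply: eq_integral => z _.
  rewrite !patchE; have [zh|zh] := pselect (`[0%R, h]%classic z).
    by rewrite !mem_set// add_ez add0r.
  by rewrite !memNset// => -[].
rewrite (line_FTC (q, 0) ez sF (ltW h0)) !add_ez !add0r.
by have [-> ->] := F0 q; rewrite subrr.
Qed.

Lemma smooth_parts (F G : pt -> R) : smooth F -> smooth G ->
  (forall q, G (q, 0) = 0 /\ G (q, h) = 0) ->
  ipU ('D_ez F) G = - ipU F ('D_ez G).
Proof.
move=> sF sG G0.
have sFG := smoothM sF sG.
have Z : \int[mu]_(p in C) ('D_ez (fun p => F p * G p) p) = 0.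
  rewrite /Rintegral integral_vertical// => q; have [-> ->] := G0 q.
  by rewrite !mulr0.
have E p : 'D_ez (fun p => F p * G p) p = 'D_ez F p * G p + F p * 'D_ez G p.
  have -> : (fun p => F p * G p) = F * G by [].
  rewrite deriveM; [|exact: (@smooth_derivable R pt F p ez sF)|exact: (@smooth_derivable R pt G p ez sG)].
  by rewrite addrC /GRing.scale /= [G p * _]mulrC.
have LF := smooth_L2 h oOmega bOmega sF; have LG := smooth_L2 h oOmega bOmega sG.
have LDF := smooth_L2 h oOmega bOmega (smooth_derive ez sF).
have LDG := smooth_L2 h oOmega bOmega (smooth_derive ez sG).
have S : ipU ('D_ez F) G + ipU F ('D_ez G) = 0.
  rewrite /ip -(RintegralD mC (L2_integrable_mul mC LDF LG) (L2_integrable_mul mC LF LDG)).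
  by rewrite -[RHS]Z; apply: eq_Rintegral => p _; rewrite E.
by apply/eqP; rewrite -addr_eq0 S.
Qed.

(** [G] vanishes at the two ends but is free on the lateral boundary, so it is not a test function
    for weak derivatives: the identity is proved for the smooth approximations of [u], line by line
    in [z], and passed to the limit. *)
Lemma limit_parts (v : nat -> pt -> R) (u G : pt -> R) : H1_approx Omega h v u -> smooth G ->
  (forall q, G (q, 0) = 0 /\ G (q, h) = 0) ->
  ipU (D ez u) G = - ipU u ('D_ez G).
Proof.
move=> [Hu sv vu Dvu] sG G0.
have Lu := H1_L2 Hu; have Wu := wder_L2 ez Hu.
have LG := smooth_L2 h oOmega bOmega sG.
have LDG := smooth_L2 h oOmega bOmega (smooth_derive ez sG).
have Hv n : H1 Omega h (v n) := H1_smooth h oOmega bOmega (sv n).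
have Wv n := wder_L2 ez (Hv n).
have base n : ipU (v n) ('D_ez G) = - ipU (D ez (v n)) G.
  rewrite (ip_ae mC (Wv n).1 (smooth_L2 h oOmega bOmega (smooth_derive ez (sv n))).1 LG.1
    (wder_smooth h oOmega bOmega ez (sv n))).
  by rewrite (smooth_parts (sv n) sG G0) opprK.
suff : ipU u ('D_ez G) = - ipU (D ez u) G by move=> ->; rewrite opprK.
apply: (@eq_of_null _ (fun n => N ('D_ez G) * N (v n \- u) + N G * N (D ez (v n \- u)))); last first.
  exact: (null_add (null_scale _ vu) (null_scale _ (Dvu ez))).
move=> n; apply: (opp_arith (base n)).
- rewrite -(ipBl mC Lu (H1_L2 (Hv n)) LDG) mulrC (L2normBC mu C (v n) u).
  exact: (L2_cauchy_schwarz mC (L2B mC Lu (H1_L2 (Hv n))) LDG).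
- rewrite -(ipBl mC Wu (Wv n) LG) mulrC (L2norm_wderB oOmega bOmega ez (Hv n) Hu).
  rewrite (L2normBC mu C (D ez (v n)) (D ez u)).
  exact: (L2_cauchy_schwarz mC (L2B mC Wu (Wv n)) LG).
Qed.

Lemma smooth_vertical (phi : R -> R) : smooth phi ->
  smooth (fun p : pt => phi p.2) /\
  forall p v, 'D_v (fun p : pt => phi p.2) p = v.2 * derive1 phi p.2.
Proof.
move=> sphi; have [s d] := @smooth_comp_affine R pt phi (fun p => p.2) (fun p => p.2) sphi
  (@continuous_coord3 R) (fun _ _ _ => erefl).
by split=> [|p v]; [exact: s|rewrite derive1_smooth; exact: d].
Qed.

Lemma test_support (V : normedModType R) (U : set V) (phi : V -> R) x :
  test_fun U phi -> ~ U x -> phi x = 0.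
Proof. by move=> [_ [K [_ KU out]]] nU; apply: out => /KU. Qed.

Lemma test_derive1_support (U : set R) (phi : R -> R) z : test_fun U phi -> ~ U z ->
  derive1 phi z = 0.
Proof.
move=> [_ [K [cK KU out]]] nU; rewrite derive1E.
have nK : (~` K) z by move=> /KU.
have oK : open (~` K) by apply: closed_openC; apply: compact_closed cK; exact: norm_hausdorff.
have Fnear : \near z, phi z = cst 0 z.
  by near=> y; apply: out; near: y; exact: open_nbhs_nbhs.
by rewrite (near_eq_derive (1 : R) Fnear) derive_cst.
Unshelve. all: by end_near.
Qed.

End VerticalParts.

Lemma rhs_arith (R : realType) (x1 x2 x3 x4 nf ng nj G L : R) : 0 <= L -> 0 <= nf -> 0 <= ng ->
  0 <= nj -> 0 <= G -> `|x1| <= nf * G -> `|x2| <= L * ng * G -> `|x3| <= L * ng * G ->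
  `|x4| <= nj * G -> `|- x1 + (x2 + x3) + x4| <= (1 + 2 * L) * (nf + ng + nj) * G.
Proof.
move=> L0 f0 g0 j0 G0 b1 b2 b3 b4.
apply: (le_trans (ler_normD _ _)); apply: (le_trans (lerD (ler_normD _ _) b4)).
apply: (le_trans (lerD (lerD (lexx _) (ler_normD _ _)) (lexx _))); rewrite normrN.
apply: (le_trans (lerD (lerD b1 (lerD b2 b3)) (lexx _))).
have := mulr_ge0 (mulr_ge0 L0 f0) G0; have := mulr_ge0 (mulr_ge0 L0 j0) G0.
have := mulr_ge0 g0 G0; nra.
Qed.

Lemma sum4_ge (R : realType) (w1 w2 w3 w4 : R) : 0 <= w1 -> 0 <= w2 -> 0 <= w3 -> 0 <= w4 ->
  [/\ w1 <= w1 + w2 + w3 + w4, w2 <= w1 + w2 + w3 + w4,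
      w3 <= w1 + w2 + w3 + w4 & w4 <= w1 + w2 + w3 + w4].
Proof. by move=> *; split; lra. Qed.

(** * The right-hand side of the variational problem *)

Section Functional.
Context (R : realType).
Local Notation pt := (R * R * R)%type.
Local Notation mR := (measurableTypeR R).
Local Notation mR2 := (mR * mR)%type.
Local Notation mpt := (mR * mR * mR)%type.
Local Notation mu := (@leb3 R).
Local Notation ez := (@ez R).
Variables (Omega : set (R * R)) (h : R) (lambda : R -> R) (Lam : R).
Hypothesis oOmega : open Omega.
Hypothesis bOmega : bounded_set Omega.
Hypothesis h0 : 0 < h.
Hypothesis clambda : continuous lambda.
Hypothesis Lam0 : 0 < Lam.
Hypothesis lambda_bounds : forall z, 0 <= z <= h -> Lam^-1 <= lambda z <= Lam.
Local Notation C := (cyl Omega h).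
Local Notation L2C := (L2 mu C).
Local Notation ipU := (@ip _ _ R mu C).
Local Notation ipO := (@ip _ _ R (@leb2 R) Omega).
Local Notation N := (L2norm mu C).
Local Notation NO := (L2norm (@leb2 R) Omega).
Local Notation L2O := (L2 (@leb2 R) Omega).
Local Notation H1C := (H1 Omega h).
Local Notation dot := (dotH Omega h lambda).
Local Notation nH := (normH Omega h lambda).
Local Notation pre := (preH Omega h).
Local Notation papprox := (preH_approx Omega h lambda).
Let mC : measurable (C : set mpt) := measurable_cyl h oOmega.
Let mOm : measurable (Omega : set mR2) := measurable_domain oOmega.

Variables (swap flip : bool) (psi : R -> R) (a b k : R).
Hypothesis ab : a < b.
Hypothesis k0 : 0 < k.
Hypothesis spsi : smooth psi.
Hypothesis bpsi : forall t, a <= t <= b -> boundary Omega (unorient swap flip t (psi t)).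
Hypothesis inO : forall t r, a <= t <= b -> 0 < r <= h ->
  Omega (unorient swap flip t (psi t + k * r)).
Local Notation lt := (lat swap flip psi a k).

Section data.
Variables (f g : pt -> R) (j : (R -> R) -> R).
Hypothesis Lf : L2C f.
Hypothesis Lg : L2_ends Omega h g.
Hypothesis Dj : H12dual h j.

Definition ends (t : pt -> R) : R := int_ends Omega h (fun p => lambda p.2 * g p * t p).
Definition weighted (z : R) (q : R * R) : R := lambda z * g (q, z).
(** Interior, end and lateral values are three separate arguments: for a smooth function they are
    read off pointwise ([rhs_pre]), for an element of [HH] they are selected traces, and differences
    between the two kinds have to be estimated. *)
Definition rhs (t : pt -> R) (e : pt -> R) (c : R -> R) : R :=
  - ipU f t + ends e + j c.

Let end_cases z : z = 0 \/ z = h -> L2O (fun q => g (q, z)).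
Proof. by case: Lg => L0 L1 [->|->]. Qed.

Lemma endsE t : ends t = ipO (weighted 0) (fun q => t (q, 0)) + ipO (weighted h) (fun q => t (q, h)).
Proof. by []. Qed.

Lemma weighted_L2 z : z = 0 \/ z = h -> L2O (weighted z).
Proof. by move=> hz; apply: (L2Z mOm (lambda z)); exact: end_cases. Qed.

Let zh z : z = 0 \/ z = h -> 0 <= z <= h.
Proof. by case=> ->; rewrite lexx ltW. Qed.

Lemma weighted_norm z : z = 0 \/ z = h -> NO (weighted z) <= Lam * L2norm_ends Omega h g.
Proof.
move=> hz; have Lz := end_cases hz; rewrite (L2norm_Z mOm (lambda z) Lz).
have /andP[l1 l2] := lambda_bounds (zh hz).
have l0 : 0 <= lambda z by apply: le_trans l1; rewrite invr_ge0 ltW.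
rewrite (ger0_norm l0); apply: (ler_pM l0 (L2norm_ge0 _ _ _) l2).
have E : L2norm_ends Omega h g ^+ 2 = NO (fun q => g (q, 0)) ^+ 2 + NO (fun q => g (q, h)) ^+ 2.
  rewrite sqr_sqrtr; last first.
    by apply: addr_ge0; apply: Rintegral_ge0 => q _; exact: sqr_ge0.
  by rewrite /L2norm !sqr_sqrtr//; apply: Rintegral_ge0 => q _; exact: sqr_ge0.
apply: le_of_sqr; first exact: sqrtr_ge0.
by rewrite E; case: hz => ->; rewrite ?lerDl ?lerDr sqr_ge0.
Qed.

Let jlin c (p q : R -> R) : H12 h p -> H12 h q -> j (fun z => c * p z + q z) = c * j p + j q.
Proof. by move=> Hp Hq; case: Dj => H _; exact: H. Qed.

Lemma rhs_lin c t t' e e' p p' : L2C t -> L2C t' ->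
  (forall z, z = 0 \/ z = h -> L2O (fun q => e (q, z))) ->
  (forall z, z = 0 \/ z = h -> L2O (fun q => e' (q, z))) -> H12 h p -> H12 h p' ->
  rhs (fun x => c * t x + t' x) (fun x => c * e x + e' x) (fun z => c * p z + p' z) =
  c * rhs t e p + rhs t' e' p'.
Proof.
move=> Lt Lt' Le Le' Hp Hp'; rewrite /rhs !endsE.
have z0 : 0 = 0 :> R \/ 0 = h by left.
have zh' : h = 0 \/ h = h by right.
rewrite (ip_linr mC c Lt Lt' Lf) (jlin c Hp Hp').
rewrite (ip_linr mOm c (Le 0 z0) (Le' 0 z0) (weighted_L2 z0)).
rewrite (ip_linr mOm c (Le h zh') (Le' h zh') (weighted_L2 zh')).
by move: (ipU _ _) (ipU _ _) (ipO _ _) (ipO _ _) (ipO _ _) (ipO _ _) (j _) (j _) => *; ring.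
Qed.

Lemma rhs_bound t e p G : L2C t -> (forall z, z = 0 \/ z = h -> L2O (fun q => e (q, z))) ->
  H12 h p -> 0 <= G -> N t <= G -> (forall z, z = 0 \/ z = h -> NO (fun q => e (q, z)) <= G) ->
  H12norm h p <= G ->
  `|rhs t e p| <= (1 + 2 * Lam) * (N f + L2norm_ends Omega h g + H12dualnorm h j) * G.
Proof.
move=> Lt Le Hp G0 tG eG pG.
have [J0 HJ] := H12dual_bound Dj.
have z0 : 0 = 0 :> R \/ 0 = h by left.
have zh' : h = 0 \/ h = h by right.
have g0 : 0 <= L2norm_ends Omega h g by exact: sqrtr_ge0.
have b1 : `|ipU f t| <= N f * G.
  apply: (le_trans (L2_cauchy_schwarz mC Lf Lt)).
  by apply: ler_wpM2l => //; exact: L2norm_ge0.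
have be z : z = 0 \/ z = h -> `|ipO (weighted z) (fun q => e (q, z))| <= Lam * L2norm_ends Omega h g * G.
  move=> hz; apply: (le_trans (L2_cauchy_schwarz mOm (weighted_L2 hz) (Le z hz))).
  by apply: ler_pM; [exact: L2norm_ge0|exact: L2norm_ge0|exact: weighted_norm|exact: eG].
have b2 := be 0 z0; have b3 := be h zh'.
have b4 : `|j p| <= H12dualnorm h j * G.
  by apply: (le_trans (HJ p Hp)); apply: ler_wpM2l.
have f0 : 0 <= N f by exact: L2norm_ge0.
exact: (rhs_arith (ltW Lam0) f0 g0 J0 G0 b1 b2 b3 b4).
Qed.

Definition rhs_pre (al : pt -> R) : R := rhs al al (lt al).

Let smooth_end al : smooth al -> forall z, z = 0 \/ z = h -> L2O (fun q => al (q, z)).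
Proof. by move=> sal z hz; have [] := end_trace_bound oOmega bOmega h0 hz sal. Qed.

Let lat_H12 al : pre al -> H12 h (lt al).
Proof.
have [K _ HK] := lat_bound oOmega bOmega h0 clambda Lam0 lambda_bounds ab k0 spsi bpsi inO.
by move=> pal; have [] := HK _ pal.
Qed.

Lemma rhs_pre_lin c u v : pre u -> pre v ->
  rhs_pre (fun p => c * u p + v p) = c * rhs_pre u + rhs_pre v.
Proof.
move=> pu pv; have [su _ _] := pu; have [sv _ _] := pv.
exact: (rhs_lin c (smooth_L2 h oOmega bOmega su) (smooth_L2 h oOmega bOmega sv)
  (smooth_end su) (smooth_end sv) (lat_H12 pu) (lat_H12 pv)).
Qed.

(** The identity passes from [preH] to [HH] by density: along the approximating sequence the end
    traces converge in L^2 and the lateral values in H^(1/2), which is what [rhs] is continuous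
    for. *)
Lemma rhs_pre_limit u al ga : H1C u -> (forall be, pre be -> dot u be = rhs_pre be) ->
  H1C ga -> papprox al ga ->
  dot u ga = rhs ga (trace_ends Omega h ga) (lateral Omega h ga).
Proof.
move=> Hu rep Hga alga; have [pal nal Nal] := alga.
have ala := preH_approx_H1 oOmega bOmega clambda Lam0 lambda_bounds Hga alga.
have [Hl [_ lc]] := lateral_cvg oOmega bOmega h0 clambda Lam0 lambda_bounds ab k0 spsi bpsi inO Hga alga.
set tr := trace_ends Omega h ga; set c := lateral Omega h ga in Hl lc *.
have z0 : 0 = 0 :> R \/ 0 = h by left.
have zh' : h = 0 \/ h = h by right.
have [Lt0 t0] := trace_endsP oOmega bOmega h0 ala z0.
have [Lth th] := trace_endsP oOmega bOmega h0 ala zh'.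
have Ltr z : z = 0 \/ z = h -> L2O (fun q => tr (q, z)) by case=> ->.
pose K0 := (1 + 2 * Lam) * (N f + L2norm_ends Omega h g + H12dualnorm h j).
(* A common bound for the four errors, as [rhs_bound] requires. *)
pose G n := N (al n \- ga) + NO (fun q => al n (q, 0) - tr (q, 0)) +
  NO (fun q => al n (q, h) - tr (q, h)) + H12norm h (fun z => lt (al n) z - c z).
apply: (@eq_of_null _ (fun n => nH u * nH (al n \- ga) + K0 * G n)); last first.
  apply: (null_add (null_scale _ nal)); apply: null_scale.
  exact: (null_add (null_add (null_add Nal t0) th) lc).
move=> n; have Hal := preH_H1 oOmega bOmega (pal n).
have [sal _ _] := pal n.
have Hd := H1B oOmega bOmega Hal Hga.
have b1 : `|dot u ga - dot u (al n)| <= nH u * nH (al n \- ga).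
  rewrite distrC (dotHC Omega h lambda u ga) (dotHC Omega h lambda u (al n)).
  rewrite -(dotHB oOmega bOmega clambda Lam0 lambda_bounds Hal Hga Hu) mulrC.
  exact: (dotH_cauchy_schwarz oOmega bOmega clambda Lam0 lambda_bounds Hd Hu).
have n1 : 0 <= N (al n \- ga) by exact: L2norm_ge0.
have n2 : 0 <= NO (fun q => al n (q, 0) - tr (q, 0)) by exact: L2norm_ge0.
have n3 : 0 <= NO (fun q => al n (q, h) - tr (q, h)) by exact: L2norm_ge0.
have n4 : 0 <= H12norm h (fun z => lt (al n) z - c z) by exact: H12norm_ge0.
have Lal := smooth_L2 h oOmega bOmega sal; have Hlt := lat_H12 (pal n).
have Ef : (fun p => -1 * ga p + al n p) = al n \- ga by apply/funext => p; rewrite mulN1r addrC.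
have Ee : (fun p => -1 * tr p + al n p) = (fun p => al n p - tr p).
  by apply/funext => p; rewrite mulN1r addrC.
have Ec : (fun z => -1 * c z + lt (al n) z) = (fun z => lt (al n) z - c z).
  by apply/funext => p; rewrite mulN1r addrC.
have L := rhs_lin (-1) (H1_L2 Hga) Lal Ltr (smooth_end sal) Hl Hlt.
have Hlc := H12_lincomb (-1) Hl Hlt.
rewrite Ef Ee Ec in L; rewrite Ec in Hlc.
have b2 : `|rhs (al n) (al n) (lt (al n)) - rhs ga tr c| <= K0 * G n.
  rewrite -[X in `|X|]addrC -mulN1r -L.
  have [g1 g2 g3 g4] := sum4_ge n1 n2 n3 n4.
  apply: rhs_bound => //.
  - exact: (L2B mC Lal (H1_L2 Hga)).
  - by move=> z hz; exact: (L2B mOm (smooth_end sal hz) (Ltr z hz)).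
  - exact: le_trans g1.
  - by move=> z [->|->].
have b3 := rep _ (pal n); rewrite /rhs_pre in b3; rewrite -b3 in b2.
have -> : dot u ga - rhs ga tr c = (dot u ga - dot u (al n)) + (dot u (al n) - rhs ga tr c).
  by rewrite addrA subrK.
by apply: (le_trans (ler_normD _ _)); apply: lerD.
Qed.

End data.

Lemma rhs_pre_bound : (exists2 K : R, 0 <= K & forall al, pre al -> N al <= K * nH al) ->
  exists2 K : R, 0 <= K & forall f g j, L2C f -> L2_ends Omega h g -> H12dual h j ->
  forall al, pre al -> `|rhs_pre f g j al| <=
    K * (N f + L2norm_ends Omega h g + H12dualnorm h j) * nH al.
Proof.
move=> [K1 K10 HK1].
have [K2 K20 HK2] := wder_le_normH oOmega bOmega clambda Lam0 lambda_bounds ez.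
have [K3 K30 HK3] := lat_bound oOmega bOmega h0 clambda Lam0 lambda_bounds ab k0 spsi bpsi inO.
pose Ke : R := 1 + (2 + 2 * h ^+ 2) / h.
have Ke0 : 0 <= Ke.
  have h2 : 0 <= 2 * h ^+ 2 by rewrite mulr_ge0// sqr_ge0.
  by apply: addr_ge0 => //; apply: divr_ge0; [exact: addr_ge0|exact: ltW].
(* [K1] is the Poincare constant, [Ke * (K1 + K2)] comes from the end traces, and each [K3] from one
   half of the H^(1/2) norm of the lateral value; none of them involves the data. *)
pose K := K1 + Ke * (K1 + K2) + (K3 + K3).
have KK : 0 <= K by rewrite /K !addr_ge0// mulr_ge0// addr_ge0.
exists ((1 + 2 * Lam) * K).
  by apply: mulr_ge0 => //; rewrite addr_ge0// mulr_ge0// ltW.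
move=> f g j Lf Lg Dj al pal; have [sal _ _] := pal.
have Hal := preH_H1 oOmega bOmega pal.
have n0 := normH_ge0 Omega h lambda al.
have [Hl l1 l2] := HK3 _ pal.
have P1 := HK1 _ pal; have P2 := HK2 _ Hal.
have H := @rhs_bound f g j Lf Lg Dj al al (lt al) (K * nH al) (smooth_L2 h oOmega bOmega sal) _ Hl.
rewrite -[X in X * nH al]mulrA [K * _]mulrC mulrA -mulrA.
have e1 : K1 * nH al <= K * nH al.
  by apply: ler_wpM2r => //; rewrite /K -addrA lerDl !addr_ge0// mulr_ge0// addr_ge0.
have e2 : Ke * (K1 + K2) * nH al <= K * nH al.
  apply: ler_wpM2r => //; rewrite /K; have := mulr_ge0 Ke0 (addr_ge0 K10 K20).
  by move: (Ke * _) => w; lra.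
have e3 : (K3 + K3) * nH al <= K * nH al.
  by apply: ler_wpM2r => //; rewrite /K lerDr !addr_ge0// mulr_ge0// addr_ge0.
apply: H.
- by move=> z hz; have [] := end_trace_bound oOmega bOmega h0 hz sal.
- exact: mulr_ge0.
- exact: (le_trans P1).
- move=> z hz; have [_ B] := end_trace_bound oOmega bOmega h0 hz sal.
  apply: (le_trans B); apply: le_trans e2; rewrite -mulrA; apply: ler_wpM2l => //.
  by rewrite mulrDl; exact: lerD.
- apply: (le_trans (H12norm_le Hl)); apply: le_trans e3.
  by rewrite mulrDl; exact: lerD.
Qed.

End Functional.

(** * Uniqueness, and the consequences of compatibility *)

Section Solution.
Context (R : realType).
Local Notation pt := (R * R * R)%type.
Local Notation mR := (measurableTypeR R).
Local Notation mR2 := (mR * mR)%type.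
Local Notation mpt := (mR * mR * mR)%type.
Local Notation mu := (@leb3 R).
Local Notation ex := (@ex R).
Local Notation ey := (@ey R).
Local Notation ez := (@ez R).
Variables (Omega : set (R * R)) (h : R) (lambda : R -> R) (Lam : R).
Hypothesis oOmega : open Omega.
Hypothesis bOmega : bounded_set Omega.
Hypothesis h0 : 0 < h.
Hypothesis slambda : smooth lambda.
Hypothesis Lam0 : 0 < Lam.
Hypothesis lambda_bounds : forall z, 0 <= z <= h -> Lam^-1 <= lambda z <= Lam.
Local Notation C := (cyl Omega h).
Local Notation L2C := (L2 mu C).
Local Notation ipU := (@ip _ _ R mu C).
Local Notation N := (L2norm mu C).
Local Notation L2O := (L2 (@leb2 R) Omega).
Local Notation D := (wder Omega h).
Local Notation H1C := (H1 Omega h).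
Local Notation dot := (dotH Omega h lambda).
Local Notation nH := (normH Omega h lambda).
Local Notation pre := (preH Omega h).
Local Notation papprox := (preH_approx Omega h lambda).
Let clambda : continuous lambda := smooth_cont slambda.
Let mC : measurable (C : set mpt) := measurable_cyl h oOmega.
Let mOm : measurable (Omega : set mR2) := measurable_domain oOmega.

Variables (swap flip : bool) (psi : R -> R) (a b k : R).
Hypothesis ab : a < b.
Hypothesis k0 : 0 < k.
Hypothesis spsi : smooth psi.
Hypothesis bpsi : forall t, a <= t <= b -> boundary Omega (unorient swap flip t (psi t)).
Hypothesis inO : forall t r, a <= t <= b -> 0 < r <= h ->
  Omega (unorient swap flip t (psi t + k * r)).
Local Notation lt := (lat swap flip psi a k).

Hypothesis poincare : exists2 K : R, 0 <= K & forall al, pre al -> N al <= K * nH al.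
Hypothesis poincareH : exists2 K : R, 0 <= K & forall u, HH Omega h lambda u -> N u <= K * nH u.

Section solution.
Variables (f g : pt -> R) (j : (R -> R) -> R) (u : pt -> R).
Hypothesis Lf : L2C f.
Hypothesis Lg : L2_ends Omega h g.
Hypothesis Dj : H12dual h j.
Local Notation F := (rhs_pre Omega h lambda swap flip psi a k f g j).
Local Notation ends := (ends Omega h lambda g).
Hypothesis Hu : H1C u.
Hypothesis uu : exists al, papprox al u.
Hypothesis rep : forall al, pre al -> dot u al = F al.

Lemma rep_solves : solves_V Omega h lambda f g j u.
Proof.
split; first by split.
move=> ga [Hga [al alga]].
exact: (rhs_pre_limit oOmega bOmega h0 clambda Lam0 lambda_bounds ab k0 spsi bpsi inO Lf Lg Dj
  Hu rep Hga alga).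
Qed.

(** The difference of two solutions is tested against itself; its energy is zero, and the Poincare
    inequality on [HH] concludes. *)
Lemma solves_unique u' : solves_V Omega h lambda f g j u' -> ae_eq mu C u' u.
Proof.
move=> [HHu' Eu']; have [HHu Eu] := rep_solves.
have Hu' : H1C u' by case: HHu'.
have HHd := HHB oOmega bOmega clambda Lam0 lambda_bounds HHu' HHu.
have Hd : H1C (u' \- u) by case: HHd.
have Z : dot (u' \- u) (u' \- u) = 0.
  rewrite (dotHB oOmega bOmega clambda Lam0 lambda_bounds Hu' Hu Hd).
  exact: (etrans (f_equal2 (fun x y => x - y) (Eu' _ HHd) (Eu _ HHd)) (subrr _)).
have n0 : nH (u' \- u) = 0 by rewrite /normH Z sqrtr0.
have [K K0 HK] := poincareH.
apply: (L2_ae_of_norm0 mC (H1_L2 Hu') (H1_L2 Hu)).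
by have := HK _ HHd; rewrite n0 mulr0.
Qed.

Lemma null_arith (x y z c : R) : x = 0 -> y = 0 -> z = 0 -> x + y + c * z <= 0.
Proof. by move=> -> -> ->; rewrite mulr0 !addr0. Qed.

(** The energy does not see constants. As the weak derivatives of 1 are selected ones, the argument
    goes through their norms and Cauchy-Schwarz. *)
Lemma dotH_cst1 : dot u (fun=> 1) = 0.
Proof.
have H1' : H1C (fun=> 1) := H1_cst h oOmega bOmega 1.
have E e : N (D e (fun=> 1)) = 0.
  rewrite -(L2norm_wder_smooth h oOmega bOmega e (@smooth_cst R pt 1)).
  rewrite (_ : 'D_e (fun _ : pt => 1 : R) = (fun=> 0)) ?L2norm0//.
  by apply/funext => p; exact: derive_cst.
have n1 : nH (fun=> 1) <= 0.
  apply: (le_trans (normH_le oOmega clambda Lam0 lambda_bounds H1')).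
  exact: (null_arith _ (E ex) (E ey) (E ez)).
have := dotH_cauchy_schwarz oOmega bOmega clambda Lam0 lambda_bounds Hu H1'.
move=> B; apply/eqP; rewrite -normr_le0; apply: (le_trans B).
by rewrite -(mulr0 (nH u)); apply: ler_wpM2l => //; exact: normH_ge0.
Qed.

Lemma mean_shift (ga : pt -> R) : smooth ga -> exists m : R,
  \int[mu]_(p in C) (- m * 1 + ga p) = 0.
Proof.
move=> sga; have Lga := smooth_L2 h oOmega bOmega sga.
have L1 : L2C (fun=> 1) := smooth_L2 h oOmega bOmega (@smooth_cst R pt 1).
have I m : \int[mu]_(p in C) (- m * 1 + ga p) = - m * ipU (fun=> 1) (fun=> 1) + ipU ga (fun=> 1).
  by rewrite -(ip_linl mC (- m) L1 Lga L1); apply: eq_Rintegral => p _; rewrite [RHS]mulr1.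
(* The mean is a quotient by the measure of the cylinder; when this real number is 0, Cauchy-Schwarz
   against 1 makes the integral of [ga] vanish. *)
have [V0|V0] := eqVneq (ipU (fun=> 1) (fun=> 1)) 0.
  exists 0; rewrite I V0 mulr0 add0r; apply/eqP; rewrite -normr_le0.
  apply: (le_trans (L2_cauchy_schwarz mC Lga L1)).
  have -> : N (fun=> 1) = 0 by apply/eqP; rewrite -sqrf_eq0 (L2norm_sqr mC L1) V0.
  by rewrite mulr0.
exists (ipU ga (fun=> 1) / ipU (fun=> 1) (fun=> 1)); rewrite I.
by rewrite mulNr divfK// addNr.
Qed.

Let smooth_end al : smooth al -> forall z, z = 0 \/ z = h -> L2O (fun q => al (q, z)).
Proof. by move=> sal z hz; have [] := end_trace_bound oOmega bOmega h0 hz sal. Qed.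

Hypothesis comp : compatible Omega h lambda f g j.

Lemma balance_arith (x x' y z z' : R) : x = x' -> z = z' -> x' = y + z' -> - x + z + y = 0.
Proof. by move=> -> -> ->; ring. Qed.

(** Compatibility says exactly that the functional vanishes at the constant 1. *)
Let rhs1 : rhs Omega h lambda f g j (fun=> 1) (fun=> 1) (fun=> 1) = 0.
Proof.
have e1 : ipU f (fun=> 1) = \int[mu]_(p in C) f p.
  by apply: eq_Rintegral => p _; rewrite mulr1.
have e2 : ends (fun=> 1) = int_ends Omega h (fun p => lambda p.2 * g p).
  by congr (_ + _); apply: eq_Rintegral => q _; rewrite mulr1.
exact: (balance_arith e1 e2 comp).
Qed.

(** Subtracting the mean puts [ga] in [preH]; the constant contributes 0 on the left by [dotH_cst1]
    and on the right by compatibility. *)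
Lemma rep_smooth (ga : pt -> R) (c : R -> R) : smooth ga ->
  (forall q z, boundary Omega q -> 0 <= z <= h -> ga (q, z) = c z) ->
  H12 h (lt ga) /\ dot u ga = rhs Omega h lambda f g j ga ga (lt ga).
Proof.
move=> sga hc; have [m Hm] := mean_shift sga.
have s1 := @smooth_cst R pt 1.
have pal : pre (fun p => - m * 1 + ga p).
  split; first exact: (smooth_lincomb (- m) s1 sga).
  - exact: Hm.
  - by exists (fun z => - m * 1 + c z) => q z bq hz; rewrite (hc q z bq hz).
have [K _ HK] := lat_bound oOmega bOmega h0 clambda Lam0 lambda_bounds ab k0 spsi bpsi inO.
have [Hl _ _] := HK _ pal.
have Hga : H12 h (lt ga).
  have := H12_lincomb m (H12_cst h 1) Hl; congr H12; apply/funext => z.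
  by rewrite /lat /=; ring.
split => //.
have Hg1 := H1_smooth h oOmega bOmega sga.
have E := rep pal; rewrite /rhs_pre in E.
have L1 := smooth_L2 h oOmega bOmega s1.
have RL := rhs_lin lambda oOmega Lf Lg Dj (- m) L1 (smooth_L2 h oOmega bOmega sga)
  (smooth_end s1) (smooth_end sga) (H12_cst h 1) Hga.
have DL : dot u (fun p => - m * 1 + ga p) = dot u ga.
  rewrite dotHC (dotH_lin oOmega bOmega clambda Lam0 lambda_bounds (- m) (H1_smooth h oOmega bOmega s1) Hg1 Hu).
  by rewrite (dotHC Omega h lambda (fun=> 1) u) dotH_cst1 mulr0 add0r dotHC.
by rewrite -DL E -[RHS]add0r -(mulr0 (- m)) -rhs1 -RL.
Qed.

(** [j] takes functions on the whole line, but vanishing on [[0, h]] makes the H^(1/2) norm 0, and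
    [j] is bounded by this norm. *)
Lemma j_zero (c : R -> R) : H12 h c -> (forall z, 0 <= z <= h -> c z = 0) -> j c = 0.
Proof.
move=> Hc c0; have [J0 HJ] := H12dual_bound Dj.
have mI : measurable (`[0, h]%classic : set mR) by exact: measurable_itv.
have mS : measurable (`[0, h] `*` `[0, h] : set mR2) by exact: measurableX.
have [L1 L2'] := (H12P h c).1 Hc.
have n1 : L2norm (@leb1 R) `[0, h] c = 0.
  apply: etrans (L2norm0 (@leb1 R) mI); apply: (L2norm_ae mI L1 (L2_cst0 _ _)).
  by apply: aeW => z /=; rewrite in_itv/=; exact: c0.
have n2 : L2norm (@leb2 R) (`[0, h] `*` `[0, h]) (quotient c) = 0.
  apply: etrans (L2norm0 (@leb2 R) mS).
  apply: (L2norm_ae mS L2' (L2_cst0 _ _)); apply: aeW => z /= [].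
  by rewrite !in_itv/= => z1 z2; rewrite /quotient (c0 _ z1) (c0 _ z2) subrr mul0r.
apply/eqP; rewrite -normr_le0; apply: (le_trans (HJ c Hc)).
rewrite -(mulr0 (H12dualnorm h j)); apply: ler_wpM2l => //.
by apply: (le_trans (H12norm_le Hc)); rewrite n1 n2 addr0.
Qed.

Lemma rep_Neumann : weak_Neumann Omega h lambda f g u.
Proof.
move=> ga sga ga0; have [Hl ->] := rep_smooth sga ga0.
rewrite /rhs (j_zero Hl) ?addr0// => z hz; apply: ga0 => //.
by rewrite chart0; apply: bpsi; rewrite lexx ltW.
Qed.

Lemma ends_zero (ga : pt -> R) : (forall q, ga (q, 0) = 0 /\ ga (q, h) = 0) -> ends ga = 0.
Proof.
move=> H; rewrite endsE.
have E0 : (fun q => ga (q, 0)) = (fun=> 0) by apply/funext => q; have [] := H q.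
have E1 : (fun q => ga (q, h)) = (fun=> 0) by apply/funext => q; have [] := H q.
by rewrite E0 E1 !(ipC _ _ _ (fun=> 0)) !ip0l addr0.
Qed.

Lemma boundary_disjoint q : boundary Omega q -> ~ Omega q.
Proof. by move=> [_ nq] Oq; apply: nq; rewrite (interior_id _).1. Qed.

(** Test functions vanish on the ends and on the lateral boundary, so the Neumann identity tests [w]
    against [f], and the fundamental lemma applies. In the flux condition [w] may then be replaced
    by [f]. *)
Lemma weak_L_eq w : is_weak_L Omega h lambda u w -> ae_eq mu C w f.
Proof.
move=> [Lw Hw].
have Ld := L2B mC Lw Lf.
have : ae_eq mu C (fun p => w p - f p) (fun=> 0).
  apply: L2_fundamental => // ps tps.
  have Lps := test_L2 oOmega bOmega tps.
  have b0 q z : boundary Omega q -> 0 <= z <= h -> ps (q, z) = 0.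
    by move=> /boundary_disjoint nq _; apply: (test_support tps) => -[].
  have z0 q : ps (q, 0) = 0 /\ ps (q, h) = 0.
    by split; apply: (test_support tps) => -[_ /=]; rewrite in_itv/= ltxx ?andbF.
  have E1 := rep_Neumann tps.1 b0.
  have E2' := Hw ps tps.
  rewrite (ipBl mC Lw Lf Lps); apply/eqP; rewrite subr_eq0; apply/eqP; apply: oppr_inj.
  rewrite -[LHS]E2' E1 -[RHS]addr0; congr (_ + _); exact: ends_zero.
by apply: filterS => p H Cp; apply/eqP; rewrite -subr_eq0 (H Cp).
Qed.

Lemma horizontal_zero (e : pt) (ga : pt -> R) : smooth ga -> (forall p, 'D_e ga p = 0) ->
  ipU (D e u) (D e ga) = 0.
Proof.
move=> sga H; have Hg1 := H1_smooth h oOmega bOmega sga.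
rewrite ipC (ip_ae mC (wder_L2 e Hg1).1 (@L2_cst0 _ _ R mu C).1 (wder_L2 e Hu).1) ?ip0l//.
have := wder_smooth h oOmega bOmega e sga; apply: filterS => p H' Cp.
by rewrite (H' Cp) H.
Qed.

Lemma sum_null_arith (x y z t : R) : x = 0 -> y = 0 -> z = t -> x + y + z = t.
Proof. by move=> -> -> ->; rewrite !add0r. Qed.

Lemma flux_arith (d x e y w z : R) : d = - x + e + y -> d = w -> w = - z -> e = 0 -> x - z = y.
Proof. by move=> *; lra. Qed.

Lemma mulr3_swap (x y z : R) : x * (y * z) = z * (y * x).
Proof. ring. Qed.

(** For a test function of [z] alone the horizontal derivatives vanish, and the energy is the
    integral of the vertical derivative of [u] against [lambda phi']; integration by parts moves the
    derivative off [u]. The end terms vanish since [phi] is supported in []0, h[]. *)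
Lemma rep_flux : weak_flux Omega h lambda j u.
Proof.
move=> w Hw phi tphi; have [sphi _] := tphi; have Lw : L2C w by case: Hw.
pose G1 z := lambda z * derive1 phi z.
have sG1 : smooth G1.
  rewrite /G1 derive1_smooth; exact: (smoothM slambda (smooth_derive (1 : R) sphi)).
have [sga dga] := smooth_vertical sphi; have [sG dG] := smooth_vertical sG1.
set ga := (fun p : pt => phi p.2) in sga dga; set G := (fun p : pt => G1 p.2) in sG dG.
have out z : z = 0 \/ z = h -> ~ (`]0, h[%classic z).
  by case=> -> /=; rewrite in_itv/= ltxx ?andbF.
have z0 : 0 = 0 :> R \/ 0 = h by left.
have zh' : h = 0 \/ h = h by right.
have ga_ends q : ga (q, 0) = 0 /\ ga (q, h) = 0.
  by split; apply: (test_support tphi); apply: out.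
have G_ends q : G (q, 0) = 0 /\ G (q, h) = 0.
  by split; rewrite /G /G1 /= (test_derive1_support tphi (out _ _)) ?mulr0.
(* The lateral value of [ga] is [phi] by computation, which produces the term [j phi]. *)
have [_ E] := rep_smooth (c := phi) sga (fun q z _ _ => erefl).
have Hg1 := H1_smooth h oOmega bOmega sga.
have Lga := smooth_L2 h oOmega bOmega sga; have LG := smooth_L2 h oOmega bOmega sG.
have LDG := smooth_L2 h oOmega bOmega (smooth_derive ez sG).
have Wez := wder_L2 ez Hu.
have dx : ipU (D ex u) (D ex ga) = 0.
  by apply: horizontal_zero => // p; rewrite dga /= mul0r.
have dy : ipU (D ey u) (D ey ga) = 0.
  by apply: horizontal_zero => // p; rewrite dga /= mul0r.
have dz : ipU (fun p => lambda p.2 * D ez u p) (D ez ga) = ipU (D ez u) G.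
  have Ll := lambda_mul_L2 oOmega clambda Lam0 lambda_bounds Wez.
  rewrite ipC (ip_ae mC (wder_L2 ez Hg1).1 (smooth_L2 h oOmega bOmega (smooth_derive ez sga)).1 Ll.1
    (wder_smooth h oOmega bOmega ez sga)).
  apply: eq_Rintegral => p _; rewrite dga /= mul1r /G /G1.
  exact: mulr3_swap.
have Edot : dot u ga = ipU (D ez u) G.
  rewrite (dotHE oOmega clambda Lam0 lambda_bounds Hu Hg1).
  exact: (sum_null_arith dx dy dz).
have [al pu] := uu.
have alu := preH_approx_H1 oOmega bOmega clambda Lam0 lambda_bounds Hu pu.
have parts := limit_parts oOmega bOmega h0 alu sG G_ends.
have EG : 'D_ez G = (fun p => derive1 G1 p.2) by apply/funext => p; rewrite dG /= mul1r.
have wf : ipU w ga = ipU f ga := ip_ae mC Lw.1 Lf.1 Lga.1 (weak_L_eq Hw).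
have S : \int[mu]_(p in C) (w p * phi p.2 - u p * derive1 G1 p.2) = ipU w ga - ipU u ('D_ez G).
  rewrite EG; rewrite EG in LDG.
  exact: (RintegralB mC (L2_integrable_mul mC Lw Lga) (L2_integrable_mul mC (H1_L2 Hu) LDG)).
rewrite [LHS]S wf; move: E; rewrite /rhs => E.
exact: (flux_arith E Edot parts (ends_zero ga_ends)).
Qed.

End solution.

Lemma solution_exists : exists2 K : R, 0 <= K & forall f g j,
  L2C f -> L2_ends Omega h g -> H12dual h j ->
  exists u, [/\ H1C u, exists al, papprox al u,
    forall al, pre al -> dot u al = rhs_pre Omega h lambda swap flip psi a k f g j al &
    nH u <= K * (N f + L2norm_ends Omega h g + H12dualnorm h j)].
Proof.
have [K K0 HK] := rhs_pre_bound oOmega bOmega h0 clambda Lam0 lambda_bounds ab k0 spsi bpsi inO poincare.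
exists K => // f g j Lf Lg Dj.
have [J0 _] := H12dual_bound Dj.
apply: (riesz_preH oOmega bOmega clambda Lam0 lambda_bounds _ poincare).
- apply: mulr_ge0 => //; apply: addr_ge0 => //.
  by apply: addr_ge0; [exact: L2norm_ge0|exact: sqrtr_ge0].
- by move=> c v v' pv pv'; exact: (rhs_pre_lin oOmega bOmega h0 clambda Lam0 lambda_bounds ab k0 spsi bpsi inO Lf Lg Dj).
- by move=> v pv; exact: HK.
Qed.

End Solution.

Theorem lemma3p1 (R : realType) (Omega : set (R * R)) (h : R)
    (lambda : R -> R) (Lam : R)
    (hOmega : smooth_bounded_domain Omega) (h_gt0 : 0 < h)
    (lambda_smooth : smooth lambda) (Lam_gt0 : 0 < Lam)
    (lambda_bounds : forall z, 0 <= z <= h -> Lam^-1 <= lambda z <= Lam) :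
  exists C : R, forall (f g : R * R * R -> R) (j : (R -> R) -> R),
    L2 (@leb3 R) (cyl Omega h) f -> L2_ends Omega h g -> H12dual h j ->
    exists u : R * R * R -> R,
      [/\ solves_V Omega h lambda f g j u,
          forall u', solves_V Omega h lambda f g j u' ->
            ae_eq (@leb3 R) (cyl Omega h) u' u,
          normH Omega h lambda u <=
            C * (L2norm (@leb3 R) (cyl Omega h) f + L2norm_ends Omega h g
                 + H12dualnorm h j) &
          compatible Omega h lambda f g j ->
          [/\ weak_Neumann Omega h lambda f g u,
              exists c : R -> R, H12 h c /\ lateral_value Omega h u c &
              weak_flux Omega h lambda j u]].
Proof.
have [oOmega _ bOmega _] := hOmega.
have clambda : continuous lambda := smooth_cont lambda_smooth.
(* The chart is fixed before the data, so that the constant [K] is uniform in [f], [g] and [j]. *)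
have [swap [flip [psi [a [b [k [ab k0 spsi bpsi inO]]]]]]] := boundary_chart h_gt0 hOmega.
have P1 := poincare_normH oOmega bOmega h_gt0 clambda Lam_gt0 lambda_bounds.
have P2 := poincare_HH oOmega bOmega h_gt0 clambda Lam_gt0 lambda_bounds.
have [K K0 HK] := solution_exists oOmega bOmega h_gt0 lambda_smooth Lam_gt0 lambda_bounds
  ab k0 spsi bpsi inO P1.
exists K => f g j Lf Lg Dj; have [u [Hu uu rep est]] := HK f g j Lf Lg Dj.
exists u; split => //.
- exact: (rep_solves oOmega bOmega h_gt0 lambda_smooth Lam_gt0 lambda_bounds
    ab k0 spsi bpsi inO Lf Lg Dj Hu uu rep).
- exact: (solves_unique oOmega bOmega h_gt0 lambda_smooth Lam_gt0 lambda_bounds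
    ab k0 spsi bpsi inO P2 Lf Lg Dj Hu uu rep).
move=> comp; split.
- exact: (rep_Neumann oOmega bOmega h_gt0 lambda_smooth Lam_gt0 lambda_bounds
    ab k0 spsi bpsi inO Lf Lg Dj Hu rep comp).
- have [al alu] := uu.
  exact: (lateral_exists oOmega bOmega h_gt0 clambda Lam_gt0 lambda_bounds ab k0 spsi bpsi inO Hu alu).
- exact: (rep_flux oOmega bOmega h_gt0 lambda_smooth Lam_gt0 lambda_bounds
    ab k0 spsi bpsi inO Lf Lg Dj Hu uu rep comp).
Qed.
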